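(* Let $\gamma=1$ and $\alpha\ge0$. Then, for any $\theta_0\in A^1$ satisfying $$\|\theta_0\|_{A^0}<\frac{\sqrt\pi}{\sqrt2},$$ there exists a unique weak solution $\theta$ of $$\theta_t+u\,\theta_x+\Lambda^{\gamma}\theta=0,\qquad u=(1-\partial_{xx})^{-\alpha}\theta,\qquad \theta(0,\cdot)=\theta_0,$$ verifying, for all $T>0$, $\theta\in\mathcal{W}_T$ and $$\sup_{t\in[0,T]}\|\theta(t)\|_{A^1}+\left(1-\frac{\sqrt2\,\|\theta_0\|_{A^0}}{\sqrt\pi}\right)\int_0^T\|\theta_x(t)\|_{A^1}\,dt\le\|\theta_0\|_{A^1}.$$
   Context: Functions are real-valued on $\mathbb{R}$. The Fourier transform is $\hat f(\xi)=\frac{1}{\sqrt{2\pi}}\int_{\mathbb{R}}f(x)e^{-ix\xi}\,dx$. $\Lambda^{\gamma}$ is the Fourier multiplier $|\xi|^{\gamma}$ and $(1-\partial_{xx})^{-\alpha}$ is the Fourier multiplier $(1+|\xi|^2)^{-\alpha}$. Wiener spaces: $A^0=\{f\in L^1_{loc}:\hat f\in L^1\}$ with $\|f\|_{A^0}=\|\hat f\|_{L^1}$, and for $s>0$, $A^s=\{f\in L^1_{loc}:\|f\|_{A^s}=\int_{\mathbb{R}}(1+|\xi|^s)|\hat f(\xi)|\,d\xi<\infty\}$. For $T>0$, $\mathcal{W}_T=L^\infty(0,T;W^{1,\infty})\cap W^{1,\infty}(0,T;L^\infty)\cap L^1(0,T;W^{2,\infty})$ (spatial spaces on $\mathbb{R}$).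 Weak solution with initial data $\theta_0$ means: for every $0<T<\infty$ and every $\psi\in C_c^\infty([0,T)\times\mathbb{R})$, $$\int_0^T\!\!\int_{\mathbb{R}}\big[\theta\psi_t+u_x\theta\psi+u\theta\psi_x-\theta\Lambda^{\gamma}\psi\big]\,dx\,dt=-\int_{\mathbb{R}}\theta_0(x)\psi(0,x)\,dx,\qquad u=(1-\partial_{xx})^{-\alpha}\theta.$$
   Formalization: The estimate is stated as sup over t in [0,T] of (‖θ(t)‖_{A^1} + c∫_0^t‖θ_x‖_{A^1}ds) ≤ ‖θ_0‖_{A^1}, since the displayed one (separate sup, integral up to T) fails for every θ_0≠0: the sup is already ≥ ‖θ_0‖_{A^1}. *)

(* Defs.v *)
From mathcomp Require Export all_boot all_order all_algebra.
From mathcomp Require Export all_classical all_reals all_analysis.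
From mathcomp Require Export complex.
Import Order.TTheory GRing.Theory Num.Theory.
Import numFieldNormedType.Exports.

Set Implicit Arguments.
Unset Strict Implicit.
Unset Printing Implicit Defensive.

Local Open Scope classical_set_scope.
Local Open Scope ring_scope.
Local Open Scope complex_scope.

(* Functions of x are functions R -> R, functions of (t, x) are curried; an
   element of a Lebesgue or Sobolev space is given by a Borel representative. *)

Definition test_fun (R : realType) (phi : R -> R) : Prop :=
  (forall n x, derivable (derive1n n phi) x 1) /\
  (exists M : R, forall x, M < `|x| -> phi x = 0).

Definition dt (R : realType) (psi : R -> R -> R) : R -> R -> R :=
  fun t x => derive1 (fun s => psi s x) t.

Definition dx (R : realType) (psi : R -> R -> R) : R -> R -> R :=
  fun t x => derive1 (psi t) x.

(* The iterated partial derivative coded by w (true for t, false for x). *)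
Definition partial (R : realType) (w : seq bool) (psi : R -> R -> R) :
  R -> R -> R := foldr (fun b : bool => if b then @dt R else @dx R) psi w.

(* C_c^oo([0, T) x R): restrictions to t >= 0 of smooth functions on R^2 with
   compact support in (-oo, T) x R. *)
Definition spacetime_test_fun (R : realType) (T : R) (psi : R -> R -> R) :
  Prop :=
  (forall w : seq bool,
     [/\ continuous (fun z : R * R => partial w psi z.1 z.2),
         forall t x, derivable (fun s => partial w psi s x) t 1
       & forall t x, derivable (partial w psi t) x 1]) /\
  (exists S M : R, S < T /\
     forall t x, [|| S < t, M < `|t| | M < `|x|] -> psi t x = 0).

Definition cintegral (R : realType) (g : R -> R[i]) : R[i] :=
  (\int[lebesgue_measure]_x complex.Re (g x))%R +i*
  (\int[lebesgue_measure]_x complex.Im (g x))%R.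

Definition cintegrable (R : realType) (g : R -> R[i]) : Prop :=
  lebesgue_measure.-integrable setT (fun x => (complex.Re (g x))%:E) /\
  lebesgue_measure.-integrable setT (fun x => (complex.Im (g x))%:E).

Definition cis (R : realType) (x : R) : R[i] := cos x +i* sin x.

(* The integral formula, meaningful for integrable f. *)
Definition fourier (R : realType) (f : R -> R) (xi : R) : R[i] :=
  ((Num.sqrt (2 * pi))^-1)%:C *
  cintegral (fun x => (f x)%:C * cis (- (x * xi))).

Definition inverse_fourier (R : realType) (g : R -> R[i]) (x : R) : R[i] :=
  ((Num.sqrt (2 * pi))^-1)%:C *
  cintegral (fun xi => g xi * cis (x * xi)).

(* The Fourier transform, in the sense of tempered distributions, of the locally
   integrable function f is the integrable function g.  It is stated by Parseval
   duality; C_c^oo is enough since it is dense in the Schwartz space. *)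
Definition has_fourier (R : realType) (f : R -> R) (g : R -> R[i]) : Prop :=
  [/\ locally_integrable setT f, cintegrable g &
   forall phi, test_fun phi ->
     (\int[lebesgue_measure]_x (f x * phi x))%R%:C =
     cintegral (fun xi => g xi * conjc (fourier phi xi))].

(* h = m(D) f, for f and h with integrable Fourier transforms *)
Definition fourier_multiplier (R : realType) (m : R -> R) (f h : R -> R) :
  Prop :=
  exists2 g, has_fourier f g & has_fourier h (fun xi => (m xi)%:C * g xi).

(* Lambda^gamma psi, for a test function psi *)
Definition Lambda (R : realType) (gamma : R) (psi : R -> R) (x : R) : R :=
  complex.Re
    (inverse_fourier (fun xi => (`|xi| `^ gamma)%:C * fourier psi xi) x).

(* u = (1 - dxx)^(-alpha) f *)
Definition is_bessel_potential (R : realType) (alpha : R) (f u : R -> R) :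
  Prop := fourier_multiplier (fun xi => (1 + `|xi| ^+ 2) `^ (- alpha)) f u.

(* N h for the h with rel f h, or +oo if there is none: in all uses below, h is
   unique up to a null set, on which N does not depend. *)
Definition norm_through (R : realType) (U : Type) (rel : (R -> R) -> U -> Prop)
  (N : U -> \bar R) (f : R -> R) : \bar R :=
  ereal_inf [set N h | h in [set h | rel f h]].

Definition wiener_weight (R : realType) (s xi : R) : R :=
  if s == 0 then 1 else 1 + `|xi| `^ s.

(* The norm of A^s; it is +oo outside of A^s. *)
Definition wiener_norm (R : realType) (s : R) : (R -> R) -> \bar R :=
  norm_through (@has_fourier R) (fun g =>
    (\int[lebesgue_measure]_xi
       (wiener_weight s xi * Normc.normc (g xi))%:E)%E).

Definition wiener (R : realType) (s : R) (f : R -> R) : Prop :=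
  (wiener_norm s f < +oo)%E.

Definition weak_deriv (R : realType) (k : nat) (f h : R -> R) : Prop :=
  [/\ locally_integrable setT f, locally_integrable setT h &
   forall phi, test_fun phi ->
     (\int[lebesgue_measure]_x (f x * derive1n k phi x))%R =
     (-1) ^+ k * (\int[lebesgue_measure]_x (h x * phi x))%R].

(* || f_x ||_{A^s} *)
Definition wiener_norm_dx (R : realType) (s : R) : (R -> R) -> \bar R :=
  norm_through (@weak_deriv R 1) (wiener_norm s).

(* The norm of W^{k,oo}(R); it is +oo outside of the space. *)
Definition Winfty_norm (R : realType) (k : nat) (f : R -> R) : \bar R :=
  (\sum_(j < k.+1)
     norm_through (@weak_deriv R j)
       (fun h => 'N[lebesgue_measure]_+oo[EFin \o h]) f)%E.

(* F is an a.e. limit, for the norm N, of simple functions of t *)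
Definition strongly_measurable (R : realType) (N : (R -> R) -> \bar R) (T : R)
  (F : R -> R -> R) : Prop :=
  exists (m : nat -> nat) (E : nat -> nat -> set R) (f : nat -> nat -> R -> R),
    (forall n i, measurable (E n i) /\ (N (f n i) < +oo)%E) /\
    {ae lebesgue_measure, forall t : R, 0 < t < T ->
      (fun n => N (fun x => F t x - \sum_(i < m n) \1_(E n i) t * f n i x))
        @ \oo --> (0 : \bar R)%E}.

Definition jointly_measurable (R : realType) (F : R -> R -> R) : Prop :=
  measurable_fun setT (fun z : R * R => F z.1 z.2).

Definition bochner_Linfty (R : realType) (N : (R -> R) -> \bar R) (T : R)
  (F : R -> R -> R) : Prop :=
  [/\ jointly_measurable F, strongly_measurable N T F &
   exists M : R,
     {ae lebesgue_measure, forall t : R, 0 < t < T -> (N (F t) <= M%:E)%E}].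

Definition bochner_L1 (R : realType) (N : (R -> R) -> \bar R) (T : R)
  (F : R -> R -> R) : Prop :=
  [/\ jointly_measurable F, strongly_measurable N T F &
   (\int[lebesgue_measure]_(t in `]0%R, T[) N (F t) < +oo)%E].

(* G is the weak time derivative of F on (0, T); for jointly measurable F in
   L^1(0,T;L^oo), the Bochner integral of F(t) phi'(t) is represented by the
   function whose value at a.e. x is the integral of F(t,x) phi'(t). *)
Definition weak_time_deriv (R : realType) (T : R) (F G : R -> R -> R) : Prop :=
  forall phi, test_fun phi ->
    (exists a b : R, [/\ 0 < a, b < T & forall t, ~~ (a <= t <= b) -> phi t = 0]) ->
    {ae lebesgue_measure, forall x : R,
      (\int[lebesgue_measure]_(t in `]0, T[) (F t x * derive1 phi t))%R =
      - (\int[lebesgue_measure]_(t in `]0, T[) (G t x * phi t))%R}.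

Definition W_space (R : realType) (T : R) (theta : R -> R -> R) : Prop :=
  [/\ bochner_Linfty (@Winfty_norm R 1) T theta,
      bochner_Linfty (@Winfty_norm R 0) T theta /\
      (exists2 G, bochner_Linfty (@Winfty_norm R 0) T G &
                  weak_time_deriv T theta G)
    & bochner_L1 (@Winfty_norm R 2) T theta].

Definition weak_integrand (R : realType) (gamma : R)
  (theta u ux psi : R -> R -> R) (t x : R) : R :=
  theta t x * dt psi t x + ux t x * theta t x * psi t x +
  u t x * theta t x * dx psi t x - theta t x * Lambda gamma (psi t) x.

Definition weak_solution (R : realType) (alpha gamma : R) (theta0 : R -> R)
  (theta : R -> R -> R) : Prop :=
  jointly_measurable theta /\
  exists u ux : R -> R -> R,
  [/\ jointly_measurable u, jointly_measurable ux,
      {ae lebesgue_measure, forall t : R, 0 < t ->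
         is_bessel_potential alpha (theta t) (u t) /\
         weak_deriv 1 (u t) (ux t)}
    & forall (T : R) (psi : R -> R -> R), 0 < T -> spacetime_test_fun T psi ->
      (lebesgue_measure \x lebesgue_measure)%E.-integrable
        (`[0, T] `*` setT)
        (fun z => (weak_integrand gamma theta u ux psi z.1 z.2)%:E) /\
      (\int[lebesgue_measure]_(t in `[0, T]) \int[lebesgue_measure]_x
         weak_integrand gamma theta u ux psi t x)%R =
      - (\int[lebesgue_measure]_x (theta0 x * psi 0 x))%R].

(* Existence and uniqueness of a function of (t, x) on (0, +oo) x R, where
   functions that are a.e. equal are identified. *)
Definition exists_unique_ae (R : realType) (P : (R -> R -> R) -> Prop) : Prop :=
  exists theta, P theta /\
    forall eta, P eta ->
      {ae (lebesgue_measure \x lebesgue_measure)%E, forall z : R * R,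
         0 < z.1 -> eta z.1 z.2 = theta z.1 z.2}.

(* Main.v *)
(* Write g(t, xi) for the Fourier transform of theta(t), m for the symbol
   (1 + |xi|^2)^(-alpha), which takes its values in [0, 1], c = 1 / sqrt (2 pi) and
   M_n h for the integral of |xi|^n |h(xi)|.  The equation becomes
   g_t = - |xi| g + q(g, g), where q(g, h) = - c (m g) * (i xi h), and
     M_0 q(g, g) <= c M_0 g M_1 g,   M_1 q(g, g) <= 2 c M_0 g M_2 g.
   Integrating Duhamel's formula,
     M_n g(t) + int_0^t M_(n+1) g <= M_n g(0) + int_0^t M_n q(g, g),
   so that, when 2 c M_0 g(0) < 1, the nonlinear term is absorbed by the dissipation:
   M_0 g does not increase, and M_0 g + M_1 g satisfies the stated estimate (note
   that 2 c = sqrt 2 / sqrt pi).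

   Existence: these bounds make Duhamel's map a contraction for a norm weighted by
   an exponential in time, once its argument is retracted onto the ball
   M_0 <= a, and the retraction is inactive at the fixed point.  The regularity and
   the weak formulation of theta = Re (inverse transform of g) follow by Fubini
   from g(t) = g(0) + int_0^t (q(g, g) - |xi| g), with Parseval's identity in space.

   Uniqueness: the transform h of another solution satisfies M_0 h + M_1 h <= B by
   the estimate.  Testing the weak formulation with products phi(t) chi(x), where
   phi' tends to the indicator of (0, r), shows that h obeys the same integral
   equation for almost every xi.  Since M_0 (q(h, h) - q(g, g)) <=
   c (B M_0 (h - g) + M_0 g M_1 (h - g)) with c M_0 g < 1, the dissipation absorbs
   the last term and Gronwall's lemma gives h = g. *)
From mathcomp Require Import all_boot all_order all_algebra all_classical.
From mathcomp Require Import all_reals all_analysis measurable_realfun complex.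
From mathcomp Require Import ring lra.
Require Import Defs.
Import Order.TTheory GRing.Theory Num.Theory.
Import numFieldNormedType.Exports.
Set Implicit Arguments.
Unset Strict Implicit.
Unset Printing Implicit Defensive.
Local Open Scope classical_set_scope.
Local Open Scope ring_scope.
Local Open Scope complex_scope.

Local Notation mu := lebesgue_measure.
Local Notation nc := Normc.normc.

(** The equation loses one derivative: [M_0] of a difference is controlled only together with the
    time integral of [M_1], whose coefficient must stay below one. This is where smallness acts, and
    why the fixed point is sought in a norm integrated in time.

    Representatives shape the rest. The constructed [g (t, xi)] satisfies Duhamel's formula at every
    point, so its integral equation holds for all times off one null set of frequencies. A second
    solution comes with no such choice: its transform must first be selected measurably in
    [(t, xi)], and null sets that depend on the test function are handled by countable families.

    The Poisson kernel serves twice. It regularizes Fourier inversion, its transform being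
    elementary; and, through [(1 - exp (-e Lambda)) / e], it gives the decay [1 / x^2] of
    [Lambda psi], which is not compactly supported, so that [theta Lambda psi] is integrable in the
    weak formulation. *)

Lemma measurable_EFin d (T : measurableType d) {R : realType} (f : T -> R) :
  measurable_fun setT f -> measurable_fun setT (fun x => (f x)%:E).
Proof. by move=> mf; apply/measurable_EFinP. Qed.

(** * Integration of nonnegative and of complex functions *)

Section almost_everywhere.
Context {R : realType}.
Implicit Types P Q : R -> Prop.

Lemma aeS P Q : (forall x, P x -> Q x) ->
  {ae mu, forall x, P x} -> {ae mu, forall x, Q x}.
Proof. by move=> PQ; apply: (@filterS _ _ (ae_filter_ringOfSetsType mu)). Qed.

Lemma aeI P Q : {ae mu, forall x, P x} -> {ae mu, forall x, Q x} ->
  {ae mu, forall x, P x /\ Q x}.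
Proof. exact: (@filterI _ _ (ae_filter_ringOfSetsType mu)). Qed.

Lemma aeT P : (forall x, P x) -> {ae mu, forall x, P x}.
Proof. by move=> h; apply: aeS (@filterT _ _ (ae_filter_ringOfSetsType mu)). Qed.

Lemma ae_neq (c : R) : {ae mu, forall x : R, x != c}.
Proof.
exists [set c]; split => //=; first by rewrite lebesgue_measure_set1.
by move=> x /= /negP; rewrite negbK => /eqP.
Qed.

Lemma ae_forall_nat (P : nat -> R -> Prop) :
  (forall n, {ae mu, forall x, P n x}) -> {ae mu, forall x, forall n, P n x}.
Proof. by move=> h; exact: ae_foralln. Qed.
End almost_everywhere.

Section ereal_integral.
Context {R : realType}.
Implicit Types (f g : R -> \bar R).

(** The integral of a nonnegative function is a supremum over the simple functions below it. This
    form applies to functions of time whose measurability is not at hand, such as the [W^{2,oo}]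
    norm or the Wiener norm of [theta_x]. *)
Lemma le_int f g : (forall x, (0 <= f x)%E) -> (forall x, (f x <= g x)%E) ->
  (\int[mu]_x f x <= \int[mu]_x g x)%E.
Proof.
move=> f0 fg.
have g0 x : (0 <= g x)%E by apply: le_trans (fg x).
rewrite !ge0_integralE// !patch_setT.
apply: ereal_sup_le => _ [h /= hf <-].
by exists h => // x; exact: le_trans (hf x) (fg x).
Qed.

Lemma int_fubini (F : R -> R -> \bar R) :
  measurable_fun setT (fun z : R * R => F z.1 z.2) ->
  (forall x y, (0 <= F x y)%E) ->
  (\int[mu]_x \int[mu]_y F x y = \int[mu]_y \int[mu]_x F x y)%E.
Proof.
move=> mF F0.
exact: (@fubini_tonelli _ _ _ _ R mu mu (fun z => F z.1 z.2)).
Qed.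

Lemma measurable_int_prod d (T : measurableType d) (F : T -> R -> \bar R) :
  measurable_fun setT (fun z : T * R => F z.1 z.2) ->
  (forall x y, (0 <= F x y)%E) ->
  measurable_fun setT (fun x => \int[mu]_y F x y)%E.
Proof.
move=> mF F0.
exact: (@measurable_fun_fubini_tonelli_F _ _ _ _ _ mu (fun z : T * R => F z.1 z.2)).
Qed.

(** The image of [mu] under [h], divided by [k], agrees with [mu] on the intervals []a, b]], hence
    everywhere by uniqueness of Lebesgue measure. Translations, the reflection and dilations are the
    instances used. *)
Lemma int_pushforward (h : R -> R) (k : R) f : measurable_fun setT h -> 0 < k ->
  (forall a b : R, a < b -> mu (h @^-1` `]a, b]) = (k * (b - a))%:E) ->
  measurable_fun setT f -> (forall x, (0 <= f x)%E) ->
  (\int[mu]_x f (h x) = k%:E * \int[mu]_x f x)%E.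
Proof.
move=> mh k0 hh mf f0.
have kge0 : 0 <= k by exact: ltW.
have ki : 0 <= k^-1 by rewrite invr_ge0.
pose nu := mscale (NngNum ki) (pushforward mu (h : R -> measurableTypeR R)).
have E1 : (\int[mu]_x f x = \int[nu mh]_x f x)%E.
  apply: eq_measure_integral => A mA _.
  apply: (@lebesgue_measure_unique _ (nu mh)) => //.
  move=> _ [[a b] _ <-]; change (mu `]a, b] = k^-1%:E * mu (h @^-1` `]a, b]))%E.
  have [ab|ba] := ltP a b.
    rewrite [X in _ = (_ * X)%E]hh// lebesgue_measure_itv/= lte_fin ab.
    by rewrite -EFinD -EFinM mulrA mulVf ?mul1r ?gt_eqF.
  by rewrite set_itv_ge ?preimage_set0 ?measure0 ?mule0// bnd_simp -leNgt.
rewrite E1 /nu ge0_integral_mscale//= ge0_integral_pushforward//=.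
  by rewrite muleA -EFinM divff ?mul1e ?gt_eqF.
Qed.

Lemma int_shift f (a : R) : measurable_fun setT f -> (forall x, (0 <= f x)%E) ->
  (\int[mu]_x f (x + a)%R = \int[mu]_x f x)%E.
Proof.
move=> mf f0; rewrite (@int_pushforward (fun x => x + a) 1) ?mul1e//.
- by apply: measurable_funD.
- move=> u v uv; rewrite (_ : _ @^-1` _ = `]u - a, v - a]%classic).
    by rewrite lebesgue_measure_itv/= lte_fin ltrD2r uv -EFinB; congr (_%:E); ring.
  by apply/seteqP; split => x /=; rewrite !in_itv/= ltrBlDr lerBrDr.
Qed.

Lemma int_opp f : measurable_fun setT f -> (forall x, (0 <= f x)%E) ->
  (\int[mu]_x f (- x)%R = \int[mu]_x f x)%E.
Proof.
move=> mf f0; rewrite (@int_pushforward -%R 1) ?mul1e//.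
move=> u v uv; rewrite (_ : _ @^-1` _ = `[- v, - u[%classic).
  by rewrite lebesgue_measure_itv/= lte_fin ltrN2 uv -EFinB; congr (_%:E); ring.
by apply/seteqP; split => x /=; rewrite !in_itv/= lerNl ltrNr andbC.
Qed.

Lemma int_scale f (k : R) : 0 < k -> measurable_fun setT f ->
  (forall x, (0 <= f x)%E) ->
  (\int[mu]_x f (k * x)%R = k^-1%:E * \int[mu]_x f x)%E.
Proof.
move=> k0 mf f0; rewrite (@int_pushforward (fun x => k * x) k^-1) ?invr_gt0//.
- by apply: measurable_funM.
- move=> u v uv; rewrite (_ : _ @^-1` _ = `]k^-1 * u, k^-1 * v]%classic).
    rewrite lebesgue_measure_itv/= lte_fin ltr_pM2l ?invr_gt0// uv -EFinB.
    by congr (_%:E); ring.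
  by apply/seteqP; split => x /=; rewrite !in_itv/= ltr_pdivrMl// ler_pdivlMl.
Qed.

Lemma int_dct0 (f : nat -> R -> R) (g : R -> R) :
  (forall n, measurable_fun setT (f n)) -> measurable_fun setT g ->
  (forall n x, 0 <= f n x) ->
  {ae mu, forall x n, f n x <= g x} ->
  (\int[mu]_x `|g x|%:E < +oo)%E ->
  {ae mu, forall x, f n x @[n --> \oo] --> 0} ->
  (\int[mu]_x (f n x)%:E)%E @[n --> \oo] --> 0%E.
Proof.
move=> mf mg f0 fg ig cvf.
have [|||||_ _] := @dominated_convergence _ _ R mu setT measurableT
  (fun n x => (f n x)%:E) (cst 0%E) (EFin \o g).
- by move=> n; exact: (measurable_EFin (mf n)).
- exact: measurable_cst.
- apply: aeS cvf => x fx _; by apply: cvg_EFin => //; exact: nearW.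
- by apply/integrableP; split => //; exact: (measurable_EFin mg).
- by apply: aeS fg => x h n _; rewrite /= lee_fin ger0_norm.
- by rewrite integral0.
Qed.

Lemma int_ae_eq0 (f : R -> R) : measurable_fun setT f -> (forall x, 0 <= f x) ->
  (\int[mu]_x (f x)%:E = 0)%E -> {ae mu, forall x, f x = 0}.
Proof.
move=> mf f0 i0.
have H := @ae_eq_integral_abs _ _ R mu setT measurableT _ (measurable_EFin mf).
have : ae_eq mu setT (fun x => (f x)%:E) (cst 0%E).
  apply/H => //; rewrite -[RHS]i0; apply: eq_integral => x _.
  by rewrite /= ger0_norm.
by apply: aeS => x /(_ I)[].
Qed.

Lemma int_lty_ae (f : R -> \bar R) : measurable_fun setT f ->
  (forall x, (0 <= f x)%E) ->
  (\int[mu]_x f x < +oo)%E -> {ae mu, forall x, (f x < +oo)%E}.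
Proof.
move=> mf f0 i0.
have /integrable_ae H : mu.-integrable setT f.
  apply/integrableP; split => //.
  by under eq_integral do rewrite gee0_abs//.
apply: aeS (H measurableT) => x /(_ I).
by rewrite ge0_fin_numE.
Qed.

Lemma le_int_ae (f g : R -> \bar R) : measurable_fun setT f ->
  measurable_fun setT g -> (forall x, (0 <= f x)%E) -> (forall x, (0 <= g x)%E) ->
  {ae mu, forall x, (f x <= g x)%E} -> (\int[mu]_x f x <= \int[mu]_x g x)%E.
Proof.
move=> mf mg f0 g0 fg; apply: ae_ge0_le_integral => //.
by apply: aeS fg => x ? _.
Qed.
End ereal_integral.

(** * Complex-valued functions through real and imaginary parts *)

Section complex_algebra.
Context {R : realType}.
Implicit Types (a b z : R[i]) (x y : R).

Lemma ReM a b : complex.Re (a * b) = complex.Re a * complex.Re b - complex.Im a * complex.Im b.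
Proof. by case: a b => [a1 a2] [b1 b2]. Qed.
Lemma ImM a b : complex.Im (a * b) = complex.Re a * complex.Im b + complex.Im a * complex.Re b.
Proof. by case: a b => [a1 a2] [b1 b2]. Qed.
Lemma ReD a b : complex.Re (a + b) = complex.Re a + complex.Re b.
Proof. by case: a b => [a1 a2] [b1 b2]. Qed.
Lemma ImD a b : complex.Im (a + b) = complex.Im a + complex.Im b.
Proof. by case: a b => [a1 a2] [b1 b2]. Qed.
Lemma ReN a : complex.Re (- a) = - complex.Re a.
Proof. by case: a. Qed.
Lemma ImN a : complex.Im (- a) = - complex.Im a.
Proof. by case: a. Qed.
Lemma ReJ a : complex.Re (conjc a) = complex.Re a.
Proof. by case: a. Qed.
Lemma ImJ a : complex.Im (conjc a) = - complex.Im a.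
Proof. by case: a. Qed.
Lemma ReRC x a : complex.Re (x%:C * a) = x * complex.Re a.
Proof. by rewrite ReM /= mul0r subr0. Qed.
Lemma ImRC x a : complex.Im (x%:C * a) = x * complex.Im a.
Proof. by rewrite ImM /= mul0r addr0. Qed.
Lemma complexP a b : complex.Re a = complex.Re b -> complex.Im a = complex.Im b -> a = b.
Proof. by case: a b => [a1 a2] [b1 b2] /= -> ->. Qed.

Lemma ReMR a x : complex.Re (a * x%:C) = complex.Re a * x.
Proof. by rewrite mulrC ReRC mulrC. Qed.
Lemma ImMR a x : complex.Im (a * x%:C) = complex.Im a * x.
Proof. by rewrite mulrC ImRC mulrC. Qed.
Lemma conjcM a b : conjc (a * b) = conjc a * conjc b.
Proof. by apply: complexP; rewrite ?(ReM, ImM, ReJ, ImJ); ring. Qed.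
Lemma conjcD a b : conjc (a + b) = conjc a + conjc b.
Proof. by apply: complexP; rewrite ?(ReD, ImD, ReJ, ImJ); ring. Qed.
Lemma conjcN a : conjc (- a) = - conjc a.
Proof. by apply: complexP; rewrite ?(ReN, ImN, ReJ, ImJ). Qed.
Lemma conjcR x : conjc x%:C = x%:C.
Proof. by apply: complexP; rewrite ?(ReJ, ImJ) //= oppr0. Qed.
Lemma RCM x y : (x * y)%:C = x%:C * y%:C.
Proof. by apply: complexP; rewrite ?ReM ?ImM /= ?mul0r ?mulr0 ?subr0 ?addr0. Qed.
Lemma RCD x y : (x + y)%:C = x%:C + y%:C.
Proof. by apply: complexP; rewrite ?ReD ?ImD /= ?addr0. Qed.
Lemma RCN x : (- x)%:C = - x%:C.
Proof. by apply: complexP; rewrite ?ReN ?ImN /= ?oppr0. Qed.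
Lemma RCB x y : (x - y)%:C = x%:C - y%:C.
Proof. by rewrite RCD RCN. Qed.

Lemma nc_ge0 z : 0 <= nc z.
Proof. by case: z => a b; exact: sqrtr_ge0. Qed.
Lemma ncE z : nc z = Num.sqrt (complex.Re z ^+ 2 + complex.Im z ^+ 2).
Proof. by case: z. Qed.
Lemma ncM a b : nc (a * b) = nc a * nc b. Proof. exact: Normc.normcM. Qed.
Lemma ncD a b : nc (a + b) <= nc a + nc b. Proof. exact: le_normcD. Qed.
Lemma ncN a : nc (- a) = nc a. Proof. exact: normcN. Qed.
Lemma ncB a b : nc (a - b) <= nc a + nc b.
Proof. by rewrite -(ncN b); exact: ncD. Qed.
Lemma ncBC a b : nc (a - b) = nc (b - a).
Proof. by rewrite -(ncN (a - b)) opprB. Qed.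
Lemma nc_triangle a b c : nc (a - b) <= nc (c - a) + nc (c - b).
Proof. by rewrite -(subrKA c a (- b)) (ncBC c a); exact: ncD. Qed.
Lemma ncB_lt a b : nc a - nc b <= nc (a - b).
Proof. by rewrite lerBlDr -{1}(subrK b a) ncD. Qed.
Lemma nc0 : nc (0 : R[i]) = 0. Proof. exact: Normc.normc0. Qed.
Lemma nc_eq0 z : nc z = 0 -> z = 0. Proof. exact: Normc.eq0_normc. Qed.
Lemma nc_real x : nc x%:C = `|x|.
Proof. by rewrite ncE /= expr0n addr0 sqrtr_sqr. Qed.
Lemma ncJ z : nc (conjc z) = nc z.
Proof. by rewrite !ncE ReJ ImJ sqrrN. Qed.
Lemma nc_i : nc ('i%C : R[i]) = 1.
Proof. by rewrite ncE /= expr0n add0r expr1n sqrtr1. Qed.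
Lemma nc_Re z : `|complex.Re z| <= nc z.
Proof. by rewrite ncE -sqrtr_sqr ler_wsqrtr// lerDl sqr_ge0. Qed.
Lemma nc_Im z : `|complex.Im z| <= nc z.
Proof. by rewrite ncE -sqrtr_sqr ler_wsqrtr// lerDr sqr_ge0. Qed.
Lemma nc_le z : nc z <= `|complex.Re z| + `|complex.Im z|.
Proof.
rewrite ncE -[leRHS]ger0_norm ?addr_ge0// -sqrtr_sqr ler_wsqrtr// sqrrD.
by rewrite !real_normK ?num_real// lerD2r lerDl mulrn_wge0// mulr_ge0.
Qed.
Lemma nc_sqr z : nc z ^+ 2 = complex.Re (conjc z * z).
Proof.
by rewrite ncE sqr_sqrtr ?addr_ge0 ?sqr_ge0// ReM ReJ ImJ mulNr opprK !expr2.
Qed.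

Lemma cisD x y : cis (x + y) = cis x * cis y.
Proof. by apply: complexP; rewrite ?ReM ?ImM /= ?cosD ?sinD //; ring. Qed.
Lemma cisN x : cis (- x) = conjc (cis x).
Proof. by rewrite /cis cosN sinN. Qed.
Lemma nc_cis x : nc (cis x) = 1.
Proof. by rewrite ncE /= cos2Dsin2 sqrtr1. Qed.
End complex_algebra.

Definition cmeas {R : realType} d (T : measurableType d) (f : T -> R[i]) :=
  measurable_fun setT (fun x => complex.Re (f x)) /\
  measurable_fun setT (fun x => complex.Im (f x)).

Section complex_measurability.
Context {R : realType} d (T : measurableType d).
Implicit Types f g : T -> R[i].

Lemma cmeas_cst (c : R[i]) : cmeas (fun _ : T => c).
Proof. by split; exact: measurable_cst. Qed.
Lemma cmeas_real (f : T -> R) : measurable_fun setT f -> cmeas (fun x => (f x)%:C).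
Proof. by split => //=; exact: measurable_cst. Qed.
Lemma cmeasD f g : cmeas f -> cmeas g -> cmeas (fun x => f x + g x).
Proof.
move=> [f1 f2] [g1 g2]; split.
  by under eq_fun do rewrite ReD; exact: measurable_funD.
by under eq_fun do rewrite ImD; exact: measurable_funD.
Qed.
Lemma cmeasN f : cmeas f -> cmeas (fun x => - f x).
Proof.
move=> [f1 f2]; split.
  by under eq_fun do rewrite ReN; exact: measurableT_comp.
by under eq_fun do rewrite ImN; exact: measurableT_comp.
Qed.
Lemma cmeasB f g : cmeas f -> cmeas g -> cmeas (fun x => f x - g x).
Proof. by move=> mf mg; apply: cmeasD => //; exact: cmeasN. Qed.
Lemma cmeasM f g : cmeas f -> cmeas g -> cmeas (fun x => f x * g x).
Proof.
move=> [f1 f2] [g1 g2]; split.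
  under eq_fun do rewrite ReM.
  by apply: measurable_funB; exact: measurable_funM.
under eq_fun do rewrite ImM.
by apply: measurable_funD; exact: measurable_funM.
Qed.
Lemma cmeasJ f : cmeas f -> cmeas (fun x => conjc (f x)).
Proof.
move=> [f1 f2]; split; first by under eq_fun do rewrite ReJ.
by under eq_fun do rewrite ImJ; exact: measurableT_comp.
Qed.
Lemma cmeas_cis (f : T -> R) : measurable_fun setT f -> cmeas (fun x => cis (f x)).
Proof.
move=> mf; split => /=.
  apply: (measurableT_comp _ mf); apply: continuous_measurable_fun.
  exact: continuous_cos.
apply: (measurableT_comp _ mf); apply: continuous_measurable_fun.
exact: continuous_sin.
Qed.
Lemma measurable_nc f : cmeas f -> measurable_fun setT (fun x => nc (f x)).
Proof.
move=> [f1 f2]; under eq_fun do rewrite ncE.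
apply: (@measurableT_comp _ _ _ _ _ _ (@Num.sqrt R)).
  by apply: continuous_measurable_fun; exact: sqrt_continuous.
by apply: measurable_funD; exact: measurable_funX.
Qed.
Lemma cmeas_comp d' (T' : measurableType d') (h : T' -> T) f :
  cmeas f -> measurable_fun setT h -> cmeas (fun x => f (h x)).
Proof. by move=> [f1 f2] mh; split; [exact: (measurableT_comp f1)|exact: (measurableT_comp f2)]. Qed.
End complex_measurability.

(** Equivalent to [cintegrable] by [cL1P]; a single integral of the modulus is the form in which all
    bounds are obtained. *)
Definition cL1 {R : realType} (f : R -> R[i]) :=
  cmeas f /\ (\int[mu]_x (nc (f x))%:E < +oo)%E.

(** Since [fine] sends both infinities to 0, scaling commutes with a difference of integrals even
    when these are infinite. Changes of variables thus hold for all measurable functions, with the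
    default value 0 on both sides when the integral is not finite. *)
Lemma fine_scaleB {R : realType} (k : R) (a b : \bar R) : 0 < k -> (0 <= a)%E ->
  (0 <= b)%E -> fine (k%:E * a - k%:E * b)%E = k * fine (a - b)%E.
Proof.
move=> k0; have kE : (0 < k%:E)%E by rewrite lte_fin.
case: a => [a||] //; case: b => [b||] //= _ _; rewrite ?gt0_muley//=.
- by rewrite mulrBr.
- by rewrite mulr0.
- by rewrite mulr0.
- by rewrite mulr0.
Qed.

Lemma fine_oppB {R : realType} (a b : \bar R) : (0 <= a)%E -> (0 <= b)%E ->
  fine (a - b)%E = - fine (b - a)%E.
Proof.
by case: a => [a||] //; case: b => [b||] //= _ _; rewrite ?oppr0 ?opprB.
Qed.

Section cintegral_theory.
Context {R : realType}.
Implicit Types f g : R -> R[i].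

Lemma Rint_pushforward (h : R -> R) (k : R) (f : R -> R) : 0 < k ->
  (forall g : R -> \bar R, measurable_fun setT g -> (forall x, (0 <= g x)%E) ->
    (\int[mu]_x g (h x) = k%:E * \int[mu]_x g x)%E) ->
  measurable_fun setT f ->
  \int[mu]_x f (h x) = k * \int[mu]_x f x.
Proof.
move=> k0 H mf; rewrite /Rintegral integralE [in RHS]integralE.
have mF := measurable_EFin mf.
have mp := measurable_funepos mF.
have mn := measurable_funeneg mF.
have E1 : (\int[mu]_x ((fun x => (f (h x))%:E)^\+ x) =
           k%:E * \int[mu]_x ((fun x => (f x)%:E)^\+ x))%E.
  rewrite -(H _ mp)//; apply: eq_integral => x _; by rewrite !funeposE.
have E2 : (\int[mu]_x ((fun x => (f (h x))%:E)^\- x) =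
           k%:E * \int[mu]_x ((fun x => (f x)%:E)^\- x))%E.
  rewrite -(H _ mn)//; apply: eq_integral => x _; by rewrite !funenegE.
by rewrite E1 E2 fine_scaleB//; exact: integral_ge0.
Qed.

Lemma Rint_opp (f : R -> R) : measurable_fun setT f ->
  \int[mu]_x f (- x) = \int[mu]_x f x.
Proof.
move=> mf; have := @Rint_pushforward -%R 1 f ltr01.
by rewrite mul1r; apply=> // g mg g0; rewrite mul1e int_opp.
Qed.

Lemma cint_pushforward (h : R -> R) (k : R) f : 0 < k ->
  (forall g : R -> \bar R, measurable_fun setT g -> (forall x, (0 <= g x)%E) ->
    (\int[mu]_x g (h x) = k%:E * \int[mu]_x g x)%E) ->
  cmeas f -> cintegral (fun x => f (h x)) = k%:C * cintegral f.
Proof.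
move=> k0 H [mf1 mf2]; apply: complexP; rewrite ?ReRC ?ImRC.
  exact: (Rint_pushforward k0 H mf1).
exact: (Rint_pushforward k0 H mf2).
Qed.

Lemma cint_shift f (a : R) : cmeas f -> cintegral (fun x => f (x + a)) = cintegral f.
Proof.
move=> mf; rewrite (@cint_pushforward (fun x => x + a) 1)// ?mul1r//.
by move=> g mg g0; rewrite mul1e int_shift.
Qed.

Lemma cint_opp f : cmeas f -> cintegral (fun x => f (- x)) = cintegral f.
Proof.
move=> mf; rewrite (@cint_pushforward -%R 1)// ?mul1r//.
by move=> g mg g0; rewrite mul1e int_opp.
Qed.

Lemma cL1P f : cL1 f <-> cintegrable f.
Proof.
split=> [[[m1 m2] i]|[i1 i2]].
  have mc : measurable_fun setT (fun x => (nc (f x))%:E).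
    by apply: measurable_EFin; exact: measurable_nc.
  split; apply/integrableP; (split; first exact: measurable_EFin);
    apply: le_lt_trans i; apply: le_int => x; rewrite ?lee_fin//.
    exact: nc_Re.
  exact: nc_Im.
have m1 := measurable_int mu i1; have m2 := measurable_int mu i2.
have mf : cmeas f by split; apply/measurable_EFinP.
split => //.
have /integrableP[_ j1] := i1.
have /integrableP[_ j2] := i2.
apply: (@le_lt_trans _ _ (\int[mu]_x (`|(complex.Re (f x))%:E| + `|(complex.Im (f x))%:E|))%E).
  apply: le_int => x; first by rewrite lee_fin nc_ge0.
  by rewrite /= -EFinD lee_fin nc_le.
rewrite ge0_integralD//; last 2 first.
  by apply: measurableT_comp.
  by apply: measurableT_comp.
exact: lte_add_pinfty.
Qed.

Lemma int_nc_ge0 f : (0 <= \int[mu]_x (nc (f x))%:E)%E.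
Proof. by apply: integral_ge0 => x _; rewrite lee_fin nc_ge0. Qed.

Lemma cL1_fin f : cL1 f -> (\int[mu]_x (nc (f x))%:E)%E \is a fin_num.
Proof. by case=> _ h; rewrite ge0_fin_numE// int_nc_ge0. Qed.

Lemma cL1_le f g : cmeas f -> cL1 g -> (forall x, nc (f x) <= nc (g x)) -> cL1 f.
Proof.
move=> mf [mg ig] fg; split => //; apply: le_lt_trans ig; apply: le_int => x.
  by rewrite lee_fin nc_ge0.
by rewrite lee_fin.
Qed.

Lemma int_ncD f g : cmeas f -> cmeas g ->
  (\int[mu]_x (nc (f x + g x))%:E <=
   \int[mu]_x (nc (f x))%:E + \int[mu]_x (nc (g x))%:E)%E.
Proof.
move=> mf mg; rewrite -ge0_integralD//.
- by apply: le_int => x; rewrite -?EFinD lee_fin ?nc_ge0 ?ncD.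
- by move=> x _; rewrite lee_fin nc_ge0.
- exact: (measurable_EFin (measurable_nc mf)).
- by move=> x _; rewrite lee_fin nc_ge0.
- exact: (measurable_EFin (measurable_nc mg)).
Qed.

Lemma cL1D f g : cL1 f -> cL1 g -> cL1 (fun x => f x + g x).
Proof.
move=> [mf i] [mg j]; split; first exact: cmeasD.
by apply: (le_lt_trans (int_ncD mf mg)); exact: lte_add_pinfty.
Qed.

Lemma cL1N f : cL1 f -> cL1 (fun x => - f x).
Proof.
move=> [mf i]; split; first exact: cmeasN.
by under eq_integral do rewrite ncN.
Qed.

Lemma cL1B f g : cL1 f -> cL1 g -> cL1 (fun x => f x - g x).
Proof. by move=> h k; apply: cL1D => //; exact: cL1N. Qed.

Lemma int_ncZ (k : R) f : 0 <= k -> cmeas f ->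
  (\int[mu]_x (k * nc (f x))%:E = k%:E * \int[mu]_x (nc (f x))%:E)%E.
Proof.
move=> k0 mf; under eq_integral do rewrite EFinM.
rewrite ge0_integralZl_EFin//.
- by move=> x _; rewrite lee_fin nc_ge0.
- exact: (measurable_EFin (measurable_nc mf)).
Qed.

Lemma cL1M_bounded (M : R) f g : cmeas f -> (forall x, nc (f x) <= M) -> cL1 g ->
  cL1 (fun x => f x * g x).
Proof.
move=> mf fM [mg ig]; have M0 : 0 <= M := le_trans (nc_ge0 _) (fM 0).
split; first exact: cmeasM.
apply: (@le_lt_trans _ _ (\int[mu]_x (M * nc (g x))%:E)%E).
  by apply: le_int => x; rewrite lee_fin ?nc_ge0// ncM ler_wpM2r ?nc_ge0.
by rewrite int_ncZ// lte_mul_pinfty ?lee_fin.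
Qed.

Lemma cL1Z (k : R[i]) f : cL1 f -> cL1 (fun x => k * f x).
Proof. by apply: cL1M_bounded => //; exact: cmeas_cst. Qed.

Lemma cL1_comp_opp f : cL1 f -> cL1 (fun x => f (- x)).
Proof.
move=> [mf i]; split; first by apply: (cmeas_comp mf).
rewrite (int_opp (f := fun x => (nc (f x))%:E))//.
  exact: (measurable_EFin (measurable_nc mf)).
by move=> x; rewrite lee_fin nc_ge0.
Qed.

Lemma cL1_comp_shift f (a : R) : cL1 f -> cL1 (fun x => f (x + a)).
Proof.
move=> [mf i]; split.
  by apply: (cmeas_comp mf); exact: measurable_funD.
rewrite (int_shift (f := fun x => (nc (f x))%:E))//.
  exact: (measurable_EFin (measurable_nc mf)).
by move=> x; rewrite lee_fin nc_ge0.
Qed.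

Lemma cintegralD f g : cL1 f -> cL1 g ->
  cintegral (fun x => f x + g x) = cintegral f + cintegral g.
Proof.
move=> /cL1P[f1 f2] /cL1P[g1 g2]; apply: complexP; rewrite ?ReD ?ImD /=.
  rewrite -RintegralD//; apply: eq_Rintegral => x _; exact: ReD.
rewrite -RintegralD//; apply: eq_Rintegral => x _; exact: ImD.
Qed.

Lemma cintegralZ (k : R[i]) f : cL1 f ->
  cintegral (fun x => k * f x) = k * cintegral f.
Proof.
move=> /cL1P[f1 f2].
have iR (r : R) (u : R -> R) : mu.-integrable setT (EFin \o u) ->
    mu.-integrable setT (EFin \o (fun x => r * u x)).
  by move=> iu; have := integrableZl measurableT r iu.
apply: complexP; rewrite ?ReM ?ImM /=.
  rewrite -!RintegralZl// -RintegralB//; [|exact: iR|exact: iR].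
  by apply: eq_Rintegral => x _; rewrite ReM.
rewrite -!RintegralZl// -RintegralD//; [|exact: iR|exact: iR].
by apply: eq_Rintegral => x _; rewrite ImM.
Qed.

Lemma cintegralN f : cL1 f -> cintegral (fun x => - f x) = - cintegral f.
Proof.
move=> h; rewrite -mulN1r -cintegralZ//; congr cintegral.
by apply/funext => x; rewrite mulN1r.
Qed.

Lemma cintegralB f g : cL1 f -> cL1 g ->
  cintegral (fun x => f x - g x) = cintegral f - cintegral g.
Proof. by move=> h k; rewrite cintegralD// ?cintegralN//; exact: cL1N. Qed.

Lemma RintN (f : R -> R) : \int[mu]_x (- f x) = - \int[mu]_x f x.
Proof.
rewrite /Rintegral integralE [in RHS]integralE fine_oppB; try exact: integral_ge0.
congr (- fine (_ - _)%E); apply: eq_integral => x _.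
  by rewrite funenegE funeposE /= opprK.
by rewrite funenegE funeposE.
Qed.

Lemma cintegralJ f : cintegral (fun x => conjc (f x)) = conjc (cintegral f).
Proof.
apply: complexP; rewrite ?ReJ ?ImJ /=.
  by apply: eq_Rintegral => x _; rewrite ReJ.
by rewrite -RintN; apply: eq_Rintegral => x _; rewrite ImJ.
Qed.

Lemma cintegral0 : cintegral (fun _ : R => 0) = 0 :> R[i].
Proof.
by apply: complexP => /=; rewrite /Rintegral integral0.
Qed.

(** Multiplying [f] by the conjugate of its integral [z] makes the integral equal to the real number
    [|z|^2], which is at most [|z|] times the integral of [|f|]. *)
Lemma nc_cintegral f : cmeas f ->
  ((nc (cintegral f))%:E <= \int[mu]_x (nc (f x))%:E)%E.
Proof.
move=> mf; have [->|iy] := eqVneq (\int[mu]_x (nc (f x))%:E)%E +oo%E.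
  exact: leey.
have fL : cL1 f by split => //; rewrite ltey.
set z := cintegral f; have [->|z0] := eqVneq z 0.
  by rewrite nc0 integral_ge0// => x _; rewrite lee_fin nc_ge0.
have nz0 : 0 < nc z.
  by rewrite lt_neqAle nc_ge0 andbT eq_sym; apply: contra_neq z0; exact: nc_eq0.
rewrite -(@lee_pmul2l _ (nc z)%:E)// -EFinM -expr2 nc_sqr -cintegralZ//=.
have zf := cL1Z (conjc z) fL.
have /cL1P[i1 _] := zf.
have := le_normr_Rintegral measurableT i1.
move=> /(le_trans (ler_norm _)) H.
rewrite -int_ncZ ?nc_ge0//.
apply: (@le_trans _ _ ((\int[mu]_t `|complex.Re (conjc z * f t)|)%:E)).
  by rewrite lee_fin.
rewrite /Rintegral fineK; last first.
  rewrite ge0_fin_numE; last by apply: integral_ge0 => x _; rewrite lee_fin.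
  by have /integrableP[_] := i1.
apply: le_int => x; first by rewrite lee_fin.
by rewrite lee_fin (le_trans (nc_Re _))// ncM ncJ.
Qed.

Lemma nc_cintegral_fine f : cL1 f ->
  nc (cintegral f) <= fine (\int[mu]_x (nc (f x))%:E)%E.
Proof.
move=> [mf fi]; rewrite -lee_fin fineK ?nc_cintegral//.
by rewrite ge0_fin_numE// integral_ge0// => x _; rewrite lee_fin nc_ge0.
Qed.

Lemma cintegral_ae f g : cmeas f -> cmeas g -> {ae mu, forall x, f x = g x} ->
  cintegral f = cintegral g.
Proof.
move=> [f1 f2] [g1 g2] fg; apply: complexP; rewrite /= /Rintegral; congr fine;
  apply: ae_eq_integral => //.
- exact: (measurable_EFin f1).
- exact: (measurable_EFin g1).
- by apply: aeS fg => x -> _.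
- exact: (measurable_EFin f2).
- exact: (measurable_EFin g2).
- by apply: aeS fg => x -> _.
Qed.

Lemma eq_cintegral f g : (forall x, f x = g x) -> cintegral f = cintegral g.
Proof. by move=> fg; congr cintegral; apply/funext. Qed.

Lemma measurable_Rint d (T : measurableType d) (F : T -> R -> R) :
  measurable_fun setT (fun z : T * R => F z.1 z.2) ->
  measurable_fun setT (fun x => \int[mu]_y F x y).
Proof.
move=> mF; apply: (measurableT_comp (fine_measurable measurableT)).
under eq_fun do rewrite integralE.
have mE := measurable_EFin mF.
apply: emeasurable_funB; apply: measurable_int_prod => //.
- have := measurable_funepos mE.
  by congr (measurable_fun _ _); apply/funext => z; rewrite !funeposE.
- have := measurable_funeneg mE.
  by congr (measurable_fun _ _); apply/funext => z; rewrite !funenegE.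
Qed.

Lemma cmeas_cintegral d (T : measurableType d) (F : T -> R -> R[i]) :
  cmeas (fun z : T * R => F z.1 z.2) -> cmeas (fun x => cintegral (F x)).
Proof. by move=> [m1 m2]; split; exact: measurable_Rint. Qed.

Lemma Rint_fubini (f : R -> R -> R) :
  measurable_fun setT (fun z : R * R => f z.1 z.2) ->
  (\int[mu]_x \int[mu]_y `|f x y|%:E < +oo)%E ->
  \int[mu]_x \int[mu]_y f x y = \int[mu]_y \int[mu]_x f x y.
Proof.
move=> mf fi.
pose F := fun z : R * R => (f z.1 z.2)%:E.
have mF : measurable_fun setT F by exact: (measurable_EFin mf).
have iF : (mu \x mu)%E.-integrable setT F by apply/integrable12ltyP.
have E1 := integral12_prod_meas1 iF; have E2 := integral21_prod_meas1 iF.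
have -> : \int[mu]_x \int[mu]_y f x y = fine (\int[mu]_x fubini_F mu F x)%E.
  congr fine; apply: ae_eq_integral => //.
  - apply: measurable_EFin; exact: measurable_Rint mf.
  - exact: measurable_fubini_F iF.
  - have := ae_integrable1 iF; apply: aeS => x ix _.
    by rewrite /Rintegral fineK// integrable_fin_num.
rewrite E1 -E2.
congr fine; apply: ae_eq_integral => //.
- exact: measurable_fubini_G iF.
- have ms : measurable_fun setT (fun z : R * R => f z.2 z.1).
    apply: (measurableT_comp mf (g := fun z : R * R => (z.2, z.1))).
    exact: measurable_swap.
  exact: (measurable_EFin (measurable_Rint (F := fun x y => f y x) ms)).
- have := ae_integrable2 iF; apply: aeS => x ix _.
  by rewrite /Rintegral fineK// integrable_fin_num.
Qed.

Lemma cfubini (F : R -> R -> R[i]) : cmeas (fun z : R * R => F z.1 z.2) ->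
  (\int[mu]_x \int[mu]_y (nc (F x y))%:E < +oo)%E ->
  cintegral (fun x => cintegral (F x)) =
  cintegral (fun y => cintegral (fun x => F x y)).
Proof.
move=> mF Fi; have le_fin (g : R[i] -> R) : (forall z, `|g z| <= nc z) ->
    (\int[mu]_x \int[mu]_y `|g (F x y)|%:E < +oo)%E.
  move=> gn; apply: (le_lt_trans _ Fi); apply: le_int => x.
    by apply: integral_ge0 => y _; rewrite lee_fin.
  by apply: le_int => y; rewrite lee_fin.
case: mF => m1 m2; apply: complexP.
  exact: (Rint_fubini m1 (le_fin _ nc_Re)).
exact: (Rint_fubini m2 (le_fin _ nc_Im)).
Qed.

Lemma measurable_int_nc d (T : measurableType d) (F : T -> R -> R[i]) :
  cmeas (fun z : T * R => F z.1 z.2) ->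
  measurable_fun setT (fun x => \int[mu]_y (nc (F x y))%:E)%E.
Proof.
move=> mF; apply: measurable_int_prod.
  exact: (measurable_EFin (measurable_nc mF)).
by move=> x y; rewrite lee_fin nc_ge0.
Qed.

Lemma cmeas_slice (F : R -> R -> R[i]) x : cmeas (fun z : R * R => F z.1 z.2) ->
  cmeas (F x).
Proof. by move=> mF; exact: (cmeas_comp mF (pair1_measurable x)). Qed.

Lemma cfubini_ae (F : R -> R -> R[i]) : cmeas (fun z : R * R => F z.1 z.2) ->
  (\int[mu]_x \int[mu]_y (nc (F x y))%:E < +oo)%E ->
  {ae mu, forall x, cL1 (F x)}.
Proof.
move=> mF Fi.
have H := int_lty_ae (measurable_int_nc mF) _ Fi.
apply: (aeS _ (H _)) => [x h|x]; last first.
  by apply: integral_ge0 => y _; rewrite lee_fin nc_ge0.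
by split => //; exact: cmeas_slice.
Qed.

(** The limit inherits the bound [b] almost everywhere, so [|f n - g|] is dominated by [2 b]. *)
Lemma cint_dct (f : nat -> R -> R[i]) g (b : R -> R) :
  (forall n, cmeas (f n)) -> cmeas g -> measurable_fun setT b ->
  (\int[mu]_x `|b x|%:E < +oo)%E ->
  {ae mu, forall x n, nc (f n x) <= b x} ->
  {ae mu, forall x, nc (f n x - g x) @[n --> \oo] --> 0} ->
  (\int[mu]_x (nc (f n x - g x))%:E)%E @[n --> \oo] --> 0%E.
Proof.
move=> mf mg mb ib fb cv.
apply: (int_dct0 (g := fun x => b x + b x)) => //.
- by move=> n; apply: measurable_nc; exact: cmeasB.
- exact: measurable_funD.
- by move=> n x; exact: nc_ge0.
- apply: aeS (aeI fb cv) => x [fbx cvx] n.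
  have gb : nc (g x) <= b x.
    have : (fun n => nc (g x) - nc (f n x - g x)) @ \oo --> nc (g x) - 0.
      by apply: cvgB => //; exact: cvg_cst.
    rewrite subr0 => /cvgr_to_le; apply; apply: nearW => m.
    by rewrite ncBC (le_trans _ (fbx m))// lerBlDr -lerBlDl ncB_lt.
  by rewrite (le_trans (ncB _ _))// lerD.
- apply: le_lt_trans (_ : (\int[mu]_x (`|b x|%:E + `|b x|%:E) < +oo)%E).
    apply: le_int => x; first by rewrite lee_fin.
    by rewrite -EFinD lee_fin ler_normD.
  rewrite ge0_integralD//; first exact: lte_add_pinfty.
  + by apply: measurable_EFin; exact: measurableT_comp.
  + by apply: measurable_EFin; exact: measurableT_comp.
Qed.
End cintegral_theory.

Section measurability_closure.
Context {R : realType} d (T : measurableType d).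
Implicit Types f g : T -> R.

Lemma mfunD f g : measurable_fun setT f -> measurable_fun setT g ->
  measurable_fun setT (fun x => f x + g x).
Proof. exact: measurable_funD. Qed.
Lemma mfunN f : measurable_fun setT f -> measurable_fun setT (fun x => - f x).
Proof. exact: measurableT_comp. Qed.
Lemma mfunM f g : measurable_fun setT f -> measurable_fun setT g ->
  measurable_fun setT (fun x => f x * g x).
Proof. exact: measurable_funM. Qed.
Lemma mfunX f n : measurable_fun setT f -> measurable_fun setT (fun x => f x ^+ n).
Proof. exact: measurable_funX. Qed.
Lemma mfun_norm f : measurable_fun setT f -> measurable_fun setT (fun x => `|f x|).
Proof. exact: measurableT_comp. Qed.
Lemma mfun_expR f : measurable_fun setT f -> measurable_fun setT (fun x => expR (f x)).
Proof. exact: measurableT_comp. Qed.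
Lemma mfun_powR f (k : R) : measurable_fun setT f -> measurable_fun setT (fun x => f x `^ k).
Proof. exact: measurableT_comp (measurable_powR k). Qed.
Lemma mfunV f : (forall x, 0 <= f x) -> measurable_fun setT f ->
  measurable_fun setT (fun x => (f x)^-1).
Proof.
move=> f0 mf; under eq_fun do rewrite -powR_inv1//.
exact: mfun_powR.
Qed.
Lemma mfun_max f g : measurable_fun setT f -> measurable_fun setT g ->
  measurable_fun setT (fun x => Num.max (f x) (g x)).
Proof. exact: measurable_maxr. Qed.
Lemma mfun_indic (A : set R) f : measurable A -> measurable_fun setT f ->
  measurable_fun setT (fun x => \1_A (f x) : R).
Proof. by move=> mA; apply: measurableT_comp; exact: measurable_indic. Qed.
Lemma mfun_pair d1 d2 (T1 : measurableType d1) (T2 : measurableType d2)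
  (f : T -> T1) (g : T -> T2) : measurable_fun setT f -> measurable_fun setT g ->
  measurable_fun setT (fun x => (f x, g x)).
Proof. exact: measurable_fun_pair. Qed.
Lemma mfun_fst d1 d2 (T1 : measurableType d1) (T2 : measurableType d2)
  (f : T -> T1 * T2) : measurable_fun setT f -> measurable_fun setT (fun x => (f x).1).
Proof. exact: (measurableT_comp measurable_fst). Qed.
Lemma mfun_snd d1 d2 (T1 : measurableType d1) (T2 : measurableType d2)
  (f : T -> T1 * T2) : measurable_fun setT f -> measurable_fun setT (fun x => (f x).2).
Proof. exact: (measurableT_comp measurable_snd). Qed.
End measurability_closure.

Lemma cmeas_joint {R : realType} d1 d2 d (T1 : measurableType d1)
  (T2 : measurableType d2) (T : measurableType d) (F : T1 -> T2 -> R[i])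
  (f : T -> T1) (g : T -> T2) :
  cmeas (fun z : T1 * T2 => F z.1 z.2) -> measurable_fun setT f ->
  measurable_fun setT g -> cmeas (fun x => F (f x) (g x)).
Proof. by move=> mF mf mg; apply: (cmeas_comp mF (mfun_pair mf mg)). Qed.

Lemma mfun_joint {R : realType} d1 d2 d (T1 : measurableType d1)
  (T2 : measurableType d2) (T : measurableType d) (F : T1 -> T2 -> R)
  (f : T -> T1) (g : T -> T2) :
  measurable_fun setT (fun z : T1 * T2 => F z.1 z.2) -> measurable_fun setT f ->
  measurable_fun setT g -> measurable_fun setT (fun x => F (f x) (g x)).
Proof. by move=> mF mf mg; exact: (measurableT_comp mF (mfun_pair mf mg)). Qed.

(** Goals on [cmeas] and [measurable_fun] are reduced along the head operation of the function; a
    hypothesis on an uncurried function also serves for its compositions with measurable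
    arguments. *)
Ltac meas1 := match goal with
  | |- cmeas _ => assumption
  | |- measurable_fun _ _ => assumption
  | |- is_true true => exact: isT
  | |- cmeas (real_complex _) => apply: (cmeas_real (f := fun x => x))
  | |- measurable_fun _ Normc.normc => apply: (measurable_nc (f := fun x => x))
  | |- cmeas (fun x => _ + _) => first [apply: cmeasB|apply: cmeasD]
  | |- cmeas (fun x => - _) => apply: cmeasN
  | |- cmeas (fun x => _ * _) => apply: cmeasM
  | |- cmeas (fun x => cis _) => apply: cmeas_cis
  | |- cmeas (fun x => conjc _) => apply: cmeasJ
  | |- cmeas (fun x => _%:C) => apply: cmeas_real
  | |- cmeas (fun _ => _) => exact: cmeas_cst
  | |- measurable_fun _ (fun _ => _) => exact: measurable_cst
  | |- measurable_fun _ (fun x => (_%:E)) => apply: measurable_EFin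
  | |- measurable_fun _ (fun x => _ + _) => apply: mfunD
  | |- measurable_fun _ (fun x => - _) => apply: mfunN
  | |- measurable_fun _ (fun x => _ * _) => apply: mfunM
  | |- measurable_fun _ (fun x => _ ^+ _) => apply: mfunX
  | |- measurable_fun _ (fun x => `|_|) => apply: mfun_norm
  | |- measurable_fun _ (fun x => expR _) => apply: mfun_expR
  | |- measurable_fun _ (fun x => powR _ _) => apply: mfun_powR
  | |- measurable_fun _ (fun x => Order.max _ _) => apply: mfun_max
  | |- measurable_fun _ (fun x => nc _) => apply: measurable_nc
  | |- measurable_fun _ (fun x => \1__ _) => apply: mfun_indic
  | |- measurable_fun _ (fun x => (_, _)) => apply: mfun_pair
  | |- measurable_fun _ (fun x => fst _) => first [exact: measurable_fst|apply: mfun_fst]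
  | |- measurable_fun _ (fun x => snd _) => first [exact: measurable_snd|apply: mfun_snd]
  | |- measurable_fun _ (fun x => x) => exact: measurable_id
  | H : cmeas ?f |- cmeas (fun x => ?f _) => apply: (cmeas_comp (f := f) H)
  | H : cmeas (fun z => ?F (fst z) (snd z)) |- cmeas (fun x => ?F _ _) =>
      apply: (cmeas_joint (F := F) H)
  | H : measurable_fun setT (fun z => ?F (fst z) (snd z)) |- measurable_fun _ (fun x => ?F _ _) =>
      apply: (mfun_joint (F := F) H)
  | H : measurable_fun setT ?f |- measurable_fun _ (fun x => ?f _) =>
      apply: (measurableT_comp (f := f) H)
  | |- measurable_fun _ _ => first [assumption | exact: measurable_fst | exact: measurable_snd | exact: normr_measurable | exact: measurable_id]
  | _ => assumption
  end.
Ltac meas := repeat meas1.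

Section indicators.
Context {R : realType}.

Lemma indicT (A : set R) x : A x -> \1_A x = 1 :> R.
Proof. by move=> Ax; rewrite indicE mem_set. Qed.
Lemma indicF (A : set R) x : ~ A x -> \1_A x = 0 :> R.
Proof. by move=> Ax; rewrite indicE memNset. Qed.

Lemma int_indic (D : set R) (f : R -> \bar R) :
  (\int[mu]_(x in D) f x = \int[mu]_x ((\1_D x)%:E * f x))%E.
Proof.
rewrite integral_mkcond; apply: eq_integral => x _.
by rewrite patchE indicE; case: ifPn => _; rewrite ?mul1e ?mul0e.
Qed.

Lemma Rint_indic (D : set R) (f : R -> R) :
  \int[mu]_(x in D) f x = \int[mu]_x (\1_D x * f x).
Proof.
rewrite Rintegral_mkcond; apply: eq_Rintegral => x _.
by rewrite patchE indicE; case: ifPn => _; rewrite ?mul1r ?mul0r.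
Qed.

Lemma nc_indicM (D : set R) x (z : R[i]) : nc ((\1_D x)%:C * z) = \1_D x * nc z.
Proof. by rewrite ncM nc_real ger0_norm. Qed.

Lemma nc_indicM_le (D : set R) x (z : R[i]) : nc ((\1_D x)%:C * z) <= nc z.
Proof.
rewrite nc_indicM indicE; case: (x \in D); rewrite ?mul1r ?mul0r//.
exact: nc_ge0.
Qed.

Lemma Rint_FTC2 (f F : R -> R) (a b : R) : a <= b ->
  (forall x : R, is_derive x 1 F (f x)) -> continuous f ->
  \int[mu]_(x in `[a, b]) f x = F b - F a.
Proof.
rewrite le_eqVlt => /predU1P[->|ab] dF cf.
  by rewrite set_itv1 Rintegral_set1 subrr.
have cF : continuous F.
  by move=> x; apply: differentiable_continuous; apply/derivable1_diffP; case: (dF x).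
rewrite /Rintegral (@continuous_FTC2 _ f F)//.
- exact: continuous_subspaceT.
- split => [x _||]; first by case: (dF x).
  + by apply: cvg_at_right_filter; exact: cF.
  + by apply: cvg_at_left_filter; exact: cF.
- by move=> x _; rewrite derive1E; case: (dF x).
Qed.

Lemma int_oneDsqr : (\int[mu]_x ((1 + x ^+ 2)^-1)%:E)%E = (pi : R)%:E.
Proof.
have := @ge0_symfun_integralT R (fun x => (oneDsqr x)^-1).
rewrite /oneDsqr => ->.
- rewrite (_ : [set x | _] = `[0, +oo[%classic); last first.
    by apply/seteqP; split => x /=; rewrite in_itv/= andbT.
  by rewrite integral0y_oneDsqr -EFinM mulrC divfK.
- by move=> x; rewrite invr_ge0 addr_ge0 ?sqr_ge0.
- exact: continuous_oneDsqrV.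
- by move=> x /=; rewrite sqrrN.
Qed.

Lemma oneDsqr_gt0 (x : R) : 0 < 1 + x ^+ 2.
Proof. by rewrite ltr_pwDl ?sqr_ge0. Qed.

Lemma measurable_oneDsqrV : measurable_fun setT (fun x : R => (1 + x ^+ 2)^-1).
Proof.
apply: continuous_measurable_fun; exact: continuous_oneDsqrV.
Qed.
End indicators.

Section dominated_convergence_consequences.
Context {R : realType}.

Lemma Rint_dct (f : nat -> R -> R) (g b : R -> R) :
  (forall n, measurable_fun setT (f n)) -> measurable_fun setT g ->
  measurable_fun setT b -> (\int[mu]_x `|b x|%:E < +oo)%E ->
  {ae mu, forall x n, `|f n x| <= b x} ->
  {ae mu, forall x, f n x @[n --> \oo] --> g x} ->
  \int[mu]_x f n x @[n --> \oo] --> \int[mu]_x g x.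
Proof.
move=> mf mg mb ib fb cv.
have [|||||ig _ H] := @dominated_convergence _ _ R mu setT measurableT
  (fun n x => (f n x)%:E) (EFin \o g) (EFin \o b).
- by move=> n; exact: (measurable_EFin (mf n)).
- exact: (measurable_EFin mg).
- apply: aeS cv => x fx _.
  by apply: cvg_EFin => //; exact: nearW.
- by apply/integrableP; split => //; exact: (measurable_EFin mb).
- by apply: aeS fb => x h n _; rewrite /= lee_fin.
- apply: (fine_cvg (f := fun n => (\int[mu]_x (f n x)%:E)%E)).
  by rewrite /Rintegral fineK ?integrable_fin_num.
Qed.

Lemma cintegral_cvg_L1 (f : nat -> R -> R[i]) (g : R -> R[i]) :
  (forall n, cL1 (f n)) -> cL1 g ->
  (\int[mu]_x (nc (f n x - g x))%:E)%E @[n --> \oo] --> 0%E ->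
  nc (cintegral (f n) - cintegral g) @[n --> \oo] --> 0.
Proof.
move=> Lf Lg H.
have H' : fine (\int[mu]_x (nc (f n x - g x))%:E)%E @[n --> \oo] --> 0.
  exact: (fine_cvg (f := fun n => (\int[mu]_x (nc (f n x - g x))%:E)%E)).
apply: (squeeze_cvgr _ (cvg_cst 0) H'); apply: nearW => n.
rewrite nc_ge0 -cintegralB//=; apply: nc_cintegral_fine; exact: cL1B.
Qed.

Lemma cintegral_dct (f : nat -> R -> R[i]) (g : R -> R[i]) (b : R -> R) :
  (forall n, cmeas (f n)) -> cL1 g -> measurable_fun setT b ->
  (\int[mu]_x `|b x|%:E < +oo)%E ->
  {ae mu, forall x n, nc (f n x) <= b x} ->
  {ae mu, forall x, nc (f n x - g x) @[n --> \oo] --> 0} ->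
  nc (cintegral (f n) - cintegral g) @[n --> \oo] --> 0.
Proof.
move=> mf [mg ig] mb ib fb cv; apply: cintegral_cvg_L1 => //; last first.
  exact: (cint_dct mf mg mb ib fb cv).
move=> n; split => //; apply: le_lt_trans ib; apply: le_int_ae => //.
- exact: (measurable_EFin (measurable_nc (mf n))).
- by apply: measurable_EFin; meas.
- by move=> x; rewrite lee_fin nc_ge0.
- by apply: aeS fb => x /(_ n) h; rewrite lee_fin (le_trans h)// ler_norm.
Qed.
End dominated_convergence_consequences.

(** * The Poisson kernel and Fourier inversion *)

Section laplace.
Context {R : realType}.
Implicit Types (e x xi : R).

(** This is [2 pi] times the Poisson kernel of the half plane at height [e]. Its mass is [2 pi] for
    every [e], the factor of the unnormalized inversion formula. *)
Definition poisson (e x : R) := 2 * e / (e ^+ 2 + x ^+ 2).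

(** With [a = e |x| / 2], [exp (2 a) >= (1 + a)^2 >= 1 + a^2]. *)
Lemma expN_le e x : 0 < e -> expR (- (e * `|x|)) <= (1 + (e / 2 * x) ^+ 2)^-1.
Proof.
move=> e0; set a := e / 2 * `|x|.
have a0 : 0 <= a by rewrite mulr_ge0// divr_ge0// ltW.
have -> : e * `|x| = a + a by rewrite /a; field.
rewrite expRN lef_pV2 ?posrE ?expR_gt0 ?oneDsqr_gt0// expRD.
have -> : (e / 2 * x) ^+ 2 = a ^+ 2.
  by rewrite /a !exprMn real_normK ?num_real.
have h := expR_ge1Dx a.
apply: (@le_trans _ _ ((1 + a) * (1 + a))).
  by rewrite -expr2 sqrrD expr1n mul1r lerD2r lerDl mulrn_wge0.
by apply: ler_pM => //; rewrite addr_ge0.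
Qed.

Lemma measurable_expN e : measurable_fun setT (fun x => expR (- (e * `|x|))).
Proof. by meas. Qed.

Lemma int_oneDsqr_scale (k : R) : 0 < k ->
  (\int[mu]_x ((1 + (k * x) ^+ 2)^-1)%:E)%E = (k^-1 * pi : R)%:E.
Proof.
move=> k0; rewrite (int_scale (f := fun x => ((1 + x ^+ 2)^-1)%:E))//.
- by rewrite int_oneDsqr -EFinM.
- exact: (measurable_EFin measurable_oneDsqrV).
- by move=> x; rewrite lee_fin invr_ge0 ltW// oneDsqr_gt0.
Qed.

Lemma int_expN_lty e : 0 < e -> (\int[mu]_x (expR (- (e * `|x|)))%:E < +oo)%E.
Proof.
move=> e0; have e20 : 0 < e / 2 by rewrite divr_gt0.
apply: (@le_lt_trans _ _ (\int[mu]_x ((1 + (e / 2 * x) ^+ 2)^-1)%:E)%E).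
  by apply: le_int => x; rewrite lee_fin ?expR_ge0 ?expN_le.
by rewrite int_oneDsqr_scale// ltry.
Qed.

Lemma cL1_expN e : 0 < e -> cL1 (fun x => (expR (- (e * `|x|)))%:C).
Proof.
move=> e0; split; first by apply: cmeas_real; exact: measurable_expN.
under eq_integral do rewrite nc_real ger0_norm ?expR_ge0//.
exact: int_expN_lty.
Qed.

(** The antiderivative is the real part of [exp ((- e + i xi) x) / (- e + i xi)]. *)
Lemma is_derive_expcos e xi x : 0 < e ->
  is_derive x 1 (fun x : R => expR (- (e * x)) * ((xi * sin (x * xi) - e * cos (x * xi)) / (e ^+ 2 + xi ^+ 2)))
    (expR (- (e * x)) * cos (x * xi)).
Proof.
move=> e0.
have d1 : is_derive x 1 (fun x : R => expR (- (e * x))) (expR (- (e * x)) * - e).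
  apply: (@is_derive1_comp _ expR (fun x : R => - (e * x))).
  by apply: is_derive_eq; rewrite /GRing.scale /= mulr1.
have d0 : is_derive x 1 (fun x : R => x * xi) xi.
  by apply: is_derive_eq; rewrite /GRing.scale /= mulr0 add0r mulr1.
have d2 : is_derive x 1 (fun x : R => sin (x * xi)) (cos (x * xi) * xi).
  exact: (@is_derive1_comp _ sin (fun x : R => x * xi)).
have d3 : is_derive x 1 (fun x : R => cos (x * xi)) (- sin (x * xi) * xi).
  exact: (@is_derive1_comp _ cos (fun x : R => x * xi)).
have n0 : e ^+ 2 + xi ^+ 2 != 0.
  by rewrite gt_eqF// ltr_pwDl ?sqr_ge0// exprn_gt0.
apply: is_derive_eq; rewrite /GRing.scale /=.
by field.
Qed.

Lemma cvg_expN e : 0 < e -> expR (- (e * n%:R)) @[n --> \oo] --> 0.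
Proof.
move=> e0; under eq_fun do rewrite -mulNr expRM_natr.
apply: cvg_expr; rewrite ger0_norm ?expR_ge0//.
by rewrite expR_lt1 oppr_lt0.
Qed.

Lemma continuous_comp_cos xi : continuous (fun x : R => cos (x * xi)).
Proof.
move=> x; apply: continuous_comp; last exact: continuous_cos.
by apply: cvgM; [exact: cvg_id|exact: cvg_cst].
Qed.

Lemma Rint_expcos_half e xi : 0 < e ->
  \int[mu]_x (\1_(`[0, +oo[%classic) x * (expR (- (e * `|x|)) * cos (x * xi)))
  = e / (e ^+ 2 + xi ^+ 2).
Proof.
move=> e0.
set F := fun x : R => expR (- (e * x)) * ((xi * sin (x * xi) - e * cos (x * xi)) / (e ^+ 2 + xi ^+ 2)).
have n0 : e ^+ 2 + xi ^+ 2 != 0.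
  by rewrite gt_eqF// ltr_pwDl ?sqr_ge0// exprn_gt0.
have mc : measurable_fun setT (fun x : R => cos (x * xi)).
  by apply: continuous_measurable_fun; exact: continuous_comp_cos.
have mi (D : set R) : measurable D -> measurable_fun setT
    (fun x => \1_D x * (expR (- (e * `|x|)) * cos (x * xi))).
  by move=> mD; meas.
have H := @Rint_dct R (fun n x => \1_(`[0, n%:R]%classic) x * (expR (- (e * `|x|)) * cos (x * xi)))
  (fun x => \1_(`[0, +oo[%classic) x * (expR (- (e * `|x|)) * cos (x * xi)))
  (fun x => expR (- (e * `|x|))).
have {H} H : \int[mu]_x (\1_(`[0, n%:R]%classic) x * (expR (- (e * `|x|)) * cos (x * xi)))
    @[n --> \oo] --> \int[mu]_x (\1_(`[0, +oo[%classic) x * (expR (- (e * `|x|)) * cos (x * xi))).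
  apply: H => //.
  - by move=> n; exact: mi.
  - exact: mi.
  - exact: measurable_expN.
  - by under eq_integral do rewrite ger0_norm ?expR_ge0//; exact: int_expN_lty.
  - apply: aeT => x n; rewrite !normrM (ger0_norm (expR_ge0 _)) indicE.
    case: (_ \in _); rewrite ?normr0 ?mul0r ?expR_ge0// normr1 mul1r.
    by rewrite ler_piMr ?expR_ge0// ler_norml cos_geN1 cos_le1.
  - apply: aeT => x; apply: cvg_near_cst.
    have [x0|x0] := ltP x 0.
      by apply: nearW => n; rewrite !indicF// => /=; rewrite in_itv/= leNgt x0.
    near=> n; rewrite !indicT//= in_itv/= x0//=.
    by near: n; exact: nbhs_infty_ger.
have E n : \int[mu]_x (\1_(`[0, n%:R]%classic) x * (expR (- (e * `|x|)) * cos (x * xi))) = F n%:R - F 0.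
  have <- : \int[mu]_(x in `[0, n%:R]) (expR (- (e * x)) * cos (x * xi)) = F n%:R - F 0; last first.
    rewrite -Rint_indic; apply: eq_Rintegral => x.
    by rewrite inE/= in_itv/= => /andP[x0 _]; rewrite ger0_norm.
  apply: Rint_FTC2 => //.
  - by move=> x; exact: is_derive_expcos.
  - move=> x; apply: cvgM; last exact: continuous_comp_cos.
    apply: continuous_comp; last exact: continuous_expR.
    by apply: cvgN; apply: cvgM; [exact: cvg_cst|exact: cvg_id].
have F0 : F 0 = - (e / (e ^+ 2 + xi ^+ 2)).
  by rewrite /F mulr0 oppr0 expR0 mul0r sin0 cos0 mulr0 mul1r mulr1 sub0r mulNr.
have H2 : (fun n : nat => F n%:R - F 0) @ \oo --> 0 - F 0.
  apply: cvgB; last exact: cvg_cst.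
  apply/cvgr0Pnorm_le => /= d d0.
  pose M := (`|xi| + e) / (e ^+ 2 + xi ^+ 2).
  have M0 : 0 <= M.
    by rewrite divr_ge0 ?addr_ge0 ?sqr_ge0// ltW.
  have : (fun n : nat => expR (- (e * n%:R)) * M) @ \oo --> 0 * M.
    by apply: cvgM; [exact: cvg_expN|exact: cvg_cst].
  rewrite mul0r => /cvgr0Pnorm_le/(_ d d0); apply: filterS => n.
  apply: le_trans; rewrite /F !normrM ler_wpM2l//.
  rewrite ler_wpM2r// [leRHS]ger0_norm ?addr_ge0 ?(ltW e0)//.
  apply: (le_trans (ler_normB _ _)); rewrite !normrM (gtr0_norm e0) lerD//.
    by rewrite ler_piMr// ler_norml sin_geN1 sin_le1.
  by rewrite ler_piMr ?(ltW e0)// ler_norml cos_geN1 cos_le1.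
rewrite -(cvg_lim (@Rhausdorff R) H); apply: (cvg_lim (@Rhausdorff R)).
by rewrite -(opprK (e / _)) -F0 -sub0r; under eq_fun do rewrite E; exact: H2.
Unshelve. all: by end_near. Qed.

Lemma even_Rint (f : R -> R) : mu.-integrable setT (EFin \o f) ->
  (forall x, f (- x) = f x) ->
  \int[mu]_x f x = 2 * \int[mu]_x (\1_(`[0, +oo[%classic) x * f x).
Proof.
move=> fi fN.
have mf : measurable_fun setT f by apply/measurable_EFinP; exact: measurable_int fi.
have ii (D : set R) : measurable D -> mu.-integrable D (EFin \o f).
  by move=> mD; exact: (integrableS measurableT).
have E : \int[mu]_x f x = \int[mu]_(x in `]-oo, 0[) f x + \int[mu]_(x in `[0, +oo[) f x.
  rewrite -Rintegral_setU//.
  - by rewrite -itv_bndbnd_setU// set_itvE.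
  - by rewrite -itv_bndbnd_setU// set_itvE; exact: ii.
  - by apply/disj_setPLR => x /=; rewrite !in_itv/= andbT => h; apply/negP; rewrite -ltNge.
rewrite E [X in X + _](_ : _ = \int[mu]_(x in `[0, +oo[) f x).
  by rewrite -Rint_indic mulr2n mulrDl !mul1r.
rewrite -Rintegral_itv_obnd_cbnd; last exact: ii.
rewrite (Rint_indic `]-oo, 0[%classic) (Rint_indic `]0, +oo[%classic).
have mg : measurable_fun setT (fun x => \1_(`]0, +oo[%classic) x * f x) by meas.
rewrite -(Rint_opp mg); apply: eq_Rintegral => x _; rewrite fN; congr (_ * _).
by rewrite !indicE; congr ((_ : bool)%:R); apply/idP/idP; rewrite !inE/= !in_itv/= ?andbT ?oppr_gt0.
Qed.

Lemma FT_expN e xi : 0 < e ->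
  cintegral (fun x => (expR (- (e * `|x|)))%:C * cis (x * xi)) = (poisson e xi)%:C.
Proof.
move=> e0.
have L : cL1 (fun x => (expR (- (e * `|x|)))%:C * cis (x * xi)).
  apply: cL1_le (cL1_expN e0) _ => [|x]; last by rewrite ncM nc_cis mulr1.
  by meas.
have /cL1P[i1 i2] := L.
apply: complexP => /=.
  under eq_Rintegral do rewrite mul0r subr0.
  rewrite even_Rint.
  - by rewrite Rint_expcos_half// /poisson mulrA.
  - apply: eq_integrable i1 => // x _ /=.
    by rewrite mul0r subr0.
  - by move=> x; rewrite normrN mulNr cosN.
under eq_Rintegral do rewrite mul0r addr0.
(* The imaginary part is the integral of an odd function, hence equal to its own opposite. *)
set v := \int[mu]_x _; have : v = - v; last first.
  by move=> h; apply/eqP; rewrite -[_ == 0](mulrn_eq0 _ 2) mulr2n {1}h addNr.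
have mv : measurable_fun setT (fun x => expR (- (e * `|x|)) * sin (x * xi)).
  meas; have mi : measurable_fun setT (fun x : R => x * xi) by meas.
  exact: (cmeas_cis mi).2.
rewrite -RintN /v -(Rint_opp mv).
by apply: eq_Rintegral => x _; rewrite normrN mulNr sinN mulrN.
Qed.

Lemma poisson_ge0 e x : 0 < e -> 0 <= poisson e x.
Proof.
by move=> e0; rewrite divr_ge0 ?addr_ge0 ?sqr_ge0// mulr_ge0// ltW.
Qed.

Lemma poissonE e x : 0 < e -> poisson e x = 2 / e * (1 + (e^-1 * x) ^+ 2)^-1.
Proof.
move=> e0; have n0 : e ^+ 2 + x ^+ 2 != 0.
  by rewrite gt_eqF// ltr_pwDl ?sqr_ge0// exprn_gt0.
have en0 : e != 0 by rewrite gt_eqF.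
rewrite /poisson exprMn; field.
by rewrite en0 n0.
Qed.

Lemma poisson_le e x : 0 < e -> poisson e x <= 2 / e.
Proof.
move=> e0; rewrite poissonE// ler_piMr ?divr_ge0 ?(ltW e0)//.
by rewrite invf_le1 ?oneDsqr_gt0// lerDl sqr_ge0.
Qed.

Lemma measurable_poisson e : 0 < e -> measurable_fun setT (poisson e).
Proof.
move=> e0; rewrite (_ : poisson e = fun x => 2 / e * (1 + (e^-1 * x) ^+ 2)^-1); last first.
  by apply/funext => x; rewrite poissonE.
meas; apply: mfunV; last by meas.
by move=> x; rewrite ltW// oneDsqr_gt0.
Qed.

Lemma int_poisson e : 0 < e -> (\int[mu]_x (poisson e x)%:E = (2 * pi : R)%:E)%E.
Proof.
move=> e0; under eq_integral do rewrite poissonE// EFinM.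
rewrite ge0_integralZl_EFin//.
- rewrite int_oneDsqr_scale ?invr_gt0// invrK -EFinM.
  by congr (_%:E); field; rewrite gt_eqF.
- by move=> x _; rewrite lee_fin invr_ge0 ltW// oneDsqr_gt0.
- meas; apply: mfunV; last by meas.
  by move=> x; rewrite ltW// oneDsqr_gt0.
- by rewrite divr_ge0// ltW.
Qed.
End laplace.

(** * Functions determined almost everywhere by their integrals over intervals *)

Section lebesgue_points.
Context {R : realType}.

Definition inv_succ (n : nat) : R := n.+1%:R^-1.

Lemma inv_succ_gt0 n : 0 < inv_succ n.
Proof. by rewrite invr_gt0. Qed.

Lemma cvg_inv_succ : inv_succ n @[n --> \oo] --> 0.
Proof. exact: cvg_harmonic. Qed.

Definition box (x : R) (n : nat) : set R := `]x - inv_succ n, x + inv_succ n[%classic.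

Lemma box_ball x n : box x n = ball x (inv_succ n).
Proof. by rewrite ball_itv. Qed.

Lemma box_averages (f : R -> R) : locally_integrable setT f ->
  {ae mu, forall x, n.+1%:R / 2 * \int[mu]_(y in box x n) f y @[n --> \oo] --> f x}.
Proof.
move=> lf; apply: aeS (lebesgue_differentiation lf) => x lx.
have nice z : nicely_shrinking z (box z).
  split=> [n|]; first by rewrite /box.
  exists (1, fun n => PosNum (inv_succ_gt0 n)); split => //=.
  - exact: cvg_inv_succ.
  - by move=> n; rewrite box_ball.
  - by move=> n; rewrite box_ball mul1e.
have H := nice_lebesgue_differentiation nice lf lx.
rewrite (_ : (fun n => _) = fine \o (fun n => ((mu (box x n))^-1 *
    \int[mu]_(y in box x n) (f y)%:E)%E)); first exact: fine_cvg H.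
apply/funext => n /=.
have bE : mu (box x n) = (inv_succ n *+ 2)%:E.
  by rewrite box_ball lebesgue_measure_ball// ltW// inv_succ_gt0.
have ifin : (\int[mu]_(y in box x n) (f y)%:E)%E \is a fin_num.
  apply: integrable_fin_num => //; first by rewrite /box.
  have sub : box x n `<=` `[x - inv_succ n, x + inv_succ n]%classic.
    by apply: subset_itv; rewrite bnd_simp.
  apply: (@integrableS _ (measurableTypeR R) R mu `[x - inv_succ n, x + inv_succ n]%classic (box x n)) => //; first by rewrite /box.
  case: lf => mf _ /(_ _ _ (@segment_compact R (x - inv_succ n) (x + inv_succ n))) li.
  apply/integrableP; split; last exact: li.
  by apply: measurable_funTS; exact: (measurable_EFin mf).
rewrite [X in (X^-1)%E]bE inver ifF; last first.
  by apply/gt_eqF; rewrite pmulrn_lgt0 ?inv_succ_gt0.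
rewrite fineM//; congr (_ * _) => /=.
by rewrite /inv_succ -[X in _ = X^-1]mulr_natr invfM invrK.
Qed.

(** By Lebesgue differentiation, [f] is the almost everywhere limit of its averages over small
    intervals, all of which are zero here. *)
Lemma ae0_of_intervals (f : R -> R) : locally_integrable setT f ->
  (forall a b, a < b -> \int[mu]_(y in `]a, b[) f y = 0) ->
  {ae mu, forall x, f x = 0}.
Proof.
move=> lf f0; apply: aeS (box_averages lf) => x.
under eq_fun => n do rewrite f0 ?mulr0 ?ltrD2l ?gtrN ?inv_succ_gt0//.
by move=> /(cvg_lim (@Rhausdorff R)) <-; rewrite lim_cst.
Qed.

Lemma bounded_locally_integrable (f : R -> R) (M : R) : measurable_fun setT f ->
  (forall x, `|f x| <= M) -> locally_integrable setT f.
Proof.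
move=> mf fM; split => //; first exact: openT.
move=> K _ cK; apply: (@le_lt_trans _ _ (\int[mu]_(x in K) (cst M%:E x))%E).
  apply: ge0_le_integral => //.
  - exact: compact_measurable.
  - by apply: measurable_funTS; apply: measurable_EFin; meas.
  - by move=> x _; rewrite lee_fin.
rewrite integral_cst; last exact: compact_measurable.
rewrite lte_mul_pinfty// ?lee_fin.
  exact: le_trans (fM 0).
exact: compact_finite_measure.
Qed.

Lemma cL1_locally_integrable (f : R -> R[i]) : cL1 f ->
  locally_integrable setT (fun x => complex.Re (f x)) /\
  locally_integrable setT (fun x => complex.Im (f x)).
Proof.
by move=> /cL1P[f1 f2]; split; apply: open_integrable_locally => //; exact: openT.
Qed.

Lemma cae0_of_intervals (f : R -> R[i]) :
  locally_integrable setT (fun x => complex.Re (f x)) ->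
  locally_integrable setT (fun x => complex.Im (f x)) ->
  (forall a b, a < b -> cintegral (fun y => (\1_(`]a, b[%classic) y)%:C * f y) = 0) ->
  {ae mu, forall x, f x = 0}.
Proof.
move=> l1 l2 f0.
have h1 : {ae mu, forall x, complex.Re (f x) = 0}.
  apply: ae0_of_intervals => // a b /f0 /(congr1 (@complex.Re R)) /= H.
  by rewrite Rint_indic -[RHS]H; apply: eq_Rintegral => x _; rewrite ReRC.
have h2 : {ae mu, forall x, complex.Im (f x) = 0}.
  apply: ae0_of_intervals => // a b /f0 /(congr1 (@complex.Im R)) /= H.
  by rewrite Rint_indic -[RHS]H; apply: eq_Rintegral => x _; rewrite ImRC.
by apply: aeS (aeI h1 h2) => x [? ?]; exact: complexP.
Qed.
End lebesgue_points.

(** * The unnormalized transform on integrable functions and its Abel regularization *)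

Section fourier_L1.
Context {R : realType}.
Implicit Types f g : R -> R[i].

(** One transform, without constant and with the sign of the inverse one; [fourierE] and
    [inverse_fourierE] express both normalized transforms through it. *)
Definition FT f (xi : R) : R[i] := cintegral (fun x => f x * cis (x * xi)).

Lemma cmeas_FT f : cmeas f -> cmeas (FT f).
Proof.
move=> mf.
have m : cmeas (fun z : R * R => f z.2 * cis (z.2 * z.1)).
  by meas.
exact: (cmeas_cintegral (F := fun z y => f y * cis (y * z)) m).
Qed.

Lemma cL1_cis f xi : cL1 f -> cL1 (fun x => f x * cis (x * xi)).
Proof.
move=> Lf; have [mf _] := Lf; apply: cL1_le Lf _ => [|x]; first by meas.
by rewrite ncM nc_cis mulr1.
Qed.

Lemma nc_FT f xi : cL1 f -> nc (FT f xi) <= fine (\int[mu]_x (nc (f x))%:E)%E.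
Proof.
move=> Lf; apply: le_trans (nc_cintegral_fine (cL1_cis xi Lf)) _.
by rewrite le_eqVlt; apply/predU1P; left; congr fine; apply: eq_integral => x _; rewrite ncM nc_cis mulr1.
Qed.

Lemma int_prod_fin (u v : R -> R) : measurable_fun setT u -> measurable_fun setT v ->
  (forall x, 0 <= u x) -> (forall x, 0 <= v x) ->
  (\int[mu]_x \int[mu]_y (u x * v y)%:E =
   \int[mu]_x (u x)%:E * \int[mu]_y (v y)%:E)%E.
Proof.
move=> m1 m2 u0 v0.
have iv0 : (0 <= \int[mu]_y (v y)%:E)%E by apply: integral_ge0 => y _; rewrite lee_fin.
rewrite -ge0_integralZr//.
- apply: eq_integral => x _; under eq_integral do rewrite EFinM.
  rewrite ge0_integralZl_EFin//; first by move=> y _; rewrite lee_fin.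
  exact: (measurable_EFin m2).
- exact: (measurable_EFin m1).
- by move=> x _; rewrite lee_fin.
Qed.

(* Fubini applied to [f xi * g x * cis (x * xi)]. *)
Lemma FT_parseval f g : cL1 f -> cL1 g ->
  cintegral (fun x => FT f x * g x) = cintegral (fun xi => f xi * FT g xi).
Proof.
move=> Lf Lg; have [mf fi] := Lf; have [mg gi] := Lg.
have mF : cmeas (fun z : R * R => f z.2 * cis (z.2 * z.1) * g z.1).
  by meas.
have Fi : (\int[mu]_x \int[mu]_y (nc (f y * cis (y * x) * g x))%:E < +oo)%E.
  rewrite (_ : (\int[mu]_x _)%E = (\int[mu]_x \int[mu]_y (nc (g x) * nc (f y))%:E)%E).
    rewrite int_prod_fin; [|exact: measurable_nc|exact: measurable_nc|exact: (fun=> nc_ge0 _)|exact: (fun=> nc_ge0 _)].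
    by apply: lte_mul_pinfty => //; [exact: int_nc_ge0|exact: cL1_fin].
  apply: eq_integral => x _; apply: eq_integral => y _.
  by rewrite !ncM nc_cis mulr1 mulrC.
have E1 : forall x, FT f x * g x = cintegral (fun y => f y * cis (y * x) * g x).
  move=> x; rewrite mulrC -cintegralZ; last exact: cL1_cis.
  by apply: eq_cintegral => y; rewrite mulrC.
rewrite (eq_cintegral E1) (cfubini (F := fun x y => f y * cis (y * x) * g x) mF Fi).
apply: eq_cintegral => y; rewrite /FT -cintegralZ; last exact: cL1_cis.
by apply: eq_cintegral => x; rewrite (mulrC x y); ring.
Qed.

Definition poisson_avg g (e eta : R) : R[i] :=
  cintegral (fun xi => g xi * (poisson e (xi - eta))%:C).

(** Parseval's identity moves the factor [exp (- e |x|) cis (- x eta)] onto the side of [g], where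
    its transform is the Poisson kernel centred at [eta]. *)
Lemma FT_abel g e eta : cL1 g -> 0 < e ->
  FT (fun x => FT g x * (expR (- (e * `|x|)))%:C) (- eta) = poisson_avg g e eta.
Proof.
move=> Lg e0.
pose k x : R[i] := (expR (- (e * `|x|)))%:C * cis (x * - eta).
have Lk : cL1 k by apply: cL1_cis; exact: cL1_expN.
rewrite /FT (eq_cintegral (g := fun x => FT g x * k x)); last by move=> x; rewrite mulrA.
rewrite FT_parseval//; apply: eq_cintegral => xi; congr (_ * _).
rewrite -FT_expN//; apply: eq_cintegral => x.
by rewrite /k -mulrA -cisD -mulrDr (addrC (- eta)).
Qed.
End fourier_L1.

Section poisson_approximation.
Context {R : realType}.
Implicit Types (f g : R -> R[i]) (a b x : R).

Lemma Rint_shift (f : R -> R) a : measurable_fun setT f ->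
  \int[mu]_x f (x + a) = \int[mu]_x f x.
Proof.
move=> mf; have := @Rint_pushforward R (fun x => x + a) 1 f ltr01.
by rewrite mul1r; apply=> // g mg g0; rewrite mul1e int_shift.
Qed.

Lemma Rint_scale (f : R -> R) k : 0 < k -> measurable_fun setT f ->
  \int[mu]_x f (k * x) = k^-1 * \int[mu]_x f x.
Proof.
move=> k0 mf; apply: (@Rint_pushforward R ( *%R k) k^-1) => //.
  by rewrite invr_gt0.
by move=> g mg g0; rewrite int_scale.
Qed.

(** The substitution [y = x + e z] turns the kernel into the fixed Lorentzian [2 / (1 + z^2)] and
    puts the parameter into the argument of [u], where it can tend to 0 under a fixed dominating
    function. *)
Lemma Rint_poisson_scale (u : R -> R) (e x M : R) : 0 < e -> measurable_fun setT u ->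
  (forall y, `|u y| <= M) ->
  \int[mu]_y (u y * poisson e (x - y)) =
  \int[mu]_z (u (x + e * z) * (2 / (1 + z ^+ 2))).
Proof.
move=> e0 mu_ uM.
have en0 : e != 0 by rewrite gt_eqF.
have M0 : 0 <= M := le_trans (normr_ge0 _) (uM 0).
have mp := @measurable_poisson R e e0.
have mf : measurable_fun setT (fun y : R => u y * poisson e (x - y)) by meas.
have mf1 : measurable_fun setT (fun y : R => u (y + x) * poisson e (x - (y + x))) by meas.
have mf2 : measurable_fun setT (fun z : R => u (x + e * z) * (2 / (1 + z ^+ 2))).
  have mi : measurable_fun setT (fun z : R => (1 + z ^+ 2)^-1) by exact: measurable_oneDsqrV.
  by meas.
rewrite -(Rint_shift x mf).
have := Rint_scale e0 mf1 => H.
rewrite -[LHS](mulVKf en0) -H -RintegralZl//.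
  apply: eq_Rintegral => z _.
  rewrite /poisson opprD addrCA subrr addr0 (addrC _ x) sqrrN exprMn.
  move: (u _) => v; set w : R := z.
  have n0 : 1 + w ^+ 2 != 0 by rewrite gt_eqF// oneDsqr_gt0.
  have -> : e ^+ 2 + e ^+ 2 * w ^+ 2 = e ^+ 2 * (1 + w ^+ 2) by ring.
  by field; rewrite n0 en0.
apply/integrableP; split; first by apply: measurable_EFin; meas.
apply: (@le_lt_trans _ _ (\int[mu]_z (M * (2 / e) * (1 + z ^+ 2)^-1)%:E)%E).
  apply: le_int => z; first by rewrite lee_fin.
  rewrite lee_fin normrM -mulrA ler_pM//.
  rewrite poissonE// opprD addrCA subrr addr0 mulrN mulKf// sqrrN.
  by rewrite ger0_norm// mulr_ge0 ?divr_ge0 ?invr_ge0 ?(ltW e0)// ltW// oneDsqr_gt0.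
under eq_integral do rewrite EFinM.
rewrite ge0_integralZl_EFin//.
- by rewrite int_oneDsqr -EFinM ltry.
- by move=> z _; rewrite lee_fin invr_ge0 ltW// oneDsqr_gt0.
- exact: (measurable_EFin measurable_oneDsqrV).
- by rewrite mulr_ge0// divr_ge0// ltW.
Qed.

Definition poisson_itv a b (n : nat) x : R :=
  \int[mu]_y (\1_(`]a, b[%classic) y * poisson (inv_succ n) (x - y)).

Lemma poisson_itv_ge0 a b n x : 0 <= poisson_itv a b n x.
Proof.
apply: Rintegral_ge0 => y _; rewrite mulr_ge0//.
by apply: poisson_ge0; exact: inv_succ_gt0.
Qed.

Lemma int_lorentz : (\int[mu]_z (2 / (1 + z ^+ 2))%:E)%E = (2 * pi : R)%:E.
Proof.
under eq_integral do rewrite EFinM.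
rewrite ge0_integralZl_EFin//.
- by rewrite int_oneDsqr -EFinM.
- by move=> z _; rewrite lee_fin invr_ge0 ltW// oneDsqr_gt0.
- exact: (measurable_EFin measurable_oneDsqrV).
Qed.

Lemma measurable_lorentz : measurable_fun setT (fun z : R => 2 / (1 + z ^+ 2)).
Proof.
have mi : measurable_fun setT (fun z : R => (1 + z ^+ 2)^-1) by exact: measurable_oneDsqrV.
by meas.
Qed.

Lemma lorentz_ge0 (z : R) : 0 <= 2 / (1 + z ^+ 2).
Proof. by rewrite divr_ge0// ltW// oneDsqr_gt0. Qed.

Lemma indic_le1 (A : set R) x : `|\1_A x| <= 1 :> R.
Proof. by rewrite indicE; case: (_ \in _); rewrite ?normr1 ?normr0. Qed.

(** The points [x + z / (n + 1)] tend to [x], so off the endpoints the indicator is eventually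
    constant along them, and the Lorentzian has mass [2 pi]. At an endpoint of a nonempty interval
    half of the mass is lost in the limit. *)
Lemma cvg_poisson_itv a b x : x != a -> x != b ->
  poisson_itv a b n x @[n --> \oo] --> 2 * pi * \1_(`]a, b[%classic) x.
Proof.
move=> xa xb.
have mI : measurable_fun setT (\1_(`]a, b[%classic) : R -> R) by exact: measurable_indic.
have E n : poisson_itv a b n x = \int[mu]_z (\1_(`]a, b[%classic) (x + inv_succ n * z) * (2 / (1 + z ^+ 2))).
  exact: (Rint_poisson_scale x (inv_succ_gt0 n) mI (indic_le1 _)).
under eq_fun do rewrite E.
have -> : 2 * (pi : R) * \1_(`]a, b[%classic) x = \int[mu]_z (\1_(`]a, b[%classic) x * (2 / (1 + z ^+ 2))).
  rewrite RintegralZl//; last first.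
    apply/integrableP; split; first by apply: measurable_EFin; exact: measurable_lorentz.
    under eq_integral do rewrite abse_EFin ger0_norm ?lorentz_ge0//.
    by rewrite int_lorentz ltry.
  by rewrite /Rintegral int_lorentz /= mulrC.
have ml := measurable_lorentz.
have mi : measurable_fun setT (fun z : R => (1 + z ^+ 2)^-1) by exact: measurable_oneDsqrV.
apply: (Rint_dct (b := fun z => 2 / (1 + z ^+ 2))).
- by move=> n; meas.
- by meas.
- by [].
- under eq_integral do rewrite ger0_norm ?lorentz_ge0//.
  by rewrite int_lorentz ltry.
- apply: aeT => z n; rewrite normrM (ger0_norm (lorentz_ge0 z)).
  by rewrite ler_piMl ?lorentz_ge0 ?indic_le1.
- apply: aeT => z; apply: cvgM; last exact: cvg_cst.
  have c : (fun n => x + inv_succ n * z) @ \oo --> x.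
    rewrite -[X in _ --> X]addr0 -(mul0r z).
    by apply: cvgD; [exact: cvg_cst|apply: cvgM; [exact: cvg_inv_succ|exact: cvg_cst]].
  apply: cvg_near_cst.
  have [Ix|Ix] := boolP (x \in `]a, b[).
    have h : \forall n \near \oo, (x + inv_succ n * z) \in `]a, b[.
      exact: (c _ (near_in_itvoo Ix)).
    apply: filterS h => n nI.
    by rewrite !indicT.
  have : x < a \/ b < x.
    move: Ix; rewrite in_itv/= negb_and -!leNgt => /orP[h|h]; [left|right].
      by rewrite lt_neqAle xa.
    by rewrite lt_neqAle eq_sym xb.
  case=> h.
    have h' : \forall n \near \oo, x + inv_succ n * z < a.
      exact: (c _ (lt_nbhsl h)).
    apply: filterS h' => n nI.
    rewrite !indicF// => /=; rewrite in_itv/= => /andP[k _].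
      by move: (lt_trans h k); rewrite ltxx.
    by move: (lt_trans nI k); rewrite ltxx.
  have h' : \forall n \near \oo, b < x + inv_succ n * z.
    exact: (c _ (lt_nbhsr h)).
  apply: filterS h' => n nI.
  rewrite !indicF// => /=; rewrite in_itv/= => /andP[_ k].
    by move: (lt_trans h k); rewrite ltxx.
  by move: (lt_trans nI k); rewrite ltxx.
Qed.
End poisson_approximation.

Section inversion.
Context {R : realType}.
Implicit Types (f g : R -> R[i]) (a b x : R).

Lemma int_indic_itvoo a b : (\int[mu]_x (\1_(`]a, b[%classic) x)%:E < +oo)%E.
Proof.
have -> : (\int[mu]_x (\1_(`]a, b[%classic) x)%:E = mu (`]a, b[%classic : set R))%E.
  by rewrite integral_indic// setIT.
rewrite lebesgue_measure_itv/=.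
by case: ifP => _; rewrite -?EFinD ltry.
Qed.

Lemma cmeas_poisson_avg g (e : R) : 0 < e -> cmeas g -> cmeas (poisson_avg g e).
Proof.
move=> e0 mg; have mp := measurable_poisson e0.
have m : cmeas (fun z : R * R => g z.2 * (poisson e (z.2 - z.1))%:C) by meas.
have := cmeas_cintegral (F := fun z y : R => g y * (poisson e (y - z))%:C) m.
by congr cmeas.
Qed.

Lemma poisson_itv_le a b n x : poisson_itv a b n x <= 2 * pi.
Proof.
have e0 := @inv_succ_gt0 R n; have mp := measurable_poisson e0.
have mI : measurable_fun setT (\1_(`]a, b[%classic) : R -> R) by exact: measurable_indic.
rewrite /poisson_itv (Rint_poisson_scale x e0 mI (indic_le1 _)).
rewrite /Rintegral.
have le2pi : (\int[mu]_z (\1_(`]a, b[%classic) (x + inv_succ n * z) * (2 / (1 + z ^+ 2)))%:E <= (2 * pi : R)%:E)%E.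
  rewrite -int_lorentz; apply: le_int => z; rewrite lee_fin.
    by rewrite mulr_ge0// lorentz_ge0.
  rewrite ler_piMl ?lorentz_ge0//; exact: le_trans (ler_norm _) (indic_le1 _ _).
rewrite -lee_fin fineK//.
have ge0 : (0 <= \int[mu]_z (\1_(`]a, b[%classic) (x + inv_succ n * z) * (2 / (1 + z ^+ 2)))%:E)%E.
  by apply: integral_ge0 => z _; rewrite lee_fin mulr_ge0// lorentz_ge0.
by rewrite ge0_fin_numE// (le_lt_trans le2pi)// ltry.
Qed.

Lemma measurable_poisson_itv a b n : measurable_fun setT (poisson_itv a b n).
Proof.
have e0 := @inv_succ_gt0 R n; have mp := measurable_poisson e0.
apply: (measurable_Rint (F := fun x y => \1_(`]a, b[%classic) y * poisson (inv_succ n) (x - y))).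
by meas.
Qed.

Lemma pi2_gt0 : 0 < 2 * pi :> R.
Proof. by rewrite mulr_gt0// pi_gt0. Qed.

(** Fubini moves the averaging from [g] to the indicator of the interval, where its limit is
    explicit. *)
Lemma cintegral_poisson_avg g a b n : cL1 g ->
  cintegral (fun y => (\1_(`]a, b[%classic) y)%:C * poisson_avg g (inv_succ n) y) =
  cintegral (fun x => g x * (poisson_itv a b n x)%:C).
Proof.
move=> Lg; have [mg gi] := Lg.
have e0 := @inv_succ_gt0 R n; have mp := measurable_poisson e0.
pose F y x := (\1_(`]a, b[%classic) y)%:C * (g x * (poisson (inv_succ n) (x - y))%:C).
have mF : cmeas (fun z : R * R => F z.1 z.2) by rewrite /F; meas.
have nF y x : nc (F y x) = nc (g x) * (\1_(`]a, b[%classic) y * poisson (inv_succ n) (x - y)).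
  by rewrite /F nc_indicM ncM nc_real ger0_norm ?poisson_ge0//; ring.
have Lp y : cL1 (fun x => g x * (poisson (inv_succ n) (x - y))%:C).
  have := @cL1M_bounded R (2 / inv_succ n) (fun x => (poisson (inv_succ n) (x - y))%:C) g.
  move=> H; rewrite (_ : (fun x => _) = (fun x => (poisson (inv_succ n) (x - y))%:C * g x)); last first.
    by apply/funext => x; rewrite mulrC.
  apply: H => //; first by meas.
  by move=> x; rewrite nc_real ger0_norm ?poisson_ge0 ?poisson_le.
have Fi : (\int[mu]_y \int[mu]_x (nc (F y x))%:E < +oo)%E.
  rewrite (int_fubini (F := fun y x => (nc (F y x))%:E)); last 2 first.
    by meas.
    by move=> y x; rewrite lee_fin nc_ge0.
  apply: (@le_lt_trans _ _ (\int[mu]_x (2 * pi * nc (g x))%:E)%E); last first.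
    rewrite int_ncZ ?(ltW pi2_gt0)// lte_mul_pinfty ?lee_fin ?(ltW pi2_gt0)//.
  apply: le_int => x; first by apply: integral_ge0 => y _; rewrite lee_fin nc_ge0.
  under eq_integral do rewrite nF EFinM.
  have i0 y : 0 <= \1_(`]a, b[%classic) y * poisson (inv_succ n) (x - y) :> R.
    by rewrite mulr_ge0// poisson_ge0.
  rewrite ge0_integralZl_EFin ?nc_ge0//; last 2 first.
    by move=> y _; rewrite lee_fin.
    by meas.
  rewrite mulrC EFinM lee_wpmul2l ?lee_fin ?nc_ge0//.
  have -> : (2 * pi : R)%:E = (\int[mu]_y (poisson (inv_succ n) (x - y))%:E)%E.
    rewrite -(int_poisson e0) -(int_opp (f := fun y => (poisson (inv_succ n) y)%:E)); last 2 first.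
      by meas.
      by move=> y; rewrite lee_fin poisson_ge0.
    rewrite -(int_shift (- x) (f := fun y : R => (poisson (inv_succ n) (- y))%:E)); last 2 first.
      by meas.
      by move=> y; rewrite lee_fin poisson_ge0.
    by apply: eq_integral => y _; rewrite opprD opprK addrC.
  apply: le_int => y; rewrite lee_fin//.
  by rewrite ler_piMl ?poisson_ge0// (le_trans (ler_norm _) (indic_le1 _ _)).
rewrite (eq_cintegral (g := fun y => cintegral (F y))); last first.
  by move=> y; rewrite -cintegralZ.
rewrite (cfubini mF Fi); apply: eq_cintegral => x.
have E y : F y x = g x * (\1_(`]a, b[%classic) y * poisson (inv_succ n) (x - y))%:C.
  by rewrite /F mulrCA (RCM _ (poisson _ _)).
rewrite (eq_cintegral E) cintegralZ.
  congr (_ * _); apply: complexP => //=.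
  by rewrite /Rintegral integral0.
split; first by meas.
have i0 y : 0 <= \1_(`]a, b[%classic) y * poisson (inv_succ n) (x - y) :> R.
  by rewrite mulr_ge0// poisson_ge0.
under eq_integral do rewrite nc_real (ger0_norm (i0 _)).
apply: (@le_lt_trans _ _ (\int[mu]_y (\1_(`]a, b[%classic) y * (2 / inv_succ n))%:E)%E).
  apply: le_int => y; rewrite lee_fin ?i0//.
  by rewrite ler_wpM2l ?poisson_le.
under eq_integral do rewrite EFinM.
rewrite ge0_integralZr//; last 2 first.
  by meas.
  by rewrite lee_fin divr_ge0// ltW.
rewrite muleC lte_mul_pinfty ?lee_fin ?divr_ge0 ?(ltW e0)//.
exact: int_indic_itvoo.
Qed.

(** Dominated convergence with bound [2 pi |g|]; the two endpoints, excluded in [cvg_poisson_itv],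
    form a null set. *)
Lemma poisson_avg_interval g a b : cL1 g ->
  nc (cintegral (fun y => (\1_(`]a, b[%classic) y)%:C * poisson_avg g (inv_succ n) y) -
      (2 * pi)%:C * cintegral (fun y => (\1_(`]a, b[%classic) y)%:C * g y)) @[n --> \oo] --> 0.
Proof.
move=> Lg; have [mg gi] := Lg.
under eq_fun do rewrite cintegral_poisson_avg//.
have LI : cL1 (fun y => (\1_(`]a, b[%classic) y)%:C * g y).
  by apply: cL1_le Lg _ => [|x]; [meas|exact: nc_indicM_le].
rewrite -cintegralZ//.
apply: (cintegral_dct (b := fun x => 2 * pi * nc (g x))).
- by move=> n; have := measurable_poisson_itv a b n => mp; meas.
- exact: cL1Z.
- by meas.
- under eq_integral do rewrite ger0_norm ?mulr_ge0 ?pi_ge0 ?nc_ge0//.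
  by rewrite int_ncZ ?(ltW pi2_gt0)// lte_mul_pinfty ?lee_fin ?(ltW pi2_gt0).
- apply: aeT => x n; rewrite ncM nc_real ger0_norm ?poisson_itv_ge0//.
  by rewrite mulrC ler_wpM2r ?nc_ge0 ?poisson_itv_le.
- have nab := @ae_neq R.
  apply: aeS (aeI (nab a) (nab b)) => x [xa xb].
  have := cvg_poisson_itv xa xb => H.
  have := cvgM H (cvg_cst (nc (g x))) => {}H.
  have H2 : (fun n => `|poisson_itv a b n x - 2 * pi * \1_(`]a, b[%classic) x| * nc (g x)) @ \oo --> 0 * nc (g x).
    apply: cvgM; last exact: cvg_cst.
    rewrite -[X in _ --> X](normr0 R).
    apply: cvg_norm; rewrite -[X in _ --> X](subrr (2 * pi * \1_(`]a, b[%classic) x)).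
    by apply: cvgB; [exact: cvg_poisson_itv|exact: cvg_cst].
  rewrite mul0r in H2; apply: cvg_trans H2; apply: near_eq_cvg; apply: nearW => n.
  rewrite -nc_real -ncM; congr nc.
  by rewrite RCB !RCM; ring.
Qed.
End inversion.

Section fourier_uniqueness.
Context {R : realType}.
Implicit Types (f g : R -> R[i]).

Lemma cL1_FT_mul_expN g (e : R) : 0 < e -> cL1 g ->
  cL1 (fun x => FT g x * (expR (- (e * `|x|)))%:C).
Proof.
move=> e0 Lg; have mF := cmeas_FT Lg.1.
by apply: cL1M_bounded (cL1_expN e0) => // x; exact: nc_FT.
Qed.

Lemma cL1_indic_bounded (a b M : R) f : cmeas f -> (forall x, nc (f x) <= M) ->
  cL1 (fun x => (\1_(`]a, b[%classic) x)%:C * f x).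
Proof.
move=> mf fM; rewrite (_ : (fun x => _) = fun x => f x * (\1_(`]a, b[%classic) x)%:C); last first.
  by apply/funext => x; rewrite mulrC.
apply: cL1M_bounded fM _ => //; split; first by meas.
under eq_integral do rewrite nc_real ger0_norm//.
exact: int_indic_itvoo.
Qed.

(* Both sides have the same integral over every bounded interval: regularize
   by [expR (- (e * `|x|))] and let [e] tend to [0]. *)
Lemma FT_inversion g : cL1 g -> cL1 (FT g) ->
  {ae mu, forall x, FT (FT g) (- x) = (2 * pi)%:C * g x}.
Proof.
move=> Lg LG.
have mH : cmeas (fun x : R => FT (FT g) (- x)).
  by have := cmeas_FT LG.1 => m; meas.
pose M := fine (\int[mu]_x (nc (FT g x))%:E)%E.
have HM x : nc (FT (FT g) (- x)) <= M by exact: nc_FT.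
have [lg1 lg2] := cL1_locally_integrable (cL1Z (2 * pi)%:C Lg).
have lH1 : locally_integrable setT (fun x => complex.Re (FT (FT g) (- x))).
  apply: (bounded_locally_integrable mH.1) => x.
  exact: le_trans (nc_Re _) (HM x).
have lH2 : locally_integrable setT (fun x => complex.Im (FT (FT g) (- x))).
  apply: (bounded_locally_integrable mH.2) => x.
  exact: le_trans (nc_Im _) (HM x).
have : {ae mu, forall x, FT (FT g) (- x) - (2 * pi)%:C * g x = 0}.
  apply: cae0_of_intervals.
  - have := locally_integrableB lH1 lg1.
    by congr locally_integrable; apply/funext => x /=; rewrite ReD ReN.
  - have := locally_integrableB lH2 lg2.
    by congr locally_integrable; apply/funext => x /=; rewrite ImD ImN.
  move=> a b ab.
  have LI : cL1 (fun y => (\1_(`]a, b[%classic) y)%:C * FT (FT g) (- y)).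
    exact: cL1_indic_bounded HM.
  have LIg : cL1 (fun y => (\1_(`]a, b[%classic) y)%:C * g y).
    have [mg _] := Lg.
    by apply: cL1_le Lg _ => [|x]; [meas|exact: nc_indicM_le].
  have E1 : nc (cintegral (fun y => (\1_(`]a, b[%classic) y)%:C * poisson_avg g (inv_succ n) y) -
      cintegral (fun y => (\1_(`]a, b[%classic) y)%:C * FT (FT g) (- y))) @[n --> \oo] --> 0.
    apply: (cintegral_dct (b := fun y => \1_(`]a, b[%classic) y * M)) => //.
    - by move=> n; have := cmeas_poisson_avg (inv_succ_gt0 n) Lg.1 => mp; meas.
    - by meas.
    - under eq_integral do rewrite normrM (ger0_norm (_ : 0 <= \1_(`]a, b[%classic) _))// EFinM.
      rewrite ge0_integralZr//; last first.
        by apply: measurable_EFin; apply: measurable_indic.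
      rewrite muleC lte_mul_pinfty ?lee_fin//; exact: int_indic_itvoo.
    - apply: aeT => x n; rewrite nc_indicM ler_wpM2l//.
      rewrite -FT_abel ?inv_succ_gt0//.
      apply: (le_trans (nc_FT _ (cL1_FT_mul_expN (inv_succ_gt0 n) Lg))).
      apply: fine_le; [exact: (cL1_fin (cL1_FT_mul_expN (inv_succ_gt0 n) Lg))|exact: cL1_fin|].
      apply: le_int => y; rewrite lee_fin ?nc_ge0// ncM nc_real ler_piMr ?nc_ge0//.
      rewrite ger0_norm ?expR_ge0// -expR0 ler_expR oppr_le0 mulr_ge0//.
      by rewrite ltW// inv_succ_gt0.
    - apply: aeT => x.
      have H : nc (poisson_avg g (inv_succ n) x - FT (FT g) (- x)) @[n --> \oo] --> 0.
        under eq_fun => n do rewrite -FT_abel ?inv_succ_gt0//.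
        apply: (cintegral_dct (b := fun y => nc (FT g y))).
        + move=> n; have [m _] := cL1_FT_mul_expN (inv_succ_gt0 n) Lg.
          by meas.
        + exact: cL1_cis.
        + by have [m _] := LG; meas.
        + under eq_integral do rewrite ger0_norm ?nc_ge0//.
          by case: LG.
        + apply: aeT => y n; rewrite !ncM nc_cis mulr1 nc_real ler_piMr ?nc_ge0//.
          rewrite ger0_norm ?expR_ge0// -expR0 ler_expR oppr_le0 mulr_ge0//.
          by rewrite ltW// inv_succ_gt0.
        + apply: aeT => y.
          have : (fun n => nc (FT g y) * `|expR (- (inv_succ n * `|y|)) - 1|) @ \oo --> nc (FT g y) * `|(1 : R) - 1|.
            apply: cvgM; first exact: cvg_cst.
            apply: cvg_norm; apply: cvgB; last exact: cvg_cst.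
            rewrite -[X in _ --> X](expR0 R) -oppr0 -(mul0r `|y|).
            apply: continuous_cvg; first exact: continuous_expR.
            by apply: cvgN; apply: cvgM; [exact: cvg_inv_succ|exact: cvg_cst].
          rewrite subrr normr0 mulr0; apply: cvg_trans; apply: near_eq_cvg; apply: nearW => n.
          rewrite -nc_real; move: (FT g y) (cis _) (nc_cis (y * - x)) => G c c1.
          rewrite (_ : G * _ * c - G * c = G * (expR (- (inv_succ n * `|y|)) - 1)%:C * c).
            by rewrite !ncM c1 mulr1.
          by rewrite RCB; ring.
      apply: (squeeze_cvgr _ (cvg_cst 0) H); apply: nearW => n.
      have := nc_indicM_le `]a, b[%classic x (poisson_avg g (inv_succ n) x - FT (FT g) (- x)).
      by rewrite mulrBr => h; rewrite nc_ge0; exact: h.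
  have E2 := poisson_avg_interval a b Lg.
  rewrite (eq_cintegral (g := fun y => (\1_(`]a, b[%classic) y)%:C * FT (FT g) (- y) -
      (2 * pi)%:C * ((\1_(`]a, b[%classic) y)%:C * g y))); last by move=> y; ring.
  rewrite cintegralB//; last exact: cL1Z.
  rewrite cintegralZ//.
  set A := cintegral _ in E1 *; set B := (2 * pi)%:C * _ in E2 *.
  apply/nc_eq0/eqP; rewrite eq_le nc_ge0 andbT.
  pose C n := cintegral (fun y => (\1_(`]a, b[%classic) y)%:C * poisson_avg g (inv_succ n) y).
  have E : (fun n => nc (C n - A) + nc (C n - B)) @ \oo --> (0 : R).
    by rewrite -[X in _ --> X]addr0; apply: cvgD; [exact: E1|exact: E2].
  apply: (cvgr_to_ge E); apply: nearW => n.
  exact: nc_triangle.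
by apply: aeS => x /eqP; rewrite subr_eq0 => /eqP.
Qed.

(** A transform that vanishes almost everywhere is integrable and has zero transform, so inversion
    gives [2 pi g = 0]. *)
Lemma FT_eq0 g : cL1 g -> {ae mu, forall x, FT g x = 0} -> {ae mu, forall x, g x = 0}.
Proof.
move=> Lg g0.
have E x : FT (FT g) x = 0.
  rewrite /FT -[RHS](@cintegral0 R); apply: cintegral_ae.
  - by have := cmeas_FT Lg.1 => m; rewrite -/(FT g); meas.
  - exact: cmeas_cst.
  - by apply: aeS g0 => y gy; rewrite -/(FT g y) gy mul0r.
have LG : cL1 (FT g).
  split; first exact: cmeas_FT Lg.1.
  rewrite (_ : (\int[mu]_x _)%E = 0%E) ?ltry//.
  rewrite -(@integral0 _ _ R mu setT); apply: ge0_ae_eq_integral => //.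
  - by have := cmeas_FT Lg.1 => m; meas.
  - by move=> x _; rewrite lee_fin nc_ge0.
  - apply: aeS g0 => y gy _; transitivity ((nc (0 : R[i]))%:E); last by rewrite nc0.
    by congr ((nc _)%:E).
apply: aeS (FT_inversion Lg LG) => x; rewrite E => /esym/eqP.
rewrite mulf_eq0 => /orP[|/eqP//].
by rewrite eq_complex /= gt_eqF ?pi2_gt0.
Qed.
End fourier_uniqueness.

(** * Smooth functions of compact support *)

Section smooth_functions.
Context {R : realType}.
Implicit Types (f g : R -> R) (n k : nat).

(** [Cn n] asks for [n + 1] derivatives. The recursion on the derivative makes stability under sums,
    products and affine substitutions a plain induction. *)
Fixpoint Cn n f : Prop := (forall x : R, derivable f x 1) /\
  (if n is m.+1 then Cn m (derive1 f) else True).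

Definition smooth f := forall n, Cn n f.

Lemma smoothP f : smooth f <-> (forall n (x : R), derivable (derive1n n f) x 1).
Proof.
split=> [sf n|df n].
  elim: n f sf => [|n IH] f sf; first by case: (sf 0%N).
  by rewrite derive1Sn; apply: IH => m; case: (sf m.+1).
elim: n f df => [|n IH] f df; first by split => //; exact: (df 0%N).
split; first exact: (df 0%N).
by apply: IH => m; rewrite -derive1Sn; exact: df.
Qed.

Lemma smooth_derivable f (x : R) : smooth f -> derivable f x 1.
Proof. by move=> sf; case: (sf 0%N). Qed.

Lemma smooth_derive1 f : smooth f -> smooth (derive1 f).
Proof. by move=> sf n; case: (sf n.+1). Qed.

Lemma derivable_continuous f : (forall x : R, derivable f x 1) -> continuous f.
Proof.
by move=> df x; apply: differentiable_continuous; apply/derivable1_diffP; exact: df.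
Qed.

Lemma smooth_continuous f : smooth f -> continuous f.
Proof. by move=> sf; apply: derivable_continuous => x; exact: smooth_derivable. Qed.

Lemma CnS n f : Cn n.+1 f -> Cn n f.
Proof.
elim: n f => [f [h _]|n IH f [df h]]; first exact: (conj h I).
exact: (conj df (IH _ h)).
Qed.

Lemma CnD n f g : Cn n f -> Cn n g -> Cn n (fun x => f x + g x).
Proof.
have D (u v : R -> R) : (forall x : R, derivable u x 1) -> (forall x : R, derivable v x 1) ->
    forall x : R, derivable (fun x => u x + v x : R) x 1.
  by move=> du dv x; exact: (derivableD (du x) (dv x)).
elim: n f g => [f g [df hf] [dg hg]|n IH f g [df hf] [dg hg]].
  exact: (conj (D _ _ df dg) I).
split; first exact: D.
rewrite (_ : derive1 _ = fun x => derive1 f x + derive1 g x); first exact: IH.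
apply/funext => x; rewrite !derive1E; exact: (deriveD (df x) (dg x)).
Qed.

Lemma CnM n f g : Cn n f -> Cn n g -> Cn n (fun x => f x * g x).
Proof.
have D (u v : R -> R) : (forall x : R, derivable u x 1) -> (forall x : R, derivable v x 1) ->
    forall x : R, derivable (fun x => u x * v x : R) x 1.
  by move=> du dv x; exact: (derivableM (du x) (dv x)).
elim: n f g => [f g [df hf] [dg hg]|n IH f g Hf Hg].
  exact: (conj (D _ _ df dg) I).
have [df hf] := Hf; have [dg hg] := Hg.
split; first exact: D.
rewrite (_ : derive1 _ = fun x => derive1 f x * g x + f x * derive1 g x).
  apply: CnD; apply: IH; [exact: hf|exact: CnS|exact: CnS|exact: hg].
apply/funext => x; rewrite !derive1E (deriveM (df x) (dg x)) /GRing.scale /=.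
by rewrite addrC mulrC.
Qed.

Lemma Cn_cst n (c : R) : Cn n (fun=> c).
Proof.
elim: n c => [|n IH] c; split => //; try by move=> x; exact: derivable_cst.
rewrite (_ : derive1 _ = fun=> 0); first exact: IH.
by apply/funext => x; rewrite derive1_cst.
Qed.

Lemma Cn_affine n f (k c : R) : Cn n f -> Cn n (fun x => f (k * x + c)).
Proof.
have daff (x : R) : is_derive x 1 (fun x : R => k * x + c) k.
  by apply: is_derive_eq; rewrite /GRing.scale /= mulr1 addr0.
elim: n f => [|n IH] f [df hf].
  split => // x; have h : is_derive (k * x + c) 1 f (derive1 f (k * x + c)).
    by rewrite derive1E; exact: derivableP.
  by have [] := @is_derive1_comp _ f (fun x : R => k * x + c) x _ _ h (daff x).
split.
  move=> x; have h : is_derive (k * x + c) 1 f (derive1 f (k * x + c)).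
    by rewrite derive1E; exact: derivableP.
  by have [] := @is_derive1_comp _ f (fun x : R => k * x + c) x _ _ h (daff x).
rewrite (_ : derive1 _ = fun x => derive1 f (k * x + c) * k).
  by apply: CnM; [exact: IH|exact: Cn_cst].
apply/funext => x; have h : is_derive (k * x + c) 1 f (derive1 f (k * x + c)).
  by rewrite derive1E; exact: derivableP.
have [_] := @is_derive1_comp _ f (fun x : R => k * x + c) x _ _ h (daff x).
by move=> H; rewrite [LHS]derive1E; exact: H.
Qed.

(* [flat 0] is the classical function [exp (-1/x)] on [x > 0], and [flat k] are
   the functions spanning its derivatives. *)
Definition flat k (x : R) : R := if 0 < x then x^-1 ^+ k * expR (- x^-1) else 0.

(** The [k]-th power of [y / k <= 1 + y / k <= exp (y / k)]. *)
Lemma pow_le_exp k (y : R) : 0 <= y -> y ^+ k <= k%:R ^+ k * expR y.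
Proof.
move=> y0; case: k => [|k]; first by rewrite !expr0 mul1r -expR0 ler_expR.
have kn0 : k.+1%:R != 0 :> R by rewrite pnatr_eq0.
have -> : expR y = expR (y / k.+1%:R) ^+ k.+1.
  by rewrite -expRM_natr divfK.
rewrite -exprMn lerXn2r ?nnegrE ?mulr_ge0 ?expR_ge0//.
rewrite mulrC -ler_pdivrMr ?ltr0n//.
by apply: le_trans (expR_ge1Dx _); rewrite lerDr.
Qed.

(** Two more powers of [1 / x] are absorbed by the exponential, which leaves a factor [x^2]: the
    difference quotient at 0 is then of order [x]. *)
Lemma flat_bound k (x : R) : `|flat k x| <= (k.+2)%:R ^+ k.+2 * x ^+ 2.
Proof.
rewrite /flat; case: ifPn => x0; last first.
  by rewrite normr0; apply: mulr_ge0; [exact: exprn_ge0|exact: sqr_ge0].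
have y0 : 0 <= x^-1 by rewrite invr_ge0 ltW.
rewrite ger0_norm ?mulr_ge0 ?exprn_ge0 ?expR_ge0// expRN.
rewrite ler_pdivrMr ?expR_gt0// mulrAC -ler_pdivrMr ?exprn_gt0//.
rewrite -exprVn -exprD addn2; exact: pow_le_exp.
Qed.

(** The family is closed under differentiation up to linear combinations, so smoothness of all its
    members follows by one induction. At 0 the derivative is zero by the quadratic bound, and the
    formula also gives zero there. *)
Lemma is_derive_flat k (x : R) :
  is_derive x 1 (flat k) (flat k.+2 x - k%:R * flat k.+1 x).
Proof.
have [x0|x0|->] := ltgtP x 0.
- apply: (@near_eq_is_derive _ _ _ (fun=> 0)) => //.
    near=> y; rewrite /flat ifF//; apply/negbTE; rewrite -leNgt ltW//.
    by near: y; exact: lt_nbhsl.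
  rewrite /flat; have -> : (0 < x) = false by apply/negbTE; rewrite -leNgt ltW.
  by rewrite mulr0 subr0; exact: is_derive_cst.
- have xn0 : x != 0 by rewrite gt_eqF.
  apply: (@near_eq_is_derive _ _ _ (fun y : R => y^-1 ^+ k * expR (- y^-1))) => //.
    near=> y; rewrite /flat ifT//.
    by near: y; exact: lt_nbhsr.
  have dV : is_derive x 1 (fun y : R => y^-1) (- x ^- 2).
    by apply: is_derive_eq; [exact: is_deriveV|rewrite /GRing.scale /= mulr1].
  have dE : is_derive x 1 (fun y : R => expR (- y^-1)) (expR (- x^-1) * x ^- 2).
    apply: (@is_derive1_comp _ expR (fun y : R => - y^-1)).
    by apply: is_derive_eq; rewrite opprK.
  have dP : is_derive x 1 (fun y : R => y^-1 ^+ k) (k%:R * x^-1 ^+ k.-1 * - x ^- 2).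
    have -> : (fun y : R => y^-1 ^+ k) = (fun y : R => y^-1) ^+ k.
      by apply/funext => y; rewrite exprfctE.
    exact: (is_deriveX k dV).
  apply: (is_derive_eq (is_deriveM dP dE)).
  rewrite /flat x0 /GRing.scale /=.
  rewrite -!exprVn (exprS _ k.+1) (exprS _ k); move: x^-1 (expR (- x^-1)) => y E.
  by case: k {dP} => [|k] /=; rewrite ?exprS; ring.
- have E : flat k.+2 0 - k%:R * flat k.+1 0 = 0.
    by rewrite /flat ltxx mulr0 subr0.
  have H : (fun h : R => h^-1 *: (flat k (h *: (1 : R) + 0) - flat k 0)) @ 0^' --> (0 : R).
    apply/cvgr0Pnorm_le => /= d d0.
    pose C : R := (k.+2)%:R ^+ k.+2.
    have C0 : 0 < C by rewrite exprn_gt0// ltr0n.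
    near=> h.
    have hn0 : h != 0 by near: h; exact: nbhs_dnbhs_neq.
    rewrite /GRing.scale /= mulr1 addr0 {2}/flat ltxx subr0 normrM normfV.
    rewrite ler_pdivrMl ?normr_gt0// (le_trans (flat_bound _ _))//.
    rewrite -/C -[h ^+ 2]ger0_norm ?sqr_ge0// normrX expr2 mulrCA ler_wpM2l//.
    rewrite -ler_pdivlMl//; near: h; apply: dnbhs0_le.
    by rewrite mulr_gt0// invr_gt0.
  rewrite E; apply: DeriveDef; first exact: (cvgP _ H).
  exact: (cvg_lim (@Rhausdorff R) H).
Unshelve. all: by end_near. Qed.

Lemma smooth_flat k : smooth (flat k).
Proof.
move=> n; elim: n k => [|n IH] k.
  by split => // x; case: (is_derive_flat k x).
split; first by move=> x; case: (is_derive_flat k x).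
rewrite (_ : derive1 _ = fun x => flat k.+2 x + (fun=> - k%:R) x * flat k.+1 x).
  by apply: CnD; [exact: IH|apply: CnM; [exact: Cn_cst|exact: IH]].
apply/funext => x; rewrite derive1E mulNr; by case: (is_derive_flat k x).
Qed.

(** A smooth approximation from below of the indicator of []a, b[]: at scale [n] the arguments of
    both factors tend to infinity inside the interval, and [flat 0 y = exp (- 1 / y)] tends to 1
    there. *)
Definition bump (a b : R) n (x : R) : R :=
  flat 0 (n.+1%:R * (x - a)) * flat 0 (n.+1%:R * (b - x)).

Lemma smooth_bump a b n : smooth (bump a b n).
Proof.
move=> m; rewrite (_ : bump a b n = fun x => flat 0 (n.+1%:R * x + - (n.+1%:R * a)) *
    flat 0 (- n.+1%:R * x + n.+1%:R * b)).
  by apply: CnM; apply: (@Cn_affine _ (flat 0)); exact: smooth_flat.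
by apply/funext => x; rewrite /bump !mulrBr mulNr [- _ + _]addrC.
Qed.

Lemma flat0_ge0 x : 0 <= flat 0 x.
Proof. by rewrite /flat; case: ifP => // _; rewrite expr0 mul1r expR_ge0. Qed.

Lemma flat0_le1 x : flat 0 x <= 1.
Proof.
rewrite /flat; case: ifP => // x0; rewrite expr0 mul1r -expR0 ler_expR oppr_le0.
by rewrite invr_ge0 ltW.
Qed.

Lemma bump_ge0 a b n x : 0 <= bump a b n x.
Proof. by rewrite mulr_ge0 ?flat0_ge0. Qed.

Lemma bump_out a b n x : ~ (a < x < b) -> bump a b n x = 0.
Proof.
move=> h; rewrite /bump /flat !pmulr_rgt0 ?ltr0n// !subr_gt0.
case: ifPn => ax; last by rewrite mul0r.
by case: ifPn => xb; [move: h; rewrite ax xb|rewrite mulr0].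
Qed.

Lemma bump_le a b n x : bump a b n x <= \1_(`]a, b[%classic) x.
Proof.
have [h|/negP h] := boolP (a < x < b).
  by rewrite indicT /= ?in_itv//= mulr_ile1 ?flat0_ge0 ?flat0_le1.
by rewrite bump_out//.
Qed.

Lemma cvg_flat0 (y : R) : 0 < y -> flat 0 (n.+1%:R * y) @[n --> \oo] --> (1 : R).
Proof.
move=> y0.
have E n : flat 0 (n.+1%:R * y) = expR (- (inv_succ n * y^-1)).
  by rewrite /flat pmulr_rgt0 ?ltr0n// y0 expr0 mul1r invfM.
under eq_fun do rewrite E.
have H : expR (- (inv_succ n * y^-1)) @[n --> \oo] --> expR (- (0 * y^-1)).
  apply: continuous_cvg; first exact: continuous_expR.
  by apply: cvgN; apply: cvgM; [exact: cvg_inv_succ|exact: cvg_cst].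
by rewrite mul0r oppr0 expR0 in H.
Qed.

Lemma cvg_bump a b x : bump a b n x @[n --> \oo] --> (\1_(`]a, b[%classic) x : R).
Proof.
have [h|/negP h] := boolP (a < x < b).
  rewrite indicT /= ?in_itv//=; have /andP[ax xb] := h.
  rewrite -[X in _ --> X]mulr1.
  by apply: cvgM; apply: cvg_flat0; rewrite subr_gt0.
under eq_fun do rewrite bump_out//.
by rewrite indicF /= ?in_itv//; exact: cvg_cst.
Qed.

Lemma measurable_bump a b n : measurable_fun setT (bump a b n).
Proof. by apply: continuous_measurable_fun; exact/smooth_continuous/smooth_bump. Qed.

Lemma test_fun_bump a b n : test_fun (bump a b n).
Proof.
split; first by apply/smoothP; exact: smooth_bump.
exists (`|a| + `|b|) => x h; apply: bump_out => /andP[ax xb].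
have : `|x| <= `|a| + `|b|.
  rewrite ler_norml; apply/andP; split.
    apply: le_trans (ltW ax); rewrite lerNl (le_trans (ler_norm _))// normrN lerDl//.
  by apply: le_trans (ltW xb) _; rewrite (le_trans (ler_norm _))// lerDr.
by rewrite leNgt h.
Qed.

(** Bumps tend to the indicator of an interval under the bound [|f|] on the closed interval, so the
    integrals of [f] over all intervals vanish. *)
Lemma eq0_of_test_fun f : locally_integrable setT f ->
  (forall phi, test_fun phi -> \int[mu]_x (f x * phi x) = 0) ->
  {ae mu, forall x, f x = 0}.
Proof.
move=> lf f0; apply: ae0_of_intervals => // a b ab.
have [mf _ lK] := lf.
have H : \int[mu]_x (f x * bump a b n x) @[n --> \oo] --> \int[mu]_x (f x * \1_(`]a, b[%classic) x).
  apply: (Rint_dct (b := fun x => \1_(`[a, b]%classic) x * `|f x|)).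
  - by move=> n; have := measurable_bump a b n => m; meas.
  - by meas.
  - by meas.
  - under eq_integral do rewrite ger0_norm ?mulr_ge0// EFinM.
    rewrite -int_indic; apply: lK => //; exact: segment_compact.
  - apply: aeT => x n; rewrite normrM mulrC ler_wpM2r//.
    rewrite ger0_norm ?bump_ge0// (le_trans (bump_le _ _ _ _))//.
    rewrite !indicE; have [xI|xI] := boolP (x \in `]a, b[%classic).
      by rewrite mem_set//; move: xI; rewrite inE; exact: subset_itvW.
    by case: (_ \in _).
  - by apply: aeT => x; apply: cvgM; [exact: cvg_cst|exact: cvg_bump].
rewrite Rint_indic; under eq_Rintegral do rewrite mulrC.
rewrite -(cvg_lim (@Rhausdorff R) H).
rewrite (_ : (fun n => _) = cst 0) ?lim_cst//.
by apply/funext => n; apply: f0; exact: test_fun_bump.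
Qed.
End smooth_functions.

(** * The Fourier transform of integrable functions *)

Section fourier_transform.
Context {R : realType}.
Implicit Types (f h phi : R -> R) (g : R -> R[i]).

Definition cF : R := (Num.sqrt (2 * pi))^-1.

Lemma cF_gt0 : 0 < cF.
Proof. by rewrite invr_gt0 sqrtr_gt0 pi2_gt0. Qed.

Lemma cF_sqr : cF * cF * (2 * pi) = 1.
Proof.
rewrite /cF -invfM -expr2 sqr_sqrtr ?(ltW pi2_gt0)// mulVf//.
by rewrite gt_eqF// pi2_gt0.
Qed.

Lemma inverse_fourierE g x : inverse_fourier g x = cF%:C * FT g x.
Proof.
by congr (_ * _); apply: eq_cintegral => xi; rewrite [x * xi]mulrC.
Qed.

Lemma fourierE f xi : fourier f xi = cF%:C * FT (fun x => (f x)%:C) (- xi).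
Proof.
by congr (_ * _); apply: eq_cintegral => x; rewrite mulrN.
Qed.

Lemma FT_conj g xi : FT (fun x => conjc (g x)) xi = conjc (FT g (- xi)).
Proof.
rewrite /FT -cintegralJ; apply: eq_cintegral => x.
by rewrite conjcM -cisN mulrN opprK.
Qed.

Lemma conj_fourier f xi : conjc (fourier f xi) = cF%:C * FT (fun x => (f x)%:C) xi.
Proof.
rewrite fourierE conjcM conjcR -FT_conj; congr (_ * _).
by apply: eq_cintegral => x; rewrite conjcR.
Qed.

Lemma cmeas_inverse_fourier g : cmeas g -> cmeas (inverse_fourier g).
Proof.
move=> mg; have m := cmeas_FT mg.
rewrite (_ : inverse_fourier g = fun x => cF%:C * FT g x); first by meas.
by apply/funext => x; exact: inverse_fourierE.
Qed.

Lemma nc_inverse_fourier g x : cL1 g ->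
  nc (inverse_fourier g x) <= cF * fine (\int[mu]_xi (nc (g xi))%:E)%E.
Proof.
move=> Lg; rewrite inverse_fourierE ncM nc_real gtr0_norm ?cF_gt0//.
by rewrite ler_wpM2l ?(ltW cF_gt0)// nc_FT.
Qed.

Lemma fourier_parseval g phi : cL1 g -> cL1 (fun x => (phi x)%:C) ->
  cintegral (fun x => inverse_fourier g x * (phi x)%:C) =
  cintegral (fun xi => g xi * conjc (fourier phi xi)).
Proof.
move=> Lg Lp.
rewrite (eq_cintegral (g := fun x => cF%:C * (FT g x * (phi x)%:C))); last first.
  by move=> x; rewrite inverse_fourierE mulrA.
rewrite (eq_cintegral (f := fun xi => g xi * _)
  (g := fun xi => cF%:C * (g xi * FT (fun x => (phi x)%:C) xi))); last first.
  by move=> xi; rewrite conj_fourier mulrCA.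
have mF := cmeas_FT Lg.1; have mP := cmeas_FT Lp.1.
rewrite !cintegralZ ?FT_parseval//.
  rewrite (_ : (fun xi => _) = (fun xi => FT (fun x => (phi x)%:C) xi * g xi)); last first.
    by apply/funext => x; rewrite mulrC.
  by apply: cL1M_bounded Lg => // x; exact: nc_FT.
by apply: cL1M_bounded Lp => // x; exact: nc_FT.
Qed.

Lemma cL1_real phi : measurable_fun setT phi -> (\int[mu]_x `|phi x|%:E < +oo)%E ->
  cL1 (fun x => (phi x)%:C).
Proof.
move=> m i; split; first by meas.
by under eq_integral do rewrite nc_real.
Qed.

Lemma cL1_compact_support f (M : R) : continuous f ->
  (forall x, M < `|x| -> f x = 0) -> cL1 (fun x => (f x)%:C).
Proof.
move=> cf f0; have mf : measurable_fun setT f by exact: continuous_measurable_fun.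
apply: cL1_real => //.
have i : mu.-integrable `[- M, M]%classic (EFin \o f).
  apply: continuous_compact_integrable; first exact: segment_compact.
  exact: continuous_subspaceT.
have /integrableP[_] := i; rewrite int_indic.
apply: le_lt_trans; apply: le_int => x; first by rewrite lee_fin.
rewrite -EFinM lee_fin /=; have [xM|xM] := leP `|x| M.
  by rewrite indicT ?mul1r//= in_itv/= -ler_norml.
by rewrite f0// normr0 mulr_ge0.
Qed.

Lemma test_fun_cL1 phi : test_fun phi -> cL1 (fun x => (phi x)%:C).
Proof.
move=> [/smoothP sp [M pM]]; apply: (@cL1_compact_support _ M) => //.
exact: smooth_continuous.
Qed.

Lemma derive1_out f (M : R) : (forall x, M < `|x| -> f x = 0) ->
  forall x, M < `|x| -> derive1 f x = 0.
Proof.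
move=> f0 x xM; rewrite derive1E.
have : \forall y \near x, f y = (fun=> 0) y.
  near=> y; apply: f0; near: y.
  exact: (@norm_continuous _ _ x _ (lt_nbhsr xM)).
move=> H; have [_ ->//] : is_derive x 1 f 0.
by apply: (@near_eq_is_derive _ _ _ (fun _ : R => 0 : R)); apply: filterS H => y ->.
Unshelve. all: by end_near. Qed.

Lemma test_fun_derive1 phi : test_fun phi -> test_fun (derive1 phi).
Proof.
move=> [/smoothP sp [M pM]]; split; first by apply/smoothP; exact: smooth_derive1.
by exists M; exact: derive1_out.
Qed.

Lemma test_fun_derive1n phi n : test_fun phi -> test_fun (derive1n n phi).
Proof. by elim: n => // n IH /IH; rewrite derive1nS; exact: test_fun_derive1. Qed.

Lemma test_fun_bounded phi : test_fun phi -> exists M, forall x, `|phi x| <= M.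
Proof.
move=> [/smoothP sp [M pM]].
have cp : {within `[- M, M]%classic, continuous phi}.
  exact/continuous_subspaceT/smooth_continuous.
have [M0|M0] := ltP M 0.
  exists 0 => x; rewrite pM ?normr0//; exact: lt_le_trans M0 _.
have le : - M <= M by rewrite (le_trans _ M0)// oppr_le0.
have [c _ cM] := EVT_max le cp; have [d _ dM] := EVT_min le cp.
exists (`|phi c| + `|phi d|) => x; have [xM|xM] := leP `|x| M; last first.
  by rewrite pM// normr0 addr_ge0.
have xI : x \in `[- M, M] by rewrite in_itv/= -ler_norml.
rewrite ler_norml; apply/andP; split.
  apply: le_trans (dM _ xI); rewrite lerNl (le_trans (ler_norm _))// normrN lerDr//.
by apply: le_trans (cM _ xI) _; rewrite (le_trans (ler_norm _))// lerDl.
Qed.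

Lemma locally_integrable_mul_test f phi : locally_integrable setT f -> test_fun phi ->
  cL1 (fun x => (f x * phi x)%:C).
Proof.
move=> [mf _ lf] tp; have [B0' pB0] := test_fun_bounded tp; pose B : R := B0'.
have pB x : `|phi x| <= B := pB0 x.
have B0 : 0 <= B := le_trans (normr_ge0 _) (pB 0).
have [[mp _] _] := test_fun_cL1 tp; rewrite /= in mp.
have [_ [M pM]] := tp.
apply: cL1_real; first by meas.
apply: (@le_lt_trans _ _ (\int[mu]_x (B * (\1_(`[- M, M]%classic) x * `|f x|))%:E)%E).
  apply: le_int => x; first by rewrite lee_fin.
  rewrite lee_fin normrM mulrC; have [xM|xM] := leP `|x| M.
    by rewrite indicT ?mul1r ?ler_wpM2r//= in_itv/= -ler_norml.
  by rewrite pM// normr0 mul0r !mulr_ge0.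
under eq_integral do rewrite EFinM.
rewrite ge0_integralZl_EFin//; last by meas.
rewrite lte_mul_pinfty ?lee_fin//; under eq_integral do rewrite EFinM.
by rewrite -int_indic; apply: lf => //; exact: segment_compact.
Qed.

(** By Parseval, the duality in the definition tests [f - inverse_fourier g] against all test
    functions; it therefore states that these two locally integrable functions agree almost
    everywhere. Distributional transforms become pointwise formulas from here on. *)
Lemma has_fourierP f g : has_fourier f g <->
  [/\ locally_integrable setT f, cL1 g &
      {ae mu, forall x, inverse_fourier g x = (f x)%:C}].
Proof.
split=> [[lf /cL1P Lg fg]|[lf Lg fg]]; split => //.
- have mI := cmeas_inverse_fourier Lg.1.
  have [mf _ _] := lf.
  have lR : locally_integrable setT (fun x => complex.Re (inverse_fourier g x)).
    apply: (bounded_locally_integrable mI.1) => x.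
    exact: le_trans (nc_Re _) (nc_inverse_fourier x Lg).
  have lI : locally_integrable setT (fun x => complex.Im (inverse_fourier g x)).
    apply: (bounded_locally_integrable mI.2) => x.
    exact: le_trans (nc_Im _) (nc_inverse_fourier x Lg).
  have E phi : test_fun phi ->
      cintegral (fun x => inverse_fourier g x * (phi x)%:C) = (\int[mu]_x (f x * phi x))%:C.
    by move=> tp; rewrite fourier_parseval ?fg//; exact: test_fun_cL1.
  have bI phi : test_fun phi -> cL1 (fun x => inverse_fourier g x * (phi x)%:C).
    move=> tp; apply: cL1M_bounded (test_fun_cL1 tp) => // x; exact: nc_inverse_fourier.
  have h2 : {ae mu, forall x, complex.Im (inverse_fourier g x) = 0}.
    apply: eq0_of_test_fun => // phi tp.
    have H : \int[mu]_x complex.Im (inverse_fourier g x * (phi x)%:C) = 0 :=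
      congr1 (@complex.Im R) (E phi tp).
    by rewrite -[RHS]H; apply: eq_Rintegral => x _; rewrite ImMR.
  have h1 : {ae mu, forall x, complex.Re (inverse_fourier g x) - f x = 0}.
    apply: eq0_of_test_fun.
      by have := locally_integrableB lR lf.
    move=> phi tp.
    have H : \int[mu]_x complex.Re (inverse_fourier g x * (phi x)%:C) =
      \int[mu]_x (f x * phi x) := congr1 (@complex.Re R) (E phi tp).
    have i1 : mu.-integrable setT (EFin \o (fun x => complex.Re (inverse_fourier g x) * phi x)).
      have /cL1P[i _] := bI phi tp; apply: eq_integrable i => // x _.
      by congr (_%:E); exact: ReMR.
    have i2 : mu.-integrable setT (EFin \o (fun x => f x * phi x)).
      by have /cL1P[] := locally_integrable_mul_test lf tp.
    under eq_Rintegral do rewrite mulrBl.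
    rewrite RintegralB// -H; apply/eqP; rewrite subr_eq0; apply/eqP.
    by apply: eq_Rintegral => x _; rewrite ReMR.
  apply: aeS (aeI h1 h2) => x [/eqP]; rewrite subr_eq0 => /eqP a b.
  exact: complexP.
- exact/cL1P.
- move=> phi tp; rewrite -fourier_parseval//; last exact: test_fun_cL1.
  have mI := cmeas_inverse_fourier Lg.1.
  have [mf _ _] := lf; have [mp _] := test_fun_cL1 tp.
  rewrite (cintegral_ae (g := fun x => (f x * phi x)%:C)).
  + by apply: complexP => //=; rewrite /Rintegral integral0.
  + by meas.
  + have m2 : measurable_fun setT phi := mp.1.
    by meas.
  + by apply: aeS fg => x ->; rewrite RCM.
Qed.
End fourier_transform.

Section fourier_calculus.
Context {R : realType}.
Implicit Types (f h phi : R -> R) (g : R -> R[i]).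

Lemma eq_inverse_fourier g1 g2 x : cmeas g1 -> cmeas g2 ->
  {ae mu, forall xi, g1 xi = g2 xi} -> inverse_fourier g1 x = inverse_fourier g2 x.
Proof.
move=> m1 m2 e; congr (_ * _); apply: cintegral_ae; [by meas|by meas|].
by apply: aeS e => xi ->.
Qed.

Lemma inverse_fourierB g1 g2 x : cL1 g1 -> cL1 g2 ->
  inverse_fourier (fun xi => g1 xi - g2 xi) x = inverse_fourier g1 x - inverse_fourier g2 x.
Proof.
move=> L1 L2; rewrite !inverse_fourierE -mulrBr; congr (_ * _).
rewrite /FT -cintegralB; [|exact: cL1_cis|exact: cL1_cis].
by apply: eq_cintegral => xi; rewrite mulrBl.
Qed.

Lemma inverse_fourier_eq0 g : cL1 g -> {ae mu, forall x, inverse_fourier g x = 0} ->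
  {ae mu, forall xi, g xi = 0}.
Proof.
move=> Lg e; apply: FT_eq0 => //; apply: aeS e => x /eqP.
rewrite inverse_fourierE mulf_eq0 eq_complex /= (gt_eqF cF_gt0) /=.
by move=> /eqP.
Qed.

Lemma inverse_fourier_inj g1 g2 : cL1 g1 -> cL1 g2 ->
  {ae mu, forall x, inverse_fourier g1 x = inverse_fourier g2 x} ->
  {ae mu, forall xi, g1 xi = g2 xi}.
Proof.
move=> L1 L2 e.
have H : {ae mu, forall xi, g1 xi - g2 xi = 0}.
  apply: inverse_fourier_eq0; first exact: cL1B.
  by apply: aeS e => x ex; rewrite inverse_fourierB// ex subrr.
by apply: aeS H => xi /eqP; rewrite subr_eq0 => /eqP.
Qed.

Lemma has_fourier_unique f g1 g2 : has_fourier f g1 -> has_fourier f g2 ->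
  {ae mu, forall xi, g1 xi = g2 xi}.
Proof.
move=> /has_fourierP[_ L1 e1] /has_fourierP[_ L2 e2].
by apply: inverse_fourier_inj => //; apply: aeS (aeI e1 e2) => x [-> ->].
Qed.

(** The symmetry of transforms of real functions, required at every frequency so that inverse
    transforms are real at every point. *)
Definition hermitian g := forall xi, g (- xi) = conjc (g xi).

Lemma hermitian_real g x : cmeas g -> hermitian g ->
  complex.Im (inverse_fourier g x) = 0.
Proof.
move=> mg hg; rewrite inverse_fourierE ImRC.
suff -> : complex.Im (FT g x) = 0 by rewrite mulr0.
have E : conjc (FT g x) = FT g x.
  rewrite -[in LHS](opprK x) -FT_conj /FT.
  have m : cmeas (fun xi => conjc (g xi) * cis (xi * - x)) by meas.
  rewrite -(cint_opp m); apply: eq_cintegral => xi.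
  by rewrite hg conjcK mulrNN.
have /eqP := congr1 (@complex.Im R) E; rewrite ImJ eq_sym -addr_eq0 -mulr2n mulrn_eq0.
by move=> /eqP.
Qed.

Lemma hermitian_has_fourier g : cL1 g -> hermitian g ->
  has_fourier (fun x => complex.Re (inverse_fourier g x)) g.
Proof.
move=> Lg hg; have mI := cmeas_inverse_fourier Lg.1.
apply/has_fourierP; split => //.
  apply: (bounded_locally_integrable mI.1) => x.
  exact: le_trans (nc_Re _) (nc_inverse_fourier x Lg).
apply: aeT => x; apply: complexP => //=; exact: hermitian_real Lg.1 hg.
Qed.

(** Since [f] is real, [conj g (- xi)] is another transform of [f], hence equal to [g] almost
    everywhere; the mean of the two is exactly symmetric. *)
Lemma has_fourier_hermitian f g : has_fourier f g ->
  exists g', [/\ hermitian g', cL1 g', has_fourier f g' & {ae mu, forall xi, g xi = g' xi}].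
Proof.
move=> /has_fourierP[lf Lg fg].
pose gt xi := conjc (g (- xi)).
have Lgt : cL1 gt.
  have [m i] := cL1_comp_opp Lg; split; first by rewrite /gt; meas.
  by rewrite /gt; under eq_integral do rewrite ncJ.
have fgt : {ae mu, forall x, inverse_fourier gt x = (f x)%:C}.
  apply: aeS fg => x fx; rewrite -conjcR -fx !inverse_fourierE conjcM conjcR; congr (_ * _).
  rewrite -[in RHS](opprK x) -FT_conj /FT.
  have m : cmeas (fun xi => conjc (g xi) * cis (xi * - x)) by have [m _] := Lg; meas.
  by rewrite -(cint_opp m); apply: eq_cintegral => xi; rewrite mulrNN.
pose g' xi := (2^-1 : R)%:C * (g xi + gt xi).
have Lg' : cL1 g' by apply: cL1Z; exact: cL1D.
have ae : {ae mu, forall xi, g xi = gt xi}.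
  by apply: inverse_fourier_inj => //; apply: aeS (aeI fg fgt) => x [-> ->].
have ae' : {ae mu, forall xi, g xi = g' xi}.
  apply: aeS ae => xi e; rewrite /g' -e; apply: complexP; rewrite ?ReRC ?ImRC ?ReD ?ImD;
    by field.
exists g'; split => //.
  by move=> xi; rewrite /g' /gt opprK conjcM conjcR conjcD conjcK addrC.
apply/has_fourierP; split => //; apply: aeS fg => x <-.
by apply: eq_inverse_fourier; [case: Lg'|case: Lg|apply: aeS ae' => xi ->].
Qed.

Lemma test_fun_int_derive1 phi : test_fun phi -> \int[mu]_x derive1 phi x = 0.
Proof.
(* The support condition is strict; enlarging the bound makes [phi] vanish at [M] and [- M]
   themselves. *)
move=> tp; have [/smoothP sp [M0' pM0]] := tp; pose M := Num.max M0' 0 + 1.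
have pM x : M <= `|x| -> phi x = 0.
  move=> h; apply: pM0; apply: lt_le_trans h; rewrite /M ltr_pwDr//.
  by rewrite le_max lexx.
have M0 : 0 <= M by rewrite addr_ge0// le_max lexx orbT.
have sd := smooth_derive1 sp.
have E : \int[mu]_(x in `[- M, M]) derive1 phi x = phi M - phi (- M).
  apply: Rint_FTC2; last exact: smooth_continuous.
  - by rewrite (le_trans _ M0)// oppr_le0.
  - by move=> x; rewrite derive1E; apply: derivableP; exact: smooth_derivable.
have {}E : \int[mu]_(x in `[- M, M]) derive1 phi x = 0.
  by rewrite E !pM ?subrr// ?normrN ger0_norm.
rewrite Rint_indic in E; rewrite -[RHS]E; apply: eq_Rintegral => x _.
have [xM|xM] := leP `|x| M; first by rewrite indicT ?mul1r//= in_itv/= -ler_norml.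
rewrite indicF ?mul0r//=; last by rewrite in_itv/= -ler_norml leNgt xM.
by apply: (derive1_out (M := M)) => // y /ltW; exact: pM.
Qed.

Lemma is_derive_sincos (xi x : R) :
  is_derive x 1 (fun x : R => cos (x * xi)) (- sin (x * xi) * xi) /\
  is_derive x 1 (fun x : R => sin (x * xi)) (cos (x * xi) * xi).
Proof.
have d0 : is_derive x 1 (fun x : R => x * xi) xi.
  by apply: is_derive_eq; rewrite /GRing.scale /= mulr0 add0r mulr1.
split; first exact: (@is_derive1_comp _ cos (fun x : R => x * xi)).
exact: (@is_derive1_comp _ sin (fun x : R => x * xi)).
Qed.

Lemma smooth_cos_sin (xi : R) n :
  Cn n (fun x : R => cos (x * xi)) /\ Cn n (fun x : R => sin (x * xi)).
Proof.
have dc x := (is_derive_sincos xi x).1; have ds x := (is_derive_sincos xi x).2.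
have Ec : derive1 (fun x : R => cos (x * xi)) = fun x => sin (x * xi) * (fun=> - xi) x.
  by apply/funext => x; rewrite derive1E mulrN -mulNr; case: (dc x).
have Es : derive1 (fun x : R => sin (x * xi)) = fun x => cos (x * xi) * (fun=> xi) x.
  by apply/funext => x; rewrite derive1E; case: (ds x).
elim: n => [|n [IHc IHs]].
  by split; split.
split; split.
- by move=> x; case: (dc x).
- by rewrite Ec; apply: CnM => //; exact: Cn_cst.
- by move=> x; case: (ds x).
- by rewrite Es; apply: CnM => //; exact: Cn_cst.
Qed.

Lemma test_funM phi h : test_fun phi -> smooth h -> test_fun (fun x => phi x * h x).
Proof.
move=> [/smoothP sp [M pM]] sh; split.
  by apply/smoothP => n; apply: CnM.
by exists M => x /pM ->; rewrite mul0r.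
Qed.

Lemma test_fun_parts phi h : test_fun phi -> smooth h ->
  \int[mu]_x (derive1 phi x * h x) = - \int[mu]_x (phi x * derive1 h x).
Proof.
move=> tp sh; have tm := test_funM tp sh.
have sp : smooth phi by case: tp => /smoothP.
have t1 := test_funM (test_fun_derive1 tp) sh.
have t2 := test_funM tp (smooth_derive1 sh).
have /cL1P[i1 _] := test_fun_cL1 t1; have /cL1P[i2 _] := test_fun_cL1 t2.
have := test_fun_int_derive1 tm.
have E x : derive1 (fun x => phi x * h x) x = derive1 phi x * h x + phi x * derive1 h x.
  rewrite derive1E deriveM; [|exact: smooth_derivable|exact: smooth_derivable].
  by rewrite /GRing.scale /= !derive1E addrC mulrC.
under eq_Rintegral do rewrite E.
by rewrite RintegralD// => /eqP; rewrite addr_eq0 => /eqP.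
Qed.

Lemma FT_derive1 phi (xi : R) : test_fun phi ->
  FT (fun x => (derive1 phi x)%:C) xi = - ('i%C * xi%:C) * FT (fun x => (phi x)%:C) xi.
Proof.
move=> tp; have sc n := (smooth_cos_sin xi n).1; have ss n := (smooth_cos_sin xi n).2.
have dc x := (is_derive_sincos xi x).1; have ds x := (is_derive_sincos xi x).2.
have /cL1P[i1 _] := test_fun_cL1 (test_funM tp sc).
have /cL1P[i2 _] := test_fun_cL1 (test_funM tp ss).
have Ec : \int[mu]_x (derive1 phi x * cos (x * xi)) = xi * \int[mu]_x (phi x * sin (x * xi)).
  rewrite (test_fun_parts tp sc) -RintegralZl// -RintN.
  apply: eq_Rintegral => x _; rewrite derive1E; case: (dc x) => _ ->; ring.
have Es : \int[mu]_x (derive1 phi x * sin (x * xi)) = - xi * \int[mu]_x (phi x * cos (x * xi)).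
  rewrite (test_fun_parts tp ss) -RintegralZl// -RintN.
  apply: eq_Rintegral => x _; rewrite derive1E; case: (ds x) => _ ->; ring.
have FE (u : R -> R) : FT (fun x => (u x)%:C) xi =
    (\int[mu]_x (u x * cos (x * xi)) +i* \int[mu]_x (u x * sin (x * xi)))%C.
  by apply: complexP => /=; apply: eq_Rintegral => x _; rewrite ?mul0r ?subr0 ?addr0.
rewrite !FE Ec Es; apply: complexP => /=; ring.
Qed.

Lemma fourier_derive1 phi (xi : R) : test_fun phi ->
  fourier (derive1 phi) xi = 'i%C * xi%:C * fourier phi xi.
Proof.
move=> tp; rewrite !fourierE FT_derive1// RCN mulrN opprK.
by rewrite mulrCA.
Qed.

Lemma nc_fourier phi xi : cL1 (fun x => (phi x)%:C) ->
  nc (fourier phi xi) <= cF * fine (\int[mu]_x (`|phi x|)%:E)%E.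
Proof.
move=> Lp; rewrite fourierE ncM nc_real gtr0_norm ?cF_gt0//.
rewrite ler_wpM2l ?(ltW cF_gt0)//; apply: le_trans (nc_FT _ Lp) _.
by under eq_integral do rewrite nc_real.
Qed.

(** Bounds the transforms of [phi] and of its first three derivatives, since
    [(1 + y) (1 + y^2) = 1 + y + y^2 + y^3] in [fourier_decay]. *)
Definition decay_const phi : R :=
  \sum_(n < 4) cF * fine (\int[mu]_x (`|derive1n n phi x|)%:E)%E.

Lemma nc_fourier_derive1n phi (xi : R) n : test_fun phi ->
  nc (fourier (derive1n n phi) xi) = `|xi| ^+ n * nc (fourier phi xi).
Proof.
move=> tp; elim: n => [|n IH]; first by rewrite expr0 mul1r.
rewrite derive1nS fourier_derive1; last exact: test_fun_derive1n.
by rewrite ncM IH ncM nc_i mul1r nc_real exprS mulrA.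
Qed.

Lemma fourier_decay phi (xi : R) : test_fun phi ->
  (1 + `|xi|) * (1 + xi ^+ 2) * nc (fourier phi xi) <= decay_const phi.
Proof.
move=> tp.
have B n : `|xi| ^+ n * nc (fourier phi xi) <= cF * fine (\int[mu]_x (`|derive1n n phi x|)%:E)%E.
  by rewrite -nc_fourier_derive1n//; exact: nc_fourier (test_fun_cL1 (test_fun_derive1n n tp)).
have P (y z D0 D1 D2 D3 : R) : y ^+ 0 * z <= D0 -> y ^+ 1 * z <= D1 ->
    y ^+ 2 * z <= D2 -> y ^+ 3 * z <= D3 -> (1 + y) * (1 + y ^+ 2) * z <= D0 + D1 + D2 + D3.
  by rewrite !exprS expr0; lra.
have := P _ _ _ _ _ _ (B 0%N) (B 1%N) (B 2%N) (B 3%N).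
have -> : xi ^+ 2 = `|xi| ^+ 2 by rewrite real_normK ?num_real.
by move=> H; rewrite /decay_const !big_ord_recr big_ord0 Monoid.mul1m; exact: H.
Qed.

Lemma cmeas_fourier phi : measurable_fun setT phi -> cmeas (fourier phi).
Proof.
move=> mp.
have m : cmeas (fun x => (phi x)%:C) by meas.
have mF := cmeas_FT m.
rewrite (_ : fourier phi = fun xi => cF%:C * FT (fun x => (phi x)%:C) (- xi)); first by meas.
by apply/funext => xi; exact: fourierE.
Qed.

Lemma decay_const_ge0 phi : 0 <= decay_const phi.
Proof.
apply: sumr_ge0 => n _; apply: mulr_ge0; first exact: ltW cF_gt0.
by apply: fine_ge0; apply: integral_ge0 => x _; rewrite lee_fin.
Qed.

Lemma cL1_fourier_weight phi : test_fun phi ->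
  cL1 (fun xi => (1 + `|xi|)%:C * fourier phi xi).
Proof.
move=> tp.
have mp : measurable_fun setT phi.
  by apply: continuous_measurable_fun; apply: smooth_continuous; case: tp => /smoothP.
have mf := cmeas_fourier mp.
apply: (@cL1_le _ _ (fun xi => (decay_const phi * (1 + xi ^+ 2)^-1)%:C)).
- by meas.
- apply: cL1_real; first by have := @measurable_oneDsqrV R => m; meas.
  have E (x : R) : (`|decay_const phi / (1 + x ^+ 2)|%:E = (decay_const phi)%:E * ((1 + x ^+ 2)^-1)%:E)%E.
    by rewrite ger0_norm ?EFinM// divr_ge0 ?decay_const_ge0// ltW// oneDsqr_gt0.
  under eq_integral do rewrite E.
  rewrite ge0_integralZl_EFin ?decay_const_ge0//.
  + by rewrite int_oneDsqr -EFinM ltry.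
  + by move=> x _; rewrite lee_fin invr_ge0 ltW// oneDsqr_gt0.
  + exact: (measurable_EFin measurable_oneDsqrV).
- move=> xi; rewrite ncM !nc_real ger0_norm ?addr_ge0//.
  rewrite [leRHS]ger0_norm; last by rewrite divr_ge0 ?decay_const_ge0// ltW// oneDsqr_gt0.
  rewrite ler_pdivlMr ?oneDsqr_gt0// mulrAC; exact: fourier_decay.
Qed.
End fourier_calculus.

(** * Convolution and the advection term *)

Section convolution.
Context {R : realType}.
Implicit Types (A B f g h k : R -> R[i]).

Lemma intZ (k : R) (f : R -> R) : 0 <= k -> measurable_fun setT f -> (forall x, 0 <= f x) ->
  (\int[mu]_x (k * f x)%:E = k%:E * \int[mu]_x (f x)%:E)%E.
Proof.
move=> k0 mf f0; under eq_integral do rewrite EFinM.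
by rewrite ge0_integralZl_EFin// => [x _|]; [rewrite lee_fin|exact: measurable_EFin].
Qed.

Lemma intD (f1 f2 : R -> R) : measurable_fun setT f1 -> measurable_fun setT f2 ->
  (forall x, 0 <= f1 x) -> (forall x, 0 <= f2 x) ->
  (\int[mu]_x (f1 x + f2 x)%:E = \int[mu]_x (f1 x)%:E + \int[mu]_x (f2 x)%:E)%E.
Proof.
move=> m1 m2 f10 f20; under eq_integral do rewrite EFinD.
by rewrite ge0_integralD// => [x _||x _|]; rewrite ?lee_fin//; exact: measurable_EFin.
Qed.

Lemma int_conv (F : R -> R -> R) : measurable_fun setT (fun z : R * R => F z.1 z.2) ->
  (forall a b, 0 <= F a b) ->
  (\int[mu]_x \int[mu]_y (F (x - y)%R y)%:E = \int[mu]_x \int[mu]_y (F x y)%:E)%E.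
Proof.
move=> mF F0; rewrite int_fubini; last 2 first.
- apply: measurable_EFin; apply: (mfun_joint (F := F) (f := fun z : R * R => z.1 - z.2)) => //; meas.
- by move=> x y; rewrite lee_fin.
rewrite [RHS]int_fubini; last 2 first.
- exact: measurable_EFin.
- by move=> x y; rewrite lee_fin.
apply: eq_integral => y _; apply: (int_shift (f := fun x => (F x y)%:E) (- y)).
  by apply: measurable_EFin; apply: (mfun_joint (F := F) (f := fun x => x)) => //; meas.
by move=> x; rewrite lee_fin.
Qed.

Definition conv A B (xi : R) : R[i] := cintegral (fun eta => A (xi - eta) * B eta).

Lemma cmeas_conv_kernel d (T : measurableType d) (A B : T -> R -> R[i]) :
  cmeas (fun z : T * R => A z.1 z.2) -> cmeas (fun z : T * R => B z.1 z.2) ->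
  cmeas (fun w : (T * R) * R => A w.1.1 (w.1.2 - w.2) * B w.1.1 w.2).
Proof.
move=> mA mB; apply: cmeasM.
  by apply: (cmeas_joint (F := A) (f := fun w : (T * R) * R => w.1.1)
    (g := fun w : (T * R) * R => w.1.2 - w.2)) => //; meas.
by apply: (cmeas_joint (F := B) (f := fun w : (T * R) * R => w.1.1)
    (g := fun w : (T * R) * R => w.2)) => //; meas.
Qed.

Lemma cmeas_conv_joint d (T : measurableType d) (A B : T -> R -> R[i]) :
  cmeas (fun z : T * R => A z.1 z.2) -> cmeas (fun z : T * R => B z.1 z.2) ->
  cmeas (fun z : T * R => conv (A z.1) (B z.1) z.2).
Proof.
move=> mA mB.
exact: (cmeas_cintegral (F := fun (z : T * R) y => A z.1 (z.2 - y) * B z.1 y)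
  (cmeas_conv_kernel mA mB)).
Qed.

Lemma cmeas_conv2 A B : cmeas A -> cmeas B -> cmeas (fun z : R * R => A (z.1 - z.2) * B z.2).
Proof.
move=> mA mB; apply: cmeasM.
  by apply: (cmeas_comp (h := fun z : R * R => z.1 - z.2) mA); meas.
by apply: (cmeas_comp (h := fun z : R * R => z.2) mB); meas.
Qed.

Lemma cmeas_conv A B : cmeas A -> cmeas B -> cmeas (conv A B).
Proof.
move=> mA mB; exact: (cmeas_cintegral (F := fun x y : R => A (x - y) * B y) (cmeas_conv2 mA mB)).
Qed.

(** The change of variables [a = x - b] turns the weight at [x] into [w (a + b)], so that weighted
    norms of convolutions reduce to inequalities between [a] and [b]. *)
Lemma int_conv_norm A B (w : R -> R) : cmeas A -> cmeas B -> measurable_fun setT w ->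
  (forall x, 0 <= w x) ->
  (\int[mu]_x (w x * nc (conv A B x))%:E <=
   \int[mu]_a \int[mu]_b (w (a + b)%R * (nc (A a) * nc (B b)))%:E)%E.
Proof.
move=> mA mB mw w0.
pose F a b := w (a + b) * (nc (A a) * nc (B b)).
have F0 a b : 0 <= F a b by rewrite mulr_ge0// mulr_ge0// nc_ge0.
have mnA := measurable_nc mA; have mnB := measurable_nc mB.
have mF : measurable_fun setT (fun z : R * R => F z.1 z.2).
  apply: mfunM; first by apply: (measurableT_comp mw); meas.
  by apply: mfunM; [apply: (measurableT_comp mnA)|apply: (measurableT_comp mnB)]; meas.
rewrite -(int_conv mF F0); apply: le_int => x; first by rewrite lee_fin mulr_ge0// nc_ge0.
have mk : cmeas (fun y : R => A (x - y) * B y).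
  by apply: cmeasM => //; apply: (cmeas_comp (h := fun y : R => x - y) mA); meas.
rewrite EFinM; apply: (@le_trans _ _ ((w x)%:E * \int[mu]_y (nc (A (x - y)%R * B y))%:E)%E).
  by rewrite lee_wpmul2l ?lee_fin//; exact: nc_cintegral.
rewrite -intZ//; [|exact: measurable_nc|by move=> y; exact: nc_ge0].
by apply: le_int => y; rewrite ?lee_fin ?mulr_ge0 ?nc_ge0// /F subrK ncM.
Qed.

Lemma int_nc_conv A B : cmeas A -> cmeas B ->
  (\int[mu]_x (nc (conv A B x))%:E <= \int[mu]_x (nc (A x))%:E * \int[mu]_x (nc (B x))%:E)%E.
Proof.
move=> mA mB; have mnA := measurable_nc mA; have mnB := measurable_nc mB.
rewrite -int_prod_fin//; [|by move=> x; exact: nc_ge0|by move=> x; exact: nc_ge0].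
have := @int_conv_norm A B (fun=> 1) mA mB (measurable_cst _) (fun=> ler01).
by under eq_integral do rewrite mul1r; under [X in (_ <= X)%E]eq_integral do
  under eq_integral do rewrite mul1r.
Qed.

Lemma cL1_conv A B : cL1 A -> cL1 B -> cL1 (conv A B).
Proof.
move=> [mA iA] [mB iB]; split; first exact: cmeas_conv.
apply: le_lt_trans (int_nc_conv mA mB) _; apply: lte_mul_pinfty => //; first exact: int_nc_ge0.
by rewrite (cL1_fin (conj mA iA)).
Qed.

Lemma int_conv_fin A B : cL1 A -> cL1 B ->
  (\int[mu]_x \int[mu]_y (nc (A (x - y)%R * B y))%:E < +oo)%E.
Proof.
move=> LA LB; have [mA iA] := LA; have [mB iB] := LB.
have mnA := measurable_nc mA; have mnB := measurable_nc mB.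
under eq_integral do under eq_integral do rewrite ncM.
rewrite (int_conv (F := fun x y => nc (A x) * nc (B y))).
- rewrite int_prod_fin//; try by move=> x; exact: nc_ge0.
  by apply: lte_mul_pinfty => //; [exact: int_nc_ge0|exact: cL1_fin].
- by apply: mfunM; [apply: (measurableT_comp mnA)|apply: (measurableT_comp mnB)]; meas.
- by move=> a b; rewrite mulr_ge0 ?nc_ge0.
Qed.

Lemma conv_integrable A B : cL1 A -> cL1 B ->
  {ae mu, forall x, cL1 (fun y => A (x - y) * B y)}.
Proof.
move=> LA LB; apply: (cfubini_ae (F := fun x y : R => A (x - y) * B y)).
  by apply: cmeas_conv2; [case: LA|case: LB].
exact: int_conv_fin.
Qed.

Lemma FT_conv A B (x : R) : cL1 A -> cL1 B -> FT (conv A B) x = FT A x * FT B x.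
Proof.
move=> LA LB; have [mA iA] := LA; have [mB iB] := LB.
pose F (xi eta : R) := cis (xi * x) * (A (xi - eta) * B eta).
have mF : cmeas (fun z : R * R => F z.1 z.2).
  by apply: cmeasM; [meas|exact: cmeas_conv2].
have -> : FT (conv A B) x = cintegral (fun xi => cintegral (F xi)).
  apply: cintegral_ae; first by have m := cmeas_conv mA mB; meas.
    exact: (cmeas_cintegral mF).
  apply: aeS (conv_integrable LA LB) => xi Lxi.
  by rewrite cintegralZ// mulrC.
rewrite cfubini//; last first.
  have E xi eta : (nc (F xi eta))%:E = (nc (A (xi - eta) * B eta))%:E.
    by rewrite /F ncM nc_cis mul1r.
  under eq_integral do under eq_integral do rewrite E.
  exact: int_conv_fin.
rewrite -cintegralZ; last exact: cL1_cis.
apply: eq_cintegral => eta.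
have m : cmeas (fun xi => A xi * cis (xi * x)) by meas.
have E : cintegral (fun xi => A (xi - eta) * cis ((xi - eta) * x)) = FT A x.
  exact: (cint_shift (f := fun xi => A xi * cis (xi * x)) (- eta) m).
rewrite -E mulrC -cintegralZ.
  apply: eq_cintegral => xi; rewrite /F.
  have -> : xi * x = (xi - eta) * x + eta * x by rewrite -mulrDl subrK.
  rewrite cisD; move: (cis _) (cis _) (A _) (B _) => c1 c2 a b.
  by rewrite [RHS]mulrACA mulrC [a * b]mulrC [c2 * c1]mulrC.
exact: (cL1_comp_shift (f := fun xi => A xi * cis (xi * x)) (- eta) (cL1_cis x LA)).
Qed.

Lemma inverse_fourier_mul A B (x : R) : cL1 A -> cL1 B ->
  inverse_fourier A x * inverse_fourier B x = cF%:C * inverse_fourier (conv A B) x.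
Proof.
move=> LA LB; rewrite !inverse_fourierE mulrACA FT_conv// -!mulrA; congr (_ * _).
Qed.

Lemma convB A1 A2 B1 B2 : cL1 A1 -> cL1 A2 -> cL1 B1 -> cL1 B2 ->
  {ae mu, forall x, conv A1 B1 x - conv A2 B2 x =
    conv (fun y => A1 y - A2 y) B1 x + conv A2 (fun y => B1 y - B2 y) x}.
Proof.
move=> LA1 LA2 LB1 LB2.
apply: aeS (aeI (conv_integrable LA1 LB1) (aeI (conv_integrable LA2 LB2) (conv_integrable LA2 LB1))).
move=> x [i1 [i2 i3]].
have -> : conv (fun y => A1 y - A2 y) B1 x = conv A1 B1 x - conv A2 B1 x.
  by rewrite /conv -cintegralB//; apply: eq_cintegral => y; rewrite mulrBl.
have -> : conv A2 (fun y => B1 y - B2 y) x = conv A2 B1 x - conv A2 B2 x.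
  by rewrite /conv -cintegralB//; apply: eq_cintegral => y; rewrite mulrBr.
by rewrite addrA subrK.
Qed.

(* Leibniz rule on the Fourier side: [xi = (xi - eta) + eta]. *)
Lemma conv_leibniz A B : cL1 A -> cL1 B ->
  cL1 (fun y => ('i%C * y%:C) * A y) -> cL1 (fun y => ('i%C * y%:C) * B y) ->
  {ae mu, forall x, ('i%C * x%:C) * conv A B x =
    conv (fun y => ('i%C * y%:C) * A y) B x + conv A (fun y => ('i%C * y%:C) * B y) x}.
Proof.
move=> LA LB LA' LB'.
apply: aeS (aeI (conv_integrable LA LB) (aeI (conv_integrable LA' LB) (conv_integrable LA LB'))).
move=> x [i1 [i2 i3]]; rewrite /conv -cintegralD// -cintegralZ//.
apply: eq_cintegral => y.
have -> : x%:C = (x - y)%:C + y%:C :> R[i] by rewrite -RCD subrK.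
by rewrite mulrDr mulrDl mulrA; congr (_ + _); rewrite [RHS]mulrCA.
Qed.
End convolution.

Section advection.
Context {R : realType} (m : R -> R).
Hypotheses (mm : measurable_fun setT m) (m_ge0 : forall x, 0 <= m x)
  (m_le1 : forall x, m x <= 1).
Implicit Types (h k : R -> R[i]).

Definition moment n h : \bar R := (\int[mu]_x (`|x| ^+ n * nc (h x))%:E)%E.

Lemma moment_ge0 n h : (0 <= moment n h)%E.
Proof. by apply: integral_ge0 => x _; rewrite lee_fin mulr_ge0 ?exprn_ge0 ?nc_ge0. Qed.

Lemma moment0 h : moment 0 h = (\int[mu]_x (nc (h x))%:E)%E.
Proof. by apply: eq_integral => x _; rewrite expr0 mul1r. Qed.

Lemma moment0_cL1 h : cmeas h -> (moment 0 h < +oo)%E -> cL1 h.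
Proof. by rewrite moment0. Qed.

Lemma momentD n h k : cmeas h -> cmeas k ->
  (moment n (fun x => h x + k x)%R <= moment n h + moment n k)%E.
Proof.
move=> mh mk; have mnk := measurable_nc mk; have mnh := measurable_nc mh.
rewrite /moment -intD; [|by meas|by meas| |]; try by move=> x; rewrite mulr_ge0 ?nc_ge0 ?exprn_ge0.
apply: le_int => x; rewrite lee_fin ?mulr_ge0 ?nc_ge0 ?exprn_ge0//.
by rewrite -mulrDr ler_wpM2l ?exprn_ge0// ncD.
Qed.

Lemma momentN n h : moment n (fun x => - h x) = moment n h.
Proof. by apply: eq_integral => x _; rewrite ncN. Qed.

Lemma momentB n h k : cmeas h -> cmeas k ->
  (moment n (fun x => h x - k x)%R <= moment n h + moment n k)%E.
Proof.
by move=> mh mk; rewrite -(momentN n k); apply: momentD => //; exact: cmeasN.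
Qed.

Definition mult h (x : R) : R[i] := (m x)%:C * h x.
Definition ixi h (x : R) : R[i] := ('i%C * x%:C) * h x.

Lemma cmeas_mult h : cmeas h -> cmeas (mult h).
Proof. by move=> mh; rewrite /mult; meas. Qed.

Lemma cmeas_ixi h : cmeas h -> cmeas (ixi h).
Proof. by move=> mh; rewrite /ixi; meas. Qed.

Lemma nc_mult h x : nc (mult h x) <= nc (h x).
Proof. by rewrite ncM nc_real ger0_norm// ler_piMl ?nc_ge0. Qed.

Lemma nc_ixi h x : nc (ixi h x) = `|x| * nc (h x).
Proof. by rewrite !ncM nc_i mul1r nc_real. Qed.

Lemma moment0_ixi h : (\int[mu]_x (nc (ixi h x))%:E)%E = moment 1 h.
Proof. by apply: eq_integral => x _; rewrite nc_ixi expr1. Qed.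

Lemma moment_mult n h : (moment n (mult h) <= moment n h)%E.
Proof.
apply: le_int => x; rewrite lee_fin ?mulr_ge0 ?nc_ge0 ?exprn_ge0//.
by rewrite ler_wpM2l ?exprn_ge0// nc_mult.
Qed.

Lemma moment_ixi n h : moment n (ixi h) = moment n.+1 h.
Proof. by apply: eq_integral => x _; rewrite nc_ixi exprSr mulrA. Qed.

Lemma cL1_mult h : cL1 h -> cL1 (mult h).
Proof. by move=> L; apply: (cL1_le _ L) => [|x]; [apply: cmeas_mult; case: L|exact: nc_mult]. Qed.

Lemma cL1_ixi h : cmeas h -> (moment 1 h < +oo)%E -> cL1 (ixi h).
Proof. by move=> mh h1; split; [exact: cmeas_ixi|rewrite moment0_ixi]. Qed.

(** Minus the transform of [u v_x], where [u] and [v] have transforms [m h] and [k]; the factor [cF]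
    is that of [inverse_fourier_mul]. *)
Definition advec h k (xi : R) : R[i] := - (cF%:C * conv (mult h) (ixi k) xi).

Lemma cmeas_advec h k : cmeas h -> cmeas k -> cmeas (advec h k).
Proof.
move=> mh mk; have mc := cmeas_conv (cmeas_mult mh) (cmeas_ixi mk).
by rewrite /advec; meas.
Qed.

Lemma cmeas_advec_joint d (T : measurableType d) (h k : T -> R -> R[i]) :
  cmeas (fun z : T * R => h z.1 z.2) -> cmeas (fun z : T * R => k z.1 z.2) ->
  cmeas (fun z : T * R => advec (h z.1) (k z.1) z.2).
Proof.
move=> mh mk; apply: cmeasN; apply: cmeasM; first exact: cmeas_cst.
apply: (cmeas_conv_joint (A := fun t => mult (h t)) (B := fun t => ixi (k t))).
  by apply: cmeasM => //; apply: cmeas_real; apply: (measurableT_comp mm); meas.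
by apply: cmeasM => //; meas.
Qed.

Lemma nc_advec h k x : nc (advec h k x) = cF * nc (conv (mult h) (ixi k) x).
Proof. by rewrite ncN ncM nc_real ger0_norm// ltW// cF_gt0. Qed.

Lemma moment_advec n h k : cmeas h -> cmeas k ->
  moment n (advec h k) = (cF%:E * moment n (conv (mult h) (ixi k)))%E.
Proof.
move=> mh mk; have mc := measurable_nc (cmeas_conv (cmeas_mult mh) (cmeas_ixi mk)).
rewrite -intZ ?(ltW cF_gt0)//; last 2 first.
- by meas.
- by move=> x; rewrite mulr_ge0 ?nc_ge0 ?exprn_ge0.
by apply: eq_integral => x _; rewrite nc_advec mulrCA.
Qed.

Lemma moment0_advec h k : cmeas h -> cmeas k ->
  (moment 0 (advec h k) <= cF%:E * (moment 0 h * moment 1 k))%E.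
Proof.
move=> mh mk; rewrite moment_advec// lee_wpmul2l ?lee_fin ?(ltW cF_gt0)//.
rewrite moment0; apply: le_trans (int_nc_conv (cmeas_mult mh) (cmeas_ixi mk)) _.
rewrite moment0_ixi -moment0 lee_wpmul2r ?moment_ge0//; exact: moment_mult.
Qed.

(* [|a + b| |b| <= a^2 / 2 + 3 b^2 / 2] *)
Lemma moment1_advec h : cmeas h ->
  (moment 1 (advec h h) <= (2 * cF)%:E * (moment 0 h * moment 2 h))%E.
Proof.
move=> mh; have mnh := measurable_nc mh.
rewrite moment_advec// (mulrC 2) EFinM -muleA lee_wpmul2l ?lee_fin ?(ltW cF_gt0)//.
rewrite /moment; under eq_integral do rewrite expr1.
apply: le_trans (int_conv_norm (cmeas_mult mh) (cmeas_ixi mh) (mfun_norm (@measurable_id _ R setT)) _) _ => //.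
have N0 x : 0 <= nc (h x) := nc_ge0 (h x).
have N2 x : 0 <= `|x| ^+ 2 * nc (h x) by rewrite mulr_ge0 ?exprn_ge0.
have m2 : measurable_fun setT (fun x : R => `|x| ^+ 2 * nc (h x)) by meas.
have P1 : (\int[mu]_a \int[mu]_b ((`|a| ^+ 2 * nc (h a)) * nc (h b))%:E = moment 2 h * moment 0 h)%E.
  by rewrite moment0 -int_prod_fin.
have P2 : (\int[mu]_a \int[mu]_b (nc (h a) * (`|b| ^+ 2 * nc (h b)))%:E = moment 0 h * moment 2 h)%E.
  by rewrite moment0 -int_prod_fin.
apply: (@le_trans _ _ (\int[mu]_a \int[mu]_b (2^-1 * ((`|a| ^+ 2 * nc (h a)) * nc (h b)) +
   3 / 2 * (nc (h a) * (`|b| ^+ 2 * nc (h b))))%:E)%E).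
  apply: le_int => a; first by apply: integral_ge0 => b _; rewrite lee_fin !mulr_ge0 ?nc_ge0.
  apply: le_int => b; first by rewrite lee_fin !mulr_ge0 ?nc_ge0.
  rewrite lee_fin nc_ixi.
  apply: (@le_trans _ _ ((`|a| + `|b|) * (nc (h a) * (`|b| * nc (h b))))).
    apply: ler_pM => //; [by rewrite !mulr_ge0 ?nc_ge0|exact: ler_normD|].
    by rewrite ler_wpM2r ?nc_mult// mulr_ge0.
  have P := mulr_ge0 (N0 a) (N0 b); set p := _ * _ in P.
  have -> : (`|a| + `|b|) * (nc (h a) * (`|b| * nc (h b))) = (`|a| * `|b| + `|b| ^+ 2) * p.
    by rewrite /p; ring.
  have -> : 2^-1 * (`|a| ^+ 2 * nc (h a) * nc (h b)) + 3 / 2 * (nc (h a) * (`|b| ^+ 2 * nc (h b)))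
     = (`|a| ^+ 2 / 2 + 3 / 2 * `|b| ^+ 2) * p by rewrite /p; field.
  rewrite ler_wpM2r// -subr_ge0.
  have -> : `|a| ^+ 2 / 2 + 3 / 2 * `|b| ^+ 2 - (`|a| * `|b| + `|b| ^+ 2) = (`|a| - `|b|) ^+ 2 / 2.
    by field.
  by rewrite divr_ge0 ?sqr_ge0.
have mj1 : measurable_fun setT (fun z : R * R => (`|z.1| ^+ 2 * nc (h z.1)) * nc (h z.2)).
  have M1 := measurableT_comp mnh (@measurable_fst _ _ R R).
  have M2 := measurableT_comp mnh (@measurable_snd _ _ R R).
  by meas.
have mj2 : measurable_fun setT (fun z : R * R => nc (h z.1) * (`|z.2| ^+ 2 * nc (h z.2))).
  have M1 := measurableT_comp mnh (@measurable_fst _ _ R R).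
  have M2 := measurableT_comp mnh (@measurable_snd _ _ R R).
  by meas.
have D a : (\int[mu]_b (2^-1 * ((`|a| ^+ 2 * nc (h a)) * nc (h b)) +
   3 / 2 * (nc (h a) * (`|b| ^+ 2 * nc (h b))))%:E =
   2^-1%:E * \int[mu]_b ((`|a| ^+ 2 * nc (h a)) * nc (h b))%:E +
   (3 / 2)%:E * \int[mu]_b (nc (h a) * (`|b| ^+ 2 * nc (h b)))%:E)%E.
  rewrite intD; [|by meas|by meas| |]; try by move=> x; rewrite !mulr_ge0.
  by rewrite intZ ?intZ//; [by meas| |by meas|]; move=> x; rewrite !mulr_ge0.
under eq_integral do rewrite D.
have G1 a : (0 <= \int[mu]_b ((`|a| ^+ 2 * nc (h a)) * nc (h b))%:E)%E.
  by apply: integral_ge0 => b _; rewrite lee_fin !mulr_ge0.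
have G2 a : (0 <= \int[mu]_b (nc (h a) * (`|b| ^+ 2 * nc (h b)))%:E)%E.
  by apply: integral_ge0 => b _; rewrite lee_fin !mulr_ge0.
have M1 := measurable_int_prod (F := fun a b : R => ((`|a| ^+ 2 * nc (h a)) * nc (h b))%:E) (measurable_EFin mj1).
have M2 := measurable_int_prod (F := fun a b : R => (nc (h a) * (`|b| ^+ 2 * nc (h b)))%:E) (measurable_EFin mj2).
rewrite ge0_integralD//; last 4 first.
- by move=> a _; rewrite mule_ge0.
- by apply: measurable_funeM; apply: M1 => a b; rewrite lee_fin mulr_ge0.
- by move=> a _; rewrite mule_ge0// lee_fin divr_ge0.
- by apply: measurable_funeM; apply: M2 => a b; rewrite lee_fin mulr_ge0.
rewrite ge0_integralZl_EFin ?ge0_integralZl_EFin//; last 2 first.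
- by apply: M2 => a b; rewrite lee_fin mulr_ge0.
- by apply: M1 => a b; rewrite lee_fin mulr_ge0.
(* Both double integrals equal [M_0 M_2], so the coefficients add up to [1/2 + 3/2 = 2], the
   constant behind the smallness threshold. *)
rewrite P1 P2 [(moment 2 h * _)%E]muleC -ge0_muleDl ?lee_fin ?divr_ge0// -EFinD -/(moment 0 h) -/(moment 2 h).
by rewrite (_ : 2^-1 + 3 / 2 = 2 :> R)//; field.
Qed.

Lemma cL1_advec h k : cL1 h -> cL1 (ixi k) -> cL1 (advec h k).
Proof.
move=> Lh Lk; have L := cL1N (cL1Z cF%:C (cL1_conv (cL1_mult Lh) Lk)); exact: L.
Qed.

Lemma advecB h1 h2 k1 k2 : cL1 h1 -> cL1 h2 -> cL1 (ixi k1) -> cL1 (ixi k2) ->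
  {ae mu, forall x, advec h1 k1 x - advec h2 k2 x =
    advec (fun y => h1 y - h2 y) k1 x + advec h2 (fun y => k1 y - k2 y) x}.
Proof.
move=> L1 L2 K1 K2; apply: aeS (convB (cL1_mult L1) (cL1_mult L2) K1 K2) => x E.
rewrite /advec -!mulrN -!mulrDr -!opprD E; congr (_ * - (_ + _));
  by apply: eq_cintegral => y; rewrite /mult /ixi -mulrBr.
Qed.

(** The splitting puts [h2] in front of the derivative of the difference: in both applications its
    [M_0] is the small quantity, so the derivative term can be absorbed by dissipation. *)
Lemma moment0_advecB h1 h2 k1 k2 : cL1 h1 -> cL1 h2 -> cL1 (ixi k1) -> cL1 (ixi k2) ->
  cmeas k1 -> cmeas k2 ->
  (moment 0 (fun x => advec h1 k1 x - advec h2 k2 x)%R <=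
   cF%:E * (moment 0 (fun y => h1 y - h2 y)%R * moment 1 k1 +
            moment 0 h2 * moment 1 (fun y => k1 y - k2 y)%R))%E.
Proof.
move=> L1 L2 K1 K2 mk1 mk2; have [m1 _] := L1; have [m2 _] := L2.
have mh : cmeas (fun y => h1 y - h2 y) by meas.
have mk : cmeas (fun y => k1 y - k2 y) by meas.
have A1 := cmeas_advec m1 mk1; have A2 := cmeas_advec m2 mk2.
have A3 := cmeas_advec mh mk1; have A4 := cmeas_advec m2 mk.
apply: (@le_trans _ _ (moment 0 (fun x => advec (fun y => h1 y - h2 y) k1 x +
    advec h2 (fun y => k1 y - k2 y) x)%R)).
  rewrite !moment0; apply: le_int_ae => //.
  - by meas.
  - exact: (measurable_EFin (measurable_nc (cmeasD A3 A4))).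
  - by move=> x; rewrite lee_fin nc_ge0.
  - by move=> x; rewrite lee_fin nc_ge0.
  - by apply: aeS (advecB L1 L2 K1 K2) => x ->.
apply: le_trans (momentD _ A3 A4) _; rewrite ge0_muleDr ?mule_ge0 ?moment_ge0//.
by apply: leeD; exact: moment0_advec.
Qed.

Hypothesis m_even : forall x, m (- x) = m x.

Lemma hermitian_mult h : hermitian h -> hermitian (mult h).
Proof. by move=> hh x; rewrite /mult m_even hh conjcM conjcR. Qed.

Lemma hermitian_ixi h : hermitian h -> hermitian (ixi h).
Proof.
move=> hh x; rewrite /ixi hh conjcM conjcM conjcR RCN mulrN -mulNr; congr (_ * _ * _).
by apply: complexP => /=; rewrite ?oppr0.
Qed.

Lemma hermitian_conv h k : cmeas h -> cmeas k -> hermitian h -> hermitian k ->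
  hermitian (conv h k).
Proof.
move=> mh mk hh hk x; rewrite /conv -cintegralJ.
have mc : cmeas (fun y : R => h (- x - y) * k y).
  by apply: cmeasM => //; apply: (cmeas_comp (h := fun y : R => - x - y) mh); meas.
rewrite -(cint_opp mc); apply: eq_cintegral => y.
by rewrite hk conjcM -hh opprB opprK addrC.
Qed.

Lemma hermitian_advec h k : cmeas h -> cmeas k -> hermitian h -> hermitian k ->
  hermitian (advec h k).
Proof.
move=> mh mk hh hk x; rewrite /advec conjcN conjcM conjcR.
by rewrite (hermitian_conv (cmeas_mult mh) (cmeas_ixi mk) (hermitian_mult hh) (hermitian_ixi hk)).
Qed.
End advection.

(** * Duhamel's formula *)

Section triangle.
Context {R : realType}.

(** The indicator of [0 <= s <= t] ([triE]). Integrals over [[0, t]] are written over the whole line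
    against it, so that Fubini and joint measurability apply with [t] as a variable. *)
Definition tri (t s : R) : R :=
  \1_(`[0, +oo[%classic) s * \1_(`[0, +oo[%classic) (t - s).

Lemma indic_ge0E (x : R) : \1_(`[0, +oo[%classic) x = (0 <= x)%R%:R :> R.
Proof.
have [h|h] := boolP (0 <= x); [rewrite indicT//|rewrite indicF//]; rewrite /= in_itv/= andbT//.
exact/negP.
Qed.

Lemma indic_itvccE (a b x : R) : \1_(`[a, b]%classic) x = (a <= x <= b)%R%:R :> R.
Proof.
have [h|h] := boolP (a <= x <= b); [rewrite indicT//|rewrite indicF//]; rewrite /= in_itv/=//.
exact/negP.
Qed.

Lemma triE t s : tri t s = (0 <= s <= t)%R%:R.
Proof. by rewrite /tri !indic_ge0E subr_ge0; case: (0 <= s); rewrite ?mul1r ?mul0r. Qed.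

Lemma tri_ge0 t s : 0 <= tri t s. Proof. by rewrite triE. Qed.

Lemma tri_le1 t s : tri t s <= 1. Proof. by rewrite triE lern1 leq_b1. Qed.

Lemma measurable_tri : measurable_fun setT (fun z : R * R => tri z.1 z.2).
Proof. by rewrite /tri; meas; first [exact: measurable_itv|exact: measurable_indic]. Qed.

Lemma measurable_tri1 t : measurable_fun setT (tri t).
Proof.
exact: (measurableT_comp measurable_tri (pair1_measurable t)).
Qed.

Lemma measurable_triM (t : R) (B : R -> \bar R) : measurable_fun setT B ->
  measurable_fun setT (fun s => (tri t s)%:E * B s)%E.
Proof.
by move=> mB; apply: emeasurable_funM => //; exact: measurable_EFin (measurable_tri1 t).
Qed.

(** The two descriptions of the simplex [0 <= r <= s <= t], for exchanging the order of the two time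
    integrals. *)
Lemma tri_trans t s r : tri t s * tri s r = tri t r * \1_(`[r, t]%classic) s.
Proof.
rewrite !triE indic_itvccE -!natrM !mulnb; congr (nat_of_bool _)%:R.
apply/idP/idP => /and3P[/andP[a b] c d]; apply/and3P; split => //.
  by rewrite c (le_trans d b).
by rewrite d (le_trans a c).
Qed.

Lemma int_exp_itv (k a b : R) : a <= b ->
  (\int[mu]_s (\1_(`[a, b]%classic) s * (k * expR (- (s * k))))%:E =
   (expR (- (a * k)) - expR (- (b * k)))%:E)%E.
Proof.
move=> ab; under eq_integral do rewrite EFinM; rewrite -int_indic.
have df (x : R) : is_derive x 1 (fun x : R => - expR (- (x * k))) (k * expR (- (x * k))).
  have d0 : is_derive x 1 (fun x : R => - (x * k)) (- k).
    by apply: is_derive_eq; rewrite /GRing.scale /= mulr0 add0r mulr1.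
  have d1 := @is_derive1_comp _ expR (fun x : R => - (x * k)) _ _ _ (is_derive_expR _) d0.
  by apply: is_derive_eq; rewrite mulrN opprK mulrC.
have := @Rint_FTC2 R (fun x => k * expR (- (x * k))) (fun x => - expR (- (x * k))) a b ab df.
have cf : continuous (fun x : R => k * expR (- (x * k))).
  move=> x; apply: cvgM; first exact: cvg_cst.
  apply: continuous_comp; last exact: continuous_expR.
  by apply: cvgN; apply: cvgM; [exact: cvg_id|exact: cvg_cst].
move=> /(_ cf); rewrite opprK addrC => <-.
have i : mu.-integrable `[a, b]%classic (EFin \o (fun x : R => k * expR (- (x * k)))).
  apply: continuous_compact_integrable; first exact: segment_compact.
  exact: continuous_subspaceT.
by rewrite /Rintegral fineK//; exact: (integrable_fin_num _ i).
Qed.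

(** The mass lost by the exponential kernel between [r] and [t]. Together with the remaining mass
    [exp (- (t - r) k)] it gives 1, from which the balance between decay and dissipation follows. *)
Lemma int_tri_exp (k t r : R) :
  (\int[mu]_s (tri t s * (tri s r * (k * expR (- ((s - r) * k)))))%:E =
   (tri t r * (1 - expR (- ((t - r) * k))))%:E)%E.
Proof.
have E s : (tri t s * (tri s r * (k * expR (- ((s - r) * k)))))%:E =
    ((tri t r * expR (r * k))%:E * (\1_(`[r, t]%classic) s * (k * expR (- (s * k))))%:E)%E.
  rewrite mulrA tri_trans -EFinM mulrBl opprB expRD; congr (_%:E); ring.
under eq_integral do rewrite E.
have [tr|tr] := boolP (0 <= r <= t); last first.
  by rewrite triE (negbTE tr) !mul0r; under eq_integral do rewrite mul0e; rewrite integral0.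
have /andP[r0 rt] := tr.
rewrite integralZl//; last first.
  apply/integrableP; split; first by meas.
  have Ek s : `|(\1_(`[r, t]%classic) s * (k * expR (- (s * k))))%:E|%E =
    ((`|k|)%:E * (\1_(`[r, t]%classic) s * expR (- (s * k)))%:E)%E.
    rewrite abse_EFin -EFinM normrM normrM (ger0_norm (expR_ge0 _)) ger0_norm// ; congr (_%:E); ring.
  under eq_integral do rewrite Ek.
  rewrite ge0_integralZl_EFin//; last by meas.
  apply: lte_mul_pinfty; [by rewrite lee_fin|by []|].
  under eq_integral do rewrite EFinM.
  rewrite -int_indic.
  have i : mu.-integrable `[r, t]%classic (EFin \o (fun x : R => expR (- (x * k)))).
    apply: continuous_compact_integrable; first exact: segment_compact.
    apply: continuous_subspaceT => x; apply: continuous_comp; last exact: continuous_expR.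
    by apply: cvgN; apply: cvgM; [exact: cvg_id|exact: cvg_cst].
  by have := integrable_fin_num _ i; rewrite fin_numElt => /(_ _)/andP[].
rewrite int_exp_itv// -EFinM triE tr !mul1r mulrBr -!expRD addrN expR0.
by rewrite -mulrBl -[r - t]opprB mulNr.
Qed.

Lemma int_tri_exp0 (k t : R) : 0 <= t ->
  (\int[mu]_s (tri t s * (k * expR (- (s * k))))%:E = (1 - expR (- (t * k)))%:E)%E.
Proof.
move=> t0; have := int_tri_exp k t 0; rewrite triE lexx t0 mul1r subr0 => <-.
apply: eq_integral => s _; rewrite subr0 !triE lexx andTb.
by case: (boolP (0 <= s <= t)) => [/andP[-> _]|]; rewrite ?mul1r ?mul0r.
Qed.

Lemma kernel_fubini (K : R -> R -> R) (v : R -> R) (B : R -> \bar R) :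
  measurable_fun setT (fun z : R * R => K z.1 z.2) -> (forall t s, 0 <= K t s) ->
  measurable_fun setT B -> (forall s, (0 <= B s)%E) ->
  (forall s, (\int[mu]_t (K t s)%:E = (v s)%:E)%E) ->
  (\int[mu]_t \int[mu]_s ((K t s)%:E * B s) = \int[mu]_s ((v s)%:E * B s))%E.
Proof.
move=> mK K0 mB B0 Kv; rewrite int_fubini; last 2 first.
- apply: emeasurable_funM; first exact: measurable_EFin.
  exact: (measurableT_comp mB).
- by move=> t s; rewrite mule_ge0// lee_fin.
apply: eq_integral => s _; rewrite -Kv; under eq_integral do rewrite muleC.
rewrite ge0_integralZl//; first by rewrite muleC.
  by apply: measurable_EFin; apply: (mfun_joint (F := K) mK); meas.
by move=> t _; rewrite lee_fin.
Qed.

End triangle.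

(** * Exponential weights in time and Gronwall's lemma *)

Section weighted_estimates.
Context {R : realType}.
Implicit Types (A B f u : R -> \bar R).

Lemma integral_expN_half (k : R) : 0 < k ->
  (\int[mu]_t (\1_(`[0, +oo[%classic) t * (k * expR (- (t * k))))%:E = 1)%E.
Proof.
move=> k0; rewrite -(integral_exponential_pdf k0); apply: eq_integral => t _; congr (_%:E).
rewrite indic_ge0E; have [t0|t0] := leP 0 t; last by rewrite lt0_exponential_pdf// mul0r.
by rewrite exponential_pdfE// mul1r mulNr [k * t]mulrC.
Qed.

Lemma measurable_int_tri (B : R -> \bar R) : measurable_fun setT B -> (forall s, (0 <= B s)%E) ->
  measurable_fun setT (fun t => \int[mu]_s ((tri t s)%:E * B s))%E.
Proof.
move=> mB B0; apply: measurable_int_prod => [|t s]; last by rewrite mule_ge0// lee_fin tri_ge0.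
apply: emeasurable_funM; first exact: measurable_EFin measurable_tri.
exact: (measurableT_comp mB).
Qed.

(** The Laplace transform of a primitive: by Fubini, [k exp (- k t)] is integrated over [t >= s],
    which gives [exp (- k s)]. *)
Lemma weighted_triangle (k : R) B : 0 < k -> measurable_fun setT B -> (forall s, (0 <= B s)%E) ->
  (\int[mu]_t ((\1_(`[0, +oo[%classic) t * (k * expR (- (t * k))))%:E * \int[mu]_s ((tri t s)%:E * B s)) =
   \int[mu]_s ((\1_(`[0, +oo[%classic) s * expR (- (s * k)))%:E * B s))%E.
Proof.
move=> k0 mB B0; have mt := @measurable_tri R.
pose w (t : R) : R := \1_(`[0, +oo[%classic) t * (k * expR (- (t * k))).
have w0 t : 0 <= w t by rewrite !mulr_ge0 ?expR_ge0// ltW.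
have mw : measurable_fun setT w by rewrite /w; meas; first [exact: measurable_itv|exact: measurable_indic].
have m2 (t : R) := measurable_tri1 t.
rewrite -(@kernel_fubini R (fun t s => w t * tri t s) (fun s => \1_(`[0, +oo[%classic) s * expR (- (s * k))) B) => //.
- apply: eq_integral => t _; rewrite -ge0_integralZl ?lee_fin//.
  + by apply: eq_integral => s _; rewrite muleA.
  + exact: measurable_triM.
  + by move=> s _; rewrite mule_ge0// lee_fin tri_ge0.
  + exact: w0.
- by apply: mfunM => //; apply: (measurableT_comp mw); meas.
- by move=> t s; rewrite mulr_ge0// tri_ge0.
move=> s; have [s0|s0] := leP 0 s; last first.
  have Z (t : R) : (w t * tri t s)%:E = 0%E by rewrite triE (lt_geF s0) mulr0.
  by under eq_integral do rewrite Z; rewrite integral0 indic_ge0E (lt_geF s0) mul0r.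
rewrite indic_ge0E s0 mul1r.
have E (t : R) : w t * tri t s =
  expR (- (s * k)) * (\1_(`[0, +oo[%classic) (t + - s) * (k * expR (- ((t + - s) * k)))).
  rewrite /w triE !indic_ge0E subr_ge0 s0/=.
  have [st|st] := leP s t; last by rewrite mulr0 mul0r mulr0.
  rewrite (le_trans s0 st) !mul1r mulr1 mulrCA -expRD; congr (_ * expR _).
  by ring.
under eq_integral do rewrite E EFinM.
have mh : measurable_fun setT (fun t : R => (\1_(`[0, +oo[%classic) t * (k * expR (- (t * k))))%:E).
  exact: (measurable_EFin mw).
rewrite ge0_integralZl_EFin ?expR_ge0//; last 2 first.
- by move=> t _; rewrite lee_fin; exact: w0.
- by apply: (measurableT_comp mh); meas.
by rewrite (int_shift (- s) mh) ?integral_expN_half ?mule1.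
Qed.

(* Integrate the hypothesis against [k e^(-kt)]. *)
Lemma weighted_bound (k : R) A B f : 0 < k ->
  measurable_fun setT A -> measurable_fun setT B -> measurable_fun setT f ->
  (forall t, (0 <= A t)%E) -> (forall t, (0 <= B t)%E) -> (forall t, (0 <= f t)%E) ->
  (forall t, 0 <= t ->
    (A t + \int[mu]_s ((tri t s)%:E * B s) <= \int[mu]_s ((tri t s)%:E * f s))%E) ->
  (\int[mu]_t ((\1_(`[0, +oo[%classic) t * (k * expR (- (t * k))))%:E * A t) +
   \int[mu]_s ((\1_(`[0, +oo[%classic) s * expR (- (s * k)))%:E * B s) <=
   \int[mu]_s ((\1_(`[0, +oo[%classic) s * expR (- (s * k)))%:E * f s))%E.
Proof.
move=> k0 mA mB mf A0 B0 f0 H.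
have w0 (t : R) : (0 <= (\1_(`[0, +oo[%classic) t * (k * expR (- (t * k))))%:E)%E.
  by rewrite lee_fin !mulr_ge0 ?expR_ge0// ltW.
have mw : measurable_fun setT (fun t : R => (\1_(`[0, +oo[%classic) t * (k * expR (- (t * k))))%:E).
  by meas; first [exact: measurable_itv|exact: measurable_indic].
have I0 (t : R) : (0 <= \int[mu]_s ((tri t s)%:E * B s))%E.
  by apply: integral_ge0 => s _; rewrite mule_ge0// lee_fin tri_ge0.
rewrite -(weighted_triangle k0 mB B0) -(weighted_triangle k0 mf f0) -ge0_integralD//; last 4 first.
- by move=> t _; rewrite mule_ge0.
- exact: emeasurable_funM.
- by move=> t _; rewrite mule_ge0.
- by apply: emeasurable_funM => //; exact: measurable_int_tri.
apply: le_int => t; first by rewrite adde_ge0// mule_ge0.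
rewrite -ge0_muleDr//; have [t0|t0] := leP 0 t; first by rewrite lee_wpmul2l// H.
by rewrite indic_ge0E (lt_geF t0) !mul0r !mul0e.
Qed.

(** Let [X] be the integral of [u] over [[0, T]] against [k exp (- k t)]. The hypothesis and Fubini
    give [k X <= C X], and [X] is finite; since [k = 2 C + 1] exceeds [2 C], [X = 0]. *)
Lemma gronwall u (C T : R) : 0 <= C -> measurable_fun setT u -> (forall t, (0 <= u t)%E) ->
  (\int[mu]_s ((tri T s)%:E * u s) < +oo)%E ->
  {ae mu, forall t : R, 0 <= t <= T -> (u t <= C%:E * \int[mu]_s ((tri t s)%:E * u s))%E} ->
  {ae mu, forall t : R, 0 <= t <= T -> u t = 0%E}.
Proof.
move=> C0 mu' u0 fin H; have mt := @measurable_tri R.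
pose k := 2 * C + 1; have k0 : 0 < k by rewrite ltr_pwDr// mulr_ge0.
pose w (t : R) : R := tri T t * (k * expR (- (t * k))).
have w0 t : 0 <= w t by rewrite !mulr_ge0 ?expR_ge0 ?tri_ge0// ltW.
have m2 (t : R) := measurable_tri1 t.
have mT := m2 T.
have mw : measurable_fun setT w by rewrite /w; meas.
set X := (\int[mu]_t ((w t)%:E * u t))%E.
have X0 : (0 <= X)%E by apply: integral_ge0 => t _; rewrite mule_ge0// lee_fin.
have Xfin : (X < +oo)%E.
  apply: (@le_lt_trans _ _ (k%:E * \int[mu]_s ((tri T s)%:E * u s))%E); last first.
    apply: lte_mul_pinfty => //; first by rewrite lee_fin ltW.
  rewrite -ge0_integralZl//; last 3 first.
  - by apply: emeasurable_funM => //; exact: measurable_EFin.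
  - by move=> s _; rewrite mule_ge0// lee_fin tri_ge0.
  - by rewrite lee_fin ltW.
  apply: le_int => t; first by rewrite mule_ge0// lee_fin.
  rewrite muleA -EFinM lee_wpmul2r// lee_fin /w triE; case: (boolP (0 <= t <= T)) => h.
    rewrite mul1r mulr1 ler_piMr ?(ltW k0)// -[leRHS]expR0 ler_expR oppr_le0 mulr_ge0 ?(ltW k0)//.
    by case/andP: h.
  by rewrite mul0r mulr0.
have HX : (k%:E * X <= (2 * C)%:E * X)%E -> X = 0%E.
  move: X0 Xfin; case: X => // x; rewrite lee_fin => x0 _; rewrite -!EFinM lee_fin /k => hx.
  by congr (_%:E); nra.
have EX : X = 0%E.
  apply: HX.
  have Kf : (\int[mu]_t \int[mu]_s ((w t * tri t s)%:E * u s) =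
    \int[mu]_s ((tri T s * (expR (- (s * k)) - expR (- (T * k))))%:E * u s))%E.
    apply: kernel_fubini => //.
    - by apply: mfunM => //; apply: (measurableT_comp mw); meas.
    - by move=> t s; rewrite mulr_ge0// tri_ge0.
    move=> s; rewrite -[RHS]/((tri T s)%:E * (expR (- (s * k)) - expR (- (T * k)))%:E)%E.
    have E t : (w t * tri t s)%:E = ((tri T s)%:E * (\1_(`[s, T]%classic) t * (k * expR (- (t * k))))%:E)%E.
      by rewrite /w mulrAC tri_trans -EFinM -mulrA.
    under eq_integral do rewrite E.
    rewrite ge0_integralZl_EFin ?tri_ge0//; last 2 first.
    - by move=> t _; rewrite lee_fin !mulr_ge0 ?expR_ge0// ltW.
    - by meas; first [exact: measurable_itv|exact: measurable_indic].
    have [sT|sT] := leP s T; first by rewrite int_exp_itv.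
    by rewrite triE [s <= T]leNgt sT andbF !mul0e.
  have XE : (k%:E * (\int[mu]_s ((tri T s * expR (- (s * k)))%:E * u s)) = X)%E.
    rewrite -ge0_integralZl//; last 3 first.
    - by apply: emeasurable_funM => //; meas.
    - by move=> s _; rewrite mule_ge0// lee_fin mulr_ge0 ?tri_ge0 ?expR_ge0.
    - by rewrite lee_fin ltW.
    by apply: eq_integral => t _; rewrite muleA -EFinM /w mulrCA.
  have L1 : (X <= C%:E * \int[mu]_s ((tri T s * expR (- (s * k)))%:E * u s))%E.
    apply: (@le_trans _ _ (C%:E * (\int[mu]_t \int[mu]_s ((w t * tri t s)%:E * u s)))%E); last first.
      rewrite lee_wpmul2l ?lee_fin// Kf; apply: le_int => s.
        rewrite mule_ge0// lee_fin triE; case: (boolP (0 <= s <= T)) => h; rewrite ?mul0r// mul1r.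
        rewrite subr_ge0 ler_expR lerN2 ler_wpM2r ?(ltW k0)//; by case/andP: h.
      by rewrite lee_wpmul2r// lee_fin ler_wpM2l ?tri_ge0// gerBl expR_ge0.
    have mi : measurable_fun setT (fun t => \int[mu]_s ((w t * tri t s)%:E * u s))%E.
      apply: measurable_int_prod => [|t s]; last by rewrite mule_ge0// lee_fin mulr_ge0 ?tri_ge0.
      apply: emeasurable_funM; last exact: (measurableT_comp mu').
      by apply: measurable_EFin; apply: mfunM => //; apply: (measurableT_comp mw); meas.
    have i0 (t : R) : (0 <= \int[mu]_s ((w t * tri t s)%:E * u s))%E.
      by apply: integral_ge0 => s _; rewrite mule_ge0// lee_fin mulr_ge0 ?tri_ge0.
    rewrite -ge0_integralZl// ?lee_fin//; apply: le_int_ae.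
    - by apply: emeasurable_funM => //; exact: measurable_EFin.
    - exact: measurable_funeM.
    - by move=> t; rewrite mule_ge0// lee_fin.
    - by move=> t; rewrite mule_ge0// lee_fin.
    apply: aeS H => t Ht.
    have -> : (\int[mu]_s ((w t * tri t s)%:E * u s) = (w t)%:E * \int[mu]_s ((tri t s)%:E * u s))%E.
      rewrite -ge0_integralZl ?lee_fin//.
      + by apply: eq_integral => s _; rewrite muleA.
      + exact: measurable_triM.
      + by move=> s _; rewrite mule_ge0// lee_fin tri_ge0.
    rewrite muleCA; have [tT|tT] := boolP (0 <= t <= T).
      by rewrite lee_wpmul2l ?lee_fin// Ht.
    by rewrite /w triE (negbTE tT) mul0r !mul0e.
  apply: (@le_trans _ _ (C%:E * X)%E).
    by rewrite -[in leRHS]XE muleCA lee_wpmul2l// lee_fin ltW.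
  by rewrite lee_wpmul2r// lee_fin mulr_natl mulr2n lerDl.
have mwu : measurable_fun setT (fun t => (w t)%:E * u t)%E.
  by apply: emeasurable_funM => //; exact: measurable_EFin.
have := @ae_eq_integral_abs _ _ R mu setT measurableT _ mwu.
have -> : (\int[mu]_x `|(w x)%:E * u x| = 0)%E.
  by rewrite -[RHS]EX; apply: eq_integral => t _; rewrite gee0_abs// mule_ge0// lee_fin.
move=> [/(_ erefl) h _]; apply: aeS h => t ht tT; have := ht I.
move=> /eqP; rewrite mule_eq0 => /orP[|/eqP//].
by rewrite eqe /w triE tT mul1r mulf_eq0 gt_eqF//= gt_eqF// expR_gt0.
Qed.
End weighted_estimates.

Section scalar_duhamel.
Context {R : realType}.
Implicit Types (k t : R) (f : R -> R[i]).

(* Duhamel's formula for [y' = - k y + f], [y 0 = y0]. *)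
Definition sduh k (y0 : R[i]) f t : R[i] :=
  (expR (- (t * k)))%:C * y0 + cintegral (fun s => (tri t s * expR (- ((t - s) * k)))%:C * f s).

Definition trin f t : \bar R := (\int[mu]_s (tri t s * nc (f s))%:E)%E.

Lemma trin_ge0 f t : (0 <= trin f t)%E.
Proof. by apply: integral_ge0 => s _; rewrite lee_fin mulr_ge0 ?tri_ge0 ?nc_ge0. Qed.

Lemma trin_le f t T : t <= T -> (trin f t <= trin f T)%E.
Proof.
move=> tT; apply: le_int => s; rewrite lee_fin ?mulr_ge0 ?tri_ge0 ?nc_ge0//.
rewrite ler_wpM2r ?nc_ge0// !triE ler_nat.
by case: (boolP (0 <= s <= t)) => // /andP[-> st]; rewrite (le_trans st tT).
Qed.

Lemma cmeas_tri f t : cmeas f -> cmeas (fun s => (tri t s)%:C * f s).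
Proof. by move=> mf; have m := measurable_tri1 t; meas. Qed.

Lemma cL1_tri f t : cmeas f -> (trin f t < +oo)%E -> cL1 (fun s => (tri t s)%:C * f s).
Proof.
move=> mf i; split; first exact: cmeas_tri.
by under eq_integral do rewrite ncM nc_real ger0_norm ?tri_ge0//.
Qed.

Lemma cmeas_sduh k (y0 : R[i]) f : cmeas f -> cmeas (sduh k y0 f).
Proof.
move=> mf; rewrite /sduh; apply: cmeasD; first by meas.
apply: (cmeas_cintegral (F := fun t s : R => (tri t s * expR (- ((t - s) * k)))%:C * f s)).
have mt := @measurable_tri R.
apply: cmeasM; last by apply: (cmeas_comp mf); meas.
by meas.
Qed.

Lemma nc_sduh k (y0 : R[i]) f t : cmeas f ->
  ((nc (sduh k y0 f t))%:E <= (expR (- (t * k)) * nc y0)%:E +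
    \int[mu]_s (tri t s * (expR (- ((t - s) * k)) * nc (f s)))%:E)%E.
Proof.
move=> mf; have mt := measurable_tri1 t.
apply: (@le_trans _ _ ((nc ((expR (- (t * k)))%:C * y0))%:E +
  (nc (cintegral (fun s => (tri t s * expR (- ((t - s) * k)))%:C * f s)))%:E)%E).
  by rewrite -EFinD lee_fin ncD.
apply: leeD; first by rewrite ncM nc_real ger0_norm// expR_ge0.
apply: le_trans (nc_cintegral _) _; first by meas.
apply: le_int => s; rewrite lee_fin ?nc_ge0// ncM nc_real ger0_norm ?mulr_ge0 ?tri_ge0 ?expR_ge0//.
by rewrite mulrA.
Qed.

(** The kernel [exp (- (t - s) k)] and [k] times its integral over [[s, t]] add up to 1, so that
    decay and dissipation together account for exactly the mass of the data. All moment estimates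
    are this one, weighted and integrated over the frequencies. *)
Lemma sduh_bound k (y0 : R[i]) f t : 0 <= k -> cmeas f -> 0 <= t ->
  ((nc (sduh k y0 f t))%:E + \int[mu]_s (tri t s * (k * nc (sduh k y0 f s)))%:E <=
   (nc y0)%:E + trin f t)%E.
Proof.
move=> k0 mf t0; have mt := measurable_tri1 t; have mt2 := @measurable_tri R.
have mnf := measurable_nc mf; have msd := measurable_nc (cmeas_sduh k y0 mf).
have nf s : 0 <= nc (f s) := nc_ge0 (f s).
pose I s := (\int[mu]_r (tri s r * (expR (- ((s - r) * k)) * nc (f r)))%:E)%E.
have mKj : measurable_fun setT (fun z : R * R => tri z.1 z.2 * (expR (- ((z.1 - z.2) * k)) * nc (f z.2))).
  have m2 := measurableT_comp mnf (@measurable_snd _ _ R R).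
  by meas.
have mI : measurable_fun setT I.
  apply: (measurable_int_prod (F := fun s r => (tri s r * (expR (- ((s - r) * k)) * nc (f r)))%:E)).
    exact: measurable_EFin.
  by move=> s r; rewrite lee_fin !mulr_ge0 ?tri_ge0 ?expR_ge0.
have I0 s : (0 <= I s)%E.
  by apply: integral_ge0 => r _; rewrite lee_fin !mulr_ge0 ?tri_ge0 ?expR_ge0.
have A : (\int[mu]_s (tri t s * (k * nc (sduh k y0 f s)))%:E <=
    \int[mu]_s ((tri t s * (k * expR (- (s * k))) * nc y0)%:E + (tri t s * k)%:E * I s))%E.
  apply: le_int => s; first by rewrite lee_fin !mulr_ge0 ?tri_ge0 ?nc_ge0.
  rewrite mulrA EFinM; apply: (@le_trans _ _ ((tri t s * k)%:E * ((expR (- (s * k)) * nc y0)%:E + I s))%E).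
    by rewrite lee_wpmul2l ?lee_fin ?mulr_ge0 ?tri_ge0//; exact: nc_sduh.
  rewrite ge0_muleDr ?lee_fin ?mulr_ge0 ?expR_ge0 ?nc_ge0//.
  by rewrite -EFinM !mulrA.
have B : (\int[mu]_s ((tri t s * (k * expR (- (s * k))) * nc y0)%:E + (tri t s * k)%:E * I s) =
    ((1 - expR (- (t * k))) * nc y0)%:E +
    \int[mu]_s ((tri t s * (1 - expR (- ((t - s) * k))))%:E * (nc (f s))%:E))%E.
  rewrite ge0_integralD//; last 4 first.
  - by move=> s _; rewrite lee_fin !mulr_ge0 ?tri_ge0 ?expR_ge0 ?nc_ge0.
  - by meas.
  - by move=> s _; rewrite mule_ge0// lee_fin mulr_ge0 ?tri_ge0.
  - by apply: emeasurable_funM => //; meas.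
  congr (_ + _)%E.
    under eq_integral do rewrite mulrC.
    rewrite intZ ?nc_ge0//; last 2 first.
    - by meas.
    - by move=> s; rewrite !mulr_ge0 ?tri_ge0 ?expR_ge0.
    by rewrite int_tri_exp0// -EFinM mulrC.
  rewrite -(@kernel_fubini R (fun s r => tri t s * (tri s r * (k * expR (- ((s - r) * k)))))
    (fun s => tri t s * (1 - expR (- ((t - s) * k)))) (fun s => (nc (f s))%:E)).
  - apply: eq_integral => s _; rewrite /I -ge0_integralZl_EFin ?mulr_ge0 ?tri_ge0//.
    + apply: eq_integral => r _; rewrite -!EFinM; congr (_%:E); ring.
    + by move=> r _; rewrite lee_fin !mulr_ge0 ?tri_ge0 ?expR_ge0.
    + by apply: measurable_EFin; have m1 := measurable_tri1 s; meas.
  - by apply: mfunM; [apply: (measurableT_comp mt)|]; meas.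
  - by move=> s r; rewrite !mulr_ge0 ?tri_ge0 ?expR_ge0.
  - by meas.
  - by move=> s; rewrite lee_fin.
  - by move=> r; exact: int_tri_exp.
apply: (@le_trans _ _ (((expR (- (t * k)) * nc y0)%:E + I t) + (((1 - expR (- (t * k))) * nc y0)%:E +
    \int[mu]_s ((tri t s * (1 - expR (- ((t - s) * k))))%:E * (nc (f s))%:E)))%E).
  by apply: leeD; [exact: nc_sduh|rewrite -B].
rewrite addeACA -EFinD -mulrDl [expR _ + _]addrC subrK mul1r leeD2l//.
have e1 s : s <= t -> expR (- ((t - s) * k)) <= 1.
  by move=> st; rewrite -[leRHS]expR0 ler_expR oppr_le0 mulr_ge0// subr_ge0.
rewrite -ge0_integralD//; last 4 first.
- by move=> s _; rewrite lee_fin !mulr_ge0 ?tri_ge0 ?expR_ge0.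
- by meas.
- move=> s _; rewrite lee_fin mulr_ge0// triE; case: (boolP (0 <= s <= t)) => h; last by rewrite mul0r.
  by rewrite mul1r subr_ge0 e1//; case/andP: h.
- by apply: emeasurable_funM; meas.
apply: le_int => s.
  rewrite -EFinM -EFinD lee_fin triE; case: (boolP (0 <= s <= t)) => h; last by rewrite !mul0r addr0.
  by rewrite !mul1r addr_ge0 ?mulr_ge0 ?expR_ge0// subr_ge0 e1//; case/andP: h.
by rewrite -EFinM -EFinD lee_fin mulrA -mulrDl -mulrDr [expR _ + _]addrC subrK mulr1.
Qed.

Lemma cintegral_real (u : R -> R) (v : R) (z : R[i]) : measurable_fun setT u ->
  (forall s, 0 <= u s) -> (\int[mu]_s (u s)%:E = v%:E)%E ->
  cintegral (fun s => (u s)%:C * z) = v%:C * z.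
Proof.
move=> m u0 uv.
have L : cL1 (fun s => (u s)%:C).
  apply: cL1_real => //; under eq_integral do rewrite ger0_norm//.
  by rewrite uv ltry.
rewrite (eq_cintegral (g := fun s => z * (u s)%:C)); last by move=> s; rewrite mulrC.
rewrite cintegralZ// mulrC; congr (_ * _); apply: complexP => /=.
  by rewrite /Rintegral uv.
by rewrite /Rintegral integral0.
Qed.

(* Fubini on the triangle turns the mild formulation into the integral one. *)
Lemma sduh_eq k (y0 : R[i]) f t : 0 <= k -> cmeas f -> 0 <= t -> (trin f t < +oo)%E ->
  sduh k y0 f t = y0 + cintegral (fun s => (tri t s)%:C * (f s - k%:C * sduh k y0 f s)).
Proof.
move=> k0 mf t0 fin; have mt := measurable_tri1 t; have mt2 := @measurable_tri R.
have ms := cmeas_sduh k y0 mf.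
have Lf := cL1_tri mf fin.
have bnd := sduh_bound y0 k0 mf t0.
have finR : ((nc y0)%:E + trin f t < +oo)%E by rewrite lte_add_pinfty ?ltry.
have Ls : cL1 (fun s => (tri t s)%:C * (k%:C * sduh k y0 f s)).
  split; first by meas.
  have E s : (nc ((tri t s)%:C * (k%:C * sduh k y0 f s)))%:E = (tri t s * (k * nc (sduh k y0 f s)))%:E.
    by rewrite !ncM !nc_real !ger0_norm ?tri_ge0.
  under eq_integral do rewrite E.
  by apply: le_lt_trans finR; apply: le_trans bnd; rewrite leeDr// lee_fin nc_ge0.
rewrite (eq_cintegral (f := fun s => _ * (_ - _)) (g := fun s => (tri t s)%:C * f s - (tri t s)%:C * (k%:C * sduh k y0 f s))); last first.
  by move=> s; rewrite mulrBr.
rewrite cintegralB//.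
pose K (s r : R) : R := tri t s * (tri s r * (k * expR (- ((s - r) * k)))).
have K0 s r : 0 <= K s r by rewrite !mulr_ge0 ?tri_ge0 ?expR_ge0.
have mK : measurable_fun setT (fun z : R * R => K z.1 z.2).
  by apply: mfunM; [apply: (measurableT_comp mt)|]; meas.
have LK : (\int[mu]_s \int[mu]_r (nc ((K s r)%:C * f r))%:E < +oo)%E.
  have E s r : (nc ((K s r)%:C * f r))%:E = ((K s r)%:E * (nc (f r))%:E)%E.
    by rewrite ncM nc_real ger0_norm.
  under eq_integral do under eq_integral do rewrite E.
  rewrite (kernel_fubini (v := fun r => tri t r * (1 - expR (- ((t - r) * k)))))//.
  - apply: le_lt_trans fin; apply: le_int => r; last first.
      by rewrite -EFinM lee_fin ler_wpM2r ?nc_ge0// ler_piMr ?tri_ge0// gerBl expR_ge0.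
    rewrite -EFinM lee_fin triE; case: (boolP (0 <= r <= t)) => h; last by rewrite !mul0r.
    rewrite mul1r mulr_ge0 ?nc_ge0// subr_ge0 -[leRHS]expR0 ler_expR oppr_le0 mulr_ge0// subr_ge0.
    by case/andP: h.
  - by have mnf := measurable_nc mf; meas.
  - by move=> r; rewrite lee_fin nc_ge0.
  - by move=> r; exact: int_tri_exp.
have mKf : cmeas (fun z : R * R => (K z.1 z.2)%:C * f z.2).
  by apply: cmeasM; [apply: cmeas_real|apply: (cmeas_comp mf); meas].
have Lse : cL1 (fun s => (tri t s * (k * expR (- (s * k))))%:C * y0).
  rewrite (_ : (fun s => _) = fun s => y0 * (tri t s * (k * expR (- (s * k))))%:C); last first.
    by apply/funext => s; rewrite mulrC.
  apply: cL1Z; apply: cL1_real; first by meas.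
  under eq_integral do rewrite ger0_norm ?mulr_ge0 ?tri_ge0 ?expR_ge0//.
  by rewrite int_tri_exp0// ltry.
have LKf : cL1 (fun s => cintegral (fun r => (K s r)%:C * f r)).
  split; first exact: (cmeas_cintegral (F := fun s r : R => (K s r)%:C * f r) mKf).
  apply: le_lt_trans LK; apply: le_int => s; first by rewrite lee_fin nc_ge0.
  by apply: nc_cintegral; exact: (cmeas_slice (F := fun s r : R => (K s r)%:C * f r) s mKf).
have -> : cintegral (fun s => (tri t s)%:C * (k%:C * sduh k y0 f s)) =
    (1 - expR (- (t * k)))%:C * y0 +
    cintegral (fun r => (tri t r * (1 - expR (- ((t - r) * k))))%:C * f r).
  rewrite -(cintegral_real y0 (u := fun s => tri t s * (k * expR (- (s * k))))); last 3 first.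
  - by meas.
  - by move=> s; rewrite !mulr_ge0 ?tri_ge0 ?expR_ge0.
  - exact: int_tri_exp0.
  have -> : cintegral (fun r => (tri t r * (1 - expR (- ((t - r) * k))))%:C * f r) =
      cintegral (fun s => cintegral (fun r => (K s r)%:C * f r)).
    rewrite (cfubini (F := fun s r : R => (K s r)%:C * f r))//; apply: eq_cintegral => r.
    rewrite (cintegral_real _ (u := K^~ r) (v := tri t r * (1 - expR (- ((t - r) * k)))))//.
      by apply: (mfun_joint (F := K) mK); meas.
    exact: int_tri_exp.
  rewrite -cintegralD//; apply: cintegral_ae.
  - by meas.
  - by apply: cmeasD; [exact: Lse.1|exact: LKf.1].
  have := cfubini_ae (F := fun s r : R => (K s r)%:C * f r) mKf LK.
  apply: aeS => s _; rewrite /sduh mulrDr mulrDr; congr (_ + _).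
    by rewrite !RCM !mulrA.
  have [ts|ts] := boolP (0 <= s <= t); last first.
    rewrite triE (negbTE ts) mul0r; under eq_cintegral => r do rewrite /K triE (negbTE ts) !mul0r.
    by rewrite cintegral0.
  have fs : (trin f s < +oo)%E by apply: le_lt_trans (trin_le _ _) fin; case/andP: ts.
  rewrite mulrA -cintegralZ.
    apply: eq_cintegral => r; rewrite mulrA -!RCM; congr (_%:C * _).
    by rewrite /K; ring.
  apply: (@cL1_le _ _ (fun r => (tri s r)%:C * f r)).
  - by have m := measurable_tri1 s; meas.
  - exact: cL1_tri.
  move=> r; rewrite ncM ncM ler_wpM2r ?nc_ge0// !nc_real !ger0_norm ?mulr_ge0 ?tri_ge0 ?expR_ge0//.
  rewrite triE; case: (boolP (0 <= r <= s)) => h; last by rewrite mul0r.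
  rewrite mul1r -[leRHS]expR0 ler_expR oppr_le0 mulr_ge0// subr_ge0.
  by case/andP: h.
have e01 s : tri t s * expR (- ((t - s) * k)) <= tri t s.
  rewrite triE; case: (boolP (0 <= s <= t)) => h; last by rewrite mul0r.
  rewrite mul1r -[leRHS]expR0 ler_expR oppr_le0 mulr_ge0// subr_ge0.
  by case/andP: h.
have Le : cL1 (fun s => (tri t s * expR (- ((t - s) * k)))%:C * f s).
  apply: (@cL1_le _ _ (fun r => (tri t r)%:C * f r)) => // [|s]; first by meas.
  by rewrite ncM ncM ler_wpM2r ?nc_ge0// !nc_real !ger0_norm ?mulr_ge0 ?tri_ge0 ?expR_ge0.
have L2 : cL1 (fun s => (tri t s * (1 - expR (- ((t - s) * k))))%:C * f s).
  apply: (@cL1_le _ _ (fun r => (tri t r)%:C * f r)) => // [|s]; first by meas.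
  have h : 0 <= tri t s * (1 - expR (- ((t - s) * k))) by rewrite mulrBr mulr1 subr_ge0.
  rewrite ncM ncM ler_wpM2r ?nc_ge0// !nc_real (ger0_norm h) ger0_norm ?tri_ge0//.
  by rewrite mulrBr mulr1 gerBl mulr_ge0 ?tri_ge0 ?expR_ge0.
have -> : cintegral (fun s => (tri t s)%:C * f s) =
    cintegral (fun s => (tri t s * expR (- ((t - s) * k)))%:C * f s) +
    cintegral (fun s => (tri t s * (1 - expR (- ((t - s) * k))))%:C * f s).
  rewrite -cintegralD//; apply: eq_cintegral => s.
  by rewrite -mulrDl -RCD -mulrDr addrC subrK mulr1.
have P (a b c d : R[i]) : a + b = d + (b + c - ((d - a) + c)).
  by rewrite opprD opprB addrACA subrr addr0 addrCA [d + _]addrC subrK addrC.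
rewrite RCB mulrBl mul1r; exact: P.
Qed.

(** The converse of [sduh_eq], for an equation known at almost every time only: the difference [d]
    satisfies [|d| <= k] times its own primitive, and Gronwall's lemma applies. *)
Lemma sduh_unique k (y0 : R[i]) f (y : R -> R[i]) (T : R) : 0 <= k -> cmeas f -> cmeas y -> 0 <= T ->
  (trin f T < +oo)%E -> (trin y T < +oo)%E ->
  {ae mu, forall t : R, 0 <= t <= T ->
     y t = y0 + cintegral (fun s => (tri t s)%:C * (f s - k%:C * y s))} ->
  {ae mu, forall t : R, 0 <= t <= T -> y t = sduh k y0 f t}.
Proof.
move=> k0 mf my T0 ff fy H; have mT := measurable_tri1 T.
have ms := cmeas_sduh k y0 mf.
pose d t := y t - sduh k y0 f t.
have md : cmeas d by rewrite /d; meas.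
have mnd := measurable_nc md; have mny := measurable_nc my; have mns := measurable_nc ms.
have M0 : (0 <= (nc y0)%:E + trin f T)%E by apply: adde_ge0; [rewrite lee_fin nc_ge0|exact: trin_ge0].
have Mf : ((nc y0)%:E + trin f T)%E \is a fin_num by rewrite ge0_fin_numE// lte_add_pinfty ?ltry.
have fs : (trin (sduh k y0 f) T < +oo)%E.
  apply: (@le_lt_trans _ _ (\int[mu]_t (fine ((nc y0)%:E + trin f T)%E * \1_(`[0, T]%classic) t)%:E)%E).
    apply: le_int => t; first by rewrite lee_fin mulr_ge0 ?tri_ge0 ?nc_ge0.
    rewrite lee_fin triE indic_itvccE; case: (boolP (0 <= t <= T)) => h; last by rewrite mul0r mulr0.
    have /andP[t0 tT] := h; rewrite mul1r mulr1 -lee_fin fineK//.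
    apply: le_trans (leeD2l _ (trin_le f tT)); apply: le_trans (sduh_bound y0 k0 mf t0).
    by rewrite leeDl// integral_ge0// => s _; rewrite lee_fin !mulr_ge0 ?tri_ge0 ?nc_ge0.
  rewrite intZ ?(fine_ge0 M0)//.
  apply: lte_mul_pinfty; [by rewrite lee_fin fine_ge0|by []|].
  rewrite integral_indic//= setIT lebesgue_measure_itv/=.
  by case: ifP => _; rewrite ?ltry.
have fd : (trin d T < +oo)%E.
  apply: (@le_lt_trans _ _ (trin y T + trin (sduh k y0 f) T)%E); last by rewrite lte_add_pinfty.
  rewrite /trin -intD; [|by meas|by meas| |]; try by move=> t; rewrite mulr_ge0 ?tri_ge0 ?nc_ge0.
  apply: le_int => t; rewrite lee_fin ?mulr_ge0 ?tri_ge0 ?nc_ge0//.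
  by rewrite -mulrDr ler_wpM2l ?tri_ge0// ncB.
suff : {ae mu, forall t : R, 0 <= t <= T -> (nc (d t))%:E = 0%E :> \bar R}.
  apply: aeS => t h /h [] /nc_eq0 /eqP; rewrite subr_eq0; exact: eqP.
apply: (gronwall (C := k)) => //.
- exact: measurable_EFin.
- by move=> t; rewrite lee_fin nc_ge0.
apply: aeS H => t h tT; have /andP[t0 tT'] := tT.
have mt := measurable_tri1 t.
have ft (z : R -> R[i]) : (trin z T < +oo)%E -> (trin z t < +oo)%E.
  by apply: le_lt_trans; exact: trin_le.
have Lf := cL1_tri mf (ft _ ff).
have Ly := cL1_tri my (ft _ fy); have Ls := cL1_tri ms (ft _ fs); have Ld := cL1_tri md (ft _ fd).
have L z : cL1 (fun s => (tri t s)%:C * z s) -> cL1 (fun s => (tri t s)%:C * (f s - k%:C * z s)).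
  move=> Lz; have L1 := cL1B Lf (cL1Z k%:C Lz).
  rewrite (_ : (fun s => _) = fun s => (tri t s)%:C * f s - k%:C * ((tri t s)%:C * z s))//.
  by apply/funext => s; rewrite mulrBr [k%:C * (_ * _)]mulrCA.
have dE : d t = - (k%:C * cintegral (fun s => (tri t s)%:C * d s)).
  rewrite /d (h tT) (sduh_eq y0 k0 mf t0 (ft _ ff)) opprD addrACA subrr add0r.
  rewrite -cintegralB; [|exact: L|exact: L].
  rewrite -cintegralZ// -cintegralN; last exact: cL1Z.
  apply: eq_cintegral => s.
  have P (a b c : R[i]) : (a - b) - (a - c) = - (b - c).
    by rewrite opprB addrC addrA subrK opprB.
  by rewrite -mulrBr P -mulrBr mulrN mulrCA.
rewrite dE ncN ncM nc_real ger0_norm// EFinM lee_wpmul2l ?lee_fin//.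
apply: le_trans (nc_cintegral Ld.1) _; apply: le_int => s; first by rewrite lee_fin nc_ge0.
by rewrite ncM nc_real ger0_norm ?tri_ge0// EFinM.
Qed.

End scalar_duhamel.

(** * Duhamel's formula at all frequencies and the moments of its solution *)

Section spacetime_duhamel.
Context {R : realType}.
Implicit Types (z F : R -> R -> R[i]).

Lemma measurable_moment d (T : measurableType d) n (z : T -> R -> R[i]) :
  cmeas (fun w : T * R => z w.1 w.2) -> measurable_fun setT (fun t => moment n (z t)).
Proof.
move=> mz; apply: (measurable_int_prod (F := fun t xi => (`|xi| ^+ n * nc (z t xi))%:E)).
  by have mn := measurable_nc mz; meas.
by move=> t xi; rewrite lee_fin mulr_ge0 ?exprn_ge0 ?nc_ge0.
Qed.

Definition trim n z (t : R) : \bar R := (\int[mu]_s ((tri t s)%:E * moment n (z s)))%E.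

Lemma trim_ge0 n z t : (0 <= trim n z t)%E.
Proof. by apply: integral_ge0 => s _; rewrite mule_ge0 ?moment_ge0// lee_fin tri_ge0. Qed.

Lemma tri_le (t T s : R) : t <= T -> tri t s <= tri T s.
Proof.
move=> tT; rewrite !triE ler_nat; case: (boolP (0 <= s <= t)) => // /andP[-> st].
by rewrite (le_trans st tT).
Qed.

Lemma trim_le n z (t T : R) : t <= T -> (trim n z t <= trim n z T)%E.
Proof.
move=> tT; apply: le_int => s; first by rewrite mule_ge0 ?moment_ge0// lee_fin tri_ge0.
by rewrite lee_wpmul2r ?moment_ge0// lee_fin tri_le.
Qed.

Lemma cmeas_swap_slice z (xi : R) : cmeas (fun w : R * R => z w.1 w.2) -> cmeas (z^~ xi).
Proof. by move=> mz; apply: (cmeas_joint (F := z) mz); meas. Qed.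

Lemma measurable_trin z (t : R) : cmeas (fun w : R * R => z w.1 w.2) ->
  measurable_fun setT (fun xi => trin (z^~ xi) t).
Proof.
move=> mz; apply: (measurable_int_prod (F := fun xi s : R => (tri t s * nc (z s xi))%:E)).
  apply: measurable_EFin; apply: mfunM; first by apply: (measurableT_comp (measurable_tri1 t)); meas.
  by apply: measurable_nc; apply: (cmeas_joint (F := z) mz); meas.
by move=> xi s; rewrite lee_fin mulr_ge0 ?tri_ge0 ?nc_ge0.
Qed.

Lemma tri_moment n z t : cmeas (fun w : R * R => z w.1 w.2) ->
  (\int[mu]_xi ((`|xi| ^+ n)%:E * trin (z^~ xi) t) = trim n z t)%E.
Proof.
move=> mz; have mt := measurable_tri1 t.
have E1 xi : ((`|xi| ^+ n)%:E * trin (z^~ xi) t = \int[mu]_s (`|xi| ^+ n * (tri t s * nc (z s xi)))%:E)%E.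
  have mn := measurable_nc (cmeas_swap_slice xi mz).
  rewrite /trin -intZ ?exprn_ge0//; first by meas.
  by move=> s; rewrite mulr_ge0 ?tri_ge0 ?nc_ge0.
under eq_integral do rewrite E1.
rewrite int_fubini; last 2 first.
- apply: measurable_EFin; apply: mfunM; first by meas.
  apply: mfunM; first by apply: (measurableT_comp mt); meas.
  by apply: measurable_nc; apply: (cmeas_joint (F := z) mz); meas.
- by move=> xi s; rewrite lee_fin !mulr_ge0 ?exprn_ge0 ?tri_ge0 ?nc_ge0.
apply: eq_integral => s _; under eq_integral do rewrite mulrCA.
have mn := measurable_nc (cmeas_slice s mz).
by rewrite intZ ?tri_ge0//; [meas|move=> xi; rewrite mulr_ge0 ?exprn_ge0 ?nc_ge0].
Qed.

(** Tonelli bounds the integral of [|xi|^n] times the time integral at [xi]. The frequency 0, where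
    the weight may vanish, is removed as a null set. *)
Lemma trim_fin_ae n z t : cmeas (fun w : R * R => z w.1 w.2) -> (trim n z t < +oo)%E ->
  {ae mu, forall xi : R, (trin (z^~ xi) t < +oo)%E}.
Proof.
move=> mz; rewrite -tri_moment// => fin.
have m : measurable_fun setT (fun xi : R => (`|xi| ^+ n)%:E * trin (z^~ xi) t)%E.
  by apply: emeasurable_funM; [meas|exact: measurable_trin].
have p (xi : R) : (0 <= (`|xi| ^+ n)%:E * trin (z^~ xi) t)%E.
  by rewrite mule_ge0 ?trin_ge0// lee_fin exprn_ge0.
have z0 : {ae mu, forall xi : R, xi != 0}.
  exists [set 0]; split => //; first exact: lebesgue_measure_set1.
  by move=> x /= /negP; rewrite negbK => /eqP ->.
apply: aeS (aeI (int_lty_ae m p fin) z0) => xi [h x0].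
rewrite ltNge leye_eq; apply/negP => /eqP e; move: h.
by rewrite e gt0_muley ?ltxx// lte_fin exprn_gt0// normr_gt0.
Qed.

Lemma moment_tri_bound n (y F : R -> R -> R[i]) (a : R -> R[i]) (t : R) :
  cmeas (fun w : R * R => y w.1 w.2) -> cmeas (fun w : R * R => F w.1 w.2) -> cmeas a ->
  {ae mu, forall xi : R, ((nc (y t xi))%:E + (`|xi|)%:E * trin (y^~ xi) t <=
    (nc (a xi))%:E + trin (F^~ xi) t)%E} ->
  (moment n (y t) + trim n.+1 y t <= moment n a + trim n F t)%E.
Proof.
move=> my mF ma H.
have mny := measurable_nc (cmeas_slice t my); have mna := measurable_nc ma.
have mTy := measurable_trin t my; have mTF := measurable_trin t mF.
rewrite -!tri_moment// /moment -!ge0_integralD//; last first.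
- by apply: emeasurable_funM; meas.
- by move=> xi _; rewrite mule_ge0 ?trin_ge0// lee_fin exprn_ge0.
- by meas.
- by move=> xi _; rewrite lee_fin mulr_ge0 ?exprn_ge0 ?nc_ge0.
- by apply: emeasurable_funM; meas.
- by move=> xi _; rewrite mule_ge0 ?trin_ge0// lee_fin exprn_ge0.
- by meas.
- by move=> xi _; rewrite lee_fin mulr_ge0 ?exprn_ge0 ?nc_ge0.
apply: le_int_ae.
- by apply: emeasurable_funD; [meas|apply: emeasurable_funM; meas].
- by apply: emeasurable_funD; [meas|apply: emeasurable_funM; meas].
- by move=> xi; rewrite adde_ge0 ?mule_ge0 ?trin_ge0// lee_fin ?mulr_ge0 ?exprn_ge0 ?nc_ge0.
- by move=> xi; rewrite adde_ge0 ?mule_ge0 ?trin_ge0// lee_fin ?mulr_ge0 ?exprn_ge0 ?nc_ge0.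
apply: aeS H => xi Hxi.
rewrite exprSr !EFinM -muleA -!ge0_muleDr ?mule_ge0 ?trin_ge0 ?lee_fin ?nc_ge0//.
by rewrite lee_wpmul2l// lee_fin exprn_ge0.
Qed.

Definition duh (a : R -> R[i]) F (t xi : R) : R[i] := sduh `|xi| (a xi) (F^~ xi) t.

Lemma cmeas_duh (a : R -> R[i]) F : cmeas a -> cmeas (fun w : R * R => F w.1 w.2) ->
  cmeas (fun w : R * R => duh a F w.1 w.2).
Proof.
move=> ma mF; have mt := @measurable_tri R; rewrite /duh /sduh; apply: cmeasD.
  by apply: cmeasM; [meas|apply: (cmeas_comp ma); meas].
apply: (cmeas_cintegral (F := fun (w : R * R) (s : R) =>
  (tri w.1 s * expR (- ((w.1 - s) * `|w.2|)))%:C * F s w.2)).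
apply: cmeasM; first by meas.
by apply: (cmeas_joint (F := F) mF); meas.
Qed.

Lemma sduh_bound_trin k (y0 : R[i]) (f : R -> R[i]) (t : R) : 0 <= k -> cmeas f -> 0 <= t ->
  ((nc (sduh k y0 f t))%:E + k%:E * trin (sduh k y0 f) t <= (nc y0)%:E + trin f t)%E.
Proof.
move=> k0 mf t0; have := sduh_bound y0 k0 mf t0.
under eq_integral do rewrite mulrCA.
have mt := measurable_tri1 t; have mn := measurable_nc (cmeas_sduh k y0 mf).
by rewrite intZ//; [meas|move=> s; rewrite mulr_ge0 ?tri_ge0 ?nc_ge0].
Qed.

Lemma moment_duh n (a : R -> R[i]) F (t : R) : cmeas a -> cmeas (fun w : R * R => F w.1 w.2) -> 0 <= t ->
  (moment n (duh a F t) + trim n.+1 (duh a F) t <= moment n a + trim n F t)%E.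
Proof.
move=> ma mF t0; apply: moment_tri_bound => //; first exact: cmeas_duh.
by apply: aeT => xi; apply: sduh_bound_trin => //; exact: cmeas_swap_slice.
Qed.

Lemma trinB_fin (f1 f2 : R -> R[i]) (t : R) : cmeas f1 -> cmeas f2 ->
  (trin f1 t < +oo)%E -> (trin f2 t < +oo)%E ->
  forall k (y0 : R[i]), 0 <= k -> forall s : R, s <= t ->
  sduh k y0 f1 s - sduh k y0 f2 s = sduh k 0 (fun r => f1 r - f2 r) s.
Proof.
move=> m1 m2 i1 i2 k y0 k0 s st; rewrite /sduh opprD addrACA subrr mulr0; congr (_ + _).
have L (f : R -> R[i]) : cmeas f -> (trin f t < +oo)%E ->
    cL1 (fun r => (tri s r * expR (- ((s - r) * k)))%:C * f r).
  move=> mf fi; apply: (@cL1_le _ _ (fun r => (tri s r)%:C * f r)).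
  - by have m := measurable_tri1 s; meas.
  - by apply: cL1_tri => //; apply: le_lt_trans fi; exact: trin_le.
  move=> r; rewrite ncM ncM ler_wpM2r ?nc_ge0// !nc_real !ger0_norm ?mulr_ge0 ?tri_ge0 ?expR_ge0//.
  rewrite triE; case: (boolP (0 <= r <= s)) => h; last by rewrite mul0r.
  rewrite mul1r -[leRHS]expR0 ler_expR oppr_le0 mulr_ge0// subr_ge0.
  by case/andP: h.
rewrite -cintegralB; [|exact: L|exact: L].
by apply: eq_cintegral => r; rewrite mulrBr.
Qed.

(** The common initial datum cancels, so the difference is a Duhamel integral with zero datum. *)
Lemma moment_duhB n (a : R -> R[i]) F1 F2 (t : R) : cmeas a ->
  cmeas (fun w : R * R => F1 w.1 w.2) -> cmeas (fun w : R * R => F2 w.1 w.2) -> 0 <= t ->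
  (trim 0 F1 t < +oo)%E -> (trim 0 F2 t < +oo)%E ->
  (moment n (fun xi => duh a F1 t xi - duh a F2 t xi)%R +
   trim n.+1 (fun s xi => duh a F1 s xi - duh a F2 s xi)%R t <=
   trim n (fun s xi => F1 s xi - F2 s xi)%R t)%E.
Proof.
move=> ma m1 m2 t0 i1 i2.
have md1 := cmeas_duh ma m1; have md2 := cmeas_duh ma m2.
have mF : cmeas (fun w : R * R => F1 w.1 w.2 - F2 w.1 w.2) by meas.
have := @moment_tri_bound n (fun s xi => duh a F1 s xi - duh a F2 s xi)
  (fun s xi => F1 s xi - F2 s xi) (fun=> 0) t _ mF (cmeas_cst _ 0).
have -> : moment n (fun=> 0 : R[i]) = 0%E.
  by rewrite /moment; under eq_integral do rewrite nc0 mulr0; rewrite integral0.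
rewrite add0e; apply; first by meas.
apply: aeS (aeI (trim_fin_ae m1 i1) (trim_fin_ae m2 i2)) => xi [f1 f2].
have s1 := cmeas_swap_slice xi m1; have s2 := cmeas_swap_slice xi m2.
have E := trinB_fin s1 s2 f1 f2 (a xi) (normr_ge0 xi).
have m12 : cmeas (fun r => F1 r xi - F2 r xi) by meas.
have := sduh_bound_trin 0 (normr_ge0 xi) m12 t0.
rewrite -E//; congr (_ <= _)%E; congr (_ + _ * _)%E.
apply: eq_integral => s _; congr (_%:E); rewrite triE.
case: (boolP (0 <= s <= t)) => h; last by rewrite !mul0r.
by rewrite -E//; case/andP: h.
Qed.

Lemma duh_eq (a : R -> R[i]) F (T : R) : cmeas (fun w : R * R => F w.1 w.2) ->
  (trim 0 F T < +oo)%E ->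
  {ae mu, forall xi : R, forall t : R, 0 <= t <= T ->
    duh a F t xi = a xi +
      cintegral (fun s => (tri t s)%:C * (F s xi - (`|xi|)%:C * duh a F s xi))}.
Proof.
move=> mF fin; apply: aeS (trim_fin_ae mF fin) => xi f t /andP[t0 tT].
apply: sduh_eq => //; first exact: cmeas_swap_slice.
by apply: le_lt_trans f; exact: trin_le.
Qed.

Lemma hermitian_duh (a : R -> R[i]) F (t : R) : hermitian a ->
  (forall s, 0 <= s -> hermitian (F s)) -> hermitian (duh a F t).
Proof.
move=> ha hF xi; rewrite /duh /sduh normrN conjcD conjcM conjcR ha; congr (_ + _).
rewrite -cintegralJ; apply: eq_cintegral => s; rewrite conjcM conjcR.
rewrite triE; case: (boolP (0 <= s <= t)) => h; last by rewrite !mul0r.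
by rewrite hF//; case/andP: h.
Qed.
End spacetime_duhamel.

(** * Existence on the Fourier side *)

Section limits.
Context {R : realType}.

Lemma limn_einf_le (x : (\bar R)^nat) c : (forall n, (x n <= c)%E) -> (limn_einf x <= c)%E.
Proof.
move=> xc; rewrite limn_einf_lim; apply: lime_le; first exact: is_cvg_einfs.
apply: nearW => n; apply: le_trans (xc n); apply: ereal_inf_lbound.
by exists n => //=.
Qed.

Lemma fatou_ae (f : nat -> R -> \bar R) (g : R -> \bar R) :
  (forall n, measurable_fun setT (f n)) -> measurable_fun setT g ->
  (forall n x, (0 <= f n x)%E) -> (forall x, (0 <= g x)%E) ->
  {ae mu, forall x, (g x <= limn_einf (f^~ x))%E} ->
  (\int[mu]_x g x <= limn_einf (fun n => \int[mu]_x f n x))%E.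
Proof.
move=> mf mg f0 g0 H; apply: le_trans (fatou mu measurableT mf (fun n x _ => f0 n x)).
apply: le_int_ae => //.
- rewrite (_ : (fun x => limn_einf (f^~ x)) = fun x => (- limn_esup (fun n => - f n x))%E).
    apply: measurableT_comp; first exact: oppe_measurable.
    by apply: measurable_fun_limn_esup => n; exact: (measurableT_comp (@oppe_measurable _ _) (mf n)).
  apply/funext => x; have -> : limn_esup (fun n => - f n x)%E = (- limn_einf (f^~ x))%E.
    exact: limn_esupN.
  by rewrite oppeK.
move=> x; rewrite limn_einf_lim; apply: lime_ge; first exact: is_cvg_einfs.
by apply: nearW => n; apply/ereal_infP => _ [k /= _ <-].
Qed.

Lemma cvg_nc (z : nat -> R[i]) (l : R[i]) : nc (z n - l) @[n --> \oo] --> (0 : R) ->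
  nc (z n) @[n --> \oo] --> nc l.
Proof.
move=> h; apply/subr_cvg0; apply/norm_cvg0P; apply: (squeeze_cvgr _ (cvg_cst 0) h).
apply: nearW => n /=; rewrite normr_ge0 /= ler_norml ncB_lt andbT lerNl opprB.
by rewrite ncBC ncB_lt.
Qed.

Lemma limn_einf_nc (k : R) (z : nat -> R[i]) (l : R[i]) : nc (z n - l) @[n --> \oo] --> (0 : R) ->
  limn_einf (fun n => (k * nc (z n))%:E) = (k * nc l)%:E.
Proof.
move=> h; have H : (k * nc (z n))%:E @[n --> \oo] --> (k * nc l)%:E.
  apply: cvg_EFin; first exact: nearW.
  by apply: cvgM; [exact: cvg_cst|exact: cvg_nc].
by have [-> _] := cvg_limn_einf_sup H.
Qed.

Lemma fatou_weight (k : R -> R) (z : nat -> R -> R[i]) (y : R -> R[i]) :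
  measurable_fun setT k -> (forall x, 0 <= k x) -> (forall n, cmeas (z n)) -> cmeas y ->
  {ae mu, forall xi, nc (z n xi - y xi) @[n --> \oo] --> (0 : R)} ->
  (\int[mu]_x (k x * nc (y x))%:E <= limn_einf (fun n => \int[mu]_x (k x * nc (z n x))%:E))%E.
Proof.
move=> mk k0 mz my H; apply: fatou_ae.
- by move=> n; have m := mz n; meas.
- by meas.
- by move=> n x; rewrite lee_fin mulr_ge0 ?nc_ge0.
- by move=> x; rewrite lee_fin mulr_ge0 ?nc_ge0.
by apply: aeS H => xi h; rewrite (limn_einf_nc _ h).
Qed.

Lemma fatou_moment n (z : nat -> R -> R[i]) (y : R -> R[i]) : (forall k, cmeas (z k)) -> cmeas y ->
  {ae mu, forall xi, nc (z k xi - y xi) @[k --> \oo] --> (0 : R)} ->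
  (moment n y <= limn_einf (fun k => moment n (z k)))%E.
Proof. by apply: fatou_weight => [|x]; [meas|rewrite exprn_ge0]. Qed.

Lemma int0_ae (f : R -> \bar R) : measurable_fun setT f -> (forall x, (0 <= f x)%E) ->
  (\int[mu]_x f x = 0)%E -> {ae mu, forall x, f x = 0%E}.
Proof.
move=> mf f0 f_0; have := @ae_eq_integral_abs _ _ R mu setT measurableT _ mf.
have -> : (\int[mu]_x `|f x| = 0)%E.
  by rewrite -[RHS]f_0; apply: eq_integral => t _; rewrite gee0_abs.
by move=> [/(_ erefl) h _]; apply: aeS h => t ht; exact: ht.
Qed.

Lemma ae_reflect (P : R -> Prop) (x : R) : {ae mu, forall y, P y} -> {ae mu, forall y : R, P (x - y)}.
Proof.
move=> [A [mA A0 PA]].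
have mi : measurable_fun setT (fun y : R => (\1_A y : R)%:E) by exact: measurable_EFin (measurable_indic mA).
have i0 y : (0 <= (\1_A y : R)%:E)%E by rewrite lee_fin.
have mh : measurable_fun setT (fun y : R => x - y) by meas.
have mB : measurable ((fun y : R => x - y) @^-1` A) by rewrite -[X in measurable X]setTI; exact: mh.
exists ((fun y : R => x - y) @^-1` A); split => //; last by move=> y /PA.
have E := @integral_indic _ _ R mu setT measurableT.
rewrite -[X in mu X]setIT -(E _ mB).
have -> : (\int[mu]_y (\1_((fun y : R => x - y) @^-1` A) y)%:E = \int[mu]_y (\1_A (x + - y))%:E)%E.
  by apply: eq_integral => y _; rewrite !indicE /in_mem /= /mem /=.
have mh2 : measurable_fun setT (fun y : R => x + y) by meas.
have mi' : measurable_fun setT (fun y : R => (\1_A (x + y) : R)%:E) := measurableT_comp mi mh2.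
rewrite (int_opp mi')//.
under eq_integral do rewrite addrC.
by rewrite (int_shift x mi)// (E _ mA) setIT; exact: A0.
Qed.

Lemma nneseries_le (x : nat -> \bar R) c : (forall n, (0 <= x n)%E) ->
  (forall n, (\sum_(0 <= i < n) x i <= c)%E) -> (\sum_(0 <= i <oo) x i <= c)%E.
Proof.
move=> x0 H; apply: lime_le; first by apply: is_cvg_nneseries => n _ _.
exact: nearW.
Qed.

Lemma sum_half_le (C : R) n : 0 <= C -> \sum_(0 <= i < n) C * 2^-1 ^+ i <= 2 * C.
Proof.
move=> C0; suff -> : \sum_(0 <= i < n) C * 2^-1 ^+ i = 2 * C - 2 * C * 2^-1 ^+ n.
  by rewrite gerBl !mulr_ge0// exprn_ge0.
elim: n => [|n IH]; first by rewrite big_geq// expr0 mulr1 subrr.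
by rewrite big_nat_recr//= IH exprS; field.
Qed.

Lemma cvgn_of_summable (x : nat -> R) : (\sum_(0 <= n <oo) (`|x n.+1 - x n|)%:E < +oo)%E -> cvgn x.
Proof.
move=> h; have c : cvgn (series (telescope x)).
  by apply: normed_cvg; apply: (nnseries_is_cvg (u := fun n => `|telescope x n|)).
rewrite (_ : x = fun n => x 0%N + series (telescope x) n); last by apply/funext => n; exact: eq_sum_telescope.
by apply: is_cvgD => //; exact: is_cvg_cst.
Qed.
End limits.

(** * Limits of sequences with geometrically small increments in a norm weighted in time *)

Section completeness.
Context {R : realType} (u : nat -> R -> R -> R[i]) (w : R -> R) (lam C : R).
Hypotheses (m_u : forall n, cmeas (fun z : R * R => u n z.1 z.2))
  (mw : measurable_fun setT w) (w_ge0 : forall t, 0 <= w t)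
  (w_gt0 : forall t, 0 <= t -> 0 < w t) (lam_gt0 : 0 < lam) (C_ge0 : 0 <= C).

(** Weighted by [exp (- lam t)] and integrated in time, its two terms are those on the left of
    [weighted_bound] with [k = lam]. *)
Definition energy (z : R -> R -> R[i]) (t : R) : \bar R :=
  (lam%:E * moment 0 (z t) + moment 1 (z t))%E.

Definition total (z : R -> R -> R[i]) : \bar R := (\int[mu]_t ((w t)%:E * energy z t))%E.

Lemma energy_ge0 z t : (0 <= energy z t)%E.
Proof. by rewrite adde_ge0 ?mule_ge0 ?moment_ge0// lee_fin ltW. Qed.

Lemma measurable_energy z : cmeas (fun z' : R * R => z z'.1 z'.2) ->
  measurable_fun setT (energy z).
Proof.
move=> mz; apply: emeasurable_funD; last exact: measurable_moment.
exact/measurable_funeM/measurable_moment.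
Qed.

Lemma wenergyE z t : cmeas (fun z' : R * R => z z'.1 z'.2) ->
  ((w t)%:E * energy z t = \int[mu]_x ((w t * (lam + `|x|)) * nc (z t x))%:E)%E.
Proof.
move=> mz; have mn := measurable_nc (cmeas_slice t mz).
rewrite /energy /moment -intZ ?(ltW lam_gt0)//; last 2 first.
- by meas.
- by move=> x; rewrite mulr_ge0 ?nc_ge0 ?exprn_ge0.
rewrite -intD; [|by meas|by meas| |]; last 2 first.
- by move=> x; rewrite !mulr_ge0 ?nc_ge0 ?exprn_ge0 ?(ltW lam_gt0).
- by move=> x; rewrite !mulr_ge0 ?nc_ge0 ?exprn_ge0.
rewrite -intZ//; last 2 first.
- by meas.
- by move=> x; rewrite addr_ge0 ?mulr_ge0 ?nc_ge0 ?exprn_ge0 ?(ltW lam_gt0).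
by apply: eq_integral => x _; rewrite expr0 expr1 mul1r -mulrDl mulrA.
Qed.

Let dif n t xi := u n.+1 t xi - u n t xi.
Hypothesis total_dif : forall n, (total (dif n) <= (C * 2^-1 ^+ n)%:E)%E.

Let m_dif n : cmeas (fun z : R * R => dif n z.1 z.2).
Proof. by have m1 := m_u n; have m2 := m_u n.+1; rewrite /dif; meas. Qed.

(** Convergence is obtained in two stages: [Ps t] is finite for almost every [t >= 0], and at such a
    time [qs t xi] is finite for almost every [xi]. *)
Let qs (t xi : R) : \bar R := (\sum_(0 <= n <oo) (nc (dif n t xi))%:E)%E.
Let Ps (t : R) : \bar R := (\sum_(0 <= n <oo) energy (dif n) t)%E.

Let m_qs : measurable_fun setT (fun z : R * R => qs z.1 z.2).
Proof.
apply: (@ge0_emeasurable_sum _ _ _ _ (fun n (z : R * R) => (nc (dif n z.1 z.2))%:E) predT).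
  by move=> k x _ _; rewrite lee_fin nc_ge0.
by move=> k _; exact: (measurable_EFin (measurable_nc (m_dif k))).
Qed.

Let m_Ps : measurable_fun setT Ps.
Proof.
apply: (@ge0_emeasurable_sum _ _ _ _ (fun n t => energy (dif n) t) predT).
  by move=> k x _ _; exact: energy_ge0.
by move=> k _; exact: measurable_energy.
Qed.

Let Ps_fin : {ae mu, forall t : R, 0 <= t -> (Ps t < +oo)%E}.
Proof.
have Ps0 t : (0 <= Ps t)%E by apply: nneseries_ge0 => n _ _; exact: energy_ge0.
have m : measurable_fun setT (fun t => (w t)%:E * Ps t)%E.
  by apply: emeasurable_funM => //; exact: measurable_EFin.
have /(int_lty_ae m) : (\int[mu]_t ((w t)%:E * Ps t) < +oo)%E.
  apply: (@le_lt_trans _ _ (2 * C)%:E); last exact: ltry.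
  have E t : ((w t)%:E * Ps t = \sum_(0 <= n <oo) ((w t)%:E * energy (dif n) t))%E.
    by rewrite nneseriesZl// => n _; exact: energy_ge0.
  under eq_integral do rewrite E.
  rewrite integral_nneseries//; last 2 first.
  - by move=> n; apply: emeasurable_funM; [exact: measurable_EFin|exact: measurable_energy].
  - by move=> n t _; rewrite mule_ge0 ?energy_ge0// lee_fin.
  apply: nneseries_le => [n|n].
    by apply: integral_ge0 => t _; rewrite mule_ge0 ?energy_ge0// lee_fin.
  apply: (@le_trans _ _ (\sum_(0 <= i < n) (C * 2^-1 ^+ i)%:E)%E).
    by apply: lee_sum => i _; exact: total_dif.
  by rewrite sumEFin lee_fin sum_half_le.
move=> h; have {}h := h (fun t => mule_ge0 _ (Ps0 t)).
apply: aeS (h _) => [t ht t0|t]; last by rewrite lee_fin.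
rewrite ltNge leye_eq; apply/negP => /eqP e; move: ht.
by rewrite e gt0_muley ?ltxx// lte_fin w_gt0.
Qed.

Let qs_fin t : (Ps t < +oo)%E -> {ae mu, forall xi : R, (qs t xi < +oo)%E}.
Proof.
move=> h; apply: int_lty_ae.
- by apply: (measurableT_comp m_qs (pair1_measurable t)).
- by move=> xi; apply: nneseries_ge0 => n _ _; rewrite lee_fin nc_ge0.
rewrite integral_nneseries//; last 2 first.
- move=> n; have m := cmeas_slice t (m_dif n); exact: (measurable_EFin (measurable_nc m)).
- by move=> n x _; rewrite lee_fin nc_ge0.
apply: (@le_lt_trans _ _ (lam^-1%:E * Ps t)%E).
  rewrite -nneseriesZl; last by move=> n _; exact: energy_ge0.
  apply: lee_nneseries => [n _ _|n _]; first exact: int_nc_ge0.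
  apply: (@le_trans _ _ (lam^-1%:E * (lam%:E * moment 0 (dif n t)))%E).
    by rewrite muleA -EFinM mulVf ?gt_eqF// mul1e moment0.
  by rewrite lee_wpmul2l ?lee_fin ?invr_ge0 ?(ltW lam_gt0)// leeDl// moment_ge0.
by apply: lte_mul_pinfty => //; rewrite lee_fin invr_ge0 ltW.
Qed.

Definition conv_times : set R := [set t : R | (Ps t < +oo)%E].
Let A1 := conv_times.
Let A2 := [set z : R * R | (qs z.1 z.2 < +oo)%E].

Let mA1 : measurable A1.
Proof.
rewrite [A1](_ : _ = setT `&` Ps @^-1` [set` `[-oo%E, +oo%E[ ]).
  by apply: m_Ps => //; exact: emeasurable_itv.
by apply/seteqP; split => t; rewrite /A1 /conv_times /A2 /= in_itv/= leNye => // -[].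
Qed.

Let mA2 : measurable A2.
Proof.
rewrite [A2](_ : _ = setT `&` (fun z : R * R => qs z.1 z.2) @^-1` [set` `[-oo%E, +oo%E[ ]).
  by apply: m_qs => //; exact: emeasurable_itv.
by apply/seteqP; split => t; rewrite /A1 /conv_times /A2 /= in_itv/= leNye => // -[].
Qed.

(** Multiplying by this indicator makes the sequence converge at every point, so that its limit is
    measurable without further choice. *)
Let J (t xi : R) : R := \1_A1 t * \1_A2 (t, xi).
Let v n t xi := (J t xi)%:C * u n t xi.

Let m_v n : cmeas (fun z : R * R => v n z.1 z.2).
Proof.
apply: cmeasM => //; apply: cmeas_real; apply: mfunM.
  by apply: (measurableT_comp (measurable_indic mA1)); meas.
by apply: (measurableT_comp (measurable_indic mA2)); meas.
Qed.

Let v_summable t xi : (\sum_(0 <= n <oo) (nc (v n.+1 t xi - v n t xi))%:E < +oo)%E.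
Proof.
have E n : (nc (v n.+1 t xi - v n t xi))%:E = ((J t xi)%:E * (nc (dif n t xi))%:E)%E.
  by rewrite -mulrBr ncM nc_real ger0_norm// mulr_ge0.
rewrite (eq_eseriesr (g := fun n => ((J t xi)%:E * (nc (dif n t xi))%:E)%E)); last by move=> n _; exact: E.
rewrite nneseriesZl; last by move=> n _; rewrite lee_fin nc_ge0.
have [h|h] := pselect (A2 (t, xi)).
  by apply: lte_mul_pinfty => //; rewrite lee_fin mulr_ge0.
by rewrite /J [\1_A2 _]indicE memNset// mulr0 mul0e ltry.
Qed.

Let v_cvg t xi : cvgn (fun n => complex.Re (v n t xi)) /\ cvgn (fun n => complex.Im (v n t xi)).
Proof.
split; apply: cvgn_of_summable; apply: le_lt_trans (v_summable t xi);
  apply: lee_nneseries => [n _ _|n _]; rewrite lee_fin//.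
  by rewrite -ReN -ReD nc_Re.
by rewrite -ImN -ImD nc_Im.
Qed.

Definition glim (t xi : R) : R[i] :=
  (limn (fun n => complex.Re (v n t xi)) +i* limn (fun n => complex.Im (v n t xi)))%C.

Lemma cmeas_glim : cmeas (fun z : R * R => glim z.1 z.2).
Proof.
split => /=; apply: (measurable_fun_cvg (h := fun n z => _)).
- by move=> n; exact: (m_v n).1.
- by move=> z _; exact: (v_cvg z.1 z.2).1.
- by move=> n; exact: (m_v n).2.
- by move=> z _; exact: (v_cvg z.1 z.2).2.
Qed.

Let v_glim t xi : nc (v n t xi - glim t xi) @[n --> \oo] --> (0 : R).
Proof.
have [c1 c2] := v_cvg t xi.
have d1 : `|complex.Re (v n t xi) - complex.Re (glim t xi)| @[n --> \oo] --> (0 : R).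
  by apply/norm_cvg0P; apply/subr_cvg0.
have d2 : `|complex.Im (v n t xi) - complex.Im (glim t xi)| @[n --> \oo] --> (0 : R).
  by apply/norm_cvg0P; apply/subr_cvg0.
have d : `|complex.Re (v n t xi) - complex.Re (glim t xi)| +
  `|complex.Im (v n t xi) - complex.Im (glim t xi)| @[n --> \oo] --> (0 : R).
  by rewrite -[0]addr0; apply: cvgD.
apply: (squeeze_cvgr _ (cvg_cst 0) d); apply: nearW => n /=.
by rewrite nc_ge0 /=; apply: le_trans (nc_le _) _; rewrite ReD ReN ImD ImN.
Qed.

(** The moduli of the increments are even in [xi], so the set where the sequence is kept is
    symmetric and the limit is symmetric at every frequency. *)
Lemma hermitian_glim t : (forall n, hermitian (u n t)) -> hermitian (glim t).
Proof.
move=> hu xi.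
have hq : qs t (- xi) = qs t xi.
  by apply: eq_eseriesr => n _; rewrite /dif !hu -conjcN -conjcD ncJ.
have hJ : J t (- xi) = J t xi.
  by rewrite /J; congr (_ * _); rewrite !indicE; congr (nat_of_bool _)%:R;
    apply/idP/idP; rewrite !inE /A2/= hq.
have hv n : v n t (- xi) = conjc (v n t xi) by rewrite /v hJ hu conjcM conjcR.
have [c1 c2] := v_cvg t xi.
apply: complexP => /=.
  have -> // : (fun n => complex.Re (v n t (- xi))) = (fun n => complex.Re (v n t xi)).
  by apply/funext => n; rewrite hv ReJ.
rewrite -limN//.
have -> // : (fun n => complex.Im (v n t (- xi))) = - (fun n => complex.Im (v n t xi)).
by apply/funext => n; rewrite hv ImJ.
Qed.

(* Off a null set of times, [u n t] converges to [glim t]; at the other times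
   [glim t] is [0]. *)
Lemma glimP t : {ae mu, forall xi : R, nc ((\1_conv_times t)%:C * u n t xi - glim t xi) @[n --> \oo] --> (0 : R)}.
Proof.
have [h|h] := pselect (A1 t); last first.
  apply: aeT => xi; have := @v_glim t xi.
  by rewrite /v /J [\1_A1 t]indicE memNset// mul0r.
apply: aeS (qs_fin h) => xi hxi; have := @v_glim t xi.
by rewrite /v /J [\1_A2 _]indicE mem_set// mulr1.
Qed.

Lemma glim_ae : {ae mu, forall t : R, 0 <= t -> \1_conv_times t = 1 :> R}.
Proof. by apply: aeS Ps_fin => t h /h ht; rewrite indicE mem_set. Qed.

End completeness.

(** * Picard iteration with a retraction *)

Section picard.
Context {R : realType} (m : R -> R).
Hypotheses (mm : measurable_fun setT m) (m_ge0 : forall x, 0 <= m x)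
  (m_le1 : forall x, m x <= 1) (m_even : forall x, m (- x) = m x).

(** For a positive factor the identity survives infinite integrals. Hence [advecZ] holds at every
    frequency, also where the convolution integral diverges. *)
Lemma RintZ_gt0 (k : R) (f : R -> R) : 0 < k -> measurable_fun setT f ->
  \int[mu]_x (k * f x) = k * \int[mu]_x f x.
Proof.
move=> k0 mf; rewrite /Rintegral.
under eq_integral do rewrite EFinM.
have me := measurable_EFin mf.
rewrite integralE [X in _ = k * fine X]integralE ge0_funeposM ?ge0_funenegM ?ltW//.
rewrite !ge0_integralZl_EFin ?ltW//; last 2 first.
- exact: measurable_funeneg.
- exact: measurable_funepos.
by rewrite fine_scaleB//; apply: integral_ge0.
Qed.

Lemma cintegralZ_gt0 (k : R) (f : R -> R[i]) : 0 < k -> cmeas f ->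
  cintegral (fun x => k%:C * f x) = k%:C * cintegral f.
Proof.
move=> k0 [m1 m2]; apply: complexP; rewrite ?ReRC ?ImRC /=.
  by rewrite -RintZ_gt0//; apply: eq_Rintegral => x _; rewrite ReRC.
by rewrite -RintZ_gt0//; apply: eq_Rintegral => x _; rewrite ImRC.
Qed.

Lemma advecZ (k : R) (h z : R -> R[i]) x : 0 < k -> cmeas h -> cmeas z ->
  advec m (fun x => k%:C * h x) z x = k%:C * advec m h z x.
Proof.
move=> k0 mh mz; rewrite /advec mulrN mulrCA; congr (- (_ * _)).
rewrite /conv -cintegralZ_gt0//.
  have E (p q r s : R[i]) : p * (q * r) * s = q * (p * r * s) by ring.
  by apply: eq_cintegral => y; exact: E.
apply: cmeasM; last exact: cmeas_ixi.
by apply: (cmeas_comp (h := fun y : R => x - y) (cmeas_mult mm mh)); meas.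
Qed.

Lemma momentZ n (k : R) (h : R -> R[i]) : 0 <= k -> cmeas h ->
  moment n (fun x => k%:C * h x) = (k%:E * moment n h)%E.
Proof.
move=> k0 mh; have mn := measurable_nc mh.
rewrite /moment -intZ//; [|by meas|by move=> x; rewrite mulr_ge0 ?exprn_ge0 ?nc_ge0].
by apply: eq_integral => x _; rewrite ncM nc_real (ger0_norm k0) mulrCA.
Qed.

Lemma trim_leM n n' (k : R) (F z : R -> R -> R[i]) (t : R) : 0 <= k ->
  cmeas (fun w : R * R => z w.1 w.2) ->
  (forall s, 0 <= s -> (moment n (F s) <= k%:E * moment n' (z s))%E) ->
  (trim n F t <= k%:E * trim n' z t)%E.
Proof.
move=> k0 mz H; rewrite /trim -ge0_integralZl_EFin//; last 2 first.
- by move=> s _; rewrite mule_ge0 ?moment_ge0// lee_fin tri_ge0.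
- by apply: measurable_triM; exact: measurable_moment.
apply: le_int => s; first by rewrite mule_ge0 ?moment_ge0// lee_fin tri_ge0.
rewrite muleCA; have [s0|s0] := leP 0 s; first by rewrite lee_wpmul2l ?lee_fin ?tri_ge0// H.
by rewrite triE (lt_geF s0) !mul0e.
Qed.

Variables (g0 : R -> R[i]) (a a1 : R).
Hypotheses (mg0 : cmeas g0) (hg0 : hermitian g0) (a_gt0 : 0 < a)
  (a_small : 2 * cF * a < 1) (g0_0 : (moment 0 g0 <= a%:E)%E)
  (g0_1 : (moment 1 g0 <= a1%:E)%E).

(** [b] and [K] solve [b = a + cF a b] and [K = a1 + 2 cF a K]: they are the bounds that Duhamel's
    map reproduces once the forcing has relative size [cF a] for [M_0] and [2 cF a] for [M_1]. *)
Let b := a / (1 - cF * a).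
Let K := a1 / (1 - 2 * cF * a).
Let c0 : 0 < cF := @cF_gt0 R.

Let a1_ge0 : 0 <= a1.
Proof. by rewrite -lee_fin (le_trans _ g0_1)// moment_ge0. Qed.

Let ca_gt0 : 0 < cF * a. Proof. by rewrite mulr_gt0. Qed.

Let ca_small : cF * a < 2^-1.
Proof. by rewrite -(ltr_pM2l (ltr0n R 2)) mulrA divff. Qed.

Let b_ge0 : 0 <= b.
Proof. by rewrite divr_ge0 ?(ltW a_gt0)// subr_ge0; have := ca_small; lra. Qed.

Let K_ge0 : 0 <= K.
Proof. by rewrite divr_ge0// subr_ge0 ltW. Qed.

Let bE : a + cF * a * b = b.
Proof. by rewrite /b; field; rewrite subr_eq0 eq_sym lt_eqF//; have := ca_small; lra. Qed.

Let KE : a1 + 2 * cF * a * K = K.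
Proof. by rewrite /K; field; rewrite subr_eq0 eq_sym lt_eqF. Qed.

(** A set stable under the iteration. Pointwise bounds in time give a meaning to the nonlinearity,
    and the bounds on the dissipation are those that the forcing estimates consume. *)
Record good (g : R -> R -> R[i]) : Prop := Good {
  good_meas : cmeas (fun w : R * R => g w.1 w.2);
  good_herm : forall t, 0 <= t -> hermitian (g t);
  good_0 : forall t, 0 <= t -> (moment 0 (g t) <= b%:E)%E;
  good_1 : forall t, 0 <= t -> (moment 1 (g t) <= K%:E)%E;
  good_tri1 : forall t, 0 <= t -> (trim 1 g t <= b%:E)%E;
  good_tri2 : forall t, 0 <= t -> (trim 2 g t <= K%:E)%E }.

(** The factor of the radial projection onto the ball [M_0 <= a]: 1 in the ball and [a / M_0 h]
    where [M_0 h] is finite and larger than [a]. *)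
Definition rho (h : R -> R[i]) : R := a / Num.max a (fine (moment 0 h)).

Let max_gt0 (x : R) : 0 < Num.max a x.
Proof. by rewrite lt_max a_gt0. Qed.

Lemma rho_gt0 h : 0 < rho h. Proof. by rewrite divr_gt0. Qed.

Lemma rho_le1 h : rho h <= 1.
Proof. by rewrite ler_pdivrMr// mul1r le_max lexx. Qed.

Lemma rho_moment h : rho h * fine (moment 0 h) <= a.
Proof.
rewrite /rho mulrAC ler_pdivrMr// ler_wpM2l ?(ltW a_gt0)//.
by rewrite le_max lexx orbT.
Qed.

Lemma rho1 h : (moment 0 h <= a%:E)%E -> rho h = 1.
Proof.
move=> h0; rewrite /rho max_l ?divff ?gt_eqF// -lee_fin fineK//.
by rewrite ge0_fin_numE ?moment_ge0// (le_lt_trans h0)// ltry.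
Qed.

Definition scaled (h : R -> R[i]) (x : R) : R[i] := (rho h)%:C * h x.
Definition forcing (g : R -> R -> R[i]) (t : R) := advec m (scaled (g t)) (g t).
Definition Phi (g : R -> R -> R[i]) := duh g0 (forcing g).

Lemma moment_fin n h (c : R) : (moment n h <= c%:E)%E -> moment n h \is a fin_num.
Proof. by move=> h0; rewrite ge0_fin_numE ?moment_ge0// (le_lt_trans h0)// ltry. Qed.

Lemma cmeas_scaled h : cmeas h -> cmeas (scaled h).
Proof. by move=> mh; rewrite /scaled; meas. Qed.

Lemma moment0_scaled h : cmeas h -> moment 0 h \is a fin_num -> (moment 0 (scaled h) <= a%:E)%E.
Proof.
move=> mh hf; rewrite momentZ ?(ltW (rho_gt0 _))// -[moment 0 h]fineK// -EFinM lee_fin.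
exact: rho_moment.
Qed.

Lemma cmeas_scaled_joint g : cmeas (fun w : R * R => g w.1 w.2) ->
  cmeas (fun w : R * R => scaled (g w.1) w.2).
Proof.
move=> mg; apply: cmeasM => //; apply: cmeas_real.
have mf : measurable_fun setT (fun t => fine (moment 0 (g t))).
  by apply: (measurableT_comp (@fine_measurable _ _ measurableT)); exact: measurable_moment.
have mr : measurable_fun setT (fun t => rho (g t)).
  apply: mfunM; first exact: measurable_cst.
  apply: mfunV; first by move=> t; rewrite ltW.
  by apply: mfun_max => //; exact: measurable_cst.
by apply: (measurableT_comp mr); meas.
Qed.

Lemma cmeas_forcing g : cmeas (fun w : R * R => g w.1 w.2) ->
  cmeas (fun w : R * R => forcing g w.1 w.2).
Proof.
move=> mg; apply: (cmeas_advec_joint mm (h := fun t => scaled (g t)) (k := g)) => //.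
exact: cmeas_scaled_joint.
Qed.

(** The retracted factor has [M_0] at most [a], although [g] itself is only known to satisfy
    [M_0 <= b]; the estimate is linear in [g], with a small constant. *)
Lemma moment0_forcing g t : good g -> 0 <= t ->
  (moment 0 (forcing g t) <= (cF * a)%:E * moment 1 (g t))%E.
Proof.
move=> gg t0; have mg := cmeas_slice t (good_meas gg).
apply: le_trans (moment0_advec mm m_ge0 m_le1 (cmeas_scaled mg) mg) _.
rewrite EFinM -muleA lee_wpmul2l ?lee_fin ?(ltW c0)// lee_wpmul2r ?moment_ge0//.
by apply: moment0_scaled => //; exact: moment_fin (good_0 gg t0).
Qed.

Lemma moment1_forcing g t : good g -> 0 <= t ->
  (moment 1 (forcing g t) <= (2 * cF * a)%:E * moment 2 (g t))%E.
Proof.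
move=> gg t0; have mg := cmeas_slice t (good_meas gg).
(* [moment1_advec] takes twice the same function, so the factor [rho] is pulled out first and then
   recombined into [rho M_0 <= a]. *)
have -> : forcing g t = (fun x => (rho (g t))%:C * advec m (g t) (g t) x).
  by apply/funext => x; rewrite /forcing -advecZ ?rho_gt0.
have ma := cmeas_advec mm mg mg.
rewrite momentZ ?(ltW (rho_gt0 _))//.
apply: (@le_trans _ _ ((rho (g t))%:E * ((2 * cF)%:E * (moment 0 (g t) * moment 2 (g t))))%E).
  by rewrite lee_wpmul2l ?lee_fin ?(ltW (rho_gt0 _))//; exact: moment1_advec.
rewrite muleCA [(2 * cF * a)%:E]EFinM -muleA lee_wpmul2l ?lee_fin ?mulr_ge0 ?(ltW c0)//.
rewrite muleA lee_wpmul2r ?moment_ge0//.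
by rewrite -[moment 0 _]fineK ?(moment_fin (good_0 gg t0))// -EFinM lee_fin rho_moment.
Qed.

Lemma trim0_forcing g t : good g -> (trim 0 (forcing g) t <= (cF * a)%:E * trim 1 g t)%E.
Proof.
move=> gg; apply: trim_leM; [exact: ltW|exact: good_meas|].
by move=> s; exact: moment0_forcing.
Qed.

Lemma trim1_forcing g t : good g -> (trim 1 (forcing g) t <= (2 * cF * a)%:E * trim 2 g t)%E.
Proof.
move=> gg; apply: trim_leM; [by rewrite !mulr_ge0 ?(ltW c0) ?(ltW a_gt0)|exact: good_meas|].
by move=> s; exact: moment1_forcing.
Qed.

Lemma trim0_forcing_fin g t : good g -> 0 <= t -> (trim 0 (forcing g) t < +oo)%E.
Proof.
move=> gg t0; apply: le_lt_trans (trim0_forcing t gg) _.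
apply: (@le_lt_trans _ _ ((cF * a)%:E * b%:E)%E); last by rewrite -EFinM ltry.
by rewrite lee_wpmul2l ?lee_fin ?(ltW ca_gt0)//; exact: good_tri1.
Qed.

Lemma good_Phi g : good g -> good (Phi g).
Proof.
move=> gg; have mg := good_meas gg; have mf := cmeas_forcing mg.
have E0 t : 0 <= t -> (moment 0 (Phi g t) + trim 1 (Phi g) t <= b%:E)%E.
  move=> t0; apply: le_trans (moment_duh 0 mg0 mf t0) _; rewrite -bE EFinD.
  apply: leeD => //; apply: le_trans (trim0_forcing t gg) _.
  by rewrite [(_ * b)%:E]EFinM lee_wpmul2l ?lee_fin ?(ltW ca_gt0)//; exact: good_tri1.
have E1 t : 0 <= t -> (moment 1 (Phi g t) + trim 2 (Phi g) t <= K%:E)%E.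
  move=> t0; apply: le_trans (moment_duh 1 mg0 mf t0) _; rewrite -KE EFinD.
  apply: leeD => //; apply: le_trans (trim1_forcing t gg) _.
  rewrite [(_ * K)%:E]EFinM lee_wpmul2l ?lee_fin ?mulr_ge0 ?(ltW c0) ?(ltW a_gt0)//.
  exact: good_tri2.
split.
- exact: cmeas_duh.
- move=> t t0; apply: hermitian_duh => // s s0.
  have hs := good_herm gg s0; have ms := cmeas_slice s mg.
  apply: hermitian_advec => //; first exact: cmeas_scaled.
  by move=> x; rewrite /scaled hs conjcM conjcR.
- by move=> t t0; apply: le_trans (E0 t t0); rewrite leeDl// trim_ge0.
- by move=> t t0; apply: le_trans (E1 t t0); rewrite leeDl// trim_ge0.
- by move=> t t0; apply: le_trans (E0 t t0); rewrite leeDr// moment_ge0.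
- by move=> t t0; apply: le_trans (E1 t t0); rewrite leeDr// moment_ge0.
Qed.

(* [scaled] is a retraction onto the ball of radius [a]. *)
Lemma scaled_lipschitz h k : cmeas h -> cmeas k -> moment 0 h \is a fin_num ->
  moment 0 k \is a fin_num ->
  (moment 0 (fun x => scaled h x - scaled k x)%R <= 2%:E * moment 0 (fun x => h x - k x)%R)%E.
Proof.
move=> mh mk fh fk; have mhk : cmeas (fun x => h x - k x) by meas.
have ph := rho_gt0 h.
have fd : moment 0 (fun x => h x - k x) \is a fin_num.
  rewrite ge0_fin_numE ?moment_ge0//; apply: le_lt_trans (momentB 0 mh mk) _.
  by rewrite lte_add_pinfty// -ge0_fin_numE ?moment_ge0.
have tri1 : (moment 0 h <= moment 0 (fun x => h x - k x)%R + moment 0 k)%E.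
  apply: le_trans (momentD 0 mhk mk); rewrite /moment; apply: le_int => x.
    by rewrite lee_fin mulr_ge0 ?nc_ge0 ?exprn_ge0.
  by rewrite subrK.
have tri2 : (moment 0 k <= moment 0 (fun x => h x - k x)%R + moment 0 h)%E.
  apply: (@le_trans _ _ (moment 0 (fun x => h x - (h x - k x))%R)).
    rewrite /moment; apply: le_int => x; first by rewrite lee_fin mulr_ge0 ?nc_ge0 ?exprn_ge0.
    by rewrite opprB addrC subrK.
  by rewrite addeC; exact: momentB.
have E : (fun x => scaled h x - scaled k x) =
    (fun x => (rho h)%:C * (h x - k x) + (rho h - rho k)%:C * k x).
  by apply/funext => x; rewrite /scaled RCB mulrBr mulrBl addrA subrK.
have m1 : cmeas (fun x => (rho h)%:C * (h x - k x)) by meas.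
have m2 : cmeas (fun x => (rho h - rho k)%:C * k x) by meas.
rewrite E; apply: le_trans (momentD 0 m1 m2) _.
rewrite momentZ ?(ltW ph)//.
have -> : moment 0 (fun x => (rho h - rho k)%:C * k x) = (`|rho h - rho k|%:E * moment 0 k)%E.
  rewrite -momentZ//; apply: eq_integral => x _; congr (_ * _)%:E.
  by rewrite !ncM !nc_real normr_id.
move: tri1 tri2; rewrite -(fineK fd) -(fineK fh) -(fineK fk).
rewrite -!EFinM -!EFinD !lee_fin.
have := rho_le1 h; rewrite /rho.
have := fine_ge0 (moment_ge0 0 h); have := fine_ge0 (moment_ge0 0 k).
have := fine_ge0 (moment_ge0 0 (fun x => h x - k x)).
move: (fine (moment 0 (fun x => _))) (fine (moment 0 h)) (fine (moment 0 k)) => d x y d0 y0 x0.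
move=> r1 xy yx.
(* With [p] and [q] the two denominators, the term in [rho h - rho k] is [(a / p) |q - p| (y / q)].
   The map [max a] is 1-Lipschitz, so this is at most [d]; so is the other term, whence the constant
   2. *)
set p := Num.max a x; set q := Num.max a y.
have p0 : 0 < p := max_gt0 x; have q0 : 0 < q := max_gt0 y.
have ap : a <= p by rewrite le_max lexx.
have yq : y <= q by rewrite le_max lexx orbT.
have qp : `|q - p| <= d.
  rewrite ler_norml /p /q; apply/andP; split.
    by rewrite lerBrDr; case: (leP a x) => _; case: (leP a y); lra.
  by rewrite lerBlDr; case: (leP a y) => _; case: (leP a x); lra.
have -> : a / p - a / q = a / p * ((q - p) / q) by field; rewrite !gt_eqF.
have ap1 : a / p <= 1 by rewrite ler_pdivrMr// mul1r.
have ap0 : 0 <= a / p by rewrite divr_ge0 ?(ltW a_gt0)// ltW.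
rewrite normrM (ger0_norm ap0) normrM normfV (gtr0_norm q0).
have B1 : a / p * d <= d by rewrite ler_piMl.
have yq1 : y / q <= 1 by rewrite ler_pdivrMr// mul1r.
have yq0 : 0 <= y / q by rewrite divr_ge0 ?(ltW q0).
have -> : a / p * (`|q - p| / q) * y = (a / p) * (`|q - p| * (y / q)) by ring.
have B2 : `|q - p| * (y / q) <= d by apply: le_trans qp; rewrite ler_piMr.
have B3 : (a / p) * (`|q - p| * (y / q)) <= d.
  by apply: le_trans B2; rewrite ler_piMl// mulr_ge0.
by rewrite mulr_natl mulr2n lerD.
Qed.

Lemma moment0_forcingB g1 g2 t : good g1 -> good g2 -> 0 <= t ->
  (moment 0 (fun x => forcing g1 t x - forcing g2 t x)%R <=
   (2 * cF * K)%:E * moment 0 (fun x => g1 t x - g2 t x)%R +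
   (cF * a)%:E * moment 1 (fun x => g1 t x - g2 t x)%R)%E.
Proof.
move=> G1 G2 t0; have m1 := cmeas_slice t (good_meas G1); have m2 := cmeas_slice t (good_meas G2).
have f1 := moment_fin (good_0 G1 t0); have f2 := moment_fin (good_0 G2 t0).
have L g (mg : cmeas g) : moment 0 g \is a fin_num -> cL1 (scaled g).
  move=> fg; split; first exact: cmeas_scaled.
  by rewrite -moment0; apply: le_lt_trans (moment0_scaled mg fg) _; exact: ltry.
have L' g : good g -> cL1 (ixi (g t)).
  move=> G; apply: cL1_ixi; first exact: cmeas_slice t (good_meas G).
  by apply: le_lt_trans (good_1 G t0) _; exact: ltry.
have B := moment0_advecB mm m_ge0 m_le1 (L _ m1 f1) (L _ m2 f2) (L' _ G1) (L' _ G2) m1 m2.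
apply: le_trans B _.
rewrite (ge0_muleDr _ (mule_ge0 _ _)) ?mule_ge0 ?moment_ge0//; apply: leeD.
  have -> : (2 * cF * K)%:E = (cF%:E * (2%:E * K%:E))%E by rewrite -!EFinM; congr (_%:E); ring.
  rewrite -muleA lee_wpmul2l ?lee_fin ?(ltW c0)// muleAC.
  apply: (@le_trans _ _ (2%:E * moment 0 (fun x => g1 t x - g2 t x)%R * moment 1 (g1 t))%E).
    by rewrite lee_wpmul2r ?moment_ge0//; exact: scaled_lipschitz.
  by rewrite lee_wpmul2l ?mule_ge0 ?moment_ge0//; exact: good_1.
rewrite [(cF * a)%:E]EFinM -muleA lee_wpmul2l ?lee_fin ?(ltW c0)// lee_wpmul2r ?moment_ge0//.
exact: moment0_scaled.
Qed.

(** Large enough that the coefficient [2 cF K] of [M_0] in [moment0_forcingB] is at most [lam / 2].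
    The coefficient [cF a] of [M_1] is below [1/2] by smallness alone, and no choice of weight would
    improve it. *)
Let lam := 4 * cF * K + 1.
Let lam_gt0 : 0 < lam.
Proof. by apply: ltr_pwDr => //; apply: mulr_ge0 => //; apply: mulr_ge0 => //; exact: ltW. Qed.
Let w (t : R) : R := \1_(`[0, +oo[%classic) t * expR (- (t * lam)).
Let w_ge0 t : 0 <= w t. Proof. by rewrite mulr_ge0 ?expR_ge0. Qed.
Let mw : measurable_fun setT w.
Proof. by rewrite /w; meas; first [exact: measurable_itv|exact: measurable_indic]. Qed.
Let X := total w lam.

(** [weighted_bound] with [k = lam] bounds the left-hand side by the weighted integral of [M_0] of
    the difference of forcings, which [moment0_forcingB] compares with half of the energy. *)
Lemma Phi_contraction g1 g2 : good g1 -> good g2 ->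
  (X (fun t x => Phi g1 t x - Phi g2 t x)%R <= 2^-1%:E * X (fun t x => g1 t x - g2 t x)%R)%E.
Proof.
move=> G1 G2; have m1 := good_meas G1; have m2 := good_meas G2.
have mf1 := cmeas_forcing m1; have mf2 := cmeas_forcing m2.
have md : cmeas (fun z : R * R => g1 z.1 z.2 - g2 z.1 z.2) by meas.
have mp1 := cmeas_duh mg0 mf1; have mp2 := cmeas_duh mg0 mf2.
have mD : cmeas (fun z : R * R => Phi g1 z.1 z.2 - Phi g2 z.1 z.2) := cmeasB mp1 mp2.
have mF : cmeas (fun z : R * R => forcing g1 z.1 z.2 - forcing g2 z.1 z.2) by meas.
pose D t x := Phi g1 t x - Phi g2 t x; pose d t x := g1 t x - g2 t x.
pose F t x := forcing g1 t x - forcing g2 t x.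
have M0 := measurable_moment 0 (z := D) mD; have M1 := measurable_moment 1 (z := D) mD.
have N0 := measurable_moment 0 (z := F) mF.
have n0 := measurable_moment 0 (z := d) md; have n1 := measurable_moment 1 (z := d) md.
have B := weighted_bound lam_gt0 M0 M1 N0 (fun t => moment_ge0 0 (D t)) (fun t => moment_ge0 1 (D t))
  (fun t => moment_ge0 0 (F t)).
have {}B := B (fun t t0 => moment_duhB 0 mg0 mf1 mf2 t0 (trim0_forcing_fin G1 t0) (trim0_forcing_fin G2 t0)).
have XE z : X z = (\int[mu]_t ((w t)%:E * energy lam z t))%E by [].
have -> : X D = (\int[mu]_t ((\1_(`[0, +oo[%classic) t * (lam * expR (- (t * lam))))%:E * moment 0 (D t)) +
   \int[mu]_s ((\1_(`[0, +oo[%classic) s * expR (- (s * lam)))%:E * moment 1 (D s)))%E.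
  have mw' : measurable_fun setT (fun t => (w t)%:E) by exact: measurable_EFin.
  have mwl : measurable_fun setT (fun t : R => (\1_(`[0, +oo[%classic) t * (lam * expR (- (t * lam))))%:E).
    by meas; first [exact: measurable_itv|exact: measurable_indic].
  rewrite XE -ge0_integralD//; last 4 first.
  - by move=> t _; rewrite mule_ge0 ?moment_ge0// lee_fin !mulr_ge0 ?expR_ge0 ?(ltW lam_gt0).
  - exact: emeasurable_funM.
  - by move=> t _; rewrite mule_ge0 ?moment_ge0// lee_fin w_ge0.
  - exact: emeasurable_funM.
  apply: eq_integral => t _; rewrite /energy ge0_muleDr ?mule_ge0 ?moment_ge0 ?lee_fin ?(ltW lam_gt0)//.
  by rewrite muleA -EFinM /w -mulrA [expR _ * _]mulrC.
apply: le_trans B _.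
rewrite XE -ge0_integralZl_EFin//; last 2 first.
- by move=> t _; rewrite mule_ge0 ?energy_ge0// lee_fin w_ge0.
- by apply: emeasurable_funM; [exact: measurable_EFin|exact: measurable_energy].
apply: le_int => t; first by rewrite mule_ge0 ?moment_ge0// lee_fin w_ge0.
rewrite muleCA; have [t0|t0] := leP 0 t; last first.
  by rewrite /w indic_ge0E (lt_geF t0) !mul0r !mul0e.
rewrite lee_wpmul2l ?lee_fin ?w_ge0//; apply: le_trans (moment0_forcingB G1 G2 t0) _.
have L0 : (0 <= lam%:E * moment 0 (d t))%E.
  by apply: mule_ge0; [rewrite lee_fin ltW|exact: moment_ge0].
rewrite /energy (ge0_muleDr _ L0 (moment_ge0 1 (d t))).
apply: leeD; last by rewrite lee_wpmul2r ?moment_ge0// lee_fin ltW.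
rewrite muleA -EFinM lee_wpmul2r ?moment_ge0// lee_fin /lam.
have := K_ge0; have := c0; nra.
Qed.

Lemma good_zero : good (fun _ _ => 0).
Proof.
have Z n : moment n (fun=> 0 : R[i]) = 0%E.
  by rewrite /moment; under eq_integral do rewrite nc0 mulr0; rewrite integral0.
have T n t : trim n (fun _ _ => 0 : R[i]) t = 0%E.
  by rewrite /trim; under eq_integral do rewrite Z mule0; rewrite integral0.
split => //.
- by move=> t _ x; rewrite rmorph0.
- by move=> t _; rewrite Z lee_fin.
- by move=> t _; rewrite Z lee_fin.
- by move=> t _; rewrite T lee_fin.
- by move=> t _; rewrite T lee_fin.
Qed.

Let u n := iter n Phi (fun _ _ => 0).

Let good_u n : good (u n).
Proof. by elim: n => [|n IH]; [exact: good_zero|exact: good_Phi]. Qed.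

Let C0 := b + K.

Let total_u1 : (X (fun t x => u 1 t x - u 0 t x)%R <= C0%:E)%E.
Proof.
have G := good_u 1%N; have mG := good_meas G.
have E t : energy lam (fun t x => u 1 t x - u 0 t x) t = energy lam (u 1) t.
  by rewrite /energy; congr (_ * _ + _)%E; apply: eq_integral => x _; rewrite subr0.
rewrite /X /total; under eq_integral do rewrite E.
have mw' : measurable_fun setT (fun t : R => \1_(`[0, +oo[%classic) t * (lam * expR (- (t * lam)))).
  by meas; first [exact: measurable_itv|exact: measurable_indic].
have w0' t : 0 <= \1_(`[0, +oo[%classic) t * (lam * expR (- (t * lam))).
  by rewrite !mulr_ge0 ?expR_ge0 ?(ltW lam_gt0).
apply: (@le_trans _ _ (\int[mu]_t (C0 * (\1_(`[0, +oo[%classic) t * (lam * expR (- (t * lam)))))%:E)%E).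
  apply: le_int => t.
    by apply: mule_ge0; [rewrite lee_fin w_ge0|exact: energy_ge0].
  have [t0|t0] := leP 0 t; last by rewrite /w indic_ge0E (lt_geF t0) !mul0r mulr0 mul0e.
  have -> : C0 * (\1_(`[0, +oo[%classic) t * (lam * expR (- (t * lam)))) = w t * (lam * C0).
    by rewrite /w; ring.
  rewrite [leRHS]EFinM lee_wpmul2l ?lee_fin ?w_ge0// /energy mulrDr [leRHS]EFinD; apply: leeD.
    by rewrite [leRHS]EFinM lee_wpmul2l ?lee_fin ?(ltW lam_gt0)//; exact: good_0.
  apply: le_trans (good_1 G t0) _; rewrite lee_fin ler_peMl// /lam lerDr.
  by apply: mulr_ge0 => //; apply: mulr_ge0 => //; exact: ltW.
rewrite intZ ?addr_ge0// integral_expN_half// mule1//.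
Qed.

Let C0_ge0 : 0 <= C0. Proof. exact: addr_ge0. Qed.

Let total_u n : (X (fun t x => u n.+1 t x - u n t x)%R <= (C0 * 2^-1 ^+ n)%:E)%E.
Proof.
elim: n => [|n IH]; first by rewrite expr0 mulr1; exact: total_u1.
apply: le_trans (Phi_contraction (good_u n.+1) (good_u n)) _.
apply: (@le_trans _ _ (2^-1%:E * (C0 * 2^-1 ^+ n)%:E)%E); first by rewrite lee_wpmul2l// lee_fin.
by rewrite -EFinM lee_fin exprS mulrCA.
Qed.

Let w_gt0 t : 0 <= t -> 0 < w t.
Proof. by move=> t0; rewrite /w indic_ge0E t0 mul1r expR_gt0. Qed.

Let m_u n : cmeas (fun z : R * R => u n z.1 z.2) := good_meas (good_u n).
Let g := glim u lam.
Let mg : cmeas (fun z : R * R => g z.1 z.2).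
Proof. exact: cmeas_glim. Qed.

Let gP := glimP m_u lam_gt0.

Let moment_indic n k t : (moment n (fun x => (\1_(conv_times u lam) t)%:C * u k t x)%R <= moment n (u k t))%E.
Proof.
apply: le_int => x; first by rewrite lee_fin mulr_ge0 ?nc_ge0 ?exprn_ge0.
by rewrite lee_fin ler_wpM2l ?exprn_ge0// ncM nc_real ger0_norm// ler_piMl ?nc_ge0// indicE lern1 leq_b1.
Qed.

(** Fatou's lemma in frequency. At the times outside [conv_times] the iterates are replaced by 0, so
    the bound passes to the limit at every time. *)
Let moment_g n t (z : nat -> \bar R) : (forall k, (moment n (u k t) <= z k)%E) ->
  (moment n (g t) <= limn_einf z)%E.
Proof.
move=> H; apply: (@le_trans _ _ (limn_einf (fun k => moment n (fun x => (\1_(conv_times u lam) t)%:C * u k t x)%R))).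
  apply: fatou_moment.
  - by move=> k; have m1 := cmeas_slice t (m_u k); meas.
  - exact: cmeas_slice t mg.
  - exact: gP.
rewrite !limn_einf_lim; apply: lee_lim; [exact: is_cvg_einfs|exact: is_cvg_einfs|].
apply: nearW => k; apply/ereal_infP => _ [j /= kj <-].
apply: le_trans (H j); apply: le_trans (moment_indic n j t); apply: ereal_inf_lbound.
by exists j.
Qed.

Let good_g : good g.
Proof.
have B n t c : (forall k, (moment n (u k t) <= c)%E) -> (moment n (g t) <= c)%E.
  by move=> H; apply: le_trans (moment_g H) _; exact: limn_einf_le.
have T n t c : (forall k, (trim n (u k) t <= c)%E) -> (trim n g t <= c)%E.
  move=> H; apply: le_trans (limn_einf_le H); apply: fatou_ae.
  - by move=> k; apply: measurable_triM; exact: measurable_moment (m_u k).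
  - by apply: measurable_triM; exact: measurable_moment mg.
  - by move=> k s; rewrite mule_ge0 ?moment_ge0// lee_fin tri_ge0.
  - by move=> s; rewrite mule_ge0 ?moment_ge0// lee_fin tri_ge0.
  apply: aeT => s; rewrite triE; case: (0 <= s <= t).
    by under [X in (_ <= limn_einf X)%E]funext do rewrite mul1e; rewrite mul1e; exact: moment_g.
  rewrite mul0e limn_einf_lim; apply: lime_ge; first exact: is_cvg_einfs.
  by apply: nearW => n'; apply/ereal_infP => _ [k /= _ <-]; rewrite mul0e.
split.
- exact: mg.
- by move=> t t0; apply: hermitian_glim => // k; exact: good_herm (good_u k) _ t0.
- by move=> t t0; apply: B => k; exact: good_0 (good_u k) _ t0.
- by move=> t t0; apply: B => k; exact: good_1 (good_u k) _ t0.
- by move=> t t0; apply: T => k; exact: good_tri1 (good_u k) _ t0.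
- by move=> t t0; apply: T => k; exact: good_tri2 (good_u k) _ t0.
Qed.

Let X_triangle (z1 z2 z3 : R -> R -> R[i]) : cmeas (fun z : R * R => z1 z.1 z.2) ->
  cmeas (fun z : R * R => z2 z.1 z.2) -> cmeas (fun z : R * R => z3 z.1 z.2) ->
  (X (fun t x => z1 t x - z3 t x)%R <= X (fun t x => z1 t x - z2 t x)%R + X (fun t x => z2 t x - z3 t x)%R)%E.
Proof.
move=> m1 m2 m3.
have m12 : cmeas (fun z : R * R => z1 z.1 z.2 - z2 z.1 z.2) by meas.
have m23 : cmeas (fun z : R * R => z2 z.1 z.2 - z3 z.1 z.2) by meas.
have mE := measurable_energy lam; have mw' := measurable_EFin mw.
have E0 z t : (0 <= (w t)%:E * energy lam z t)%E.
  by apply: mule_ge0; [rewrite lee_fin w_ge0|exact: energy_ge0].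
rewrite /X /total -ge0_integralD//; last 2 first.
- by apply: emeasurable_funM => //; exact: (mE _ m12).
- by apply: emeasurable_funM => //; exact: (mE _ m23).
apply: le_int => t; first exact: E0.
rewrite -ge0_muleDr ?energy_ge0// lee_wpmul2l ?lee_fin ?w_ge0// /energy addeACA.
have D n : (moment n (fun x => z1 t x - z3 t x)%R <= moment n (fun x => z1 t x - z2 t x)%R +
    moment n (fun x => z2 t x - z3 t x)%R)%E.
  have s12 := cmeas_slice (F := fun t x => z1 t x - z2 t x) t m12.
  have s23 := cmeas_slice (F := fun t x => z2 t x - z3 t x) t m23.
  apply: le_trans (momentD n s12 s23); apply: le_int => x.
    by rewrite lee_fin mulr_ge0 ?nc_ge0 ?exprn_ge0.
  by rewrite addrA subrK.
apply: leeD; last exact: D.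
rewrite -ge0_muleDr ?moment_ge0//; apply: lee_wpmul2l; [by rewrite lee_fin ltW|exact: D].
Qed.

(** The subtracted term is the remainder of the geometric series; with it the induction on [k]
    closes exactly. *)
Let X_tail n k : (X (fun t x => u n t x - u (n + k) t x)%R <= (2 * C0 * 2^-1 ^+ n - 2 * C0 * 2^-1 ^+ (n + k))%:E)%E.
Proof.
elim: k => [|k IH].
  rewrite addn0 subrr /X /total; under eq_integral => t _.
    rewrite (_ : energy _ _ _ = 0%E) ?mule0; last first.
      rewrite /energy /moment; under eq_integral do rewrite subrr nc0 mulr0.
      by under [X in (_ + X)%E]eq_integral do rewrite subrr nc0 mulr0; rewrite integral0 mule0 adde0.
    over.
  by rewrite integral0.
apply: le_trans (X_triangle (m_u n) (m_u (n + k)) (m_u (n + k.+1))) _.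
have S : (X (fun t x => u (n + k) t x - u (n + k.+1) t x)%R <= (C0 * 2^-1 ^+ (n + k))%:E)%E.
  apply: le_trans (total_u (n + k)); rewrite addnS; apply: le_int => t.
    by apply: mule_ge0; [rewrite lee_fin w_ge0|exact: energy_ge0].
  rewrite lee_wpmul2l ?lee_fin ?w_ge0// /energy.
  have M j : moment j (fun x => u (n + k) t x - u (n + k).+1 t x) = moment j (fun x => u (n + k).+1 t x - u (n + k) t x).
    by apply: eq_integral => x _; rewrite ncBC.
  by rewrite !M.
apply: le_trans (leeD IH S) _; rewrite -EFinD lee_fin addnS exprS.
by rewrite le_eqVlt; apply/orP; left; apply/eqP; field.
Qed.

(** Fatou's lemma, in frequency at almost every time and then in time, applied to [u n - u (n + k)]
    as [k] grows. *)
Let X_limit n : (X (fun t x => u n t x - g t x)%R <= (2 * C0 * 2^-1 ^+ n)%:E)%E.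
Proof.
have md k : cmeas (fun z : R * R => u n z.1 z.2 - u (n + k) z.1 z.2).
  by have h1 := m_u n; have h2 := m_u (n + k); meas.
have md' : cmeas (fun z : R * R => u n z.1 z.2 - g z.1 z.2) by have h1 := m_u n; meas.
apply: (@le_trans _ _ (limn_einf (fun k => X (fun t x => u n t x - u (n + k) t x)%R))); last first.
  apply: limn_einf_le => k; apply: le_trans (X_tail n k) _.
  by rewrite lee_fin gerBl !mulr_ge0// exprn_ge0.
have mE := measurable_energy lam; have mw' := measurable_EFin mw.
apply: fatou_ae.
- by move=> k; apply: emeasurable_funM => //; exact: (mE _ (md k)).
- by apply: emeasurable_funM => //; exact: (mE _ md').
- by move=> k t; apply: mule_ge0; [rewrite lee_fin w_ge0|exact: energy_ge0].
- by move=> t; apply: mule_ge0; [rewrite lee_fin w_ge0|exact: energy_ge0].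
have CT := glim_ae m_u mw w_ge0 w_gt0 lam_gt0 C0_ge0 total_u.
apply: aeS CT => t ct; have [t0|t0] := leP 0 t; last first.
  rewrite /w indic_ge0E (lt_geF t0) mul0r mul0e limn_einf_lim.
  apply: lime_ge; first exact: is_cvg_einfs.
  by apply: nearW => n'; apply/ereal_infP => _ [k /= _ <-]; rewrite mul0e.
rewrite (wenergyE w_ge0 lam_gt0 t md').
have -> : (fun k => (w t)%:E * energy lam (fun t x => u n t x - u (n + k)%N t x)%R t)%E =
  (fun k => \int[mu]_x ((w t * (lam + `|x|)) * nc (u n t x - u (n + k)%N t x))%R%:E)%E.
  by apply/funext => k; rewrite (wenergyE w_ge0 lam_gt0 t (md k)).
apply: (fatou_weight (z := fun k x => u n t x - u (n + k) t x)).
- by meas.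
- by move=> x; apply: mulr_ge0; [exact: w_ge0|apply: addr_ge0 => //; exact: ltW].
- by move=> k; exact: (cmeas_slice (F := fun t x => u n t x - u (n + k) t x) t (md k)).
- exact: (cmeas_slice (F := fun t x => u n t x - g t x) t md').
apply: aeS (gP t) => x; rewrite (ct t0) => h.
have E k : nc (u n t x - u (n + k) t x - (u n t x - g t x)) = nc (1%:C * u (n + k) t x - g t x).
  have P (p q r : R[i]) : p - q - (p - r) = r - q by rewrite opprB addrC addrA subrK.
  by rewrite mul1r P ncBC.
move: h; rewrite -(cvg_shiftn n) => h.
rewrite (_ : (fun k => _) = [sequence nc (1%:C * u (k + n)%N t x - g t x)]_k); first exact: h.
by apply/funext => k /=; rewrite E addnC.
Qed.

(** Both [Phi g - u (n + 1)], by contraction, and [u (n + 1) - g] have size at most [C0 / 2^n], for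
    every [n]. *)
Let X_fixed : X (fun t x => Phi g t x - g t x)%R = 0%E.
Proof.
have mPg : cmeas (fun z : R * R => Phi g z.1 z.2) := good_meas (good_Phi good_g).
have X0 : (0 <= X (fun t x => Phi g t x - g t x)%R)%E.
  by apply: integral_ge0 => t _; apply: mule_ge0; [rewrite lee_fin w_ge0|exact: energy_ge0].
have B n : (X (fun t x => Phi g t x - g t x)%R <= (2 * C0 * 2^-1 ^+ n)%:E)%E.
  apply: le_trans (X_triangle mPg (m_u n.+1) mg) _.
  have S : X (fun t x => g t x - u n t x)%R = X (fun t x => u n t x - g t x)%R.
    apply: eq_integral => t _; congr (_ * (_ * _ + _))%E; apply: eq_integral => x _;
      by rewrite ncBC.
  have T1 : (X (fun t x => Phi g t x - u n.+1 t x)%R <= 2^-1%:E * (2 * C0 * 2^-1 ^+ n)%:E)%E.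
    apply: le_trans (Phi_contraction good_g (good_u n)) _.
    by rewrite lee_wpmul2l ?lee_fin// S; exact: X_limit.
  apply: le_trans (leeD T1 (X_limit n.+1)) _.
  by rewrite -EFinM -EFinD lee_fin exprS le_eqVlt; apply/orP; left; apply/eqP; field.
have fX : X (fun t x => Phi g t x - g t x)%R \is a fin_num.
  by rewrite ge0_fin_numE//; apply: le_lt_trans (B 0%N) _; exact: ltry.
rewrite -(fineK fX); congr EFin; apply/eqP; rewrite eq_le (fine_ge0 X0) andbT.
have cv : 2 * C0 * 2^-1 ^+ n @[n --> \oo] --> (0 : R).
  apply: (@cvg_geometric R (2 * C0) 2^-1).
  by rewrite ger0_norm// invf_lt1// ltr1n.
apply: (cvgr_to_ge cv); apply: nearW => n.
by rewrite -lee_fin fineK.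
Qed.

Let fixed_ae : {ae mu, forall t : R, 0 <= t -> {ae mu, forall x : R, Phi g t x = g t x}}.
Proof.
have mPg : cmeas (fun z : R * R => Phi g z.1 z.2) := good_meas (good_Phi good_g).
have md : cmeas (fun z : R * R => Phi g z.1 z.2 - g z.1 z.2) := cmeasB mPg mg.
have mE := measurable_energy lam (z := fun t x => Phi g t x - g t x) md; have mw' := measurable_EFin mw.
have p0 t : (0 <= (w t)%:E * energy lam (fun t x => Phi g t x - g t x)%R t)%E.
  by apply: mule_ge0; [rewrite lee_fin w_ge0|exact: energy_ge0].
apply: aeS (int0_ae (emeasurable_funM mw' mE) p0 X_fixed).
move=> t /eqP; rewrite mule_eq0 => h t0.
have {h} : energy lam (fun t x => Phi g t x - g t x) t = 0%E.
  by case/orP: h => /eqP // [] /eqP; rewrite gt_eqF// w_gt0.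
move=> /eqP; rewrite padde_eq0 ?mule_ge0 ?moment_ge0// ?lee_fin ?(ltW lam_gt0)//.
rewrite mule_eq0 eqe (gt_eqF lam_gt0) /= moment0 => /andP[/eqP h _].
have mds := measurable_nc (cmeas_slice (F := fun t x => Phi g t x - g t x) t md).
have := int_ae_eq0 mds (fun x => nc_ge0 _) h.
by apply: aeS => x /nc_eq0 /eqP; rewrite subr_eq0 => /eqP.
Qed.

Lemma moment_ae n (h k : R -> R[i]) : cmeas h -> cmeas k -> {ae mu, forall x, h x = k x} -> moment n h = moment n k.
Proof.
move=> mh mk e; have mnh := measurable_nc mh; have mnk := measurable_nc mk.
by apply: ae_eq_integral => //; [by meas|by meas|apply: aeS e => x -> _].
Qed.

Lemma advec_ae (h1 h2 k1 k2 : R -> R[i]) x : cmeas h1 -> cmeas h2 -> cmeas k1 -> cmeas k2 ->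
  {ae mu, forall x, h1 x = h2 x} -> {ae mu, forall x, k1 x = k2 x} ->
  advec m h1 k1 x = advec m h2 k2 x.
Proof.
move=> m1 m2 m3 m4 e1 e2; congr (- (_ * _)); apply: cintegral_ae.
- apply: cmeasM; last exact: cmeas_ixi.
  by apply: (cmeas_comp (h := fun y : R => x - y) (cmeas_mult mm m1)); meas.
- apply: cmeasM; last exact: cmeas_ixi.
  by apply: (cmeas_comp (h := fun y : R => x - y) (cmeas_mult mm m2)); meas.
by apply: aeS (aeI (ae_reflect x e1) e2) => y [E1 E2]; rewrite /mult /ixi E1 E2.
Qed.

Lemma forcing_ae (h1 h2 : R -> R -> R[i]) t x : cmeas (h1 t) -> cmeas (h2 t) -> {ae mu, forall x, h1 t x = h2 t x} ->
  forcing h1 t x = forcing h2 t x.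
Proof.
move=> m1 m2 e; rewrite /forcing; apply: advec_ae => //; [exact: cmeas_scaled|exact: cmeas_scaled|].
by have E2 := moment_ae 0 m1 m2 e; apply: aeS e => y E; rewrite /scaled E /rho E2.
Qed.

Lemma duh_ae (F1 F2 : R -> R -> R[i]) t x : cmeas (fun z : R * R => F1 z.1 z.2) ->
  cmeas (fun z : R * R => F2 z.1 z.2) -> {ae mu, forall s : R, 0 <= s -> F1 s x = F2 s x} ->
  duh g0 F1 t x = duh g0 F2 t x.
Proof.
move=> m1 m2 e; rewrite /duh /sduh; congr (_ + _); apply: cintegral_ae.
- by have mT := measurable_tri1 t; have mF := cmeas_swap_slice x m1; meas.
- by have mT := measurable_tri1 t; have mF := cmeas_swap_slice x m2; meas.
apply: aeS e => s hs; have [s0|s0] := leP 0 s; last by rewrite triE (lt_geF s0) !mul0r.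
by rewrite hs.
Qed.

(** The limit [g] equals [Phi g] only almost everywhere. Since [Phi] does not see null sets, [Phi g]
    is a fixed point at every time and frequency. *)
Lemma picard_fixed_point : exists2 z, good z & forall t x, z t x = Phi z t x.
Proof.
have mPg : cmeas (fun z : R * R => Phi g z.1 z.2) := good_meas (good_Phi good_g).
exists (Phi g); first exact: good_Phi.
move=> t x; apply: duh_ae; [exact: cmeas_forcing|exact: cmeas_forcing|].
apply: aeS fixed_ae => s hs s0.
apply: forcing_ae; [exact: cmeas_slice s mg|exact: cmeas_slice s mPg|].
by apply: aeS (hs s0) => y ->.
Qed.

End picard.

Section fourier_existence.
Context {R : realType} (m : R -> R).
Hypotheses (mm : measurable_fun setT m) (m_ge0 : forall x, 0 <= m x)
  (m_le1 : forall x, m x <= 1) (m_even : forall x, m (- x) = m x).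
Variable g0 : R -> R[i].
Hypotheses (mg0 : cmeas g0) (hg0 : hermitian g0) (g0_1 : (moment 1 g0 < +oo)%E)
  (g0_0 : (moment 0 g0 < +oo)%E) (small : 2 * cF * fine (moment 0 g0) < 1).

Let a0 := fine (moment 0 g0).

(** Finiteness of the dissipation [T] is what allows [k T] to be subtracted from both sides. *)
Lemma ee_absorb (x T A : \bar R) (k : R) : (0 <= T)%E -> (T < +oo)%E ->
  (x + T <= A + k%:E * T)%E -> (x + (1 - k)%:E * T <= A)%E.
Proof.
move=> T0 Tf; have : T \is a fin_num by rewrite ge0_fin_numE.
case: T T0 Tf => // T _ _ _; case: x => [x||]; case: A => [A||]//=.
- by rewrite -!EFinM -!EFinD !lee_fin; lra.
- by move=> _; rewrite leey.
- by move=> _; rewrite -!EFinM leNye.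
Qed.

Lemma fourier_existence : exists g : R -> R -> R[i],
  [/\ cmeas (fun z : R * R => g z.1 z.2),
      (forall t, 0 <= t -> hermitian (g t)),
      (forall t x, g t x = duh g0 (fun s => advec m (g s) (g s)) t x),
      (forall t, 0 <= t -> (moment 0 (g t) <= moment 0 g0)%E) &
      (forall t, 0 <= t -> [/\ (trim 1 g t < +oo)%E, (trim 2 g t < +oo)%E &
        (moment 0 (g t) + moment 1 (g t) +
         (1 - 2 * cF * fine (moment 0 g0))%:E * (trim 1 g t + trim 2 g t) <=
         moment 0 g0 + moment 1 g0)%E])].
Proof.
have c0 := @cF_gt0 R.
have f0 : moment 0 g0 \is a fin_num by rewrite ge0_fin_numE ?moment_ge0.
have f1 : moment 1 g0 \is a fin_num by rewrite ge0_fin_numE ?moment_ge0.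
have a00 : 0 <= a0 by apply: fine_ge0; exact: moment_ge0.
(* The radius must be positive even for a zero datum; [1 / (4 cF)] is a positive value that still
   satisfies [2 cF a < 1]. *)
pose a := Num.max a0 (4 * cF)^-1.
have aa0 : a0 <= a by rewrite le_max lexx.
have a_gt0 : 0 < a by rewrite lt_max invr_gt0 mulr_gt0// orbT.
have a_small : 2 * cF * a < 1.
  rewrite /a; case: (leP a0 (4 * cF)^-1) => // _.
  by rewrite (_ : _ * _ = 2^-1) ?invf_lt1 ?ltr1n//; field; rewrite gt_eqF.
have g00 : (moment 0 g0 <= a%:E)%E by rewrite -(fineK f0) lee_fin.
have g01 : (moment 1 g0 <= (fine (moment 1 g0))%:E)%E by rewrite fineK.
have [g G gE] := picard_fixed_point mm m_ge0 m_le1 m_even mg0 hg0 a_gt0 a_small g00 g01.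
have mg := good_meas G; have mF := cmeas_forcing mm a_gt0 mg.
have PE : Phi m g0 a g = g by apply/funext => t; apply/funext => x; rewrite -gE.
have t1 t : 0 <= t -> (trim 1 g t < +oo)%E.
  by move=> t0; apply: le_lt_trans (good_tri1 G t0) _; exact: ltry.
have t2 t : 0 <= t -> (trim 2 g t < +oo)%E.
  by move=> t0; apply: le_lt_trans (good_tri2 G t0) _; exact: ltry.
have ca_le1 : cF * a <= 1 by have := mulr_gt0 c0 a_gt0; lra.
(* Not circular: the retraction bounds the forcing by [cF a M_1 g] before anything sharper is known
   of [M_0 g]. *)
have N0 t : 0 <= t -> (moment 0 (g t) <= moment 0 g0)%E.
  move=> t0; have := moment_duh 0 mg0 mF t0; rewrite -/(Phi m g0 a g) PE => H.
  have {}H := ee_absorb (trim_ge0 1 g t) (t1 t t0)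
    (le_trans H (leeD2l _ (trim0_forcing mm m_ge0 m_le1 a_gt0 t G))).
  by apply: le_trans H; rewrite leeDl// mule_ge0 ?trim_ge0// lee_fin subr_ge0.
pose F s := advec m (g s) (g s).
(* By [N0], [g] stays in the ball of radius [a], where [rho] is 1: the fixed point solves the
   original equation. *)
have FE s x : 0 <= s -> forcing m a g s x = F s x.
  move=> s0; rewrite /forcing (_ : scaled a (g s) = g s)//; apply/funext => y.
  by rewrite /scaled rho1 ?mul1r//; apply: le_trans (N0 s s0) g00.
have mF' : cmeas (fun z : R * R => F z.1 z.2) := cmeas_advec_joint mm mg mg.
have gF t x : g t x = duh g0 F t x.
  rewrite {1}gE; apply: duh_ae => //; apply: aeT => s s0; exact: FE.
have gF' : duh g0 F = g by apply/funext => t; apply/funext => x; rewrite -gF.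
have F0 t : (trim 0 F t <= (cF * a0)%:E * trim 1 g t)%E.
  apply: trim_leM => //; first by rewrite mulr_ge0// ltW.
  move=> s s0; have ms := cmeas_slice s mg.
  apply: le_trans (moment0_advec mm m_ge0 m_le1 ms ms) _.
  rewrite EFinM -muleA lee_wpmul2l ?lee_fin ?(ltW c0)// lee_wpmul2r ?moment_ge0//.
  by rewrite fineK// N0.
have F1 t : (trim 1 F t <= (2 * cF * a0)%:E * trim 2 g t)%E.
  apply: trim_leM => //; first by rewrite !mulr_ge0// ltW.
  move=> s s0; have ms := cmeas_slice s mg.
  apply: le_trans (moment1_advec mm m_ge0 m_le1 ms) _.
  rewrite [(2 * cF * a0)%:E]EFinM -muleA lee_wpmul2l ?lee_fin ?mulr_ge0 ?(ltW c0)// lee_wpmul2r ?moment_ge0//.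
  by rewrite fineK// N0.
exists g; split => // t t0; first exact: good_herm G _ t0.
split; [exact: t1|exact: t2|].
have H0 := moment_duh 0 mg0 mF' t0; have H1 := moment_duh 1 mg0 mF' t0.
rewrite gF' in H0 H1.
have {}H0 := ee_absorb (trim_ge0 1 g t) (t1 t t0) (le_trans H0 (leeD2l _ (F0 t))).
have {}H1 := ee_absorb (trim_ge0 2 g t) (t2 t t0) (le_trans H1 (leeD2l _ (F1 t))).
rewrite ge0_muleDr ?trim_ge0// addeACA.
(* The estimate of [M_0] has the better coefficient [1 - cF a0]; it is weakened to the one of [M_1]
   to obtain a common factor. *)
apply: leeD => //; apply: le_trans H0; rewrite leeD2l// lee_wpmul2r ?trim_ge0// lee_fin.
by rewrite -/a0; have := mulr_ge0 (ltW c0) a00; lra.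
Qed.
End fourier_existence.

(** * The multiplier of symbol |xi| on test functions *)

Section fractional_laplacian.
Context {R : realType}.
Implicit Types (chi : R -> R).

Lemma fourier_hermitian chi : hermitian (fourier chi).
Proof. by move=> xi; rewrite conj_fourier fourierE opprK. Qed.

Definition absxi (g : R -> R[i]) (xi : R) : R[i] := (`|xi|)%:C * g xi.

Lemma nc_absxi g xi : nc (absxi g xi) = `|xi| * nc (g xi).
Proof. by rewrite ncM nc_real normr_id. Qed.

Lemma cmeas_absxi g : cmeas g -> cmeas (absxi g).
Proof. by move=> mg; rewrite /absxi; meas. Qed.

Lemma cL1_absxi g : cmeas g -> (moment 1 g < +oo)%E -> cL1 (absxi g).
Proof.
move=> mg h; split; first exact: cmeas_absxi.
suff -> : (\int[mu]_x (nc (absxi g x))%:E = moment 1 g)%E by [].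
by apply: eq_integral => x _; rewrite nc_absxi expr1.
Qed.

Lemma hermitian_absxi g : hermitian g -> hermitian (absxi g).
Proof. by move=> hg xi; rewrite /absxi normrN hg conjcM conjcR. Qed.

Lemma test_fun_measurable chi : test_fun chi -> measurable_fun setT chi.
Proof.
by move=> [/smoothP s _]; apply: continuous_measurable_fun; exact: smooth_continuous.
Qed.

Lemma test_fun_cmeas_fourier chi : test_fun chi -> cmeas (fourier chi).
Proof. by move=> tc; apply: cmeas_fourier; exact: test_fun_measurable. Qed.

Lemma moment_fourier chi n : test_fun chi -> (moment n (fourier chi) < +oo)%E.
Proof.
move=> tc; have [_ h] := cL1_fourier_weight (test_fun_derive1n n tc).
apply: le_lt_trans h; apply: le_int => x; first by rewrite lee_fin mulr_ge0 ?nc_ge0 ?exprn_ge0.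
rewrite lee_fin -nc_fourier_derive1n// ncM nc_real ler_peMl ?nc_ge0//.
by rewrite ger0_norm ?addr_ge0// lerDl.
Qed.

Lemma cL1_fourier chi : test_fun chi -> cL1 (fourier chi).
Proof.
move=> tc; apply: moment0_cL1; first exact: test_fun_cmeas_fourier.
exact: moment_fourier.
Qed.

Lemma cL1_absxi_fourier chi : test_fun chi -> cL1 (absxi (fourier chi)).
Proof.
move=> tc; apply: cL1_absxi; [exact: test_fun_cmeas_fourier|exact: moment_fourier].
Qed.

Lemma moment1_fourier chi : test_fun chi ->
  (moment 1 (fourier chi) <= (decay_const chi * pi)%:E)%E.
Proof.
move=> tc; rewrite EFinM -int_oneDsqr -intZ; last 3 first.
- exact: decay_const_ge0.
- exact: measurable_oneDsqrV.
- by move=> x; rewrite invr_ge0 ltW// oneDsqr_gt0.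
apply: le_int => x; first by rewrite lee_fin mulr_ge0 ?nc_ge0 ?exprn_ge0.
rewrite lee_fin expr1 ler_pdivlMr ?oneDsqr_gt0// mulrAC.
apply: le_trans (fourier_decay x tc); apply: ler_wpM2r; first exact: nc_ge0.
by apply: ler_wpM2r; [rewrite ltW// oneDsqr_gt0|rewrite lerDr].
Qed.

Lemma LambdaE chi x : test_fun chi ->
  inverse_fourier (absxi (fourier chi)) x = (Lambda 1 chi x)%:C.
Proof.
move=> tc.
have I0 := hermitian_real x (cmeas_absxi (test_fun_cmeas_fourier tc))
  (hermitian_absxi (@fourier_hermitian chi)).
have H : complex.Re (inverse_fourier (absxi (fourier chi)) x) = Lambda 1 chi x.
  congr (complex.Re (_ * _)); apply: eq_cintegral => xi.
  by rewrite /absxi powRr1.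
by apply: complexP; [exact: H|exact: I0].
Qed.

Lemma measurable_Lambda chi : test_fun chi -> measurable_fun setT (Lambda 1 chi).
Proof.
move=> tc; have [m _] := cmeas_inverse_fourier (cmeas_absxi (test_fun_cmeas_fourier tc)).
apply: eq_measurable_fun m => x _.
by rewrite LambdaE.
Qed.

Lemma Lambda_bounded chi x : test_fun chi -> `|Lambda 1 chi x| <= cF * (decay_const chi * pi).
Proof.
move=> tc; rewrite -nc_real -LambdaE//.
apply: le_trans (nc_inverse_fourier x (cL1_absxi_fourier tc)) _.
apply: ler_wpM2l; first exact: ltW (@cF_gt0 R).
rewrite -lee_fin fineK; last exact: cL1_fin (cL1_absxi_fourier tc).
apply: le_trans (moment1_fourier tc); apply: le_int => y; first by rewrite lee_fin nc_ge0.
by rewrite nc_absxi expr1.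
Qed.

Lemma inverse_fourier_fourier chi : test_fun chi ->
  {ae mu, forall x, inverse_fourier (fourier chi) x = (chi x)%:C}.
Proof.
move=> tc; have Lc := test_fun_cL1 tc; have LF := cL1_fourier tc.
pose F := FT (fun x => (chi x)%:C).
have E xi : F xi = (cF^-1)%:C * fourier chi (- xi).
  by rewrite fourierE opprK mulrA -RCM mulVf ?gt_eqF ?cF_gt0// mul1r.
have LFT : cL1 F.
  have L := cL1Z (cF^-1)%:C (cL1_comp_opp LF).
  by rewrite (_ : F = fun xi => (cF^-1)%:C * fourier chi (- xi))//; apply/funext.
apply: aeS (FT_inversion Lc LFT) => x h.
have m : cmeas (fun xi => fourier chi xi * cis (xi * x)) by have [m _] := LF; meas.
rewrite inverse_fourierE /FT -(cint_opp m).
have -> : cintegral (fun xi => fourier chi (- xi) * cis (- xi * x)) = cF%:C * FT F (- x).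
  rewrite /FT -cintegralZ; last exact: cL1_cis.
  by apply: eq_cintegral => xi; rewrite E !mulrA -RCM mulfV ?gt_eqF ?cF_gt0// mul1r mulNr -mulrN.
by rewrite h !mulrA -!RCM cF_sqr mul1r.
Qed.

(** The semigroup [exp (- e Lambda)] acts on test functions by averaging against the Poisson
    kernel. *)
Lemma inverse_fourier_poisson chi (e x : R) : test_fun chi -> 0 < e ->
  inverse_fourier (fun xi => (expR (- (e * `|xi|)))%:C * fourier chi xi) x =
  (cF * cF)%:C * poisson_avg (fun y => (chi y)%:C) e x.
Proof.
move=> tc e0; have Lc := test_fun_cL1 tc; rewrite -FT_abel// inverse_fourierE /FT.
have mF := test_fun_cmeas_fourier tc.
have m : cmeas (fun xi : R => (expR (- (e * `|xi|)))%:C * fourier chi xi * cis (xi * x)) by meas.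
rewrite -(cint_opp m) RCM -mulrA; congr (_ * _).
have LT := cL1_FT_mul_expN e0 Lc.
rewrite -cintegralZ; last exact: cL1_cis.
apply: eq_cintegral => xi; rewrite normrN fourierE opprK mulNr -mulrN.
by rewrite [(expR _)%:C * _]mulrC !mulrA.
Qed.

(** The symbol of [(1 - exp (- e Lambda)) / e] approximates [|xi|], with an error that two moments
    control. From [exp (- y) <= 1 / (1 + y)] with [y = e k], since
    [y - 1 + 1 / (1 + y) = y^2 / (1 + y)]. *)
Lemma expN_diff (e k : R) : 0 < e -> 0 <= k ->
  0 <= k - (1 - expR (- (e * k))) / e <= e * k ^+ 2.
Proof.
move=> e0 k0; have ek : 0 <= e * k by rewrite mulr_ge0// ltW.
have h1 := expR_ge1Dx (- (e * k)).
have h2 : expR (- (e * k)) <= (1 + e * k)^-1.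
  by rewrite expRN lef_pV2 ?posrE ?expR_gt0 ?ltr_pwDl// expR_ge1Dx.
have h3 : 0 < 1 + e * k by rewrite ltr_pwDl.
have -> : k - (1 - expR (- (e * k))) / e = (e * k - 1 + expR (- (e * k))) / e.
  by field; rewrite gt_eqF.
rewrite ler_pdivrMr//; apply/andP; split; first by rewrite divr_ge0 ?(ltW e0)//; lra.
apply: le_trans (_ : e * k - 1 + (1 + e * k)^-1 <= _); first by rewrite lerD2l.
have -> : e * k - 1 + (1 + e * k)^-1 = (e * k) ^+ 2 * (1 + e * k)^-1.
  by field; rewrite gt_eqF.
have -> : e * k ^+ 2 * e = (e * k) ^+ 2 by ring.
by rewrite ler_piMr ?sqr_ge0// invf_le1// lerDl.
Qed.

(** Where [chi] vanishes, [(1 - exp (- e Lambda)) chi / e] is minus a Poisson average divided by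
    [e]. At distance [|x| - M] from the support the kernel is at most [2 e / (|x| - M)^2], so [e]
    cancels, and [cF^2] times 2 is [1 / pi]. Replacing this operator by [Lambda] costs [e cF M_2],
    which vanishes as [e = 1 / (n + 1)] tends to 0. *)
Lemma Lambda_decay chi (M : R) : test_fun chi -> (forall x, M < `|x| -> chi x = 0) ->
  {ae mu, forall x : R, M < `|x| -> `|Lambda 1 chi x| <=
    pi^-1 * fine (\int[mu]_y (`|chi y|)%:E)%E / (`|x| - M) ^+ 2}.
Proof.
move=> tc cM; have Lc := test_fun_cL1 tc; have LF := cL1_fourier tc.
have mF := test_fun_cmeas_fourier tc; have LA := cL1_absxi_fourier tc.
apply: aeS (inverse_fourier_fourier tc) => x hx xM.
set B := _ / _.
have M0 : 0 < `|x| - M by rewrite subr_gt0.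
pose C := cF * fine (moment 2 (fourier chi)).
suff H (n : nat) : `|Lambda 1 chi x| <= B + inv_succ n * C.
  have cv : B + inv_succ n * C @[n --> \oo] --> (B + 0 * C : R).
    by apply: cvgD; [exact: cvg_cst|apply: cvgM; [exact: cvg_inv_succ|exact: cvg_cst]].
  rewrite mul0r addr0 in cv.
  by apply: (cvgr_to_ge cv); apply: nearW => n; exact: H.
set e : R := inv_succ n; have e0 : 0 < e := inv_succ_gt0 n.
pose S xi := ((1 - expR (- (e * `|xi|))) / e)%:C * fourier chi xi.
have LP : cL1 (fun xi => (expR (- (e * `|xi|)))%:C * fourier chi xi).
  apply: (@cL1_le _ _ (fourier chi)) => // [|xi]; first by meas.
  rewrite ncM nc_real ger0_norm ?expR_ge0// ler_piMl ?nc_ge0// -[leRHS]expR0 ler_expR oppr_le0.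
  by rewrite mulr_ge0// ltW.
have SE xi : S xi = (e^-1)%:C * (fourier chi xi - (expR (- (e * `|xi|)))%:C * fourier chi xi).
  by rewrite /S mulrC -{2}[fourier chi xi]mul1r -mulrBl -RCB mulrA -RCM mulrC [e^-1 * _]mulrC.
have LS : cL1 S.
  by rewrite (_ : S = fun xi => (e^-1)%:C * (fourier chi xi - (expR (- (e * `|xi|)))%:C * fourier chi xi));
    [apply: cL1Z; exact: cL1B|apply/funext].
have Sx : nc (inverse_fourier S x) <= B.
  have -> : inverse_fourier S x = (e^-1)%:C * (inverse_fourier (fourier chi) x -
      inverse_fourier (fun xi => (expR (- (e * `|xi|)))%:C * fourier chi xi) x).
    rewrite -inverse_fourierB// !inverse_fourierE mulrCA; congr (_ * _).
    rewrite /FT -cintegralZ; last by apply: cL1_cis; exact: cL1B.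
    by apply: eq_cintegral => xi; rewrite SE mulrA.
  rewrite hx cM// sub0r inverse_fourier_poisson// mulrN ncN ncM ncM !nc_real.
  have LPo : cL1 (fun y => (chi y)%:C * (poisson e (y - x))%:C).
    rewrite (_ : (fun y => _) = fun y => (poisson e (y - x))%:C * (chi y)%:C); last first.
      by apply/funext => y; rewrite mulrC.
    apply: (cL1M_bounded (M := 2 / e)) => //.
      have mp := measurable_poisson e0.
      by apply: cmeas_real; apply: (measurableT_comp mp); meas.
    by move=> y; rewrite nc_real ger0_norm ?poisson_ge0// poisson_le.
  have mc := test_fun_measurable tc.
  have P1 : nc (poisson_avg (fun y => (chi y)%:C) e x) <=
      2 * e / (`|x| - M) ^+ 2 * fine (\int[mu]_y (`|chi y|)%:E)%E.
    have fc : (\int[mu]_y (`|chi y|)%:E)%E \is a fin_num.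
      by have := cL1_fin Lc; under eq_integral do rewrite nc_real.
    rewrite -lee_fin; apply: le_trans (nc_cintegral LPo.1) _.
    rewrite EFinM fineK// -intZ//; last 2 first.
    - by rewrite divr_ge0 ?sqr_ge0// mulr_ge0// ltW.
    - by meas.
    apply: le_int => y; first by rewrite lee_fin nc_ge0.
    rewrite lee_fin ncM !nc_real mulrC; have [yM|yM] := leP `|y| M; last by rewrite cM// normr0 !mulr0.
    apply: ler_wpM2r => //; rewrite ger0_norm ?poisson_ge0// /poisson.
    have d0 : 0 < e ^+ 2 + (y - x) ^+ 2 by rewrite ltr_pwDl ?sqr_ge0// exprn_gt0.
    rewrite ler_pM2l ?mulr_gt0// lef_pV2 ?posrE ?exprn_gt0//.
    apply: le_trans (_ : (y - x) ^+ 2 <= _); last by rewrite lerDr sqr_ge0.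
    rewrite -[leRHS]real_normK ?num_real// lerXn2r ?nnegrE ?(ltW M0)//.
    rewrite distrC; have := lerB_dist x y; have := yM; lra.
  rewrite (ger0_norm (_ : 0 <= e^-1)) ?invr_ge0 ?(ltW e0)// ger0_norm ?mulr_ge0 ?(ltW (cF_gt0))//.
  apply: (@le_trans _ _ (e^-1 * (cF * cF * (2 * e / (`|x| - M) ^+ 2 * fine (\int[mu]_y (`|chi y|)%:E)%E)))).
    rewrite ler_wpM2l ?invr_ge0 ?(ltW e0)// ler_wpM2l ?mulr_ge0 ?(ltW cF_gt0)//.
  have c2 : cF * cF = (2 * pi)^-1 :> R.
    by apply: (mulIf (lt0r_neq0 (@pi2_gt0 R))); rewrite cF_sqr mulVf// gt_eqF// pi2_gt0.
  have aux (p d k f : R) : p != 0 -> d != 0 -> k != 0 ->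
      k^-1 * ((2 * p)^-1 * (2 * k / d ^+ 2 * f)) = p^-1 * f / d ^+ 2.
    by move=> p0 dn0 k0; field; rewrite p0 dn0 k0.
  rewrite /B c2 aux//; first by rewrite gt_eqF// pi_gt0.
    by rewrite gt_eqF.
  by rewrite gt_eqF.
have D : nc (inverse_fourier (absxi (fourier chi)) x - inverse_fourier S x) <= e * C.
  rewrite -inverse_fourierB//.
  have LD : cL1 (fun xi => absxi (fourier chi) xi - S xi) by exact: cL1B.
  apply: le_trans (nc_inverse_fourier x LD) _; rewrite mulrCA; apply: ler_wpM2l; first exact: ltW (@cF_gt0 R).
  have f2 : moment 2 (fourier chi) \is a fin_num by rewrite ge0_fin_numE ?moment_ge0// moment_fourier.
  rewrite -lee_fin fineK ?cL1_fin// EFinM fineK//.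
  have mnF := measurable_nc mF.
  rewrite /moment -intZ ?(ltW e0)//; last 2 first.
  - by meas.
  - by move=> y; rewrite mulr_ge0 ?nc_ge0 ?exprn_ge0.
  apply: le_int => xi; first by rewrite lee_fin nc_ge0.
  rewrite lee_fin /absxi /S -mulrBl -RCB ncM nc_real mulrA ler_wpM2r ?nc_ge0//.
  by have /andP[d0 d1] := expN_diff e0 (normr_ge0 xi); rewrite ger0_norm.
rewrite -nc_real -LambdaE//.
apply: le_trans (_ : nc (inverse_fourier S x) + nc (inverse_fourier (absxi (fourier chi)) x - inverse_fourier S x) <= _).
  by apply: le_trans (ncD _ _); rewrite addrC subrK.
exact: lerD.
Qed.

Lemma fine_int_norm_ge0 (f : R -> R) : 0 <= fine (\int[mu]_y (`|f y|)%:E)%E.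
Proof. by apply: fine_ge0; apply: integral_ge0 => y _; rewrite lee_fin. Qed.

(** The uniform bound [C1] serves up to [2 M + 1] and the decay with constant [C2] beyond, where
    [|x| - M >= (|x| + 1) / 2] and hence [1 + x^2 <= 8 (|x| - M)^2]. Only bounds enter, so the
    constant can be shared by a family of test functions depending on time. *)
Definition lambda_bound (C1 C2 M : R) : R := C1 * (1 + (2 * M + 1) ^+ 2) + 8 * C2.

Lemma Lambda_le chi (M C1 C2 : R) : test_fun chi -> 0 <= M -> (forall x, M < `|x| -> chi x = 0) ->
  cF * (decay_const chi * pi) <= C1 -> pi^-1 * fine (\int[mu]_y (`|chi y|)%:E)%E <= C2 ->
  {ae mu, forall x : R, `|Lambda 1 chi x| <= lambda_bound C1 C2 M / (1 + x ^+ 2)}.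
Proof.
move=> tc M0 cM h1 h2.
have C10 : 0 <= C1.
  by apply: le_trans h1; rewrite !mulr_ge0 ?decay_const_ge0 ?pi_ge0// ltW// cF_gt0.
have C20 : 0 <= C2.
  by apply: le_trans h2; rewrite mulr_ge0 ?invr_ge0 ?pi_ge0// fine_int_norm_ge0.
apply: aeS (Lambda_decay tc cM) => x hx.
have d0 := oneDsqr_gt0 x; rewrite ler_pdivlMr// /lambda_bound.
have E : x ^+ 2 = `|x| ^+ 2 by rewrite real_normK ?num_real.
have [xM|xM] := leP `|x| (2 * M + 1).
  apply: (@le_trans _ _ (C1 * (1 + (2 * M + 1) ^+ 2))); last by rewrite lerDl mulr_ge0.
  apply: ler_pM => //; first exact: ltW.
    exact: le_trans (Lambda_bounded x tc) h1.
  by rewrite lerD2l E lerXn2r ?nnegrE// addr_ge0// mulr_ge0.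
apply: (@le_trans _ _ (8 * C2)); last by rewrite lerDr mulr_ge0// addr_ge0// sqr_ge0.
have xM1 : M < `|x| by lra.
have p : 0 < (`|x| - M) ^+ 2 by rewrite exprn_gt0// subr_gt0.
apply: (@le_trans _ _ (C2 / (`|x| - M) ^+ 2 * (1 + x ^+ 2))).
  rewrite ler_wpM2r ?(ltW d0)//; apply: le_trans (hx xM1) _.
  by rewrite ler_wpM2r// invr_ge0 ltW.
rewrite mulrAC ler_pdivrMr// E mulrAC mulrC [leRHS]mulrC.
rewrite mulrC ler_wpM2l//; have := M0; move: xM; move: `|x| => y; nra.
Qed.

Lemma int_lambda_bound (D : R) : 0 <= D ->
  (\int[mu]_x (D / (1 + x ^+ 2))%:E < +oo)%E.
Proof.
move=> D0; rewrite intZ//; last 2 first.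
- exact: measurable_oneDsqrV.
- by move=> x; rewrite invr_ge0 ltW// oneDsqr_gt0.
by rewrite int_oneDsqr -EFinM ltry.
Qed.

Lemma cL1_Lambda chi : test_fun chi -> cL1 (fun x => (Lambda 1 chi x)%:C).
Proof.
move=> tc; have mL := measurable_Lambda tc.
have [_ [M0 cM]] := tc; pose M := Num.max M0 0.
have M_ge0 : 0 <= M by rewrite le_max lexx orbT.
have cM' x : M < `|x| -> chi x = 0 by move=> h; apply: cM; apply: le_lt_trans h; rewrite le_max lexx.
have H := Lambda_le tc M_ge0 cM' (lexx _) (lexx _).
set D := lambda_bound _ _ _ in H.
have D0 : 0 <= D.
  rewrite /D /lambda_bound addr_ge0//.
    rewrite mulr_ge0 ?addr_ge0 ?sqr_ge0// !mulr_ge0 ?decay_const_ge0 ?pi_ge0// ltW// cF_gt0//.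
  by rewrite mulr_ge0// mulr_ge0 ?invr_ge0 ?pi_ge0// fine_int_norm_ge0.
apply: cL1_real => //; apply: le_lt_trans (int_lambda_bound D0).
apply: le_int_ae.
- by meas.
- by apply: measurable_EFin; apply: mfunM; [exact: measurable_cst|exact: measurable_oneDsqrV].
- by move=> x; rewrite lee_fin.
- by move=> x; rewrite lee_fin divr_ge0// ltW// oneDsqr_gt0.
- by apply: aeS H => x; rewrite lee_fin.
Qed.

(** Both [Lambda 1 chi], by its decay, and [absxi (fourier chi)] are integrable, so the inversion
    theorem applies. *)
Lemma fourier_Lambda chi : test_fun chi ->
  {ae mu, forall xi, fourier (Lambda 1 chi) xi = absxi (fourier chi) xi}.
Proof.
move=> tc; have LL := cL1_Lambda tc; have LA := cL1_absxi_fourier tc.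
have E x : FT (absxi (fourier chi)) x = (cF^-1)%:C * (Lambda 1 chi x)%:C.
  by rewrite -LambdaE// inverse_fourierE mulrA -RCM mulVf ?gt_eqF ?cF_gt0// mul1r.
have LFT : cL1 (FT (absxi (fourier chi))).
  by rewrite (_ : FT _ = fun x => (cF^-1)%:C * (Lambda 1 chi x)%:C);
    [exact: cL1Z|apply/funext].
apply: aeS (FT_inversion LA LFT) => xi h.
rewrite fourierE.
have -> : FT (fun x => (Lambda 1 chi x)%:C) (- xi) = cF%:C * FT (FT (absxi (fourier chi))) (- xi).
  rewrite [FT (FT _) _]/FT -cintegralZ; last exact: cL1_cis.
  by apply: eq_cintegral => x; rewrite E !mulrA -RCM mulfV ?gt_eqF ?cF_gt0// mul1r.
by rewrite h mulrA -RCM mulrA -RCM cF_sqr mul1r.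
Qed.

Lemma Lambda_parseval g chi : cL1 g -> test_fun chi ->
  cintegral (fun x => inverse_fourier g x * (Lambda 1 chi x)%:C) =
  cintegral (fun xi => g xi * conjc (absxi (fourier chi) xi)).
Proof.
move=> Lg tc; have LL := cL1_Lambda tc.
rewrite fourier_parseval//; have [mg _] := Lg.
have mF := cmeas_fourier (measurable_Lambda tc).
have mA := cmeas_absxi (test_fun_cmeas_fourier tc).
apply: cintegral_ae; [by meas|by meas|].
by apply: aeS (fourier_Lambda tc) => xi ->.
Qed.
End fractional_laplacian.

Section unfolding_lemmas.
Context {R : realType}.
Lemma cintegral_of_real (f : R -> R) : cintegral (fun x => (f x)%:C) = (\int[mu]_x f x)%:C.
Proof. by apply: complexP => //=; rewrite /Rintegral integral0. Qed.

Lemma cintegral_opp (f : R -> R[i]) : cintegral (fun x => - f x) = - cintegral f.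
Proof.
by apply: complexP => /=; rewrite -RintN; apply: eq_Rintegral => x _; [exact: ReN|exact: ImN].
Qed.

Lemma Re_cintegral (f : R -> R[i]) : complex.Re (cintegral f) = \int[mu]_x complex.Re (f x).
Proof. by []. Qed.

Lemma Im_cintegral (f : R -> R[i]) : complex.Im (cintegral f) = \int[mu]_x complex.Im (f x).
Proof. by []. Qed.

Lemma advecE m h (k : R -> R[i]) x : advec m h k x = - (cF%:C * conv (mult m h) (ixi k) x).
Proof. by []. Qed.

Lemma multE m (h : R -> R[i]) x : mult m h x = (m x)%:C * h x.
Proof. by []. Qed.

Lemma ixiE (h : R -> R[i]) x : ixi h x = 'i%C * x%:C * h x.
Proof. by []. Qed.

Lemma absxiE (h : R -> R[i]) x : absxi h x = (`|x|)%:C * h x.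
Proof. by []. Qed.
End unfolding_lemmas.

(* Conversion would otherwise unfold the complex integrals. *)
Opaque inverse_fourier fourier cintegral conv mult ixi absxi advec cF derive1.

(** * The weak formulation at a fixed time, on the Fourier side *)

Section weak_pairing.
Context {R : realType} (m : R -> R).
Hypotheses (mm : measurable_fun setT m) (m_ge0 : forall x, 0 <= m x)
  (m_le1 : forall x, m x <= 1).
Variable h : R -> R[i].
Hypotheses (Lh : cL1 h) (h1 : (moment 1 h < +oo)%E).

Let mh : cmeas h. Proof. by case: Lh. Qed.
Let LU : cL1 (mult m h). Proof. exact: cL1_mult. Qed.

Lemma cL1_ixi_mult : cL1 (ixi (mult m h)).
Proof.
apply: cL1_ixi; first by case: LU.
by apply: le_lt_trans h1; exact: moment_mult.
Qed.
Let LV := cL1_ixi_mult.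

Let Lixi : cL1 (ixi h). Proof. exact: cL1_ixi. Qed.

Lemma fourier_bounded (phi : R -> R) : cL1 (fun x => (phi x)%:C) ->
  exists M, forall xi, nc (conjc (fourier phi xi)) <= M.
Proof. by move=> L; eexists => xi; rewrite ncJ; exact: nc_fourier. Qed.

Lemma cL1_pairing (g : R -> R[i]) (phi : R -> R) : cL1 g -> measurable_fun setT phi ->
  cL1 (fun x => (phi x)%:C) -> cL1 (fun xi => g xi * conjc (fourier phi xi)).
Proof.
move=> Lg mp Lp; have [M HM] := fourier_bounded Lp.
rewrite (_ : (fun xi => _) = fun xi => conjc (fourier phi xi) * g xi); last first.
  by apply/funext => xi; rewrite mulrC.
apply: (cL1M_bounded (M := M)) => //.
by have mF := cmeas_fourier mp; meas.
Qed.

Lemma cL1_inverse_mul (g : R -> R[i]) (phi : R -> R) : cL1 g -> cL1 (fun x => (phi x)%:C) ->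
  cL1 (fun x => inverse_fourier g x * (phi x)%:C).
Proof.
move=> Lg Lp; apply: cL1M_bounded Lp => //; last by move=> x; exact: nc_inverse_fourier.
by apply: cmeas_inverse_fourier; case: Lg.
Qed.

(** The identity that pairs [u_x theta chi + u theta chi_x] into [- u theta_x chi]. On the Fourier
    side, conjugating the transform of [chi_x] gives a factor [- i xi], and the Leibniz rule
    [conv_leibniz] cancels the term in [u_x]. *)
Lemma advection_pairing (chi : R -> R) : test_fun chi ->
  cintegral (fun x => inverse_fourier (ixi (mult m h)) x * inverse_fourier h x * (chi x)%:C +
    inverse_fourier (mult m h) x * inverse_fourier h x * (derive1 chi x)%:C) =
  cintegral (fun xi => advec m h h xi * conjc (fourier chi xi)).
Proof.
move=> tc; have td := test_fun_derive1 tc.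
have LVh := cL1_conv LV Lh; have LUh := cL1_conv LU Lh; have LUd := cL1_conv LU Lixi.
have Lc := test_fun_cL1 tc; have Ld := test_fun_cL1 td.
have mc := test_fun_measurable tc; have md := test_fun_measurable td.
have mF := cmeas_fourier mc.
rewrite (eq_cintegral (g := fun x => cF%:C * (inverse_fourier (conv (ixi (mult m h)) h) x * (chi x)%:C) +
    cF%:C * (inverse_fourier (conv (mult m h) h) x * (derive1 chi x)%:C))); last first.
  have T (c p q r s : R[i]) : q * r = c * p -> q * r * s = c * (p * s) by move=> ->; rewrite mulrA.
  move=> x; congr (_ + _); first exact: T (inverse_fourier_mul x LV Lh).
  exact: T (inverse_fourier_mul x LU Lh).
have I1 := cL1_inverse_mul LVh Lc; have I2 := cL1_inverse_mul LUh Ld.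
have J1 := cL1_pairing LVh mc Lc; have J2 := cL1_pairing LUh md Ld; have J3 := cL1_pairing LUd mc Lc.
have E1 := cintegralZ cF%:C I1; have E2 := cintegralZ cF%:C I2.
have F1 := fourier_parseval LVh Lc; have F2 := fourier_parseval LUh Ld.
have S (a b a1 b1 a2 b2 e c t : R[i]) : e = a + b -> a = c * a1 -> b = c * b1 -> a1 = a2 -> b1 = b2 ->
    t = c * (a2 + b2) -> e = t.
  by move=> -> -> -> -> -> ->; rewrite mulrDr.
apply: S (cintegralD (cL1Z _ I1) (cL1Z _ I2)) E1 E2 F1 F2 _.
have J3N := cL1N J3.
transitivity (cF%:C * cintegral (fun xi => - (conv (mult m h) (ixi h) xi * conjc (fourier chi xi)))).
  apply: etrans (cintegralZ cF%:C J3N).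
  by apply: eq_cintegral => xi; rewrite advecE mulrN mulNr mulrA.
apply: congr1; apply: etrans (cintegralD J1 J2).
apply: cintegral_ae.
- by have [a _] := J3; meas.
- by have [a _] := J1; have [b _] := J2; meas.
apply: aeS (conv_leibniz LU Lh LV Lixi) => xi E.
rewrite (fourier_derive1 xi tc) (conjcM ('i%C * xi%:C) (fourier chi xi)) (conjcM 'i%C xi%:C) conjcR.
have -> : conjc ('i%C : R[i]) = - 'i%C by apply: complexP => /=; rewrite ?oppr0.
have T (V D U i x F : R[i]) : i * x * U = V + D -> - (D * F) = V * F + U * (- i * x * F).
  by move=> E'; rewrite (_ : U * _ = - (i * x * U) * F); [rewrite E'; ring|ring].
exact: T E.
Qed.

(** Here [chi1] and [chi] stand for [psi_t] and [psi] at a given time. The functions [u] and [ux]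
    enter through their inverse transforms almost everywhere, so the statement serves both the
    constructed solution and an arbitrary one. *)
Lemma weak_pairing (f u ux chi1 chi : R -> R) :
  measurable_fun setT f -> measurable_fun setT u -> measurable_fun setT ux ->
  {ae mu, forall x, inverse_fourier h x = (f x)%:C} ->
  {ae mu, forall x, inverse_fourier (mult m h) x = (u x)%:C} ->
  {ae mu, forall x, inverse_fourier (ixi (mult m h)) x = (ux x)%:C} ->
  test_fun chi1 -> test_fun chi ->
  (\int[mu]_x (f x * chi1 x + ux x * f x * chi x + u x * f x * derive1 chi x - f x * Lambda 1 chi x))%:C =
  cintegral (fun xi => h xi * conjc (fourier chi1 xi) +
    (advec m h h xi - absxi h xi) * conjc (fourier chi xi)).
Proof.
move=> mf mu_ mux ef eu eux t1 tc; have td := test_fun_derive1 tc.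
have LA := cL1_advec mm m_ge0 m_le1 Lh Lixi; have Lab := cL1_absxi mh h1.
have Lc := test_fun_cL1 tc; have Ld := test_fun_cL1 td; have L1 := test_fun_cL1 t1.
have mc := test_fun_measurable tc; have md := test_fun_measurable td; have m1 := test_fun_measurable t1.
have mL := measurable_Lambda tc; have LL := cL1_Lambda tc.
have I1 := cL1_inverse_mul Lh L1; have I4 := cL1_inverse_mul Lh LL.
have bh x := nc_inverse_fourier x Lh.
have P (g : R -> R[i]) (phi : R -> R) : cL1 g -> cL1 (fun x => (phi x)%:C) ->
    cL1 (fun x => inverse_fourier g x * inverse_fourier h x * (phi x)%:C).
  move=> Lg Lp; rewrite (_ : (fun x => _) = fun x => inverse_fourier h x * (inverse_fourier g x * (phi x)%:C)); last first.
    by apply/funext => x; rewrite mulrA [inverse_fourier h x * _]mulrC.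
  by apply: cL1M_bounded (cL1_inverse_mul Lg Lp) => //; exact: cmeas_inverse_fourier.
have I2 := P _ _ LV Lc; have I3 := P _ _ LU Ld.
rewrite (_ : _%:C = cintegral (fun x => inverse_fourier h x * (chi1 x)%:C +
   (inverse_fourier (ixi (mult m h)) x * inverse_fourier h x * (chi x)%:C +
    inverse_fourier (mult m h) x * inverse_fourier h x * (derive1 chi x)%:C) -
    inverse_fourier h x * (Lambda 1 chi x)%:C)); last first.
  have -> : (\int[mu]_x (f x * chi1 x + ux x * f x * chi x + u x * f x * derive1 chi x - f x * Lambda 1 chi x))%:C =
      cintegral (fun x => (f x * chi1 x + ux x * f x * chi x + u x * f x * derive1 chi x - f x * Lambda 1 chi x)%:C).
    by rewrite cintegral_of_real.
  apply: cintegral_ae.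
  - by meas.
  - have [a1 _] := I1; have [a2 _] := I2; have [a3 _] := I3; have [a4 _] := I4.
    exact: cmeasB (cmeasD a1 (cmeasD a2 a3)) a4.
  apply: aeS (aeI ef (aeI eu eux)) => x [-> [-> ->]].
  by rewrite !(RCD, RCM, RCN) !addrA.
have I23 := cL1D I2 I3; have I123 := cL1D I1 I23.
rewrite (cintegralB I123 I4) (cintegralD I1 I23).
rewrite (advection_pairing tc) (fourier_parseval Lh L1) (Lambda_parseval Lh tc).
have J1 := cL1_pairing Lh m1 L1; have J2 := cL1_pairing LA mc Lc; have J3 := cL1_pairing Lab mc Lc.
rewrite [RHS](eq_cintegral (g := fun xi => h xi * conjc (fourier chi1 xi) +
  advec m h h xi * conjc (fourier chi xi) - absxi h xi * conjc (fourier chi xi))); last first.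
  by move=> xi; rewrite mulrBl addrA.
rewrite (cintegralB (cL1D J1 J2) J3) (cintegralD J1 J2); congr (_ - _); apply: eq_cintegral => xi.
by rewrite !absxiE conjcM conjcR mulrA [h xi * _]mulrC.
Qed.
End weak_pairing.

(** * Regularity in time and space *)

Section synthesis.
Context {R : realType}.
Implicit Types (f : R -> R[i]) (a b : R -> R).

Definition synth f (x : R) : R := complex.Re (inverse_fourier f x).

Lemma cmeas_iter_ixi j f : cmeas f -> cmeas (iter j ixi f).
Proof. by move=> mf; elim: j => //= j; exact: cmeas_ixi. Qed.

Lemma hermitian_iter_ixi j f : hermitian f -> hermitian (iter j ixi f).
Proof. by move=> hf; elim: j => // j; exact: hermitian_ixi. Qed.

Lemma moment_iter_ixi n j f : moment n (iter j ixi f) = moment (n + j) f.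
Proof. by elim: j n => [|j IH] n; rewrite ?addn0//= moment_ixi IH addSnnS. Qed.

Lemma cL1_iter_ixi j f : cmeas f -> (moment j f < +oo)%E -> cL1 (iter j ixi f).
Proof.
move=> mf f1; apply: moment0_cL1; first exact: cmeas_iter_ixi.
by rewrite moment_iter_ixi.
Qed.

Lemma iter_ixiE j f xi : iter j ixi f xi = ('i%C * xi%:C) ^+ j * f xi.
Proof. by elim: j => [|j IH]; rewrite ?expr0 ?mul1r//= ixiE IH mulrA exprS. Qed.

Lemma fourier_derive1n j (phi : R -> R) (xi : R) : test_fun phi ->
  fourier (derive1n j phi) xi = ('i%C * xi%:C) ^+ j * fourier phi xi.
Proof.
move=> tp; elim: j => [|j IH]; first by rewrite expr0 mul1r.
by rewrite derive1nS (fourier_derive1 xi (test_fun_derive1n j tp)) IH mulrA exprS.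
Qed.

Lemma conjc_ixi_pow j (xi : R) : conjc (('i%C * xi%:C) ^+ j) = (-1) ^+ j * ('i%C * xi%:C) ^+ j :> R[i].
Proof.
rewrite -exprMn mulN1r; elim: j => [|j IH]; last by rewrite !exprS conjcM IH; congr (_ * _); apply: complexP => /=; ring.
by rewrite !expr0; apply: complexP => //=; rewrite oppr0.
Qed.

(** The sign [(-1)^j] of the weak derivative is the one produced by conjugating [(i xi)^j] in
    Parseval's identity. *)
Lemma has_fourier_weak_deriv j a b f :
  has_fourier a f -> has_fourier b (iter j ixi f) -> weak_deriv j a b.
Proof.
move=> [la fa Pa] [lb fb Pb]; split => // phi tp.
have Lb : cL1 (iter j ixi f) by exact/cL1P.
have mp := test_fun_measurable tp.
have E : (((-1) ^+ j : R))%:C = (-1 : R[i]) ^+ j by rewrite rmorphXn rmorphN1.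
have K (x y : R) : x%:C = y%:C -> x = y by case.
apply: K; rewrite RCM E; apply: etrans (Pa _ (test_fun_derive1n j tp)) _.
apply: etrans (congr1 _ (esym (Pb _ tp))).
apply: etrans (cintegralZ _ (cL1_pairing Lb mp (test_fun_cL1 tp))).
apply: eq_cintegral => xi; rewrite (fourier_derive1n j xi tp) iter_ixiE.
have T (p q r s c : R[i]) : conjc p = s * p -> q * conjc (p * c) = s * (p * q * conjc c).
  by move=> e; rewrite conjcM e; ring.
exact: T (conjc_ixi_pow j xi).
Qed.

Lemma synth_has_fourier f : cL1 f -> hermitian f -> has_fourier (synth f) f.
Proof. exact: hermitian_has_fourier. Qed.

Lemma synth_weak_deriv j f : cL1 f -> hermitian f -> (moment j f < +oo)%E ->
  weak_deriv j (synth f) (synth (iter j ixi f)).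
Proof.
move=> Lf hf fj; apply: (has_fourier_weak_deriv (f := f)); first exact: synth_has_fourier.
apply: synth_has_fourier; first by apply: cL1_iter_ixi => //; case: Lf.
exact: hermitian_iter_ixi.
Qed.

Lemma synth_le f x : cL1 f -> `|synth f x| <= cF * fine (moment 0 f).
Proof.
move=> Lf; rewrite moment0; apply: le_trans (nc_Re _) _; exact: nc_inverse_fourier.
Qed.

Lemma Lnorm_infty_le (h : R -> R) (C : R) : (forall x, `|h x| <= C) ->
  ('N[lebesgue_measure]_+oo[EFin \o h] <= C%:E)%E.
Proof.
move=> hC; have C0 : 0 <= C by apply: le_trans (hC 0).
rewrite unlock /Lnorm; case: ifPn => _; last by rewrite lee_fin.
by apply/ess_sup_inf.ess_supP; apply: nearW => x /=; rewrite lee_fin.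
Qed.

Lemma norm_through_ge0 U (rel : (R -> R) -> U -> Prop) (N : U -> \bar R) a :
  (forall h, 0 <= N h)%E -> (0 <= norm_through rel N a)%E.
Proof. by move=> N0; apply/ereal_infP => _ [h _ <-]. Qed.

Lemma norm_through_le U (rel : (R -> R) -> U -> Prop) (N : U -> \bar R) a h c :
  rel a h -> (N h <= c)%E -> (norm_through rel N a <= c)%E.
Proof. by move=> r; apply: le_trans; apply: ereal_inf_lbound; exists h. Qed.

Lemma Winfty_norm_ge0 k a : (0 <= Winfty_norm k a)%E.
Proof.
by apply: sume_ge0 => j _; apply: norm_through_ge0 => h; exact: Lnorm_ge0.
Qed.

Lemma Winfty_norm_synth k f : cL1 f -> hermitian f ->
  (Winfty_norm k (synth f) <= \sum_(j < k.+1) cF%:E * moment j f)%E.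
Proof.
move=> Lf hf; apply: lee_sum => j _; have mf := Lf.1.
have [jy|] := ltP (moment j f) +oo%E; last first.
  by rewrite leye_eq => /eqP ->; rewrite gt0_muley ?leey// lte_fin cF_gt0.
apply: norm_through_le (synth_weak_deriv Lf hf jy) _.
have Lj := cL1_iter_ixi mf jy.
have fj : moment j f \is a fin_num by rewrite ge0_fin_numE ?moment_ge0.
rewrite -(fineK fj) -EFinM; apply: Lnorm_infty_le => x.
by have := synth_le x Lj; rewrite moment_iter_ixi add0n.
Qed.

Lemma wiener_weight_ge0 (s xi : R) : 0 <= wiener_weight s xi.
Proof. by rewrite /wiener_weight; case: ifP => // _; rewrite addr_ge0// powR_ge0. Qed.

Lemma wiener_norm_ge0 (s : R) a : (0 <= wiener_norm s a)%E.
Proof.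
apply: norm_through_ge0 => g; apply: integral_ge0 => x _.
by rewrite lee_fin mulr_ge0 ?wiener_weight_ge0// nc_ge0.
Qed.

Lemma measurable_wiener_weight (s : R) : measurable_fun setT (wiener_weight s).
Proof. by rewrite /wiener_weight; case: (s == 0); meas. Qed.

Lemma has_fourier_cmeas a f : has_fourier a f -> cmeas f.
Proof. by case=> _ /cL1P[]. Qed.

Lemma wiener_normE (s : R) a f : has_fourier a f ->
  wiener_norm s a = (\int[mu]_xi (wiener_weight s xi * nc (f xi))%:E)%E.
Proof.
move=> af; apply/eqP; rewrite eq_le; apply/andP; split; first exact: norm_through_le af _.
apply/ereal_infP => _ [g ag <-].
have mw := measurable_wiener_weight s.
have mf := has_fourier_cmeas af; have mg := has_fourier_cmeas ag.
have mnf := measurable_nc mf; have mng := measurable_nc mg.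
apply: le_int_ae; [by meas|by meas|move=> x|move=> x|]; last first.
  by apply: aeS (has_fourier_unique af ag) => x ->.
all: by rewrite lee_fin mulr_ge0 ?wiener_weight_ge0 ?nc_ge0.
Qed.

Lemma wiener_norm0E a f : has_fourier a f -> wiener_norm 0 a = moment 0 f.
Proof.
move=> /wiener_normE ->; apply: eq_integral => x _.
by rewrite /wiener_weight eqxx expr0.
Qed.

Lemma wiener_norm1E a f : has_fourier a f -> wiener_norm 1 a = (moment 0 f + moment 1 f)%E.
Proof.
move=> af; rewrite (wiener_normE _ af) /moment; have mf := has_fourier_cmeas af.
have mnf := measurable_nc mf.
rewrite -(intD (f1 := fun x => `|x| ^+ 0 * nc (f x)) (f2 := fun x => `|x| ^+ 1 * nc (f x))).
- apply: eq_integral => x _; rewrite /wiener_weight oner_eq0 powRr1// expr0 expr1.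
  by rewrite mul1r mulrDl mul1r.
- by meas.
- by meas.
- by move=> x; rewrite expr0 mul1r nc_ge0.
- by move=> x; rewrite mulr_ge0 ?exprn_ge0 ?nc_ge0.
Qed.

Lemma wiener_norm_dx_synth f : cL1 f -> hermitian f ->
  (wiener_norm_dx 1 (synth f) <= moment 1 f + moment 2 f)%E.
Proof.
move=> Lf hf; have mf := Lf.1.
have [f1|] := ltP (moment 1 f) +oo%E; last first.
  by rewrite leye_eq => /eqP ->; rewrite addye ?leey// gt_eqF// (lt_le_trans _ (moment_ge0 _ _)).
apply: norm_through_le (synth_weak_deriv Lf hf f1) _.
rewrite (wiener_norm1E (synth_has_fourier (cL1_iter_ixi mf f1) (hermitian_iter_ixi _ hf))).
by rewrite !moment_iter_ixi.
Qed.

End synthesis.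

(** * Strong measurability by step functions on a uniform mesh in time *)

Section time_mesh.
Context {R : realType}.

Definition mesh_floor (T : R) (N : nat) (t : R) : R :=
  (Num.truncn (t / (T / N%:R)))%:R * (T / N%:R).

Definition mesh_cell (T : R) (N i : nat) : set R :=
  `[i%:R * (T / N%:R), i.+1%:R * (T / N%:R)[%classic.

Lemma mesh_floorP (T : R) N t : 0 < T -> (0 < N)%N -> 0 <= t ->
  [/\ 0 <= mesh_floor T N t, mesh_floor T N t <= t & t < mesh_floor T N t + T / N%:R].
Proof.
move=> T0 N0 t0; have d0 : 0 < T / N%:R by rewrite divr_gt0// ltr0n.
have q0 : 0 <= t / (T / N%:R) by rewrite divr_ge0// ltW.
have /andP[a b] := truncn_itv q0; split.
- by rewrite mulr_ge0// ltW.
- by rewrite -ler_pdivlMr.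
- by rewrite /mesh_floor -[X in _ + X]mul1r -mulrDl natr1 -ltr_pdivrMr.
Qed.

Lemma sum_mesh_cell (T : R) N (t : R) (F : nat -> R) : 0 < T -> (0 < N)%N -> 0 < t < T ->
  \sum_(i < N) \1_(mesh_cell T N i) t * F i = F (Num.truncn (t / (T / N%:R))).
Proof.
move=> T0 N0 /andP[t0 tT]; have d0 : 0 < T / N%:R by rewrite divr_gt0// ltr0n.
set q := t / (T / N%:R).
have q0 : 0 <= q by rewrite divr_ge0// ltW.
have /andP[a b] := truncn_itv q0.
have iN : (Num.truncn q < N)%N.
  rewrite -(ltr_nat R); apply: le_lt_trans a _.
  by rewrite /q ltr_pdivrMr// mulrCA mulfV ?mulr1// pnatr_eq0 -lt0n.
rewrite (bigD1 (Ordinal iN))//= [X in _ + X]big1 ?addr0.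
  rewrite indicT ?mul1r// /mesh_cell/= in_itv/= -ler_pdivlMr// -ltr_pdivrMr//.
  by apply/andP.
move=> i ni; rewrite indicF ?mul0r//.
rewrite /mesh_cell/= in_itv/= -ler_pdivlMr// -ltr_pdivrMr// -/q => /andP[c d].
move/eqP: ni; apply; apply: val_inj => /=; apply/eqP; rewrite eqn_leq.
have le1 := le_lt_trans c b; have le2 := le_lt_trans a d; rewrite !ltr_nat !ltnS in le1 le2.
by rewrite le1 le2.
Qed.

Lemma synthB (f1 f2 : R -> R[i]) x : cL1 f1 -> cL1 f2 ->
  synth f1 x - synth f2 x = synth (fun xi => f1 xi - f2 xi) x.
Proof.
move=> L1 L2; rewrite /synth -ReN -ReD; apply: congr1.
exact: esym (inverse_fourierB x L1 L2).
Qed.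

Lemma hermitianB (f1 f2 : R -> R[i]) : hermitian f1 -> hermitian f2 ->
  hermitian (fun xi => f1 xi - f2 xi).
Proof. by move=> h1 h2 xi; rewrite h1 h2 conjcD conjcN. Qed.

(** At stage [n] the simple function takes, on each of [N n] cells, the value of [Z n] at the left
    endpoint. Freezing [Z n] rather than [z] leaves room for a truncation in frequency, and the free
    number of cells for a mesh adapted to it. *)
Lemma strongly_measurable_synth k (T : R) (N : nat -> nat) (z : R -> R -> R[i])
    (Z : nat -> R -> R -> R[i]) : 0 < T -> (forall n, (0 < N n)%N) ->
  (forall t, 0 <= t -> cL1 (z t) /\ hermitian (z t)) ->
  (forall n s, 0 <= s -> cL1 (Z n s) /\ hermitian (Z n s)) ->
  (forall n s j, 0 <= s -> (j <= k)%N -> (moment j (Z n s) < +oo)%E) ->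
  {ae mu, forall t : R, 0 < t < T -> exists2 e : nat -> R, e n @[n --> \oo] --> 0 &
    forall n j, (j <= k)%N ->
      (moment j (fun xi => z t xi - Z n (mesh_floor T (N n) t) xi)%R <= (e n)%:E)%E} ->
  strongly_measurable (@Winfty_norm R k) T (fun t => synth (z t)).
Proof.
move=> T0 N0 Lz LZ jZ app.
exists N, (fun n => mesh_cell T (N n)), (fun n i => synth (Z n (i%:R * (T / (N n)%:R)))); split.
  move=> n i; split; first exact: measurable_itv.
  have s0 : 0 <= i%:R * (T / (N n)%:R) by rewrite mulr_ge0// divr_ge0// ltW.
  have [L h] := LZ n _ s0.
  apply: le_lt_trans (Winfty_norm_synth k L h) _.
  apply/lte_sum_pinfty => j _.
  apply: lte_mul_pinfty; [by rewrite lee_fin; exact: ltW (@cF_gt0 R)|by []|].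
  by apply: jZ s0 _; rewrite -ltnS.
apply: aeS app => t + t0T => /(_ t0T)[e e0 He].
have t0 : 0 <= t by case/andP: t0T => /ltW.
apply: (@squeeze_cvge _ _ _ _ (fun=> 0%E) _ (fun n => ((k.+1)%:R * cF * e n)%:E)); last 2 first.
- exact: cvg_cst.
- rewrite -[0%E]/(0%:E) -(mulr0 (k.+1%:R * cF)).
  by apply: cvg_EFin; [exact: nearW|apply: cvgMr].
apply: nearW => n; rewrite Winfty_norm_ge0/=.
have [f0 _ _] := mesh_floorP T0 (N0 n) t0.
have [L h] := Lz _ t0; have [L' h'] := LZ n _ f0.
rewrite (_ : (fun x => _) = synth (fun xi => z t xi - Z n (mesh_floor T (N n) t) xi)); last first.
  apply/funext => x; rewrite -(synthB x L L'); congr (_ - _).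
  exact: (sum_mesh_cell (fun i => synth (Z n (i%:R * (T / (N n)%:R))) x) T0 (N0 n) t0T).
apply: le_trans (Winfty_norm_synth k (cL1B L L') (hermitianB h h')) _.
apply: (@le_trans _ _ (\sum_(j < k.+1) (cF * e n)%:E)%E).
  apply: lee_sum => j _; rewrite EFinM lee_wpmul2l ?lee_fin ?(ltW (@cF_gt0 R))// He//.
  by rewrite -ltnS.
rewrite sumEFin lee_fin big_const_ord iter_addr_0 -mulrA [leRHS]mulr_natl.
by [].
Qed.
End time_mesh.

Lemma strongly_measurable_le (R : realType) (N N' : (R -> R) -> \bar R) (T : R)
    (F : R -> R -> R) : (forall a, (0 <= N a)%E) -> (forall a, (N a <= N' a)%E) ->
  strongly_measurable N' T F -> strongly_measurable N T F.
Proof.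
move=> N0 le [m [E [f [fin cv]]]]; exists m, E, f; split.
  by move=> n i; have [mE fN] := fin n i; split=> //; exact: le_lt_trans fN.
apply: aeS cv => t cv /cv {}cv.
apply: (@squeeze_cvge _ _ _ _ (fun=> 0%E) _ _ _ _ _ cv); last exact: cvg_cst.
by apply: nearW => n; rewrite N0 le.
Qed.

Lemma Winfty_norm_le (R : realType) k k' (a : R -> R) : (k <= k')%N ->
  (Winfty_norm k a <= Winfty_norm k' a)%E.
Proof.
move=> kk; rewrite /Winfty_norm.
rewrite -!(big_mkord xpredT (fun j => norm_through (@weak_deriv R j)
  (fun h => 'N[lebesgue_measure]_+oo[EFin \o h])%E a)).
rewrite [leRHS](big_cat_nat _ (n := k.+1))//=; apply: leeDl.
by apply: sume_ge0 => j _; apply: norm_through_ge0 => h; exact: Lnorm_ge0.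
Qed.

(** * The time derivative on the Fourier side *)

Section rate.
Context {R : realType} (m : R -> R).
Hypotheses (mm : measurable_fun setT m) (m_ge0 : forall x, 0 <= m x)
  (m_le1 : forall x, m x <= 1) (m_even : forall x, m (- x) = m x).

Definition rate (h : R -> R[i]) (xi : R) : R[i] := advec m h h xi - absxi h xi.

Lemma cmeas_rate (h : R -> R[i]) : cmeas h -> cmeas (rate h).
Proof. by move=> mh; apply: cmeasB; [exact: cmeas_advec|exact: cmeas_absxi]. Qed.

Lemma cmeas_rate_joint (g : R -> R -> R[i]) : cmeas (fun z : R * R => g z.1 z.2) ->
  cmeas (fun z : R * R => rate (g z.1) z.2).
Proof.
move=> mg; apply: cmeasB; first exact: cmeas_advec_joint.
rewrite (_ : (fun z => _) = fun z : R * R => (`|z.2|)%:C * g z.1 z.2); first by meas.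
by apply/funext => z; rewrite absxiE.
Qed.

Lemma hermitian_rate (h : R -> R[i]) : cmeas h -> hermitian h -> hermitian (rate h).
Proof.
by move=> mh hh; apply: hermitianB; [exact: hermitian_advec|exact: hermitian_absxi].
Qed.

Lemma moment_absxi n (h : R -> R[i]) : moment n (absxi h) = moment n.+1 h.
Proof.
by apply: eq_integral => x _; rewrite nc_absxi exprSr mulrA.
Qed.

Lemma moment0_rate (h : R -> R[i]) (B : R) : cmeas h -> (moment 0 h <= B%:E)%E -> (moment 1 h <= B%:E)%E ->
  (moment 0 (rate h) <= (cF * (B * B) + B)%:E)%E.
Proof.
move=> mh h0 h1; have c0 := @cF_gt0 R.
apply: le_trans (momentB 0 (cmeas_advec mm mh mh) (cmeas_absxi mh)) _.
rewrite moment_absxi EFinD leeD//.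
apply: le_trans (moment0_advec mm m_ge0 m_le1 mh mh) _.
rewrite EFinM lee_wpmul2l ?lee_fin ?(ltW c0)// EFinM.
by apply: lee_pmul => //; exact: moment_ge0.
Qed.

Lemma moment1_rate (h : R -> R[i]) (B : R) : cmeas h -> (moment 0 h <= B%:E)%E ->
  (moment 1 (rate h) <= (2 * cF * B + 1)%:E * moment 2 h)%E.
Proof.
move=> mh h0; have c0 := @cF_gt0 R.
have B0 : 0 <= B by rewrite -lee_fin; apply: le_trans h0; exact: moment_ge0.
apply: le_trans (momentB 1 (cmeas_advec mm mh mh) (cmeas_absxi mh)) _.
rewrite moment_absxi EFinD ge0_muleDl ?lee_fin ?mulr_ge0 ?(ltW c0)// mul1e leeD2r//.
apply: le_trans (moment1_advec mm m_ge0 m_le1 mh) _.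
rewrite [in leRHS]EFinM -muleA lee_wpmul2l ?lee_fin ?mulr_ge0 ?(ltW c0)//.
by rewrite lee_wpmul2r// moment_ge0.
Qed.

Lemma moment0_rateB (h k : R -> R[i]) (B : R) : cL1 h -> cL1 k -> (moment 0 k <= B%:E)%E ->
  (moment 1 h <= B%:E)%E -> (moment 1 k <= B%:E)%E ->
  (moment 0 (fun xi => rate h xi - rate k xi)%R <=
   (cF * B + 1)%:E * (moment 0 (fun xi => h xi - k xi)%R + moment 1 (fun xi => h xi - k xi)%R))%E.
Proof.
move=> Lh Lk k0 h1 k1; have c0 := @cF_gt0 R; have [mh _] := Lh; have [mk _] := Lk.
have B0 : 0 <= B by rewrite -lee_fin; apply: le_trans k0; exact: moment_ge0.
have Lih : cL1 (ixi h) by apply: cL1_ixi => //; apply: le_lt_trans h1 (ltry _).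
have Lik : cL1 (ixi k) by apply: cL1_ixi => //; apply: le_lt_trans k1 (ltry _).
have ma := cmeas_advec mm mh mh; have mb := cmeas_advec mm mk mk.
have md := cmeasB mh mk.
have -> : moment 0 (fun xi => rate h xi - rate k xi) =
    moment 0 (fun xi => (advec m h h xi - advec m k k xi) - absxi (fun xi => h xi - k xi) xi).
  apply: eq_integral => x _; congr (_ * nc _)%:E; rewrite /rate !absxiE; ring.
apply: le_trans (momentB 0 (cmeasB ma mb) (cmeas_absxi md)) _.
rewrite moment_absxi [in leRHS]EFinD ge0_muleDl ?lee_fin ?mulr_ge0 ?(ltW c0)// mul1e.
apply: leeD; last by rewrite leeDr// moment_ge0.
apply: le_trans (moment0_advecB mm m_ge0 m_le1 Lh Lk Lih Lik mh mk) _.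
rewrite EFinM -muleA lee_wpmul2l ?lee_fin ?(ltW c0)// [leRHS]ge0_muleDr ?moment_ge0//.
apply: leeD; first by rewrite muleC lee_wpmul2r ?moment_ge0.
by rewrite lee_wpmul2r ?moment_ge0.
Qed.

End rate.

Lemma int_tri (R : realType) (t : R) : 0 <= t -> (\int[mu]_s (tri t s)%:E = t%:E)%E.
Proof.
move=> t0; transitivity (\int[mu]_(s in [set: R]) (\1_(`[0, t]%classic) s)%:E)%E.
  by apply: eq_integral => s _; rewrite triE indic_itvccE.
rewrite integral_indic// setIT; apply: etrans (lebesgue_measure_itv _) _ => /=.
by rewrite lte_fin; case: ltgtP t0 => // [_|<-] _; rewrite ?sube0 ?EFinN ?oppr0 ?subr0.
Qed.

Section evolution.
Context {R : realType} (m : R -> R).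
Hypotheses (mm : measurable_fun setT m) (m_ge0 : forall x, 0 <= m x)
  (m_le1 : forall x, m x <= 1) (m_even : forall x, m (- x) = m x).

(* The Fourier side of the equation: [g0] is the transform of the initial datum. *)
Record evolution (g0 : R -> R[i]) (B : R) (g : R -> R -> R[i]) : Prop := Evolution {
  evo_cmeas0 : cmeas g0;
  evo_cmeas : cmeas (fun z : R * R => g z.1 z.2);
  evo_moment0 : forall t, 0 <= t -> (moment 0 (g t) <= B%:E)%E;
  evo_moment1 : forall t, 0 <= t -> (moment 1 (g t) <= B%:E)%E;
  evo_eq : {ae mu, forall xi : R, forall t : R, 0 <= t ->
    g t xi = g0 xi + cintegral (fun s => (tri t s)%:C * rate m (g s) xi)} }.

Variables (g0 : R -> R[i]) (B : R) (g : R -> R -> R[i]).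
Hypothesis evo : evolution g0 B g.

Let mg := evo_cmeas evo.
Let mgt t : cmeas (g t). Proof. exact: cmeas_slice (t) mg. Qed.
Let c0 := @cF_gt0 R.
Let B0 : 0 <= B.
Proof. by rewrite -lee_fin; apply: le_trans (evo_moment0 evo (lexx 0)); exact: moment_ge0. Qed.
Let mr : cmeas (fun z : R * R => rate m (g z.1) z.2).
Proof. exact: cmeas_rate_joint. Qed.
Let C := cF * (B * B) + B.
Let C0 : 0 <= C. Proof. by rewrite addr_ge0// !mulr_ge0// ltW. Qed.

Lemma evo_cL1 (t : R) : 0 <= t -> cL1 (g t).
Proof. by move=> t0; apply: moment0_cL1 => //; apply: le_lt_trans (evo_moment0 evo t0) (ltry _). Qed.

Lemma evo_rate0 (t : R) : 0 <= t -> (moment 0 (rate m (g t)) <= C%:E)%E.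
Proof.
move=> t0.
have := moment0_rate mm m_ge0 m_le1 (mgt t) (evo_moment0 evo t0) (evo_moment1 evo t0); exact.
Qed.

Lemma evo_cL1_rate (t : R) : 0 <= t -> cL1 (rate m (g t)).
Proof.
move=> t0; apply: moment0_cL1; first exact: cmeas_rate.
by apply: le_lt_trans (evo_rate0 t0) (ltry _).
Qed.

Lemma evo_trim_rate (t : R) : (trim 0 (fun s => rate m (g s)) t < +oo)%E.
Proof.
apply: (@le_lt_trans _ _ (\int[mu]_s (C * tri t s)%:E)%E).
  apply: le_int => s; first by rewrite mule_ge0 ?moment_ge0// lee_fin tri_ge0.
  rewrite triE; case: (boolP (0 <= s <= t)) => [/andP[s0 _]|_]; last by rewrite mul0e mulr0.
  by rewrite mul1e mulr1; exact: evo_rate0.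
have mt := measurable_tri1 t.
rewrite intZ//; last by move=> s; exact: tri_ge0.
rewrite lte_mul_pinfty ?lee_fin//; have [t0|t0] := leP 0 t; first by rewrite int_tri ?ltry.
rewrite integral0_eq// => s _; rewrite triE; case: (boolP (0 <= s <= t)) => // /andP[s0 st].
by move: (le_lt_trans (le_trans s0 st) t0); rewrite ltxx.
Qed.

(** For [0 <= s <= t], the indicator of []s, t]], written as the difference that appears when two
    primitives are subtracted. *)
Definition window (s t r : R) : R := tri t r - tri s r.

Lemma window_ge0 s t r : s <= t -> 0 <= window s t r.
Proof. by move=> st; rewrite subr_ge0 tri_le. Qed.

Lemma measurable_window s t : measurable_fun setT (window s t).
Proof. by apply: mfunD; [|apply: mfunN]; exact: measurable_tri1. Qed.

Lemma evo_increment : {ae mu, forall xi : R, forall s t : R, 0 <= s <= t ->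
  ((nc (g t xi - g s xi))%:E <= \int[mu]_r (window s t r * nc (rate m (g r) xi))%:E)%E}.
Proof.
(* Integer times suffice for a null set of frequencies common to all [s] and [t], since [trin] does
   not decrease in time. *)
have F : {ae mu, forall xi : R, forall n : nat, (trin (fun s => rate m (g s) xi) n%:R < +oo)%E}.
  apply: ae_forall_nat => n; apply: (trim_fin_ae (n := 0)) => //; exact: evo_trim_rate.
apply: aeS (aeI (evo_eq evo) F) => xi [E {}F] s t /andP[s0 st].
have mx : cmeas (fun s => rate m (g s) xi) by exact: (cmeas_swap_slice (z := fun s => rate m (g s)) xi mr).
have t0 := le_trans s0 st.
have fin : (trin (fun s => rate m (g s) xi) t < +oo)%E.
  apply: le_lt_trans (F (Num.bound t)); apply: trin_le => //.
  exact: ltW (archi_boundP t0).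
have fins := le_lt_trans (trin_le _ st) fin.
rewrite (E _ t0) (E _ s0).
have T (a b c d : R[i]) : d = b - c -> a + b - (a + c) = d by move=> ->; ring.
rewrite (T _ _ _ _ (cintegralB (cL1_tri mx fin) (cL1_tri mx fins))).
apply: le_trans (nc_cintegral _) _.
  by apply: cmeasB; exact: cmeas_tri.
rewrite le_eqVlt; apply/orP; left; apply/eqP; apply: eq_integral => r _.
rewrite -mulrBl -RCB ncM nc_real ger0_norm//; exact: window_ge0.
Qed.

Lemma moment_increment n (s t : R) : 0 <= s <= t ->
  (moment n (fun xi => g t xi - g s xi)%R <=
   \int[mu]_r ((window s t r)%:E * moment n (rate m (g r))))%E.
Proof.
move=> st; have /andP[s0 ts] := st; have mw := measurable_window s t.
have mnr := measurable_nc mr.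
have mJ : measurable_fun setT (fun z : R * R => ((`|z.1| ^+ n)%:E * (window s t z.2 * nc (rate m (g z.2) z.1))%:E)%E).
  have mnr' : measurable_fun setT (fun z : R * R => nc (rate m (g z.2) z.1)).
    by apply: (measurableT_comp (f := fun z : R * R => nc (rate m (g z.1) z.2)) mnr (g := fun z : R * R => (z.2, z.1))); meas.
  by apply: measurable_EFin (_ : measurable_fun setT (fun z : R * R => `|z.1| ^+ n * (window s t z.2 * nc (rate m (g z.2) z.1)))); meas.
have p0 (a b : R) : (0 <= (`|a| ^+ n)%:E * (window s t b * nc (rate m (g b) a))%:E)%E.
  by rewrite -EFinM lee_fin !mulr_ge0 ?exprn_ge0 ?nc_ge0 ?window_ge0.
apply: (@le_trans _ _ (\int[mu]_xi \int[mu]_r ((`|xi| ^+ n)%:E * (window s t r * nc (rate m (g r) xi))%:E))%E).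
  apply: le_int_ae.
  - by have md := measurable_nc (cmeasB (mgt t) (mgt s)); meas.
  - exact: (measurable_int_prod (F := fun a b : R => (`|a| ^+ n)%:E * (window s t b * nc (rate m (g b) a))%:E)%E mJ p0).
  - by move=> x; rewrite lee_fin mulr_ge0 ?exprn_ge0 ?nc_ge0.
  - by move=> x; exact: integral_ge0.
  apply: aeS evo_increment => xi /(_ _ _ st) H.
  have mx : cmeas (fun s => rate m (g s) xi) by exact: (cmeas_swap_slice (z := fun s => rate m (g s)) xi mr).
  have mnx := measurable_nc mx.
  rewrite ge0_integralZl_EFin ?exprn_ge0//; last 2 first.
  - by move=> r _; rewrite lee_fin mulr_ge0 ?nc_ge0 ?window_ge0.
  - by meas.
  by rewrite EFinM lee_wpmul2l ?lee_fin ?exprn_ge0.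
rewrite (int_fubini mJ p0) le_eqVlt; apply/orP; left; apply/eqP.
apply: eq_integral => r _.
have mx := measurable_nc (cmeas_rate mm (mgt r)).
rewrite /moment -ge0_integralZl_EFin ?window_ge0//; last 2 first.
- by move=> x _; rewrite lee_fin mulr_ge0 ?exprn_ge0 ?nc_ge0.
- by meas.
by apply: eq_integral => x _; rewrite -!EFinM mulrCA.
Qed.

Lemma int_window (s t : R) : 0 <= s <= t -> (\int[mu]_r (window s t r)%:E = (t - s)%:E)%E.
Proof.
move=> /andP[s0 st]; have t0 := le_trans s0 st.
have mt := measurable_tri1 t; have ms := measurable_tri1 s; have mw := measurable_window s t.
have H : (\int[mu]_r (tri t r)%:E = \int[mu]_r (window s t r)%:E + \int[mu]_r (tri s r)%:E)%E.
  rewrite -intD//; [|by move=> r; exact: window_ge0|by move=> r; exact: tri_ge0].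
  by apply: eq_integral => r _; rewrite subrK.
by move: H; rewrite !int_tri// EFinB => ->; rewrite addeK.
Qed.

Lemma moment0_increment (s t : R) : 0 <= s <= t ->
  (moment 0 (fun xi => g t xi - g s xi)%R <= (C * (t - s))%:E)%E.
Proof.
move=> st; apply: le_trans (moment_increment 0 st) _; have /andP[s0 ts] := st.
have mw := measurable_window s t.
rewrite EFinM -(int_window st) -intZ//; last by move=> r; exact: window_ge0.
apply: le_int => r; first by rewrite mule_ge0 ?moment_ge0// lee_fin window_ge0.
have [r0|r0] := leP 0 r; last first.
  by rewrite /window !triE (lt_geF r0)/= subrr mul0e mulr0.
by rewrite EFinM muleC lee_wpmul2r ?lee_fin ?window_ge0// evo_rate0.
Qed.

Hypothesis g2 : forall t, 0 <= t -> (trim 2 g t < +oo)%E.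

Let K := 2 * cF * B + 1.
Let K0 : 0 <= K. Proof. by rewrite addr_ge0// !mulr_ge0// ltW. Qed.

Lemma evo_moment2_ae : {ae mu, forall t : R, 0 <= t -> (moment 2 (g t) < +oo)%E}.
Proof.
have H : {ae mu, forall t : R, forall n : nat, ((tri n%:R t)%:E * moment 2 (g t) < +oo)%E}.
  apply: ae_forall_nat => n; apply: int_lty_ae.
  - by apply: measurable_triM; exact: measurable_moment.
  - by move=> s; rewrite mule_ge0 ?moment_ge0// lee_fin tri_ge0.
  - by apply: g2.
apply: aeS H => t H t0; have := H (Num.bound t).
by rewrite triE t0 (ltW (archi_boundP t0)) mul1e.
Qed.

(** [M_1] of the rate is bounded by a multiple of [M_2], which is only integrable in time. Unlike
    [M_0], which is Lipschitz, [M_1] is therefore continuous from the left without a rate, by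
    dominated convergence on the shrinking windows []s n, t]]. *)
Lemma cvg_moment1_increment (t : R) (s : nat -> R) : (forall n, 0 <= s n <= t) ->
  s n @[n --> \oo] --> t ->
  moment 1 (fun xi => g t xi - g (s n) xi)%R @[n --> \oo] --> 0%E.
Proof.
move=> st cs; have t0 : 0 <= t by have /andP[] := st 0%N; exact: le_trans.
have mm2 : measurable_fun setT (fun r => moment 2 (g r)) by exact: measurable_moment.
(* A real-valued substitute for [M_2]: it agrees with [M_2] where this is finite, that is at almost
   every time [t >= 0], and is 0 elsewhere. *)
have [f2 [mf2 f20 f2E]] : exists f2 : R -> R, [/\ measurable_fun setT f2,
    (forall r, 0 <= f2 r) & (forall r, f2 r = fine (moment 2 (g r)))].
  exists (fun r => fine (moment 2 (g r))); split => // [|r]; last exact/fine_ge0/moment_ge0.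
  exact: (measurableT_comp (@fine_measurable _ _ measurableT) mm2).
have mt := measurable_tri1 t.
have mw n := measurable_window (s n) t.
have Z : (\int[mu]_r (K * (window (s n) t r * f2 r))%:E)%E @[n --> \oo] --> 0%E.
  apply: (int_dct0 (g := fun r => K * (tri t r * f2 r))).
  - by move=> n; have mwn := mw n; clear mm2; meas.
  - by clear mm2; meas.
  - by move=> n r; rewrite !mulr_ge0 ?window_ge0//; have /andP[] := st n.
  - apply: aeT => r n; rewrite ler_wpM2l// ler_wpM2r// gerBl; exact: tri_ge0.
  - under eq_integral do rewrite ger0_norm ?mulr_ge0 ?tri_ge0//.
    rewrite intZ//; [|by clear mm2; meas|by move=> r; rewrite mulr_ge0 ?tri_ge0].
    rewrite lte_mul_pinfty ?lee_fin//; apply: le_lt_trans (g2 t0).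
    apply: le_int => r; first by rewrite lee_fin mulr_ge0 ?tri_ge0.
    rewrite EFinM lee_wpmul2l ?lee_fin ?tri_ge0//.
    by rewrite f2E; have := moment_ge0 2 (g r); case: (moment 2 (g r)) => //= *; exact: leey.
  - have nt := ae_neq (t : R).
    apply: aeS nt => r rt; apply: cvg_near_cst.
    have W0 n : (r < s n) || (t < r) -> window (s n) t r = 0.
      have /andP[s0 sn] := st n; rewrite /window !triE; have [r0|r0] := leP 0 r; last by rewrite /= subrr.
      case/orP => h; first by rewrite (ltW h) (le_trans (ltW h) sn) subrr.
      by rewrite (lt_geF h) (lt_geF (le_lt_trans sn h)) subrr.
    case: (ltgtP r t) rt => // [rt _|tr _].
      near=> n; rewrite W0 ?mul0r ?mulr0//; apply/orP; left.
      by near: n; exact: cvgr_gt cs _ rt.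
    by apply: nearW => n; rewrite W0 ?tr ?orbT// mul0r mulr0.
apply: (squeeze_cvge _ (cvg_cst _) Z).
apply: nearW => n; rewrite moment_ge0/=.
apply: le_trans (moment_increment 1 (st n)) _.
have mw' := mw n; have w0 (r : R) : 0 <= window (s n) t r by apply: window_ge0; have /andP[] := st n.
have mr1 : measurable_fun setT (fun r => moment 1 (rate m (g r))).
  exact: (@measurable_moment _ _ _ 1 (fun r => rate m (g r)) mr).
apply: le_int_ae.
- by apply: emeasurable_funM; [clear mm2; meas|].
- by clear mm2; meas.
- by move=> r; rewrite mule_ge0 ?moment_ge0// lee_fin.
- by move=> r; rewrite lee_fin !mulr_ge0.
apply: aeS evo_moment2_ae => r H; have [r0|r0] := leP 0 r; last first.
  by rewrite /window !triE (lt_geF r0)/= subrr mul0e mul0r mulr0.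
rewrite mulrCA EFinM lee_wpmul2l ?lee_fin// EFinM f2E fineK ?ge0_fin_numE ?moment_ge0 ?H//.
have := moment1_rate mm m_ge0 m_le1 (mgt r) (evo_moment0 evo r0); exact.
Unshelve. all: by end_near. Qed.

Hypothesis hg : forall t, 0 <= t -> hermitian (g t).

Let mesh_close (T : R) (N : nat) t : 0 < T -> (0 < N)%N -> 0 <= t ->
  0 <= mesh_floor T N t <= t /\ t - mesh_floor T N t <= T / N%:R.
Proof.
move=> T0 N0 t0; have [a b c] := mesh_floorP T0 N0 t0; split; first by rewrite a b.
by rewrite lerBlDl ltW.
Qed.

Lemma cvg_harmonic_scale (c : R) : c / n.+1%:R @[n --> \oo] --> (0 : R).
Proof. by rewrite -(mulr0 c); apply: cvgMr; exact: cvg_harmonic. Qed.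

Lemma cvg_mesh_floor (T : R) t : 0 < T -> 0 <= t -> mesh_floor T n.+1 t @[n --> \oo] --> t.
Proof.
move=> T0 t0; apply/cvgrPdist_le => e e0.
have /cvgrPdist_le/(_ e e0) := cvg_harmonic_scale T.
apply: filterS => n; rewrite sub0r normrN => h.
have [/andP[_ a] b] := mesh_close T0 (ltn0Sn n) t0.
by rewrite ger0_norm ?subr_ge0//; apply: le_trans b (le_trans (ler_norm _) h).
Qed.

(** The rate frozen at the mesh points converges: [moment0_rateB] bounds its variation by the
    increments of [g] in [M_0] and [M_1], both of which vanish as the mesh is refined. *)
Lemma rate_strongly_measurable (T : R) : 0 < T ->
  strongly_measurable (@Winfty_norm R 0) T (fun t => synth (rate m (g t))).
Proof.
move=> T0; have Lh t : 0 <= t -> cL1 (rate m (g t)) /\ hermitian (rate m (g t)).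
  by move=> t0; split; [exact: evo_cL1_rate|exact: (hermitian_rate mm m_even (mgt t) (hg t0))].
apply: (strongly_measurable_synth (N := fun n => n.+1) (Z := fun _ s => rate m (g s))) => //.
  move=> n s j s0; rewrite leqn0 => /eqP ->; apply: le_lt_trans (evo_rate0 s0) (ltry _).
apply: aeT => t /andP[/ltW t0 _].
pose s n := mesh_floor T n.+1 t.
have st n : 0 <= s n <= t by have [] := mesh_close T0 (ltn0Sn n) t0.
have cs : s n @[n --> \oo] --> t by exact: cvg_mesh_floor.
have c1 := cvg_moment1_increment st cs.
pose e n := (cF * B + 1) * (C * (t - s n) + fine (moment 1 (fun xi => g t xi - g (s n) xi))).
have f1 n : moment 1 (fun xi => g t xi - g (s n) xi) \is a fin_num.
  rewrite ge0_fin_numE ?moment_ge0//; apply: le_lt_trans (momentB 1 (mgt t) (mgt (s n))) _.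
  have /andP[s0 _] := st n.
  by apply: le_lt_trans (leeD (evo_moment1 evo t0) (evo_moment1 evo s0)) (ltry _).
exists e.
  rewrite -(mulr0 (cF * B + 1)) -[X in _ * X](addr0 0); apply: cvgMr; apply: cvgD.
    by rewrite -(mulr0 C) -(subrr t); apply: cvgMr; apply: cvgB => //; exact: cvg_cst.
  exact: (fine_cvg c1).
move=> n j; rewrite leqn0 => /eqP ->; have /andP[s0 _] := st n.
apply: le_trans (moment0_rateB mm m_ge0 m_le1 (evo_cL1 t0) (evo_cL1 s0) (evo_moment0 evo s0)
  (evo_moment1 evo t0) (evo_moment1 evo s0)) _.
rewrite /e EFinM lee_wpmul2l ?lee_fin ?addr_ge0 ?mulr_ge0 ?(ltW c0)//.
by rewrite EFinD fineK// leeD2r// moment0_increment.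
Qed.

End evolution.

(** * Truncation in frequency *)

Section cutoff.
Context {R : realType}.
Implicit Types h k : R -> R[i].

(** [M_2 (g t)] is finite at almost every time only, so the value of [g] at a mesh point need not
    give an element of [W^{2,oo}]. Its truncation does, at the price of a factor of order [n^2] on
    the increments in [M_0]. *)
Definition cutoff (n : nat) h (xi : R) : R[i] := (\1_(`[- n%:R, n%:R]%classic) xi)%:C * h xi.

Lemma cmeas_cutoff n h : cmeas h -> cmeas (cutoff n h).
Proof.
move=> mh; apply: cmeasM => //; apply: cmeas_real.
exact: (mfun_indic (measurable_itv _) (@measurable_id _ _ _)).
Qed.

Lemma cutoff_indicE n (x : R) : \1_(`[- n%:R, n%:R]%classic) x = (`|x| <= n%:R)%R%:R :> R.
Proof. by rewrite indic_itvccE ler_norml. Qed.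

Lemma hermitian_cutoff n h : hermitian h -> hermitian (cutoff n h).
Proof. by move=> hh xi; rewrite /cutoff !cutoff_indicE normrN hh conjcM conjcR. Qed.

Lemma moment_cutoff n j h : cmeas h -> (moment j (cutoff n h) <= (n%:R ^+ j)%:E * moment 0 h)%E.
Proof.
move=> mh; have mnh := measurable_nc mh.
rewrite /moment -intZ ?exprn_ge0//; [|by meas|by move=> x; rewrite mulr_ge0 ?exprn_ge0 ?nc_ge0].
apply: le_int => x; rewrite lee_fin; first by rewrite mulr_ge0 ?exprn_ge0 ?nc_ge0.
rewrite /cutoff cutoff_indicE expr0 mul1r; case: (boolP (`|x| <= n%:R)) => h'.
  by rewrite mul1r ler_wpM2r ?nc_ge0// lerXn2r// nnegrE.
by rewrite mul0r nc0 mulr0 mulr_ge0 ?exprn_ge0 ?nc_ge0.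
Qed.

(** The difference is the high-frequency tail of [h], where [|xi|^j <= 1 + |xi|^2], plus the
    truncation of [h - k], where [|xi| <= n]. *)
Lemma moment_cutoffB n j h k : (j <= 2)%N -> cmeas h -> cmeas k ->
  (moment j (fun xi => h xi - cutoff n k xi)%R <=
   (moment 0 (fun xi => h xi - cutoff n h xi)%R + moment 2 (fun xi => h xi - cutoff n h xi)%R) +
   (n.+1%:R ^+ 2)%:E * moment 0 (fun xi => h xi - k xi)%R)%E.
Proof.
move=> j2 mh mk; have mch := cmeas_cutoff n mh; have mck := cmeas_cutoff n mk.
have mhk := cmeasB mh mk.
have m1 := measurable_nc (cmeasB mh mch); have m2 := measurable_nc mhk.
rewrite /moment -intZ ?exprn_ge0//; [|by meas|by move=> x; rewrite mulr_ge0 ?exprn_ge0 ?nc_ge0].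
rewrite -intD; [|by meas|by meas|by move=> x; rewrite mulr_ge0 ?exprn_ge0 ?nc_ge0..].
rewrite -intD; [|by meas|by meas|by move=> x; rewrite addr_ge0// mulr_ge0 ?exprn_ge0 ?nc_ge0|
  by move=> x; rewrite !mulr_ge0 ?exprn_ge0 ?nc_ge0].
apply: le_int => x; rewrite lee_fin; first by rewrite mulr_ge0 ?exprn_ge0 ?nc_ge0.
rewrite /cutoff cutoff_indicE !expr0 !mul1r; case: (boolP (`|x| <= n%:R)) => h'.
  rewrite !mul1r subrr nc0 mulr0 addr0 add0r ler_wpM2r ?nc_ge0//.
  have [x1|x1] := leP `|x| 1; last first.
    apply: le_trans (ler_weXn2l (ltW x1) j2) _.
    by rewrite lerXn2r ?nnegrE// (le_trans h')// ler_nat.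
  (* The constant is [(n + 1)^2] rather than [n^2] so as to dominate [|x|^j <= 1] also when
     [n = 0]. *)
  apply: (@le_trans _ _ 1); first exact: exprn_ile1.
  by rewrite exprn_ege1// ler1n.
have -> : ((false%:R : R))%:C = 0 by [].
rewrite !mul0r !subr0 -[X in _ <= X + _ + _]mul1r -mulrDl.
apply: (@le_trans _ _ ((1 + `|x| ^+ 2) * nc (h x))).
  rewrite ler_wpM2r ?nc_ge0//; have [x1|x1] := leP `|x| 1.
    by apply: (@le_trans _ _ 1); [exact: exprn_ile1|rewrite lerDl exprn_ge0].
  by apply: le_trans (ler_weXn2l (ltW x1) j2) _; rewrite lerDr.
by rewrite lerDl mulr_ge0 ?exprn_ge0 ?nc_ge0.
Qed.

Lemma cvg_moment_cutoff j h : cmeas h -> (moment j h < +oo)%E ->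
  moment j (fun xi => h xi - cutoff n h xi)%R @[n --> \oo] --> 0%E.
Proof.
move=> mh hj; have mnh := measurable_nc mh.
apply: (int_dct0 (g := fun x => `|x| ^+ j * nc (h x))).
- by move=> n; have := measurable_nc (cmeasB mh (cmeas_cutoff n mh)); move=> ?; meas.
- by meas.
- by move=> n x; rewrite mulr_ge0 ?exprn_ge0 ?nc_ge0.
- apply: aeT => x n; rewrite ler_wpM2l ?exprn_ge0//.
  rewrite /cutoff cutoff_indicE; case: (boolP (`|x| <= n%:R)) => h'.
    by rewrite mul1r subrr nc0 nc_ge0.
  by rewrite mul0r subr0.
- by under eq_integral do rewrite ger0_norm ?mulr_ge0 ?exprn_ge0 ?nc_ge0//.
apply: aeT => x; apply: cvg_near_cst; near=> n.
rewrite /cutoff cutoff_indicE (_ : (`|x| <= n%:R) = true) ?mul1r ?subrr ?nc0 ?mulr0//.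
by near: n; exact: nbhs_infty_ger.
Unshelve. all: by end_near. Qed.

End cutoff.

Section evolution_W.
Context {R : realType} (m : R -> R).
Hypotheses (mm : measurable_fun setT m) (m_ge0 : forall x, 0 <= m x)
  (m_le1 : forall x, m x <= 1) (m_even : forall x, m (- x) = m x).
Variables (g0 : R -> R[i]) (B : R) (g : R -> R -> R[i]).
Hypothesis evo : evolution m g0 B g.
Hypothesis g2 : forall t, 0 <= t -> (trim 2 g t < +oo)%E.
Hypothesis hg : forall t, 0 <= t -> hermitian (g t).

Let mg := evo_cmeas evo.
Let mgt t : cmeas (g t). Proof. exact: cmeas_slice (t) mg. Qed.
Let c0 := @cF_gt0 R.
Let B0 : 0 <= B.
Proof. by rewrite -lee_fin; apply: le_trans (evo_moment0 evo (lexx 0)); exact: moment_ge0. Qed.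
Let L1 t : 0 <= t -> cL1 (g t). Proof. exact: evo_cL1 evo t. Qed.

Lemma evo_strongly_measurable (T : R) : 0 < T ->
  strongly_measurable (@Winfty_norm R 2) T (fun t => synth (g t)).
Proof.
move=> T0.
(* Truncation costs [(n + 1)^2] times an increment in [M_0], itself at most a constant times the
   step [T / N n]; a cubic number of cells makes the product tend to 0. *)
pose N n := (n.+1 ^ 3)%N; have N0 n : (0 < N n)%N by rewrite expn_gt0.
have cut0 n t j : 0 <= t -> (moment j (cutoff n (g t)) < +oo)%E.
  move=> t0; apply: le_lt_trans (moment_cutoff n j (mgt t)) _.
  rewrite lte_mul_pinfty ?lee_fin ?exprn_ge0//.
  by apply: le_lt_trans (evo_moment0 evo t0) (ltry _).
apply: (strongly_measurable_synth (N := N) (Z := fun n s => cutoff n (g s))) => //.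
- by move=> t t0; split; [exact: L1|exact: hg].
- move=> n s s0; split; last exact/hermitian_cutoff/hg.
  by apply: moment0_cL1; [exact: cmeas_cutoff|exact: cut0].
- by move=> n s j s0 _; exact: cut0.
apply: aeS (evo_moment2_ae evo g2) => t Ht /andP[/ltW t0 _]; have {}Ht := Ht t0.
have H0 : (moment 0 (g t) < +oo)%E by apply: le_lt_trans (evo_moment0 evo t0) (ltry _).
have c1 := cvg_moment_cutoff (mgt t) H0; have c2 := cvg_moment_cutoff (mgt t) Ht.
have fin j n : (moment j (g t) < +oo)%E -> moment j (fun xi => g t xi - cutoff n (g t) xi) \is a fin_num.
  move=> h; rewrite ge0_fin_numE ?moment_ge0//.
  apply: le_lt_trans (momentB j (mgt t) (cmeas_cutoff n (mgt t))) _.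
  by rewrite lte_add_pinfty// cut0.
pose C := cF * (B * B) + B.
pose e n := fine (moment 0 (fun xi => g t xi - cutoff n (g t) xi)) +
  fine (moment 2 (fun xi => g t xi - cutoff n (g t) xi)) + C * T / n.+1%:R.
exists e.
  rewrite -(addr0 0) -[X in _ --> X + _](addr0 0); apply: cvgD; last exact: cvg_harmonic_scale.
  by apply: cvgD; [exact: (fine_cvg c1)|exact: (fine_cvg c2)].
move=> n j j2; have [f0 ft ft'] := mesh_floorP T0 (N0 n) t0.
apply: le_trans (moment_cutoffB n j2 (mgt t) (mgt (mesh_floor T (N n) t))) _.
rewrite /e !EFinD !fineK ?fin//; apply: leeD => //.
have st : 0 <= mesh_floor T (N n) t <= t by rewrite f0 ft.
apply: le_trans (lee_wpmul2l _ (moment0_increment mm m_ge0 m_le1 evo st)) _.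
  by rewrite lee_fin exprn_ge0.
have C0 : 0 <= C by rewrite addr_ge0// !mulr_ge0// ltW.
rewrite -EFinM lee_fin -/C; apply: (@le_trans _ _ (n.+1%:R ^+ 2 * (C * (T / (N n)%:R)))).
  rewrite ler_wpM2l ?exprn_ge0// ler_wpM2l//.
  by rewrite lerBlDl; exact: ltW.
rewrite le_eqVlt; apply/orP; left; apply/eqP; rewrite /N natrX.
have : n.+1%:R != 0 :> R by rewrite pnatr_eq0.
by move: (n.+1%:R) => q q0; field.
Qed.

Lemma evo_Winfty_le k (t : R) : (k <= 1)%N -> 0 <= t ->
  (Winfty_norm k (synth (g t)) <= (2 * (cF * B))%:E)%E.
Proof.
move=> k1 t0; apply: le_trans (Winfty_norm_le _ k1) _.
apply: le_trans (Winfty_norm_synth 1 (L1 t0) (hg t0)) _.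
rewrite !big_ord_recr big_ord0/= add0e mulr_natl mulr2n EFinD EFinM.
by apply: leeD; apply: lee_wpmul2l; rewrite ?lee_fin ?(ltW c0)//; [have := evo_moment0 evo t0|have := evo_moment1 evo t0].
Qed.

Lemma jointly_measurable_synth (z : R -> R -> R[i]) : cmeas (fun w : R * R => z w.1 w.2) ->
  jointly_measurable (fun t => synth (z t)).
Proof.
move=> mz.
have H : cmeas (fun w : R * R => cintegral (fun xi => z w.1 xi * cis (w.2 * xi))).
  apply: (cmeas_cintegral (F := fun (w : R * R) (xi : R) => z w.1 xi * cis (w.2 * xi))).
  by meas.
by case: (cmeasM (cmeas_cst _ (cF%:C)) H).
Qed.

(** The norm is at most [cF (M_0 + M_1 + M_2)]: two bounded terms and one whose time integral is
    part of the dissipation. *)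
Lemma evo_bochner_L1 (T : R) : 0 < T -> bochner_L1 (@Winfty_norm R 2) T (fun t => synth (g t)).
Proof.
move=> T0; split; [exact: jointly_measurable_synth|exact: evo_strongly_measurable|].
have mt := measurable_tri1 T.
have mm2 : measurable_fun setT (fun t => moment 2 (g t)) by exact: measurable_moment.
apply: (@le_lt_trans _ _ (\int[mu]_s ((2 * (cF * B))%:E * (tri T s)%:E + cF%:E * ((tri T s)%:E * moment 2 (g s))))%E).
  rewrite int_indic; apply: le_int => t.
    by rewrite mule_ge0 ?Winfty_norm_ge0// lee_fin.
  have [t0T|nt] := boolP (0 < t < T); last first.
    rewrite indicF ?mul0e; last by rewrite /= in_itv/=; exact/negP.
    by rewrite adde_ge0// !mule_ge0 ?lee_fin ?mulr_ge0 ?tri_ge0 ?(ltW c0)// ?moment_ge0.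
  have /andP[t0 tT] := t0T; have t0' := ltW t0.
  rewrite indicT ?mul1e; last by rewrite /= in_itv.
  apply: le_trans (Winfty_norm_synth 2 (L1 t0') (hg t0')) _.
  rewrite !big_ord_recr big_ord0/= add0e triE t0' (ltW tT) mule1 mul1e leeD2r//.
  rewrite mulr_natl mulr2n EFinD EFinM.
  by apply: leeD; apply: lee_wpmul2l; rewrite ?lee_fin ?(ltW c0)//; [have := evo_moment0 evo t0'|have := evo_moment1 evo t0'].
have k0 : 0 <= 2 * (cF * B) by rewrite !mulr_ge0// ltW.
rewrite ge0_integralD//; first last.
- by apply: measurable_funeM; exact: measurable_triM.
- by move=> s _; rewrite !mule_ge0 ?lee_fin ?tri_ge0 ?(ltW c0)// ?moment_ge0.
- by apply: measurable_funeM; meas.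
- by move=> s _; rewrite mule_ge0 ?lee_fin ?tri_ge0.
rewrite !ge0_integralZl_EFin//; first last.
- by meas.
- by move=> s _; rewrite lee_fin tri_ge0.
- exact: ltW.
- exact: measurable_triM.
- by move=> s _; rewrite mule_ge0 ?lee_fin ?tri_ge0// moment_ge0.
rewrite (int_tri (ltW T0)) -EFinM lte_add_pinfty ?ltry//.
by rewrite lte_mul_pinfty ?lee_fin ?(ltW c0)//; exact: g2 (ltW T0).
Qed.

End evolution_W.


(** * Integration by parts in time *)

Section time_by_parts.
Context {R : realType}.

(** [P] is the primitive of [p] that vanishes at [T]. Fubini on the triangle replaces integration by
    parts, so that [f] is only integrable and its primitive is never differentiated. *)
Lemma time_by_parts (T M : R) (z0 : R[i]) (f p P : R -> R[i]) : 0 <= T ->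
  cmeas f -> cmeas p -> (trin f T < +oo)%E -> (forall t, 0 <= t <= T -> nc (p t) <= M) ->
  (forall s : R, 0 <= s <= T -> P s = - cintegral (fun t => (tri T t * tri t s)%:C * p t)) ->
  cintegral (fun t => (tri T t)%:C * (p t * (z0 + cintegral (fun s => (tri t s)%:C * f s)))) =
  - (P 0 * z0) - cintegral (fun s => (tri T s)%:C * (f s * P s)).
Proof.
move=> T0 mf mp fT pM PE; have mt := measurable_tri1 T; have mt2 := @measurable_tri R.
have M0 : 0 <= M by apply: le_trans (pM 0 _); rewrite ?nc_ge0 ?lexx.
have mJ : cmeas (fun w : R * R => ((tri T w.1 * tri w.1 w.2)%:C * p w.1) * f w.2) by meas.
have bnd (t s : R) : nc (((tri T t * tri t s)%:C * p t) * f s) <= M * (tri T t * (tri T s * nc (f s))).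
  rewrite !ncM nc_real ger0_norm ?mulr_ge0 ?tri_ge0//.
  rewrite (triE T t); have [tT|_] := boolP (0 <= t <= T); last by rewrite !mul0r mulr0.
  rewrite mul1r mul1r; have /andP[_ tT'] := tT.
  have H1 := tri_le s tT'; have H2 := pM t tT; have N := nc_ge0 (f s).
  rewrite [leRHS]mulrA ler_wpM2r// [leRHS]mulrC; apply: ler_pM => //; [exact: tri_ge0|exact: nc_ge0].
have fin : (\int[mu]_t \int[mu]_s (nc (((tri T t * tri t s)%:C * p t) * f s))%:E < +oo)%E.
  have mnf := measurable_nc mf.
  apply: (@le_lt_trans _ _ (\int[mu]_t ((M * fine (trin f T)) * tri T t)%:E)%E).
    apply: le_int => t; first by apply: integral_ge0 => s _; rewrite lee_fin nc_ge0.
    apply: (@le_trans _ _ (\int[mu]_s ((M * tri T t) * (tri T s * nc (f s)))%:E)%E).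
      by apply: le_int => s; rewrite lee_fin ?nc_ge0// -[leRHS]mulrA; exact: bnd.
    rewrite intZ; [|by rewrite mulr_ge0 ?tri_ge0|by meas|by move=> s; rewrite mulr_ge0 ?tri_ge0 ?nc_ge0].
    by rewrite -/(trin f T) -[X in (_ * X)%E]fineK ?ge0_fin_numE ?trin_ge0// -EFinM mulrAC.
  rewrite intZ//; last by move=> s; rewrite tri_ge0.
    by rewrite int_tri// -EFinM ltry.
  by rewrite mulr_ge0// fine_ge0// trin_ge0.
have Lp : cL1 (fun t => (tri T t)%:C * p t).
  split; first by meas.
  apply: (@le_lt_trans _ _ (\int[mu]_t (M * tri T t)%:E)%E).
    apply: le_int => t; first by rewrite lee_fin nc_ge0.
    rewrite lee_fin ncM nc_real ger0_norm ?tri_ge0// triE.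
    by have [tT|_] := boolP (0 <= t <= T); rewrite ?mul0r ?mulr0// mul1r mulr1 pM.
  by rewrite intZ// ?int_tri ?ltry// => s; exact: tri_ge0.
have L2 : cL1 (fun t => cintegral (fun s => ((tri T t * tri t s)%:C * p t) * f s)).
  split; first exact: (cmeas_cintegral (F := fun t s => ((tri T t * tri t s)%:C * p t) * f s)).
  apply: le_lt_trans fin; apply: le_int => t; first by rewrite lee_fin nc_ge0.
  by apply: nc_cintegral; exact: (cmeas_slice (F := fun t s => ((tri T t * tri t s)%:C * p t) * f s)).
transitivity (cintegral (fun t => z0 * ((tri T t)%:C * p t)) +
    cintegral (fun t => cintegral (fun s => ((tri T t * tri t s)%:C * p t) * f s))).
  rewrite -(cintegralD (cL1Z z0 Lp) L2).
  have Lf (t : R) : t <= T -> cL1 (fun s => (tri t s)%:C * f s).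
    by move=> tT; apply: cL1_tri => //; apply: le_lt_trans (trin_le _ tT) fT.
  apply: eq_cintegral => t; rewrite triE; have [/andP[_ tT]|_] := boolP (0 <= t <= T); last first.
    have -> : cintegral (fun s => (false%:R * tri t s)%:C * p t * f s) = 0.
      by rewrite (eq_cintegral (g := fun _ => 0)) ?cintegral0// => s; rewrite !mul0r.
    by rewrite !mul0r mulr0 addr0.
  have -> : cintegral (fun s => (true%:R * tri t s)%:C * p t * f s) = p t * cintegral (fun s => (tri t s)%:C * f s).
    rewrite -(cintegralZ (p t) (Lf t tT)); apply: eq_cintegral => s.
    by rewrite mul1r mulrA [p t * _]mulrC.
  by rewrite -[(true%:R)%:C]/(1 : R[i]); ring.
rewrite (cintegralZ z0 Lp) (cfubini mJ fin); congr (_ + _).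
  rewrite (PE 0) ?lexx// mulNr opprK mulrC; congr (_ * _); apply: eq_cintegral => t.
  suff -> : tri T t * tri t 0 = tri T t by [].
  rewrite !triE lexx /=.
  by have [/andP[-> _]|_] := boolP (0 <= t <= T); rewrite ?mulr1 ?mul0r.
rewrite -cintegral_opp; apply: eq_cintegral => s.
transitivity (cintegral (fun t => f s * ((tri T t * tri t s)%:C * p t))).
  by apply: eq_cintegral => t; rewrite mulrC.
have Ls : cL1 (fun t => (tri T t * tri t s)%:C * p t).
  rewrite (_ : (fun t => _) = fun t => (tri t s)%:C * ((tri T t)%:C * p t)); last first.
    by apply/funext => t; rewrite RCM mulrAC mulrC mulrA.
  apply: (cL1M_bounded (M := 1)) Lp; first by meas.
  by move=> t; rewrite nc_real ger0_norm ?tri_ge0 ?tri_le1.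
rewrite (cintegralZ (f s) Ls) (triE T); have [sT|sT] := boolP (0 <= s <= T).
  by rewrite (PE s sT) mul1r mulrN opprK.
rewrite (eq_cintegral (g := fun _ => 0)) ?cintegral0 ?mulr0 ?mul0r ?oppr0// => t.
suff -> : tri T t * tri t s = 0 by rewrite mul0r.
rewrite !triE; case: (boolP (0 <= t <= T)); last by rewrite mul0r.
move=> /andP[_ tT]; case: (boolP (0 <= s <= t)) => [/andP[s0 st]|]; last by rewrite mulr0.
by move: sT; rewrite s0 (le_trans st tT).
Qed.
End time_by_parts.

Section evolution_time_derivative.
Context {R : realType} (m : R -> R).
Hypotheses (mm : measurable_fun setT m) (m_ge0 : forall x, 0 <= m x)
  (m_le1 : forall x, m x <= 1) (m_even : forall x, m (- x) = m x).
Variables (g0 : R -> R[i]) (B : R) (g : R -> R -> R[i]).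
Hypothesis evo : evolution m g0 B g.
Hypothesis g00 : (moment 0 g0 < +oo)%E.
Hypothesis g2 : forall t, 0 <= t -> (trim 2 g t < +oo)%E.
Hypothesis hg : forall t, 0 <= t -> hermitian (g t).

Let mg := evo_cmeas evo.
Let mgt t : cmeas (g t). Proof. exact: cmeas_slice (t) mg. Qed.
Let mr : cmeas (fun z : R * R => rate m (g z.1) z.2).
Proof. exact: cmeas_rate_joint. Qed.
Let mrt t : cmeas (rate m (g t)). Proof. exact: cmeas_rate. Qed.
Let c0 := @cF_gt0 R.
Let B0 : 0 <= B.
Proof. by rewrite -lee_fin; apply: le_trans (evo_moment0 evo (lexx 0)); exact: moment_ge0. Qed.
Let C := cF * (B * B) + B.
Let C0 : 0 <= C. Proof. by rewrite addr_ge0// !mulr_ge0// ltW. Qed.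

Lemma cmeas_inverse_fourier_joint (z : R -> R -> R[i]) (x : R) : cmeas (fun w : R * R => z w.1 w.2) ->
  cmeas (fun t => inverse_fourier (z t) x).
Proof.
move=> mz.
have H : cmeas (fun t => cintegral (fun xi => z t xi * cis (x * xi))).
  by apply: (cmeas_cintegral (F := fun t xi => z t xi * cis (x * xi))); meas.
exact: (cmeasM (cmeas_cst _ (cF%:C)) H).
Qed.

(** Inverting an integrable transform erases the null set of frequencies: the integral equation
    holds in physical space at every [t >= 0] and every [x]. *)
Lemma evo_eq_inverse (t x : R) : 0 <= t ->
  inverse_fourier (g t) x = inverse_fourier g0 x +
    cintegral (fun s => (tri t s)%:C * inverse_fourier (rate m (g s)) x).
Proof.
move=> t0; have mt := measurable_tri1 t.
have L0 : cL1 g0 by apply: moment0_cL1 => //; exact: evo_cmeas0 evo.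
have mJ : cmeas (fun w : R * R => ((tri t w.2)%:C * rate m (g w.2) w.1) * cis (x * w.1)).
  have mr' : cmeas (fun w : R * R => rate m (g w.2) w.1).
    by apply: (cmeas_comp (f := fun z : R * R => rate m (g z.1) z.2) mr (h := fun w : R * R => (w.2, w.1))); meas.
  by meas.
have mk : cmeas (fun w : R * R => (tri t w.2)%:C * rate m (g w.2) w.1).
  have mr' : cmeas (fun w : R * R => rate m (g w.2) w.1).
    by apply: (cmeas_comp (f := fun z : R * R => rate m (g z.1) z.2) mr (h := fun w : R * R => (w.2, w.1))); meas.
  by meas.
have fin : (\int[mu]_xi \int[mu]_s (nc (((tri t s)%:C * rate m (g s) xi) * cis (x * xi)))%:E < +oo)%E.
  have := evo_trim_rate mm m_ge0 m_le1 evo t.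
  rewrite -(tri_moment 0 t mr); apply: le_lt_trans; apply: le_int => xi.
    by apply: integral_ge0 => s _; rewrite lee_fin nc_ge0.
  rewrite expr0 mul1e; apply: le_int => s; first by rewrite lee_fin nc_ge0.
  by rewrite lee_fin !ncM nc_real nc_cis mulr1 ger0_norm ?tri_ge0.
have L2 : cL1 (fun xi => cintegral (fun s => ((tri t s)%:C * rate m (g s) xi) * cis (x * xi))).
  split; first exact: (cmeas_cintegral (F := fun xi s => ((tri t s)%:C * rate m (g s) xi) * cis (x * xi))).
  apply: le_lt_trans fin; apply: le_int => xi; first by rewrite lee_fin nc_ge0.
  by apply: nc_cintegral; exact: (cmeas_slice (F := fun xi s => ((tri t s)%:C * rate m (g s) xi) * cis (x * xi))).
have L1 : cL1 (fun xi => g0 xi * cis (x * xi)).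
  have [h i] := L0; split; first by meas.
  by under eq_integral do rewrite ncM nc_cis mulr1.
have IE f : inverse_fourier f x = cF%:C * cintegral (fun xi => f xi * cis (x * xi)) by [].
rewrite (IE (g t)) (IE g0).
rewrite (cintegral_ae (g := fun xi => g0 xi * cis (x * xi) +
   cintegral (fun s => ((tri t s)%:C * rate m (g s) xi) * cis (x * xi)))); last 3 first.
- by have mgt' := mgt t; meas.
- by apply: cmeasD; [case: L1|case: L2].
- have F := trim_fin_ae (n := 0) mr (evo_trim_rate mm m_ge0 m_le1 evo t).
  apply: aeS (aeI (evo_eq evo) F) => xi [/(_ _ t0) -> fx]; rewrite mulrDl; congr (_ + _).
  have mx : cmeas (fun s => rate m (g s) xi) by exact: (cmeas_swap_slice (z := fun s => rate m (g s)) xi mr).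
  rewrite mulrC -(cintegralZ (cis (x * xi)) (cL1_tri mx fx)).
  by apply: eq_cintegral => s; rewrite mulrC.
rewrite (cintegralD L1 L2) mulrDr; congr (_ + _).
rewrite (cfubini mJ fin).
have mI : cmeas (fun s => cintegral (fun xi => ((tri t s)%:C * rate m (g s) xi) * cis (x * xi))).
  apply: (cmeas_cintegral (F := fun s xi => ((tri t s)%:C * rate m (g s) xi) * cis (x * xi))).
  by have mr' := mr; meas.
apply: etrans (esym (cintegralZ_gt0 c0 mI)) _.
apply: eq_cintegral => s; rewrite IE triE; case: (0 <= s <= t).
  by rewrite -[(true%:R)%:C]/(1 : R[i]) mul1r; congr (_ * _); apply: eq_cintegral => xi; rewrite mul1r.
rewrite (eq_cintegral (g := fun _ => 0)); first by rewrite cintegral0 mulr0 mul0r.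
by move=> xi; rewrite !mul0r.
Qed.

Lemma synth_real (f : R -> R[i]) x : cmeas f -> hermitian f ->
  inverse_fourier f x = (synth f x)%:C.
Proof. by move=> mf hf; apply: complexP => //=; exact: hermitian_real. Qed.

Lemma inverse_rate_bound t x : 0 <= t -> nc (inverse_fourier (rate m (g t)) x) <= cF * C.
Proof.
move=> t0; have L := evo_cL1_rate mm m_ge0 m_le1 evo t0.
apply: le_trans (nc_inverse_fourier x L) _; rewrite ler_wpM2l ?(ltW c0)//.
have H := evo_rate0 mm m_ge0 m_le1 evo t0; rewrite -moment0.
by rewrite -lee_fin fineK// ge0_fin_numE ?moment_ge0//; apply: le_lt_trans H (ltry _).
Qed.

Lemma trin_bounded (f : R -> R[i]) (M T : R) : (forall t, 0 <= t -> nc (f t) <= M) -> 0 <= T -> 0 <= M ->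
  (trin f T < +oo)%E.
Proof.
move=> fM T0 M0; have mt := measurable_tri1 T.
apply: (@le_lt_trans _ _ (\int[mu]_s (M * tri T s)%:E)%E).
  apply: le_int => s; first by rewrite lee_fin mulr_ge0 ?tri_ge0 ?nc_ge0.
  rewrite lee_fin mulrC triE; have [/andP[s0 _]|_] := boolP (0 <= s <= T); last by rewrite !mulr0.
  by rewrite !mulr1 fM.
by rewrite intZ ?int_tri -?EFinM ?ltry// => s; exact: tri_ge0.
Qed.

Lemma test_fun_FTC (phi : R -> R) (s T : R) : test_fun phi -> s <= T ->
  \int[mu]_(t in `[s, T]) derive1 phi t = phi T - phi s.
Proof.
move=> tp sT; have [/smoothP sp _] := tp; apply: Rint_FTC2 => //.
  by move=> x; rewrite derive1E; apply/derivableP; exact: smooth_derivable.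
exact/smooth_continuous/smooth_derive1.
Qed.

Lemma ae_indic_tri (T : R) : {ae mu, forall t : R, \1_(`]0, T[%classic) t = tri T t}.
Proof.
have H := @ae_neq R.
apply: aeS (aeI (H 0) (H T)) => t [t0 tT].
by rewrite triE indicE mem_setE in_itv/= !lt_neqAle tT [0 == t]eq_sym t0.
Qed.

(** [time_by_parts] at each [x], with [P = phi] and [p = phi']; the boundary term vanishes because
    [phi] is supported inside []0, T[]. *)
Lemma evo_weak_time_deriv (T : R) : 0 < T ->
  weak_time_deriv T (fun t => synth (g t)) (fun t => synth (rate m (g t))).
Proof.
move=> T0 phi tp [a [b [a0 bT out]]]; apply: aeT => x.
have td := test_fun_derive1 tp; have mp := test_fun_measurable tp; have md := test_fun_measurable td.
have phi0 : phi 0 = 0 by apply: out; rewrite negb_and -ltNge a0.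
have phiT : phi T = 0 by apply: out; rewrite negb_and orbC -ltNge bT.
have [M HM] := test_fun_bounded td.
have mf := cmeas_inverse_fourier_joint (z := fun s => rate m (g s)) x mr.
have mg' := cmeas_inverse_fourier_joint x mg.
have mt2 := @measurable_tri R.
have mi : measurable_fun setT (fun t : R => \1_(`]0, T[%classic) t : R).
  exact: (mfun_indic (measurable_itv _) (@measurable_id _ _ _)).
have fT : (trin (fun s => inverse_fourier (rate m (g s)) x) T < +oo)%E.
  by apply: trin_bounded (ltW T0) _ => [t|]; [exact: inverse_rate_bound|rewrite mulr_ge0// ltW].
have mt := measurable_tri1 T.
have PE (s : R) : 0 <= s <= T -> (phi s)%:C = - cintegral (fun t => (tri T t * tri t s)%:C * (derive1 phi t)%:C).
  move=> /andP[s0 sT]; have E := test_fun_FTC tp sT; rewrite phiT sub0r in E.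
  rewrite -[phi s]opprK -E RCN Rint_indic; congr (- _).
  rewrite -cintegral_of_real; apply: eq_cintegral => t; rewrite -RCM; congr (_ * _)%:C.
  rewrite !triE indic_itvccE s0/=; have [st|st] := leP s t; last by rewrite mulr0.
  by rewrite (le_trans s0 st) mulr1.
have MB t : 0 <= t <= T -> nc ((derive1 phi t)%:C) <= M by move=> _; rewrite nc_real.
have := time_by_parts (inverse_fourier g0 x) (ltW T0) mf (cmeas_real md) fT MB PE.
rewrite phi0 mul0r oppr0 sub0r => H.
have K (u v : R) : u%:C = v%:C -> u = v by case.
apply: K; rewrite RCN; apply: etrans (etrans _ H) _.
  rewrite Rint_indic -cintegral_of_real; apply: cintegral_ae.
  - have [mre _] := mg'; apply: cmeas_real; apply: mfunM => //; apply: mfunM => //.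
  - apply: cmeasM; first by meas.
    apply: cmeasM; first by meas.
    apply: cmeasD; first exact: cmeas_cst.
    apply: (cmeas_cintegral (F := fun t s => (tri t s)%:C * inverse_fourier (rate m (g s)) x)).
    apply: cmeasM; first exact: cmeas_real mt2.
    exact: (cmeas_comp (f := fun s => inverse_fourier (rate m (g s)) x) mf (@measurable_snd _ _ _ _)).
  apply: aeS (ae_indic_tri T) => t ->; rewrite triE.
  have [/andP[t0 _]|_] := boolP (0 <= t <= T); last by rewrite !mul0r.
  rewrite -(evo_eq_inverse x t0) (synth_real x (mgt t) (hg t0)) -!RCM.
  by rewrite [derive1 phi t * _]mulrC.
congr (- _); rewrite Rint_indic -cintegral_of_real; apply: cintegral_ae.
- exact: cmeasM (cmeas_real mt) (cmeasM mf (cmeas_real mp)).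
- have [mre _] := mf; apply: cmeas_real; apply: mfunM => //; apply: mfunM => //.
apply: aeS (ae_indic_tri T) => t ->; rewrite triE.
have [/andP[t0 _]|_] := boolP (0 <= t <= T); last by rewrite !mul0r.
by rewrite (synth_real x (mrt t) (hermitian_rate mm m_even (mgt t) (hg t0))) -!RCM.
Qed.

Lemma evo_W_space (T : R) : 0 < T -> W_space T (fun t => synth (g t)).
Proof.
move=> T0; have S2 := evo_strongly_measurable mm m_ge0 m_le1 evo g2 hg T0.
have BL k : (k <= 1)%N -> bochner_Linfty (@Winfty_norm R k) T (fun t => synth (g t)).
  move=> k1; split; first exact: jointly_measurable_synth.
    apply: strongly_measurable_le S2; first by move=> a; exact: Winfty_norm_ge0.
    by move=> a; apply: Winfty_norm_le; exact: leq_trans k1 _.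
  exists (2 * (cF * B)); apply: aeT => t /andP[/ltW t0 _].
  exact: (evo_Winfty_le evo hg k1 t0).
split; [exact: BL|split; first exact: BL|exact: (evo_bochner_L1 mm m_ge0 m_le1 evo g2 hg)].
exists (fun t => synth (rate m (g t))); last exact: evo_weak_time_deriv.
split; first exact: (jointly_measurable_synth (z := fun t => rate m (g t)) mr).
  exact: (rate_strongly_measurable mm m_ge0 m_le1 m_even evo g2 hg).
exists (cF * C); apply: aeT => t /andP[/ltW t0 _].
have L := evo_cL1_rate mm m_ge0 m_le1 evo t0.
apply: le_trans (Winfty_norm_synth 0 L (hermitian_rate mm m_even (mgt t) (hg t0))) _.
rewrite big_ord_recr big_ord0 /= add0e EFinM lee_wpmul2l ?lee_fin ?(ltW c0)//.
exact: (evo_rate0 mm m_ge0 m_le1 evo t0).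
Qed.

End evolution_time_derivative.

(** * The weak formulation *)

Section caratheodory.
Context {R : realType}.

(** By continuity in [t], [F] is the limit of functions piecewise constant in [t], frozen at the
    points of a mesh of [[- c, c]]; the shift of time by [c] lets the mesh start at 0. *)
Lemma measurable_caratheodory (F : R -> R -> R) (c : R) : 0 < c ->
  (forall t, measurable_fun setT (F t)) -> (forall x, continuous (F^~ x)) ->
  (forall t x, c <= `|t| -> F t x = 0) ->
  measurable_fun setT (fun z : R * R => F z.1 z.2).
Proof.
move=> c_gt0 mF cF0 out; have c2 : 0 < 2 * c by rewrite mulr_gt0.
pose h n (z : R * R) : R := \1_(`]0, 2 * c[%classic) (z.1 + c) *
  \sum_(i < n.+1) \1_(mesh_cell (2 * c) n.+1 i) (z.1 + c) * F (i%:R * (2 * c / n.+1%:R) - c) z.2.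
apply: (measurable_fun_cvg (h := h)).
- move=> n; have mi (A : set R) : measurable A -> measurable_fun setT (fun z : R * R => \1_A (z.1 + c) : R).
    by move=> mA; apply: (mfun_indic mA); meas.
  apply: mfunM; first by apply: mi; exact: measurable_itv.
  apply: measurable_sum => i; apply: mfunM; first by apply: mi; exact: measurable_itv.
  have := mF (i%:R * (2 * c / n.+1%:R) - c) => mFi.
  exact: (measurableT_comp mFi (@measurable_snd _ _ _ _)).
suff K (t x : R) : h n (t, x) @[n --> \oo] --> F t x by move=> [t x] _; exact: K.
have [tc|tc] := ltP `|t| c; last first.
  rewrite out//; apply: cvg_near_cst; apply: nearW => n; rewrite /h /= indicF ?mul0r//.
  rewrite /= in_itv/= => /andP[a b]; move: tc; rewrite leNgt => /negP; apply.
  by rewrite ltr_norml; apply/andP; split; lra.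
have tT : 0 < t + c < 2 * c by move: tc; rewrite ltr_norml => /andP[a b]; apply/andP; split; lra.
have E n : h n (t, x) = F (mesh_floor (2 * c) n.+1 (t + c) - c) x.
  rewrite /h /= indicT; last by rewrite /= in_itv.
  by rewrite mul1r (sum_mesh_cell (fun i => F (i%:R * (2 * c / n.+1%:R) - c) x) c2 (ltn0Sn n) tT).
rewrite (_ : (fun n => h n (t, x)) = (fun n => F (mesh_floor (2 * c) n.+1 (t + c) - c) x)); last exact/funext.
have /andP[/ltW tc0 _] := tT.
apply: (cvg_comp (fun n => mesh_floor (2 * c) n.+1 (t + c) - c) (F^~ x) _ (cF0 x t)).
by have := cvgB (cvg_mesh_floor c2 tc0) (cvg_cst c); rewrite addrK; exact.
Qed.

Lemma derive1_near0 (f : R -> R) (x : R) : (\forall y \near x, f y = 0) -> derive1 f x = 0.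
Proof.
move=> H; rewrite derive1E; have [_ ->//] : is_derive x 1 f 0.
by apply: (@near_eq_is_derive _ _ _ (fun _ : R => 0 : R)); apply: filterS H => y ->.
Qed.

Lemma int_bounded_support (f : R -> R) (M K : R) : 0 <= M -> (forall x, `|f x| <= K) ->
  (forall x, M < `|x| -> f x = 0) -> (\int[mu]_x (`|f x|)%:E <= (K * (2 * M))%:E)%E.
Proof.
move=> M0 fK out; have K0 : 0 <= K by apply: le_trans (fK 0).
have M2 : 0 <= 2 * M by rewrite mulr_ge0.
have mt := measurable_tri1 (2 * M).
apply: (@le_trans _ _ (\int[mu]_x (K * tri (2 * M) (x + M))%:E)%E).
  apply: le_int => x; rewrite lee_fin// triE.
  rewrite (_ : (0 <= x + M <= 2 * M) = (`|x| <= M)); last first.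
    by rewrite ler_norml; apply/idP/idP => /andP[a b]; apply/andP; split; lra.
  by have [xM|xM] := leP `|x| M; rewrite ?mulr1// out// normr0 mulr0.
rewrite (int_shift (f := fun x => (K * tri (2 * M) x)%:E)); last 2 first.
- by meas.
- by move=> x; rewrite lee_fin mulr_ge0 ?tri_ge0.
by rewrite intZ// ?int_tri ?EFinM// => x; exact: tri_ge0.
Qed.

End caratheodory.

Section spacetime_tests.
Context {R : realType} (T : R) (psi : R -> R -> R).
Hypothesis tpsi : spacetime_test_fun T psi.

(** The conditions describing the complement of the support are strict, hence open: near such a
    point the function is zero, and so are all its derivatives, with the same [S] and [M]. *)
Lemma partial_out : exists S M : R, [/\ S < T, 0 <= M &
  forall w t x, [|| S < t, M < `|t| | M < `|x|] -> partial w psi t x = 0].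
Proof.
have [_ [S [M [ST out]]]] := tpsi; exists S, (Num.max M 0); split => //; first by rewrite le_max lexx orbT.
have {}out t x : [|| S < t, Num.max M 0 < `|t| | Num.max M 0 < `|x|] -> psi t x = 0.
  move=> h; apply: out; move: h; rewrite !gt_max => /or3P[->//|/andP[-> _]|/andP[-> _]]; by rewrite ?orbT.
elim=> [|[] w IH] t x /or3P h; first by apply: out; apply/or3P.
- apply: derive1_near0; case: h => h.
  + by near=> s; apply: IH; apply/or3P; constructor 1; near: s; exact: lt_nbhsr.
  + near=> s; apply: IH; apply/or3P; constructor 2; near: s.
    exact: (@norm_continuous _ _ t _ (lt_nbhsr h)).
  + by near=> s; apply: IH; apply/or3P; constructor 3.
- apply: derive1_near0; case: h => h.
  + by near=> s; apply: IH; apply/or3P; constructor 1.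
  + by near=> s; apply: IH; apply/or3P; constructor 2.
  + near=> s; apply: IH; apply/or3P; constructor 3; near: s.
    exact: (@norm_continuous _ _ x _ (lt_nbhsr h)).
Unshelve. all: by end_near. Qed.

Lemma partial_continuous w : continuous (fun z : R * R => partial w psi z.1 z.2).
Proof. by have [h _] := tpsi; have [] := h w. Qed.

Lemma partial_bounded w : exists2 K : R, 0 <= K & forall t x, `|partial w psi t x| <= K.
Proof.
have [S [M [_ M0 out]]] := partial_out.
have cA : compact (`[- M, M]%classic `*` `[- M, M]%classic : set (R * R)).
  by apply: compact_setX; exact: segment_compact.
have cp : continuous (fun z : R * R => partial w psi z.1 z.2) by exact: partial_continuous.
have cI := continuous_compact (continuous_subspaceT cp) cA.
have [K [_ HK]] := compact_bounded cI.
exists (Num.max K 0 + 1); first by rewrite addr_ge0// le_max lexx orbT.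
move=> t x; have K1 : 0 <= Num.max K 0 + 1 by rewrite addr_ge0// le_max lexx orbT.
have [tM|tM] := leP `|t| M; last by rewrite out ?normr0// tM orbT.
have [xM|xM] := leP `|x| M; last by rewrite out ?normr0// xM !orbT.
apply: (HK (Num.max K 0 + 1)); first by rewrite ltr_pwDr// le_max lexx.
by exists (t, x) => //; split; rewrite /= in_itv/= -ler_norml.
Qed.

Lemma partial_section w t : continuous (partial w psi t).
Proof.
move=> x; apply: (continuous_comp (f := fun y : R => (t, y)) (g := fun z : R * R => partial w psi z.1 z.2)).
  exact: (cvg_pair (cvg_cst t) (@cvg_id _ (nbhs x))).
exact: partial_continuous.
Qed.

Lemma partial_section2 w x : continuous (fun t => partial w psi t x).
Proof.
move=> t; apply: (continuous_comp (f := fun s : R => (s, x)) (g := fun z : R * R => partial w psi z.1 z.2)).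
  exact: (cvg_pair (@cvg_id _ (nbhs t)) (cvg_cst x)).
exact: partial_continuous.
Qed.

Lemma partial_measurable w : measurable_fun setT (fun z : R * R => partial w psi z.1 z.2).
Proof.
have [S [M [_ M0 out]]] := partial_out.
apply: (@measurable_caratheodory _ (partial w psi) (M + 1)); first by rewrite ltr_wpDl.
- by move=> t; apply: continuous_measurable_fun; exact: partial_section.
- exact: partial_section2.
by move=> t x h; apply: out; rewrite (lt_le_trans _ h) ?orbT// ltrDl.
Qed.

Lemma derive1n_partial n w t : derive1n n (partial w psi t) = partial (nseq n false ++ w) psi t.
Proof. by elim: n => // n IH; rewrite derive1nS IH. Qed.

Lemma partial_test_fun w t : test_fun (partial w psi t).
Proof.
have [S [M [_ M0 out]]] := partial_out; split; last first.
  by exists M => x xM; apply: out; rewrite xM !orbT.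
by move=> n x; rewrite derive1n_partial; have [h _] := tpsi; have [_ _] := h (nseq n false ++ w).
Qed.

Lemma partial_int_le w : exists2 K : R, 0 <= K & forall t,
  (\int[mu]_x (`|partial w psi t x|)%:E <= K%:E)%E.
Proof.
have [S [M [_ M0 out]]] := partial_out; have [K K0 HK] := partial_bounded w.
exists (K * (2 * M)); first by rewrite !mulr_ge0.
by move=> t; apply: int_bounded_support => // x xM; apply: out; rewrite xM !orbT.
Qed.

Lemma fine_le_real (a : \bar R) (K : R) : (0 <= a)%E -> (a <= K%:E)%E -> fine a <= K.
Proof. by case: a => //= r _; rewrite ?lee_fin. Qed.

Lemma decay_const_bounded w : exists K : R, forall t, decay_const (partial w psi t) <= K.
Proof.
have c0 := @cF_gt0 R.
have [k Hk] : exists k : nat -> R, forall n t, (\int[mu]_x (`|partial (nseq n false ++ w) psi t x|)%:E <= (k n)%:E)%E.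
  have H n : exists K : R, forall t, (\int[mu]_x (`|partial (nseq n false ++ w) psi t x|)%:E <= K%:E)%E.
    by have [K _ HK] := partial_int_le (nseq n false ++ w); exists K.
  by exists (fun n => projT1 (cid (H n))) => n; exact: projT2 (cid (H n)).
exists (\sum_(n < 4) cF * k n) => t; apply: ler_sum => n _; rewrite ler_wpM2l ?(ltW c0)//.
rewrite derive1n_partial; apply: fine_le_real; last exact: Hk.
by apply: integral_ge0 => x _; rewrite lee_fin.
Qed.

(** [Lambda_le] uses only bounds on the support, on the decay constant and on the integral, and all
    three are uniform in [t]. *)
Lemma Lambda_partial_bound w : exists2 D : R, 0 <= D & forall t,
  {ae mu, forall x : R, `|Lambda 1 (partial w psi t) x| <= D / (1 + x ^+ 2)}.
Proof.
have [S [M [_ M0 out]]] := partial_out; have [K HK] := decay_const_bounded w.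
have [I I0 HI] := partial_int_le w; have c0 := @cF_gt0 R.
have p0 : 0 < (pi : R) := pi_gt0 R.
have C1 : 0 <= cF * (K * pi).
  by rewrite !mulr_ge0 ?(ltW c0) ?(ltW p0)//; apply: le_trans (HK 0); exact: decay_const_ge0.
have C2 : 0 <= pi^-1 * I by rewrite mulr_ge0// invr_ge0 ltW.
exists (lambda_bound (cF * (K * pi)) (pi^-1 * I) M).
  by apply: addr_ge0; apply: mulr_ge0 => //; apply: addr_ge0 => //; exact: sqr_ge0.
move=> t; apply: Lambda_le => //; first exact: partial_test_fun.
- by move=> x xM; apply: out; rewrite xM !orbT.
- by rewrite ler_wpM2l ?(ltW c0)// ler_wpM2r ?(ltW p0).
- rewrite ler_wpM2l ?invr_ge0 ?(ltW p0)//; apply: fine_le_real; last exact: HI.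
  by apply: integral_ge0 => x _; rewrite lee_fin.
Qed.

Lemma fourier_partial_bound w : exists2 K : R, 0 <= K & forall t xi,
  nc (fourier (partial w psi t) xi) <= K.
Proof.
have [I I0 HI] := partial_int_le w; have c0 := @cF_gt0 R.
exists (cF * I); first by rewrite mulr_ge0// ltW.
move=> t xi; apply: le_trans (nc_fourier xi (test_fun_cL1 (partial_test_fun w t))) _.
rewrite ler_wpM2l ?(ltW c0)//; apply: fine_le_real; last exact: HI.
by apply: integral_ge0 => x _; rewrite lee_fin.
Qed.

Lemma cmeas_fourier_partial w : cmeas (fun z : R * R => fourier (partial w psi z.1) z.2).
Proof.
have mp := partial_measurable w.
have H : cmeas (fun z : R * R => cintegral (fun x => (partial w psi z.1 x)%:C * cis (- (x * z.2)))).
  apply: (cmeas_cintegral (F := fun (z : R * R) (x : R) => (partial w psi z.1 x)%:C * cis (- (x * z.2)))).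
  apply: cmeasM; last by meas.
  apply: cmeas_real; apply: (mfun_joint (F := partial w psi) mp); by meas.
exact: (cmeasM (cmeas_cst _ (cF%:C)) H).
Qed.

Lemma measurable_Lambda_partial w : measurable_fun setT (fun z : R * R => Lambda 1 (partial w psi z.1) z.2).
Proof.
have mf := cmeas_fourier_partial w.
have ma : cmeas (fun z : R * R => absxi (fourier (partial w psi z.1)) z.2).
  rewrite (_ : (fun z => _) = fun z : R * R => (`|z.2|)%:C * fourier (partial w psi z.1) z.2); last first.
    by apply/funext => z; rewrite absxiE.
  by apply: cmeasM => //; meas.
have := jointly_measurable_synth (z := fun t => absxi (fourier (partial w psi t))) ma.
rewrite /jointly_measurable; apply: eq_measurable_fun => z _.
by rewrite /synth (LambdaE z.2 (partial_test_fun w z.1)).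
Qed.

Lemma partial_FTC s x : s <= T ->
  \int[mu]_(t in `[s, T]) dt psi t x = - psi s x.
Proof.
move=> sT; have [S [M [ST M0 out]]] := partial_out; have [h _] := tpsi.
have -> : - psi s x = psi T x - psi s x.
  have H : [|| S < T, M < `|T| | M < `|x|] by rewrite ST.
  by have /= -> := out [::] T x H; rewrite sub0r.
apply: (@Rint_FTC2 _ (fun t => dt psi t x) (fun t => psi t x)) => //.
  by move=> t; rewrite /dt derive1E; apply/derivableP; have [_ d _] := h [::].
exact: (@partial_section2 [:: true] x).
Qed.

Lemma conj_fourierE (phi : R -> R) (xi : R) :
  conjc (fourier phi xi) = cF%:C * cintegral (fun x => (phi x)%:C * cis (x * xi)).
Proof. exact: conj_fourier. Qed.

(** This is the relation between [P] and [p] required by [time_by_parts], for the conjugate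
    transforms of [psi] and [psi_t]. *)
Lemma fourier_partial_FTC s xi : 0 <= s <= T ->
  conjc (fourier (psi s) xi) =
  - cintegral (fun t => (tri T t * tri t s)%:C * conjc (fourier (dt psi t) xi)).
Proof.
move=> /andP[s0 sT]; have T0 := le_trans s0 sT; have c0 := @cF_gt0 R.
have [S [M [ST M0 out]]] := partial_out.
have mp : measurable_fun setT (fun z : R * R => dt psi z.1 z.2) by exact: (partial_measurable [:: true]).
have [I I0 HI] := partial_int_le [:: true].
have mt := measurable_tri1 T; have mt2 := @measurable_tri R.
pose F t x := ((tri T t * tri t s)%:C * (dt psi t x)%:C) * cis (x * xi).
have mF : cmeas (fun z : R * R => F z.1 z.2).
  by apply: cmeasM; last (by meas); apply: cmeasM; [by meas|exact: cmeas_real].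
have mti : measurable_fun setT (fun t => tri T t * tri t s) by meas.
have fin : (\int[mu]_t \int[mu]_x (nc (F t x))%:E < +oo)%E.
  apply: (@le_lt_trans _ _ (\int[mu]_t (I * tri T t)%:E)%E); last first.
    by rewrite intZ ?int_tri -?EFinM ?ltry// => t; exact: tri_ge0.
  apply: le_int => t; first by apply: integral_ge0 => x _; rewrite lee_fin nc_ge0.
  rewrite mulrC EFinM; apply: le_trans (lee_wpmul2l _ (HI t)); last by rewrite lee_fin tri_ge0.
  have mpt : measurable_fun setT (dt psi t) by exact: (measurableT_comp mp (pair1_measurable t)).
  have mpn : measurable_fun setT (fun x => `|dt psi t x|) by meas.
  rewrite -intZ ?tri_ge0//.
  apply: le_int => x; first by rewrite lee_fin nc_ge0.
  rewrite lee_fin /F !ncM !nc_real nc_cis mulr1 ler_wpM2r// ger0_norm ?mulr_ge0 ?tri_ge0//.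
  by rewrite -[leRHS]mulr1 ler_wpM2l ?tri_ge0 ?tri_le1.
rewrite conj_fourierE.
transitivity (- (cF%:C * cintegral (fun t => cintegral (F t)))); last first.
  congr (- _); have mI : cmeas (fun t => cintegral (F t)) by exact: cmeas_cintegral.
  apply: etrans (esym (cintegralZ_gt0 c0 mI)) _.
  apply: eq_cintegral => t; rewrite conj_fourierE.
  rewrite mulrCA; congr (_ * _).
  rewrite /F !triE s0/=; case: (0 <= t <= T); case: (s <= t); rewrite ?mul1r ?mul0r.
  + by apply: eq_cintegral => x; rewrite mul1r.
  1-3: by rewrite (eq_cintegral (g := fun _ => 0)) ?cintegral0// => x; rewrite !mul0r.
rewrite (cfubini mF fin) -mulrN -cintegral_opp; congr (_ * _).
apply: eq_cintegral => x.
have E := partial_FTC x sT.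
rewrite -[psi s x]opprK -E RCN mulNr Rint_indic -cintegral_of_real; congr (- _).
have L : cL1 (fun t => (\1_(`[s, T]%classic) t * dt psi t x)%:C).
  have [K K0 HK] := partial_bounded [:: true].
  have mpx : measurable_fun setT (fun t => dt psi t x).
    by apply: continuous_measurable_fun; exact: (@partial_section2 [:: true] x).
  have mi : measurable_fun setT (fun t : R => \1_(`[s, T]%classic) t : R).
    exact: (mfun_indic (measurable_itv _) (@measurable_id _ _ _)).
  split; first by apply: cmeas_real; exact: mfunM.
  apply: (@le_lt_trans _ _ (\int[mu]_t (K * tri T t)%:E)%E).
    apply: le_int => t; rewrite lee_fin ?nc_ge0// nc_real normrM triE indic_itvccE.
    have [st|st] := leP s t; rewrite ?normr0 ?mul0r ?mulr_ge0//.
    rewrite (le_trans s0 st); case: (t <= T); rewrite ?normr0 ?mul0r ?mulr0// normr1 mul1r mulr1.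
    exact: HK.
  by rewrite intZ ?int_tri -?EFinM ?ltry// => t; exact: tri_ge0.
rewrite mulrC -(cintegralZ _ L); apply: eq_cintegral => t.
rewrite /F mulrC -RCM; congr ((_ * _)%:C * _); rewrite !triE indic_itvccE s0 /=.
have [st|st] := leP s t; last by rewrite mulr0.
by rewrite (le_trans s0 st) mulr1.
Qed.

End spacetime_tests.

Section weak_form.
Context {R : realType} (m : R -> R).
Hypotheses (mm : measurable_fun setT m) (m_ge0 : forall x, 0 <= m x)
  (m_le1 : forall x, m x <= 1) (m_even : forall x, m (- x) = m x).
Variables (g0 : R -> R[i]) (B : R) (g : R -> R -> R[i]).
Hypothesis evo : evolution m g0 B g.
Hypothesis hg : forall t, 0 <= t -> hermitian (g t).

Let mg := evo_cmeas evo.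
Let mgt t : cmeas (g t). Proof. exact: cmeas_slice (t) mg. Qed.
Let mr : cmeas (fun z : R * R => rate m (g z.1) z.2).
Proof. exact: cmeas_rate_joint. Qed.
Let c0 := @cF_gt0 R.
Let B0 : 0 <= B.
Proof. by rewrite -lee_fin; apply: le_trans (evo_moment0 evo (lexx 0)); exact: moment_ge0. Qed.
Let C := cF * (B * B) + B.
Let C0 : 0 <= C. Proof. by rewrite addr_ge0// !mulr_ge0// ltW. Qed.
Let Lg t : 0 <= t -> cL1 (g t). Proof. exact: evo_cL1 evo t. Qed.
Let g1y t : 0 <= t -> (moment 1 (g t) < +oo)%E.
Proof. by move=> t0; apply: le_lt_trans (evo_moment1 evo t0) (ltry _). Qed.

Let theta t := synth (g t).
Let u t := synth (mult m (g t)).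
Let ux t := synth (ixi (mult m (g t))).

Let mmult : cmeas (fun z : R * R => mult m (g z.1) z.2).
Proof.
rewrite (_ : (fun z => _) = fun z : R * R => (m z.2)%:C * g z.1 z.2); last by apply/funext => z; rewrite multE.
by meas.
Qed.

Let mixi : cmeas (fun z : R * R => ixi (mult m (g z.1)) z.2).
Proof.
rewrite (_ : (fun z => _) = fun z : R * R => 'i%C * (z.2)%:C * mult m (g z.1) z.2); last by apply/funext => z; rewrite ixiE.
by meas.
Qed.

Lemma evo_measurable_theta : jointly_measurable theta.
Proof. exact: jointly_measurable_synth. Qed.

Lemma evo_measurable_u : jointly_measurable u.
Proof. exact: (jointly_measurable_synth (z := fun t => mult m (g t)) mmult). Qed.

Lemma evo_measurable_ux : jointly_measurable ux.
Proof. exact: (jointly_measurable_synth (z := fun t => ixi (mult m (g t))) mixi). Qed.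

Lemma evo_cL1_mult t : 0 <= t -> cL1 (mult m (g t)).
Proof. by move=> t0; exact: (cL1_mult mm m_ge0 m_le1 (Lg t0)). Qed.

Lemma evo_cL1_ixi_mult t : 0 <= t -> cL1 (ixi (mult m (g t))).
Proof. by move=> t0; exact: (cL1_ixi_mult mm m_ge0 m_le1 (Lg t0) (g1y t0)). Qed.

Lemma evo_hermitian_mult t : 0 <= t -> hermitian (mult m (g t)).
Proof. by move=> t0; apply: hermitian_mult => //; exact: hg. Qed.

Lemma evo_potential t : 0 <= t ->
  fourier_multiplier m (theta t) (u t) /\ weak_deriv 1 (u t) (ux t).
Proof.
move=> t0; have L := evo_cL1_mult t0; have h := evo_hermitian_mult t0; split.
  exists (g t); first exact: (synth_has_fourier (Lg t0) (hg t0)).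
  exact: (synth_has_fourier L h).
apply: (has_fourier_weak_deriv (synth_has_fourier L h)).
exact: (synth_has_fourier (evo_cL1_ixi_mult t0) (hermitian_ixi h)).
Qed.

Section test.
Variables (T : R) (psi : R -> R -> R).
Hypotheses (T0 : 0 < T) (tpsi : spacetime_test_fun T psi).

Let p t xi := conjc (fourier (dt psi t) xi).
Let P t xi := conjc (fourier (psi t) xi).

Let mp : cmeas (fun z : R * R => p z.1 z.2).
Proof. exact: cmeasJ (cmeas_fourier_partial tpsi [:: true]). Qed.
Let mP : cmeas (fun z : R * R => P z.1 z.2).
Proof. exact: cmeasJ (cmeas_fourier_partial tpsi [::]). Qed.

Lemma evo_space_pairing t : 0 <= t ->
  (\int[mu]_x weak_integrand 1 theta u ux psi t x)%:C =
  cintegral (fun xi => g t xi * p t xi + rate m (g t) xi * P t xi).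
Proof.
move=> t0; have L := evo_cL1_mult t0; have h := evo_hermitian_mult t0.
have Li := evo_cL1_ixi_mult t0; have hi := hermitian_ixi h.
have M (f : R -> R[i]) : cL1 f -> measurable_fun setT (synth f).
  by move=> [mf _]; case: (cmeas_inverse_fourier mf).
have E (f : R -> R[i]) : cL1 f -> hermitian f -> {ae mu, forall x, inverse_fourier f x = (synth f x)%:C}.
  by move=> [mf _] hf; apply: aeT => x; exact: synth_real.
exact: (weak_pairing mm m_ge0 m_le1 (Lg t0) (g1y t0) (M _ (Lg t0)) (M _ L) (M _ Li)
  (E _ (Lg t0) (hg t0)) (E _ L h) (E _ Li hi)
  (partial_test_fun tpsi [:: true] t) (partial_test_fun tpsi [::] t)).
Qed.

Lemma trim_bounded n (z : R -> R -> R[i]) (K : R) : 0 <= K ->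
  (forall s, 0 <= s -> (moment n (z s) <= K%:E)%E) -> (trim n z T < +oo)%E.
Proof.
move=> K0 zK; have mt := measurable_tri1 T.
apply: (@le_lt_trans _ _ (\int[mu]_s (K * tri T s)%:E)%E).
  apply: le_int => s; first by rewrite mule_ge0 ?moment_ge0// lee_fin tri_ge0.
  rewrite triE; case: (boolP (0 <= s <= T)) => [/andP[s0 _]|_]; last by rewrite mul0e mulr0.
  by rewrite mul1e mulr1; exact: zK.
by rewrite intZ ?(int_tri (ltW T0)) -?EFinM ?ltry// => s; exact: tri_ge0.
Qed.

(** Fubini exchanges time and frequency. At almost every frequency, integration by parts in time
    replaces the term in [psi_t] by one that cancels the rate and leaves [- g0 P 0], whose integral
    is the initial term by duality. *)
Lemma evo_weak_identity (theta0 : R -> R) : has_fourier theta0 g0 ->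
  \int[mu]_(t in `[0, T]) \int[mu]_x weak_integrand 1 theta u ux psi t x =
  - (\int[mu]_x (theta0 x * psi 0 x)).
Proof.
move=> f0; have [_ _ /(_ _ (partial_test_fun tpsi [::] 0)) /= f0E] := f0.
have [K1 K10 HK1] := fourier_partial_bound tpsi [:: true].
have [K K0 HK] := fourier_partial_bound tpsi [::].
have pK t xi : nc (p t xi) <= K1 by rewrite ncJ; exact: HK1.
have PK t xi : nc (P t xi) <= K by rewrite ncJ; exact: HK.
have mt := measurable_tri1 T; have T0' := ltW T0.
pose F t xi := (tri T t)%:C * (g t xi * p t xi + rate m (g t) xi * P t xi).
have mF : cmeas (fun z : R * R => F z.1 z.2).
  apply: cmeasM; first by meas.
  apply: cmeasD; first exact: cmeasM mg mp.
  exact: cmeasM mr mP.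
have fin : (\int[mu]_t \int[mu]_xi (nc (F t xi))%:E < +oo)%E.
  apply: (@le_lt_trans _ _ (\int[mu]_t ((K1 * B + K * C) * tri T t)%:E)%E); last first.
    by rewrite intZ ?int_tri -?EFinM ?ltry ?addr_ge0 ?mulr_ge0// => s; exact: tri_ge0.
  apply: le_int => t; first by apply: integral_ge0 => x _; rewrite lee_fin nc_ge0.
  rewrite triE; have [/andP[t0 tT]|/negbTE nt] := boolP (0 <= t <= T); last first.
    rewrite mulr0; under eq_integral do rewrite /F triE nt ncM nc0 mul0r.
    by rewrite integral0.
  rewrite mulr1; have mnr := measurable_nc (cmeas_rate mm (mgt t)); have mng := measurable_nc (mgt t).
  apply: (@le_trans _ _ (\int[mu]_xi (K1 * nc (g t xi) + K * nc (rate m (g t) xi))%:E)%E).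
    apply: le_int => xi; rewrite lee_fin ?nc_ge0// /F triE t0 tT ncM nc_real normr1 mul1r.
    apply: le_trans (ncD _ _) _; rewrite !ncM; apply: lerD.
      by rewrite mulrC ler_wpM2r ?nc_ge0.
    by rewrite mulrC ler_wpM2r ?nc_ge0.
  rewrite intD; [|by meas|by meas|by move=> x; rewrite mulr_ge0 ?nc_ge0..].
  rewrite !intZ//; [|by move=> x; exact: nc_ge0..].
  rewrite EFinD !EFinM; apply: leeD; apply: lee_wpmul2l; rewrite ?lee_fin// -moment0.
    by have := evo_moment0 evo t0.
  by have := evo_rate0 mm m_ge0 m_le1 evo t0.
have Kinj (a b : R) : a%:C = b%:C -> a = b by case.
apply: Kinj; rewrite Rint_indic -cintegral_of_real RCN f0E.
transitivity (cintegral (fun t => cintegral (F t))).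
  apply: eq_cintegral => t; rewrite indic_itvccE /F triE.
  have [/andP[t0 tT]|_] := boolP (0 <= t <= T).
    rewrite mul1r (evo_space_pairing t0); apply: eq_cintegral => xi.
    by rewrite -[(true%:R)%:C]/(1 : R[i]) mul1r.
  by rewrite mul0r (eq_cintegral (g := fun _ => 0)) ?cintegral0// => xi; rewrite mul0r.
rewrite (cfubini mF fin) -cintegral_opp; apply: cintegral_ae.
- apply: (cmeas_cintegral (F := fun xi t => F t xi)).
  by apply: (cmeas_comp (f := fun z : R * R => F z.1 z.2) mF (h := fun w : R * R => (w.2, w.1))); meas.
- apply: cmeasN; apply: cmeasM; first by case/cL1P: (let: And3 _ a _ := f0 in a).
  exact: cmeas_slice 0 mP.
have Fg := trim_fin_ae (n := 0) mg (trim_bounded B0 (fun s s0 => evo_moment0 evo s0)).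
have Fr := trim_fin_ae (n := 0) mr (evo_trim_rate mm m_ge0 m_le1 evo T).
apply: aeS (aeI (evo_eq evo) (aeI Fg Fr)) => xi [E [gT rT]].
have mpx : cmeas (p^~ xi) by exact: cmeas_swap_slice.
have mPx : cmeas (P^~ xi) by exact: cmeas_swap_slice.
have mgx : cmeas (g^~ xi) by exact: cmeas_swap_slice.
have mrx : cmeas (fun s => rate m (g s) xi) by exact: (cmeas_swap_slice (z := fun s => rate m (g s)) xi mr).
have L1 := cL1M_bounded mpx (fun t => pK t xi) (cL1_tri mgx gT).
have L2 := cL1M_bounded mPx (fun t => PK t xi) (cL1_tri mrx rT).
have := time_by_parts (g0 xi) T0' mrx mpx rT (fun t _ => pK t xi) (fun s sT => fourier_partial_FTC tpsi xi sT).
set A := cintegral _; set D := cintegral _ => AD.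
transitivity (A + D); last by rewrite AD subrK mulrC.
transitivity (cintegral (fun t => p t xi * ((tri T t)%:C * g t xi) + P t xi * ((tri T t)%:C * rate m (g t) xi))).
  by apply: eq_cintegral => t; rewrite /F; ring.
rewrite (cintegralD L1 L2); congr (_ + _); apply: eq_cintegral => t; last by ring.
rewrite triE; have [/andP[t0 tT]|_] := boolP (0 <= t <= T); last by rewrite -[(false%:R)%:C]/(0 : R[i]) mul0r mulr0 mul0r.
by rewrite (E _ t0); ring.
Qed.

Lemma evo_synth_bound t x : 0 <= t ->
  [/\ `|theta t x| <= cF * B, `|u t x| <= cF * B & `|ux t x| <= cF * B].
Proof.
move=> t0; have F (f : R -> R[i]) : cL1 f -> (moment 0 f <= B%:E)%E -> `|synth f x| <= cF * B.
  move=> L fB; apply: le_trans (synth_le x L) _; rewrite ler_wpM2l ?(ltW c0)//.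
  by apply: fine_le_real fB; exact: moment_ge0.
split; [apply: F (Lg t0) _|apply: F (evo_cL1_mult t0) _|apply: F (evo_cL1_ixi_mult t0) _].
- by have := evo_moment0 evo t0.
- by apply: le_trans (moment_mult m_ge0 m_le1 0 (g t)) _; have := evo_moment0 evo t0.
- rewrite moment_ixi; apply: le_trans (moment_mult m_ge0 m_le1 1 (g t)) _.
  by have := evo_moment1 evo t0.
Qed.

(** Since [theta], [u] and [ux] are bounded, everything rests on the test function: three terms have
    compact support, and the fourth decays like [1 / (1 + x^2)] uniformly in time. *)
Lemma evo_weak_integrable :
  (lebesgue_measure \x lebesgue_measure)%E.-integrable (`[0, T] `*` setT)
    (fun z => (weak_integrand 1 theta u ux psi z.1 z.2)%:E).
Proof.
have m1 := evo_measurable_theta; have m2 := evo_measurable_u; have m3 := evo_measurable_ux.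
have q0 := partial_measurable tpsi [::]; have q1 := partial_measurable tpsi [:: true].
have q2 := partial_measurable tpsi [:: false]; have q3 := measurable_Lambda_partial tpsi [::].
have mW : measurable_fun setT (fun z : R * R => weak_integrand 1 theta u ux psi z.1 z.2).
  apply: mfunD; last exact: (mfunN (mfunM m1 q3)).
  apply: mfunD; last exact: (mfunM (mfunM m2 m1) q2).
  apply: mfunD; first exact: (mfunM m1 q1).
  exact: (mfunM (mfunM m3 m1) q0).
have mD : measurable (`[0, T]%classic `*` setT : set (R * R)).
  by apply: measurableX => //; exact: measurable_itv.
apply/integrableP; split; first by apply: measurable_funS (measurable_EFin mW).
rewrite integral_mkcond.
have mt := measurable_tri1 T.
pose H (t x : R) : \bar R := (tri T t * `|weak_integrand 1 theta u ux psi t x|)%:E.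
have mH : measurable_fun setT (fun z : R * R => H z.1 z.2).
  by apply: measurable_EFin; apply: mfunM; [meas|exact: mfun_norm].
have H0 t x : (0 <= H t x)%E by rewrite lee_fin mulr_ge0 ?tri_ge0.
apply: (@le_lt_trans _ _ (\int[(lebesgue_measure \x lebesgue_measure)%E]_z H z.1 z.2)%E).
  rewrite le_eqVlt; apply/orP; left; apply/eqP.
  apply: eq_integral => z _; rewrite /patch /H triE; case: ifPn => h.
    by move: h; rewrite inE => -[/= + _]; rewrite in_itv/= => ->; rewrite mul1r.
  have [h'|] := boolP (0 <= z.1 <= T); last by rewrite mul0r.
  by move: h; rewrite notin_setE => -[]; split => //=; rewrite in_itv.
have H0' (z : R * R) : (0 <= H z.1 z.2)%E by exact: H0.
have E := @fubini_tonelli1 _ _ _ _ R mu mu (fun z => H z.1 z.2) mH H0'.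
apply: (@le_lt_trans _ _ (\int[mu]_t fubini_F mu (fun z : R * R => H z.1 z.2) t)%E).
  by rewrite le_eqVlt; apply/orP; left; apply/eqP; exact: E.
have A0 : 0 <= cF * B by rewrite mulr_ge0// ltW.
set A := cF * B in A0.
have [I0 I00 HI0] := partial_int_le tpsi [::]; have [I1 I10 HI1] := partial_int_le tpsi [:: true].
have [I2 I20 HI2] := partial_int_le tpsi [:: false].
have [D D0 HD] := Lambda_partial_bound tpsi [::].
pose Q := A * I1 + A * A * I0 + A * A * I2 + A * (D * pi).
have Q0 : 0 <= Q by rewrite !addr_ge0 ?mulr_ge0// ltW// pi_gt0.
apply: (@le_lt_trans _ _ (\int[mu]_t (Q * tri T t)%:E)%E); last first.
  by rewrite intZ ?(int_tri (ltW T0)) -?EFinM ?ltry// => s; exact: tri_ge0.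
apply: le_int => t; first exact: integral_ge0.
rewrite /fubini_F /H triE; have [/andP[t0 tT]|_] := boolP (0 <= t <= T); last first.
  by rewrite mulr0; under eq_integral do rewrite mul0r; rewrite integral0.
rewrite mulr1; under eq_integral do rewrite mul1r.
have s1 : measurable_fun setT (dt psi t) by exact: (measurableT_comp q1 (pair1_measurable t)).
have s0 : measurable_fun setT (psi t) by exact: (measurableT_comp q0 (pair1_measurable t)).
have s2 : measurable_fun setT (dx psi t) by exact: (measurableT_comp q2 (pair1_measurable t)).
have sW : measurable_fun setT (weak_integrand 1 theta u ux psi t) by exact: (measurableT_comp mW (pair1_measurable t)).
have mo := @measurable_oneDsqrV R.
have o0 (x : R) : 0 <= D / (1 + x ^+ 2) by rewrite mulr_ge0// invr_ge0 ltW// oneDsqr_gt0.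
have AA : 0 <= A * A by rewrite mulr_ge0.
have P2 (x : R) : 0 <= A * `|dt psi t x| + A * A * `|psi t x|.
  by apply: addr_ge0; apply: mulr_ge0.
have P3 (x : R) : 0 <= A * `|dt psi t x| + A * A * `|psi t x| + A * A * `|dx psi t x|.
  by apply: addr_ge0 (P2 x) _; apply: mulr_ge0.
apply: (@le_trans _ _ (\int[mu]_x (A * `|dt psi t x| + A * A * `|psi t x| + A * A * `|dx psi t x| + A * (D / (1 + x ^+ 2)))%:E)%E).
  apply: le_int_ae; [by meas|by meas|by move=> x; rewrite lee_fin| |].
    by move=> x; rewrite lee_fin; exact: addr_ge0 (P3 x) (mulr_ge0 A0 (o0 x)).
  apply: aeS (HD t) => x Hx; have [b1 b2 b3] := evo_synth_bound x t0.
  rewrite lee_fin /weak_integrand; apply: le_trans (ler_normB _ _) _; apply: lerD; last first.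
    by rewrite normrM; apply: ler_pM.
  apply: le_trans (ler_normD _ _) _; apply: lerD; last first.
    by rewrite !normrM ler_wpM2r//; apply: ler_pM.
  apply: le_trans (ler_normD _ _) _; apply: lerD; rewrite !normrM ler_wpM2r//.
  exact: ler_pM.
rewrite (intD (f2 := fun x => A * (D / (1 + x ^+ 2)))); [|by meas|by meas|exact: P3|
  by move=> x; exact: mulr_ge0 A0 (o0 x)].
rewrite (intD (f2 := fun x => A * A * `|dx psi t x|)); [|by meas|by meas|exact: P2|
  by move=> x; exact: mulr_ge0].
rewrite (intD (f2 := fun x => A * A * `|psi t x|)); [|by meas|by meas|
  by move=> x; exact: mulr_ge0|by move=> x; exact: mulr_ge0].
have oV (x : R) : 0 <= (1 + x ^+ 2)^-1 by rewrite invr_ge0 ltW// oneDsqr_gt0.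
rewrite (intZ A0 _ o0); last by meas.
rewrite (intZ D0 mo oV) !intZ//.
rewrite int_oneDsqr /Q !EFinD; apply: leeD; last by rewrite -!EFinM.
apply: leeD; [apply: leeD|].
- by rewrite (EFinM A I1); apply: lee_wpmul2l; rewrite ?lee_fin//; have := HI1 t.
- by rewrite (EFinM (A * A) I0); apply: lee_wpmul2l; rewrite ?lee_fin//; have := HI0 t.
- by rewrite (EFinM (A * A) I2); apply: lee_wpmul2l; rewrite ?lee_fin//; have := HI2 t.
all: by meas.
Qed.

End test.
End weak_form.

Section bessel.
Context {R : realType} (alpha : R).
Hypothesis alpha_ge0 : 0 <= alpha.

Definition bessel (xi : R) : R := (1 + `|xi| ^+ 2) `^ (- alpha).

Lemma measurable_bessel : measurable_fun setT bessel.
Proof. by rewrite /bessel; meas. Qed.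

Lemma bessel_ge0 xi : 0 <= bessel xi.
Proof. exact: powR_ge0. Qed.

Lemma bessel_le1 xi : bessel xi <= 1.
Proof.
have h : 1 <= 1 + `|xi| ^+ 2 by rewrite lerDl exprn_ge0.
rewrite /bessel powRN invf_le1 ?powR_gt0 ?(lt_le_trans ltr01 h)//.
by rewrite -[leLHS](powRr0 (1 + `|xi| ^+ 2)); apply: ler_powR.
Qed.

Lemma bessel_even xi : bessel (- xi) = bessel xi.
Proof. by rewrite /bessel normrN. Qed.
End bessel.

Lemma smallness_constant (R : realType) (a : R) :
  Num.sqrt 2 * a / Num.sqrt (pi : R) = 2 * @cF R * a.
Proof.
have p0 : 0 < (pi : R) := pi_gt0 R.
have s2 : 0 < Num.sqrt (2 : R) by rewrite sqrtr_gt0.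
have sp : 0 < Num.sqrt (pi : R) by rewrite sqrtr_gt0.
have E : @cF R = (Num.sqrt 2 * Num.sqrt (pi : R))^-1.
  by rewrite -sqrtrM//.
have : (2 : R) = Num.sqrt 2 ^+ 2 by rewrite sqr_sqrtr.
rewrite E; move: (Num.sqrt (2 : R)) (Num.sqrt (pi : R)) s2 sp => x y x0 y0 ->.
by field; rewrite !gt_eqF.
Qed.

Section existence.
Context {R : realType} (alpha : R) (theta0 : R -> R).
Hypothesis alpha_ge0 : 0 <= alpha.
Hypothesis theta0_A1 : wiener 1 theta0.
Hypothesis theta0_small :
  (wiener_norm 0 theta0 < (Num.sqrt (pi : R) / Num.sqrt 2)%:E)%E.

Let m : R -> R := bessel alpha.
Let mm : measurable_fun setT m. Proof. exact: measurable_bessel. Qed.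
Let m_ge0 x : 0 <= m x. Proof. exact: bessel_ge0. Qed.
Let m_le1 x : m x <= 1. Proof. exact: bessel_le1. Qed.
Let m_even x : m (- x) = m x. Proof. exact: bessel_even. Qed.
Let c0 := @cF_gt0 R.

(** A finite norm provides a transform, because the norm is [+oo], an infimum over the empty set,
    when there is none; this transform is then symmetrized. *)
Lemma wiener_hermitian : exists2 g0, has_fourier theta0 g0 & hermitian g0.
Proof.
have [g fg] : exists g, has_fourier theta0 g.
  apply: contrapT => H; move: theta0_A1; rewrite /wiener /wiener_norm /norm_through.
  suff -> : [set h | has_fourier theta0 h] = set0 by rewrite image_set0 ereal_inf0 ltxx.
  by rewrite -subset0 => g fg; apply: H; exists g.
by have [g' [h _ fg' _]] := has_fourier_hermitian fg; exists g'.
Qed.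

Lemma trim_add (z : R -> R -> R[i]) (t : R) : cmeas (fun w : R * R => z w.1 w.2) ->
  (trim 1 z t + trim 2 z t = \int[mu]_s ((tri t s)%:E * (moment 1 (z s) + moment 2 (z s))))%E.
Proof.
move=> mz; rewrite -ge0_integralD//; last 4 first.
- by move=> s _; rewrite mule_ge0 ?moment_ge0// lee_fin tri_ge0.
- by apply: measurable_triM; exact: measurable_moment.
- by move=> s _; rewrite mule_ge0 ?moment_ge0// lee_fin tri_ge0.
- by apply: measurable_triM; exact: measurable_moment.
by apply: eq_integral => s _; apply: esym; apply: ge0_muleDr; exact: moment_ge0.
Qed.

Definition solution_estimate (theta : R -> R -> R) (T : R) :=
  (ereal_sup
         [set wiener_norm 1 (theta t) +
              (1 - Num.sqrt 2 * fine (wiener_norm 0 theta0) /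
                   Num.sqrt (pi : R))%:E *
              \int[lebesgue_measure]_(s in `[0%R, t])
                 wiener_norm_dx 1 (theta s)
         | t in `[0%R, T]]
       <= wiener_norm 1 theta0)%E.

Lemma existence : exists g0 g (B a : R),
  [/\ has_fourier theta0 g0, evolution m g0 B g, wiener_norm 1 theta0 = B%:E,
      (forall t, 0 <= t -> hermitian (g t)) /\
      cF * a < 1 /\ 0 <= a /\ (forall t, 0 <= t -> (moment 0 (g t) <= a%:E)%E) &
      weak_solution alpha 1 theta0 (fun t => synth (g t)) /\
      forall T, 0 < T -> W_space T (fun t => synth (g t)) /\
        solution_estimate (fun t => synth (g t)) T].
Proof.
have [g0 fg0 hg0] := wiener_hermitian.
have N0 := wiener_norm0E fg0; have N1 := wiener_norm1E fg0.
have mg0 : cmeas g0 by exact: has_fourier_cmeas fg0.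
have Y : (moment 0 g0 + moment 1 g0 < +oo)%E by rewrite -N1.
have g00 : (moment 0 g0 < +oo)%E by apply: le_lt_trans Y; rewrite leeDl ?moment_ge0.
have g01 : (moment 1 g0 < +oo)%E by apply: le_lt_trans Y; rewrite leeDr ?moment_ge0.
have f0 : moment 0 g0 \is a fin_num by rewrite ge0_fin_numE ?moment_ge0.
have f1 : moment 1 g0 \is a fin_num by rewrite ge0_fin_numE ?moment_ge0.
set a := fine (moment 0 g0).
have a0 : 0 <= a by apply: fine_ge0; exact: moment_ge0.
have small : 2 * cF * a < 1.
  move: theta0_small; rewrite N0 -(fineK f0) lte_fin -/a => h.
  rewrite -smallness_constant; have s2 : 0 < Num.sqrt (2 : R) by rewrite sqrtr_gt0.
  have sp : 0 < Num.sqrt (pi : R) by rewrite sqrtr_gt0 pi_gt0.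
  by rewrite ltr_pdivrMr// mul1r mulrC -ltr_pdivlMr.
have [g [mg hg gE gm gest]] := fourier_existence mm m_ge0 m_le1 m_even mg0 hg0 g01 g00 small.
pose B := fine (moment 0 g0 + moment 1 g0).
have BE : (moment 0 g0 + moment 1 g0 = B%:E)%E by rewrite /B fineK// fin_numD f0.
have k0 : 0 <= 1 - 2 * cF * a by rewrite subr_ge0 ltW.
have gB t : 0 <= t -> (moment 0 (g t) + moment 1 (g t) <= B%:E)%E.
  move=> t0; have [_ _ h] := gest t t0; rewrite -BE; apply: le_trans h.
  by rewrite leeDl// mule_ge0 ?lee_fin// adde_ge0 ?trim_ge0.
have gB0 t : 0 <= t -> (moment 0 (g t) <= B%:E)%E.
  by move=> t0; apply: le_trans (gB t t0); rewrite leeDl ?moment_ge0.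
have gB1 t : 0 <= t -> (moment 1 (g t) <= B%:E)%E.
  by move=> t0; apply: le_trans (gB t t0); rewrite leeDr ?moment_ge0.
have B0 : 0 <= B by rewrite -lee_fin -BE adde_ge0 ?moment_ge0.
have mF : cmeas (fun z : R * R => advec m (g z.1) (g z.1) z.2) by exact: cmeas_advec_joint.
have evo : evolution m g0 B g.
  split => //.
  (* The null set of [duh_eq] depends on the horizon, so integer horizons are used; [n.+1] keeps the
     horizon positive when [n = 0]. *)
  have H : {ae mu, forall xi : R, forall n : nat, forall t : R, 0 <= t <= n%:R ->
      g t xi = g0 xi + cintegral (fun s => (tri t s)%:C * rate m (g s) xi)}.
    apply: ae_forall_nat => n.
    have trF : (trim 0 (fun s => advec m (g s) (g s)) n.+1%:R < +oo)%E.
      have K0 : 0 <= cF * (B * B) by rewrite !mulr_ge0// ltW.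
      have n0 : 0 < n.+1%:R :> R by rewrite ltr0n.
      apply: (trim_bounded n0 K0).
      move=> s s0; have mgs : cmeas (g s) by exact: cmeas_slice.
      apply: le_trans (moment0_advec mm m_ge0 m_le1 mgs mgs) _.
      rewrite EFinM lee_wpmul2l ?lee_fin ?(ltW c0)// EFinM.
      by apply: lee_pmul (moment_ge0 _ _) (moment_ge0 _ _) (gB0 _ s0) (gB1 _ s0).
    apply: aeS (duh_eq g0 mF trF) => xi E t /andP[t0 tn].
    have tn' : 0 <= t <= n.+1%:R by rewrite t0 (le_trans tn)// ler_nat.
    rewrite (gE t xi) (E t tn'); congr (_ + _); apply: eq_cintegral => s.
    by rewrite /rate absxiE -gE.
  apply: aeS H => xi H t t0; apply: (H (Num.bound t)).
  by rewrite t0 ltW// archi_boundP.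
exists g0, g, B, a; split => //; first by rewrite N1.
  split; first exact: hg.
  split; last by split => // t t0; rewrite /a fineK//; exact: gm.
  apply: le_lt_trans small; rewrite ler_wpM2r// -[leLHS]mul1r ler_wpM2r ?(ltW c0)//.
  by rewrite ler1n.
have g2 t : 0 <= t -> (trim 2 g t < +oo)%E by move=> t0; have [] := gest t t0.
split.
  split; first exact: (evo_measurable_theta evo).
  exists (fun t => synth (mult m (g t))), (fun t => synth (ixi (mult m (g t)))); split.
  - exact: (evo_measurable_u mm evo).
  - exact: (evo_measurable_ux mm evo).
  - by apply: aeT => t /ltW t0; exact: (evo_potential mm m_ge0 m_le1 m_even evo hg t0).
  move=> T psi T0 tpsi; split; first exact: (evo_weak_integrable mm m_ge0 m_le1 evo T0 tpsi).
  exact: (evo_weak_identity mm m_ge0 m_le1 m_even evo hg T0 tpsi fg0).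
move=> T T0; split; first exact: (evo_W_space mm m_ge0 m_le1 m_even evo g00 g2 hg T0).
(* The comparison is made at each time and integrated by [le_int], as the left-hand side integrates
   an infimum whose measurability in [s] is not at hand. *)
have Q (t : R) : 0 <= t -> (\int[mu]_(s in `[0%R, t]) wiener_norm_dx 1 (synth (g s)) <= trim 1 g t + trim 2 g t)%E.
  move=> t0; rewrite (trim_add t mg) int_indic; apply: le_int => s.
    apply: mule_ge0; first by rewrite lee_fin indicE.
    by apply: norm_through_ge0 => h; exact: wiener_norm_ge0.
  rewrite indic_itvccE; have [/andP[s0 st]|nst] := boolP (0 <= s <= t); last by rewrite triE (negbTE nst) !mul0e.
  by rewrite triE s0 st !mul1e; exact: (wiener_norm_dx_synth (evo_cL1 evo s0) (hg _ s0)).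
apply: ub_ereal_sup => _ [t + <-]; rewrite /= in_itv/= => /andP[t0 _].
have L := evo_cL1 evo t0.
rewrite (wiener_norm1E (synth_has_fourier L (hg _ t0))) N1 N0 smallness_constant -/a.
have [_ _] := gest t t0; apply: le_trans; rewrite leeD2l// lee_wpmul2l ?lee_fin//.
exact: Q.
Qed.

End existence.


(** * Uniqueness *)

Section joint_fourier.
Context {R : realType}.

(** An upper limit is measurable in a parameter whether or not the sequences converge, and it equals
    the limit where they do. *)
Definition flim (u : nat -> R) : R := fine (limn_esup (fun n => (u n)%:E)).

Lemma flimE (u : nat -> R) (l : R) : u n @[n --> \oo] --> l -> flim u = l.
Proof.
move=> h; have H : (u n)%:E @[n --> \oo] --> l%:E by apply: cvg_EFin => //; exact: nearW.
by rewrite /flim; have [_ ->] := cvg_limn_einf_sup H.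
Qed.

Lemma measurable_flim d (T : measurableType d) (u : nat -> T -> R) :
  (forall n, measurable_fun setT (u n)) -> measurable_fun setT (fun z => flim (u ^~ z)).
Proof.
move=> mu_; apply: (measurableT_comp (@fine_measurable _ _ measurableT)).
by apply: measurable_fun_limn_esup => n; exact: measurable_EFin.
Qed.

Definition cflim (u : nat -> R[i]) : R[i] :=
  (flim (fun n => complex.Re (u n)) +i* flim (fun n => complex.Im (u n)))%C.

Lemma cflimE (u : nat -> R[i]) (l : R[i]) : nc (u n - l) @[n --> \oo] --> (0 : R) -> cflim u = l.
Proof.
move=> h; have K (f : R[i] -> R) : (forall a b, f (a - b) = f a - f b) -> (forall a, `|f a| <= nc a) ->
    f (u n) @[n --> \oo] --> f l.
  move=> fB fn; apply/cvgrPdist_le => e e0; have /cvgrPdist_le/(_ e e0) := h.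
  apply: filterS => n; rewrite sub0r normrN ger0_norm ?nc_ge0//; apply: le_trans.
  by rewrite -normrN opprB -fB.
apply: complexP; apply: flimE; apply: K => [a b|].
- by rewrite ReD ReN.
- exact: nc_Re.
- by rewrite ImD ImN.
- exact: nc_Im.
Qed.

Lemma cmeas_cflim d (T : measurableType d) (u : nat -> T -> R[i]) :
  (forall n, cmeas (u n)) -> cmeas (fun z => cflim (u ^~ z)).
Proof. by move=> mu_; split; apply: measurable_flim => n; case: (mu_ n). Qed.

(* The transform at a given time is only determined almost everywhere.  A jointly
   measurable version is obtained from the absolutely convergent transforms of
   [f t x * expR (- (`|x| / n))], averaged over a small box around [xi]. *)
Lemma jointly_measurable_fourier (f : R -> R -> R) (h : R -> R -> R[i]) (D : set R) :
  jointly_measurable f -> (forall t, D t -> has_fourier (f t) (h t)) ->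
  exists2 H : R -> R -> R[i], cmeas (fun z : R * R => H z.1 z.2) &
    forall t, D t -> has_fourier (f t) (H t).
Proof.
move=> mf fh; suff [H mH He] : exists2 H : R -> R -> R[i], cmeas (fun z : R * R => H z.1 z.2) &
    forall t, D t -> {ae mu, forall xi, H t xi = h t xi}.
  exists H => // t Dt; have mHt : cmeas (H t) := cmeas_slice t mH.
  have /has_fourierP[lf [mh hy] e] := fh _ Dt; apply/has_fourierP; split => //.
    apply: moment0_cL1 => //; rewrite (moment_ae 0 mHt mh (He t Dt)) moment0.
    exact: hy.
  by apply: aeS e => x <-; apply: eq_inverse_fourier => //; exact: He.

have c0 := @cF_gt0 R; have p0 := @pi2_gt0 R.
pose ex (n : nat) (x : R) : R := expR (- (@inv_succ R n * `|x|)).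
(* [f t] is [cF] times [FT (h t)], so this is the Poisson average of [h t]. Being an integral of
   [f], it is jointly measurable although [h] is an arbitrary choice at each time. *)
pose pa (n : nat) (t y : R) : R[i] := cintegral (fun x => ((cF^-1)%:C * (f t x)%:C * (ex n x)%:C) * cis (x * - y)).
have mex n : measurable_fun setT (ex n) by rewrite /ex; meas.
have mpa n : cmeas (fun z : R * R => pa n z.1 z.2).
  apply: (cmeas_cintegral (F := fun (z : R * R) x => ((cF^-1)%:C * (f z.1 x)%:C * (ex n x)%:C) * cis (x * - z.2))).
  have mx := mex n; apply: cmeasM; last by meas.
  apply: cmeasM; last by meas.
  apply: cmeasM; first exact: cmeas_cst.
  by apply: cmeas_real; apply: (mfun_joint (F := f) mf); meas.
have paE n t y : D t -> pa n t y = poisson_avg (h t) (inv_succ n) y.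
  move=> Dt; have /has_fourierP[lf Lh e] := fh _ Dt.
  rewrite -(FT_abel y Lh (inv_succ_gt0 n)); apply: cintegral_ae.
  - have [mft _ _] := lf; have mx := mex n; by meas.
  - have [mx _] := cL1_FT_mul_expN (inv_succ_gt0 n) Lh; by meas.
  apply: aeS e => x; rewrite inverse_fourierE => <-; congr (_ * _ * _).
  by rewrite mulrA -RCM mulVf ?gt_eqF// mul1r.
(* The box around [xi] is written with a fixed interval in [y - xi], which makes its indicator
   jointly measurable. *)
pose bx (k : nat) (xi y : R) : R := \1_(`]- inv_succ k, inv_succ k[%classic) (y - xi).
have bxE k xi y : bx k xi y = \1_(`]xi - inv_succ k, xi + inv_succ k[%classic) y.
  rewrite /bx !indicE !mem_setE !in_itv/=; congr (_%:R); congr nat_of_bool.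
  by apply/idP/idP => /andP[a b]; apply/andP; split; lra.
pose A (k : nat) (t xi : R) : R[i] := cflim (fun n => cintegral (fun y => (bx k xi y)%:C * pa n t y)).
have mA k : cmeas (fun z : R * R => A k z.1 z.2).
  apply: (cmeas_cflim (u := fun n (z : R * R) => cintegral (fun y => (bx k z.2 y)%:C * pa n z.1 y))) => n.
  apply: (cmeas_cintegral (F := fun (z : R * R) y => (bx k z.2 y)%:C * pa n z.1 y)).
  apply: cmeasM.
    by apply: cmeas_real; apply: (mfun_indic (measurable_itv _)); meas.
  by apply: (cmeas_joint (F := pa n)) => //; meas.
have AE k t xi : D t -> A k t xi = (2 * pi)%:C * cintegral (fun y => (bx k xi y)%:C * h t y).
  move=> Dt; have /has_fourierP[_ Lh _] := fh _ Dt; apply: cflimE.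
  have Eb (z : R -> R[i]) : cintegral (fun y => (bx k xi y)%:C * z y) =
      cintegral (fun y => (\1_(`]xi - inv_succ k, xi + inv_succ k[%classic) y)%:C * z y).
    by apply: eq_cintegral => y; rewrite bxE.
  have Ep n : cintegral (fun y => (bx k xi y)%:C * pa n t y) = cintegral (fun y => (bx k xi y)%:C * poisson_avg (h t) (inv_succ n) y).
    by apply: eq_cintegral => y; rewrite paE.
  under eq_fun do rewrite Ep Eb; rewrite Eb; exact: poisson_avg_interval.
(* Division by the length [2 / (k + 1)] of the box and by the mass [2 pi] of the kernel; Lebesgue
   differentiation recovers [h t] almost everywhere. *)
pose H (t xi : R) : R[i] := cflim (fun k => (k.+1%:R / 2 * (2 * pi)^-1)%:C * A k t xi).
exists H.
  apply: (cmeas_cflim (u := fun k (z : R * R) => (k.+1%:R / 2 * (2 * pi)^-1)%:C * A k z.1 z.2)) => k.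
  by apply: cmeasM; first exact: cmeas_cst.
move=> t Dt; have /has_fourierP[_ Lh _] := fh _ Dt; have /cL1P[iR iI] := Lh.
have bav (p : R -> R) : mu.-integrable setT (EFin \o p) -> {ae mu, forall x : R, k.+1%:R / 2 * \int[mu]_y (bx k x y * p y) @[k --> \oo] --> p x}.
  move=> ip; have lp : locally_integrable setT p by apply: open_integrable_locally => //; exact: openT.
  apply: aeS (box_averages lp) => x hx.
  have Eb k : \int[mu]_y (bx k x y * p y) = \int[mu]_(y in box x k) p y.
    by rewrite [RHS]Rint_indic; apply: eq_Rintegral => y _; rewrite bxE.
  by under eq_fun do rewrite Eb.
apply: aeS (aeI (bav _ iR) (bav _ iI)) => xi [cR cI].
have E k : (k.+1%:R / 2 * (2 * pi)^-1)%:C * A k t xi = (k.+1%:R / 2)%:C * cintegral (fun y => (bx k xi y)%:C * h t y).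
  by rewrite AE// [LHS]mulrA -RCM divfK ?gt_eqF.
have ER k : complex.Re ((k.+1%:R / 2 * (2 * pi)^-1)%:C * A k t xi) = k.+1%:R / 2 * \int[mu]_y (bx k xi y * complex.Re (h t y)).
  rewrite E ReRC; congr (_ * _).
  by rewrite Re_cintegral; apply: eq_Rintegral => y _; rewrite ReRC.
have EI k : complex.Im ((k.+1%:R / 2 * (2 * pi)^-1)%:C * A k t xi) = k.+1%:R / 2 * \int[mu]_y (bx k xi y * complex.Im (h t y)).
  rewrite E ImRC; congr (_ * _).
  by rewrite Im_cintegral; apply: eq_Rintegral => y _; rewrite ImRC.
apply: complexP; apply: flimE.
  by under eq_fun do rewrite ER.
by under eq_fun do rewrite EI.
Qed.

End joint_fourier.

(** * Test functions in product form and what they determine *)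

Section product_tests.
Context {R : realType}.

Lemma derivableMr_cst (u : R -> R) (k t : R) : derivable u t 1 -> derivable (fun s => u s * k) t 1.
Proof. by move=> du; exact: (derivableM du (derivable_cst k t 1)). Qed.

Lemma derivableMl_cst (u : R -> R) (k t : R) : derivable u t 1 -> derivable (fun s => k * u s) t 1.
Proof. by move=> du; exact: (derivableM (derivable_cst k t 1) du). Qed.

Lemma partial_product (phi chi : R -> R) w : smooth phi -> smooth chi ->
  partial w (fun t x => phi t * chi x) =
  fun t x => derive1n (count id w) phi t * derive1n (count negb w) chi x.
Proof.
move=> /smoothP sp /smoothP sc; elim: w => [|[] w IH]; first by [].
  rewrite -[LHS]/(dt (partial w (fun t x => phi t * chi x))) IH.
  by apply/funext => t; apply/funext => x; rewrite /dt (derive1Mr _ (sp _ t)) -derive1nS.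
rewrite -[LHS]/(dx (partial w (fun t x => phi t * chi x))) IH.
by apply/funext => t; apply/funext => x; rewrite /dx (derive1Ml _ (sc _ x)) -derive1nS.
Qed.

Lemma spacetime_product (phi chi : R -> R) (S T : R) : test_fun phi -> test_fun chi ->
  S < T -> (forall t, S < t -> phi t = 0) ->
  spacetime_test_fun T (fun t x => phi t * chi x).
Proof.
move=> tp tc ST out; have [sp [M1 o1]] := tp; have [sc [M2 o2]] := tc.
have cn (f : R -> R) n : test_fun f -> continuous (derive1n n f).
  by move=> tf; apply: derivable_continuous => x; have [s _] := tf; exact: s.
split; last first.
  exists S, (Num.max M1 M2); split => // t x /or3P[h|h|h].
  - by rewrite out// mul0r.
  - by rewrite o1 ?mul0r//; apply: le_lt_trans h; rewrite le_max lexx.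
  - by rewrite o2 ?mulr0//; apply: le_lt_trans h; rewrite le_max lexx orbT.
move=> w; have E := partial_product w (proj2 (smoothP phi) sp) (proj2 (smoothP chi) sc).
rewrite E; split.
- move=> z; apply: cvgM.
    apply: (continuous_comp (f := fst) (g := derive1n (count id w) phi)); first exact: cvg_fst.
    exact: cn.
  apply: (continuous_comp (f := snd) (g := derive1n (count negb w) chi)); first exact: cvg_snd.
  exact: cn.
- by move=> t x; apply: derivableMr_cst; exact: sp.
- by move=> t x; apply: derivableMl_cst; exact: sc.
Qed.

(** A primitive of [f] vanishing after [r] is in general a nonzero constant before 0. Only times
    [t >= 0] count, so it can be brought back to 0 at negative times. *)
Lemma test_antiderivative (f : R -> R) (r : R) : test_fun f -> 0 < r ->
  (forall t, ~ (0 < t < r) -> f t = 0) ->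
  exists phi, [/\ test_fun phi, (forall t, 0 <= t -> derive1 phi t = f t) &
    (forall t, r <= t -> phi t = 0)].
Proof.
move=> tf r0 out; have [/smoothP sf _] := tf; have cf := smooth_continuous sf.
have /cL1P[intf _] := test_fun_cL1 tf.
pose F (x : R) : R := \int[mu]_(t in `]-oo, x]%classic) f t.
have FE x : F x = \int[mu]_t (\1_(`]-oo, x]%classic) t * f t) by exact: Rint_indic.
have dF (x : R) : derivable F x 1 /\ derive1 F x = f x.
  have xx : x < x + 1 by rewrite ltrDl.
  apply: (@continuous_FTC1 _ f -oo%O x (x + 1)) => //; last exact: cf.
  - by apply: integrableS intf.
  - by rewrite ltNyr.
have F0 x : x <= 0 -> F x = 0.
  move=> x0; rewrite FE; transitivity (\int[mu]_t (0 : R)); last by rewrite /Rintegral integral0.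
  apply: eq_Rintegral => t _; rewrite indicE mem_setE in_itv/=.
  have [tx|] := leP t x; last by rewrite mul0r.
  rewrite out ?mulr0// => /andP[t0 _]; move: (lt_le_trans t0 (le_trans tx x0)).
  by rewrite ltxx.
have F1 x : r <= x -> F x = F r.
  move=> rx; rewrite !FE; apply: eq_Rintegral => t _; rewrite !indicE !mem_setE !in_itv/=.
  have [tr|tr] := leP t r; first by rewrite (le_trans tr rx).
  by rewrite out ?mulr0// => /andP[_ t0]; move: (lt_trans t0 tr); rewrite ltxx.
(* For [t >= 0] the second term is the constant [F r]; for [t <= - (r + 1)] both terms are 0, whence
   the compact support. *)
pose phi t := F t - F (t + (r + 1)).
have dphi (t : R) : is_derive t 1 phi (f t - f (t + (r + 1))).
  have D (y : R) : is_derive y 1 F (f y).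
    by have [d e] := dF y; split; [exact: d|rewrite -derive1E; exact: e].
  have i1 := D t; have i2 := D (t + (r + 1)).
  have i3 : is_derive t 1 (fun s : R => s + (r + 1)) (1 + 0).
    by apply: is_deriveD; exact: is_derive_cst.
  have i4 : is_derive t 1 (F \o (fun s : R => s + (r + 1))) (f (t + (r + 1)) * 1).
    by apply: is_derive1_comp; rewrite addr0 in i3.
  by rewrite mulr1 in i4; exact: is_deriveB.
have dE t : derive1 phi t = f t - f (t + (r + 1)).
  by rewrite derive1E; have [_ ->] := dphi t.
exists phi; split.
- split.
    apply/smoothP => -[|n].
      by split => // t; have [] := dphi t.
    split; first by move=> t; have [] := dphi t.
    have -> : derive1 phi = fun t => f t + (-1) * f (1 * t + (r + 1)).
      by apply/funext => t; rewrite dE mul1r mulN1r.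
    by apply: CnD; [exact: sf|apply: CnM; [exact: Cn_cst|exact: Cn_affine (sf n)]].
  exists (r + 1) => t; have [t0|t0] := leP 0 t.
    rewrite ger0_norm// => h; rewrite /phi !F1 ?subrr//; lra.
  rewrite ltr0_norm// => h; rewrite /phi !F0 ?subrr//; lra.
- move=> t t0; rewrite dE (out (t + (r + 1))) ?subr0// => /andP[_ h]; lra.
- by move=> t rt; rewrite /phi !F1 ?subrr//; lra.
Qed.

Lemma weak_deriv1_unique (u v1 v2 : R -> R) : weak_deriv 1 u v1 -> weak_deriv 1 u v2 ->
  {ae mu, forall x, v1 x = v2 x}.
Proof.
move=> [_ l1 e1] [_ l2 e2].
have H : {ae mu, forall x, (v1 \- v2) x = 0}.
  apply: eq0_of_test_fun; first exact: locally_integrableB.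
  move=> phi tp; have L1 := locally_integrable_mul_test l1 tp; have L2 := locally_integrable_mul_test l2 tp.
  have K (a b : R) : a%:C = b%:C -> a = b by case.
  apply: K; rewrite -cintegral_of_real.
  rewrite (eq_cintegral (g := fun x => (v1 x * phi x)%:C - (v2 x * phi x)%:C)); last first.
    by move=> x; rewrite mulrBl RCB.
  rewrite (cintegralB L1 L2) !cintegral_of_real -RCB; congr (_%:C).
  have := e1 _ tp; rewrite (e2 _ tp) !expr1 !mulN1r => /oppr_inj ->; exact: subrr.
by apply: aeS H => x /= /eqP; rewrite subr_eq0 => /eqP.
Qed.

Lemma parseval_eq0 (V : R -> R[i]) : cL1 V ->
  (forall chi, test_fun chi -> cintegral (fun xi => V xi * conjc (fourier chi xi)) = 0) ->
  {ae mu, forall xi, V xi = 0}.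
Proof.
move=> LV H; apply: inverse_fourier_eq0 => //; have mI := cmeas_inverse_fourier LV.1.
have b x := nc_inverse_fourier x LV.
have lR : locally_integrable setT (fun x => complex.Re (inverse_fourier V x)).
  by apply: (bounded_locally_integrable mI.1) => x; exact: le_trans (nc_Re _) (b x).
have lI : locally_integrable setT (fun x => complex.Im (inverse_fourier V x)).
  by apply: (bounded_locally_integrable mI.2) => x; exact: le_trans (nc_Im _) (b x).
have Z chi : test_fun chi -> cintegral (fun x => inverse_fourier V x * (chi x)%:C) = 0.
  by move=> tc; rewrite (fourier_parseval LV (test_fun_cL1 tc)); exact: H.
have ZR : {ae mu, forall x, complex.Re (inverse_fourier V x) = 0}.
  apply: eq0_of_test_fun lR _ => chi tc; have := congr1 (@complex.Re R) (Z chi tc).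
  by rewrite Re_cintegral /= => <-; apply: eq_Rintegral => x _; rewrite ReMR.
have ZI : {ae mu, forall x, complex.Im (inverse_fourier V x) = 0}.
  apply: eq0_of_test_fun lI _ => chi tc; have := congr1 (@complex.Im R) (Z chi tc).
  by rewrite Im_cintegral /= => <-; apply: eq_Rintegral => x _; rewrite ImMR.
by apply: aeS (aeI ZR ZI) => x [a c]; apply: complexP.
Qed.

(** Only rational times are tested, because in the application the null set of frequencies is fixed
    before the time and can avoid countably many conditions. Dominated convergence extends the
    hypothesis to all times, and differences of primitives give all intervals. *)
Lemma ae0_of_tri (z : R -> R[i]) : cmeas z -> (forall r, 0 <= r -> (trin z r < +oo)%E) ->
  (forall p q : nat, cintegral (fun t => (tri (p%:R / q.+1%:R) t)%:C * z t) = 0) ->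
  {ae mu, forall t : R, 0 <= t -> z t = 0}.
Proof.
move=> mz fin H.
have tri0 (b : R) : 0 <= b -> cintegral (fun t => (tri b t)%:C * z t) = 0.
  (* A rational in []b, b + 1 / (n + 1)]], of the form tested in the hypothesis. *)
  move=> b0; pose s n : R := (Num.truncn (b * n.+1%:R)).+1%:R / n.+1%:R.
  have sb n : b < s n /\ s n <= b + n.+1%:R^-1.
    have bn : 0 <= b * n.+1%:R by rewrite mulr_ge0.
    have /andP[h1 h2] := truncn_itv bn; split.
      by rewrite ltr_pdivlMr.
    by rewrite ler_pdivrMr// mulrDl mulVf ?pnatr_eq0// -natr1 lerD2r.
  have cs : s n @[n --> \oo] --> b.
    apply: (@squeeze_cvgr _ _ _ _ (fun=> b) (fun n => b + n.+1%:R^-1)).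
    - by apply: nearW => n; have [/ltW -> ->] := sb n.
    - exact: cvg_cst.
    - by rewrite -[X in _ --> X]addr0; apply: cvgD; [exact: cvg_cst|exact: cvg_harmonic].
  have b1 : 0 <= b + 1 by rewrite addr_ge0.
  have mnz := measurable_nc mz.
  have D : nc (cintegral (fun t => (tri (s n) t)%:C * z t) - cintegral (fun t => (tri b t)%:C * z t)) @[n --> \oo] --> (0 : R).
    apply: (cintegral_dct (b := fun t => tri (b + 1) t * nc (z t))).
    - by move=> n; have mt := measurable_tri1 (s n); meas.
    - by apply: cL1_tri => //; exact: fin.
    - by have mt := measurable_tri1 (b + 1); meas.
    - under eq_integral do rewrite ger0_norm ?mulr_ge0 ?tri_ge0 ?nc_ge0//.
      exact: fin b1.
    - apply: aeT => t n; rewrite ncM nc_real ger0_norm ?tri_ge0// ler_wpM2r ?nc_ge0// tri_le//.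
      by have [_ h] := sb n; apply: le_trans h _; rewrite lerD2l invf_le1 ?ler1n.
    apply: aeT => t; apply: cvg_near_cst.
    have [tb|tb] := leP t b.
      apply: nearW => n; rewrite !triE tb (le_trans tb) ?subrr ?nc0//.
      by have [/ltW] := sb n.
    near=> n; rewrite !triE (lt_geF tb) (_ : (t <= s n) = false) ?subrr ?nc0//.
    by apply/negbTE; rewrite -ltNge; near: n; exact: cvgr_lt cs _ tb.
  move: D; under eq_fun do rewrite /s H sub0r ncN.
  by move=> /(cvg_lim (@Rhausdorff R)); rewrite lim_cst// => h; exact: nc_eq0.
suff F n : {ae mu, forall t, (tri n%:R t)%:C * z t = 0}.
  apply: aeS (ae_forall_nat F) => t h t0; have := h (Num.bound t).
  by rewrite triE t0 (ltW (archi_boundP t0)) mul1r.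
have n0 : 0 <= n%:R :> R by [].
have Lz := cL1_tri mz (fin _ n0).
have [lR lI] := cL1_locally_integrable Lz.
apply: cae0_of_intervals lR lI _ => a b ab.
have T0 (c : R) : cintegral (fun t => (tri c t)%:C * z t) = 0.
  have [c0|c0] := leP 0 c; first exact: tri0.
  rewrite (eq_cintegral (g := fun _ => 0)) ?cintegral0// => t; rewrite triE.
  by have [t0|] := leP 0 t; rewrite ?mul0r// (lt_geF (lt_le_trans c0 t0)) mul0r.
have Lc (c : R) : cL1 (fun t => (tri c t)%:C * z t).
  have [c0|c0] := leP 0 c; first by apply: cL1_tri => //; exact: fin.
  apply: cL1_tri => //; apply: le_lt_trans (fin 0 (lexx 0)); apply: trin_le; exact: ltW.
pose a' := Num.min a n%:R; pose b' := Num.min b n%:R.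
have nb := ae_neq (b : R).
have mi2 : measurable_fun setT (fun t : R => \1_(`]a, b[%classic) t : R).
  exact: (mfun_indic (measurable_itv _) (@measurable_id _ _ _)).
have mt1 := measurable_tri1 a'; have mt2 := measurable_tri1 b'; have mt3 := measurable_tri1 (n%:R : R).
have := cintegralB (Lc b') (Lc a'); rewrite !T0 subr0 => <-.
apply: cintegral_ae; [by meas|by meas|].
apply: aeS nb => t tb; rewrite -mulrBl mulrA -RCM -RCB; congr (_%:C * _).
rewrite !triE indicE mem_setE in_itv/= /a' /b' !le_min [t < b]lt_neqAle tb /=.
have [t0|t0] := leP 0 t; last by rewrite mulr0 subr0.
have [at_|ta] := ltP a t; have [tb'|bt] := leP t b; have [tn|nt] := leP t n%:R; rewrite ?mulr0 ?mul0r ?subr0 ?subrr ?mulr1//.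
by move: (le_lt_trans ta ab); rewrite ltNge (ltW bt).
Unshelve. all: by end_near. Qed.

End product_tests.

(** * The integral equation satisfied by the transform of any weak solution *)

Section spectral_equation.
Context {R : realType} (alpha : R) (theta0 : R -> R) (eta : R -> R -> R).
Variables (g0 : R -> R[i]) (H : R -> R -> R[i]) (B : R).
Hypothesis alpha_ge0 : 0 <= alpha.
Hypothesis f0 : has_fourier theta0 g0.
Hypothesis weak : weak_solution alpha 1 theta0 eta.
Hypothesis mH : cmeas (fun z : R * R => H z.1 z.2).
Hypothesis fH : forall t, 0 <= t -> has_fourier (eta t) (H t).
Hypothesis H0 : forall t, 0 <= t -> (moment 0 (H t) <= B%:E)%E.
Hypothesis H1 : forall t, 0 <= t -> (moment 1 (H t) <= B%:E)%E.

Let m : R -> R := bessel alpha.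
Let mm : measurable_fun setT m. Proof. exact: measurable_bessel. Qed.
Let m_ge0 x : 0 <= m x. Proof. exact: bessel_ge0. Qed.
Let m_le1 x : m x <= 1. Proof. exact: bessel_le1. Qed.
Let c0 := @cF_gt0 R.
Let B0 : 0 <= B.
Proof. by rewrite -lee_fin; apply: le_trans (H0 (lexx 0)); exact: moment_ge0. Qed.
Let C := cF * (B * B) + B.
Let C0 : 0 <= C. Proof. by rewrite addr_ge0// !mulr_ge0// ltW. Qed.
Let mHt t : cmeas (H t). Proof. exact: cmeas_slice (t) mH. Qed.
Let mr : cmeas (fun z : R * R => rate m (H z.1) z.2).
Proof. exact: cmeas_rate_joint. Qed.
Let mg0 : cmeas g0. Proof. exact: has_fourier_cmeas f0. Qed.
Let L0 : cL1 g0. Proof. by have /has_fourierP[_ L _] := f0. Qed.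
Let LH t : 0 <= t -> cL1 (H t). Proof. by move=> /fH /has_fourierP[]. Qed.
Let H1y t : 0 <= t -> (moment 1 (H t) < +oo)%E.
Proof. by move=> t0; apply: le_lt_trans (H1 t0) (ltry _). Qed.
Let rate0 t : 0 <= t -> (moment 0 (rate m (H t)) <= C%:E)%E.
Proof.
by move=> t0; have := moment0_rate mm m_ge0 m_le1 (mHt t) (H0 t0) (H1 t0); exact.
Qed.

Lemma fourierZ (k : R) (chi : R -> R) xi : test_fun chi ->
  conjc (fourier (fun x => k * chi x) xi) = k%:C * conjc (fourier chi xi).
Proof.
move=> tc; rewrite !conj_fourierE mulrCA; congr (_ * _).
have L : cL1 (fun x => (chi x)%:C * cis (x * xi)).
  have [mc ic] := test_fun_cL1 tc; split; first by meas.
  by under eq_integral do rewrite ncM nc_cis mulr1.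
by rewrite -(cintegralZ _ L); apply: eq_cintegral => x; rewrite RCM mulrA.
Qed.

Section test.
Variables (r : R) (f phi : R -> R).
Hypotheses (r0 : 0 < r) (tf : test_fun f) (tphi : test_fun phi).
Hypothesis dphi : forall t, 0 <= t -> derive1 phi t = f t.
Hypothesis phi_out : forall t, r <= t -> phi t = 0.

Let T := r + 1.
Let T0 : 0 < T. Proof. by rewrite addr_gt0. Qed.
Let mf := test_fun_measurable tf.
Let mphi := test_fun_measurable tphi.

(** What the weak formulation tested with [phi(t) chi(x)] leaves at the frequency [xi], the initial
    term included, once [chi] is removed. *)
Let V xi : R[i] := (phi 0)%:C * g0 xi +
  cintegral (fun t => (tri T t)%:C * ((f t)%:C * H t xi + (phi t)%:C * rate m (H t) xi)).

Let F t xi : R[i] := (tri T t)%:C * ((f t)%:C * H t xi + (phi t)%:C * rate m (H t) xi).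

Let mF : cmeas (fun z : R * R => F z.1 z.2).
Proof.
have mt := measurable_tri1 T; apply: cmeasM; first by meas.
apply: cmeasD; first by meas.
by apply: cmeasM mr; meas.
Qed.

Let finF : (\int[mu]_t \int[mu]_xi (nc (F t xi))%:E < +oo)%E.
Proof.
have mt := measurable_tri1 T.
have [K1 HK1] := test_fun_bounded tf; have [K HK] := test_fun_bounded tphi.
have K10 : 0 <= K1 by apply: le_trans (HK1 0). have K0 : 0 <= K by apply: le_trans (HK 0).
apply: (@le_lt_trans _ _ (\int[mu]_t ((K1 * B + K * C) * tri T t)%:E)%E); last first.
  have T0' := ltW T0.
  by rewrite intZ ?(int_tri T0') -?EFinM ?ltry ?addr_ge0 ?mulr_ge0// => s; exact: tri_ge0.
apply: le_int => t; first by apply: integral_ge0 => x _; rewrite lee_fin nc_ge0.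
rewrite triE; have [/andP[t0 tT]|/negbTE nt] := boolP (0 <= t <= T); last first.
  rewrite mulr0; under eq_integral do rewrite /F triE nt ncM nc0 mul0r.
  by rewrite integral0.
rewrite mulr1; have mnr := measurable_nc (cmeas_rate mm (mHt t)); have mng := measurable_nc (mHt t).
apply: (@le_trans _ _ (\int[mu]_xi (K1 * nc (H t xi) + K * nc (rate m (H t) xi))%:E)%E).
  apply: le_int => xi; rewrite lee_fin ?nc_ge0// /F triE t0 tT ncM nc_real normr1 mul1r.
  by apply: le_trans (ncD _ _) _; rewrite !ncM !nc_real; apply: lerD; rewrite ler_wpM2r ?nc_ge0.
rewrite intD; [|by meas|by meas|by move=> x; rewrite mulr_ge0 ?nc_ge0..].
rewrite !intZ//; [|by move=> x; exact: nc_ge0..].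
rewrite EFinD !EFinM; apply: leeD; apply: lee_wpmul2l; rewrite ?lee_fin// -moment0.
  exact: H0.
exact: rate0.
Qed.

Let mF' : cmeas (fun z : R * R => F z.2 z.1).
Proof.
by apply: (cmeas_comp (f := fun z : R * R => F z.1 z.2) mF (h := fun w : R * R => (w.2, w.1))); meas.
Qed.

Let finF' : (\int[mu]_xi \int[mu]_t (nc (F t xi))%:E < +oo)%E.
Proof.
rewrite -(int_fubini (F := fun t xi => (nc (F t xi))%:E)) //.
- by apply: measurable_EFin; exact: measurable_nc.
- by move=> x y; rewrite lee_fin nc_ge0.
Qed.

Let mI : cmeas (fun xi => cintegral (F^~ xi)).
Proof. exact: (cmeas_cintegral (F := fun xi t => F t xi)). Qed.

Let LV : cL1 V.
Proof.
apply: cL1D; first exact: cL1Z.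
split => //; apply: le_lt_trans finF'.
apply: le_int => xi; first by rewrite lee_fin nc_ge0.
by apply: nc_cintegral; exact: (cmeas_swap_slice (z := F) xi mF).
Qed.

(** The functions [u] and [ux] of a weak solution are only given through a multiplier and a weak
    derivative. Uniqueness of transforms and of weak derivatives identifies them almost everywhere
    with the inverse transforms that [weak_pairing] expects. *)
Lemma weak_space (u ux : R -> R -> R) (chi : R -> R) (t : R) : test_fun chi -> 0 <= t ->
  is_bessel_potential alpha (eta t) (u t) -> weak_deriv 1 (u t) (ux t) ->
  (\int[mu]_x weak_integrand 1 eta u ux (fun t x => phi t * chi x) t x)%:C =
  cintegral (fun xi => ((f t)%:C * H t xi + (phi t)%:C * rate m (H t) xi) * conjc (fourier chi xi)).
Proof.
move=> tc t0 [g' fg' fu] wd; have fHt := fH t0.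
have L := LH t0; have LU : cL1 (mult m (H t)) := cL1_mult mm m_ge0 m_le1 L.
have LX : cL1 (ixi (mult m (H t))) := cL1_ixi_mult mm m_ge0 m_le1 L (H1y t0).
have /has_fourierP[[meta _ _] _ eH] := fHt.
have /has_fourierP[lu _ eu'] := fu.
have mg' := has_fourier_cmeas fg'; have mU := has_fourier_cmeas fu.
have eu : {ae mu, forall x, inverse_fourier (mult m (H t)) x = (u t x)%:C}.
  apply: aeS eu' => x <-; apply: eq_inverse_fourier; [by case: LU|exact: mU|].
  by apply: aeS (has_fourier_unique fHt fg') => xi e; rewrite multE e.
have fU : has_fourier (u t) (mult m (H t)) by apply/has_fourierP; split.
have [g'' [hg'' Lg'' fg'' eg'']] := has_fourier_hermitian fU.
have eX : {ae mu, forall xi, ixi g'' xi = ixi (mult m (H t)) xi}.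
  by apply: aeS eg'' => xi e; rewrite !ixiE e.
have LX'' : cL1 (ixi g'').
  have [mg2 _] := Lg''; apply: moment0_cL1; first exact: cmeas_ixi.
  rewrite (moment_ae 0 (cmeas_ixi mg2) LX.1 eX) moment0; exact: LX.2.
have fX := synth_has_fourier LX'' (hermitian_ixi hg'').
have wd' : weak_deriv 1 (u t) (synth (ixi g'')) by exact: (has_fourier_weak_deriv (j := 1) fg'' fX).
have eux : {ae mu, forall x, inverse_fourier (ixi (mult m (H t))) x = (ux t x)%:C}.
  have /has_fourierP[_ _ e2] := fX.
  apply: aeS (aeI e2 (weak_deriv1_unique wd' wd)) => x [e3 e4]; rewrite -e4 -e3.
  by apply: eq_inverse_fourier; [case: LX|case: LX''|apply: aeS eX => xi ->].
have [_ lux _] := wd; have [mux _ _] := lux; have [mut _ _] := lu.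
have D1 : dt (fun t x => phi t * chi x) t = fun x => f t * chi x.
  apply/funext => x; have [/smoothP sp _] := tphi.
  by rewrite /dt (derive1Mr _ (@smooth_derivable _ phi t sp)) dphi.
have tk (k : R) : test_fun (fun x => k * chi x).
  rewrite (_ : (fun x => _) = fun x => chi x * k); last by apply/funext => x; rewrite mulrC.
  by apply: test_funM => // n; exact: Cn_cst.
rewrite /weak_integrand D1.
have E := weak_pairing mm m_ge0 m_le1 L (H1y t0) meta mut mux eH eu eux (tk (f t)) (tk (phi t)).
apply: etrans E _; apply: eq_cintegral => xi.
have W (a b c d e : R[i]) : a * (b * e) + c * (d * e) = (b * a + d * c) * e by ring.
by rewrite (fourierZ (f t) xi tc) (fourierZ (phi t) xi tc); exact: W.
Qed.

(** By the weak formulation and Fubini, [V] pairs to zero with the transforms of all [chi]. The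
    resulting null set depends on [phi]. *)
Lemma weak_equation_test : {ae mu, forall xi, V xi = 0}.
Proof.
apply: parseval_eq0 => // chi tc.
have [meta [u [ux [mu_ mux pot id]]]] := weak.
have rT : r < T by rewrite ltrDl.
have tpsi : spacetime_test_fun T (fun t x => phi t * chi x).
  by apply: (spacetime_product tphi tc rT) => t /ltW; exact: phi_out.
have [_ {}id] := id _ _ T0 tpsi.
have mc := test_fun_measurable tc; have Lc := test_fun_cL1 tc.
have [M HM] := fourier_bounded Lc.
have mX : cmeas (fun xi => conjc (fourier chi xi)) by exact: cmeasJ (cmeas_fourier mc).
have M0 : 0 <= M by apply: le_trans (HM 0); exact: nc_ge0.
pose G t xi := conjc (fourier chi xi) * F t xi.
have mG : cmeas (fun z : R * R => G z.1 z.2).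
  by apply: cmeasM mF; exact: (cmeas_comp (f := fun xi => conjc (fourier chi xi)) mX (@measurable_snd _ _ _ _)).
have finG : (\int[mu]_t \int[mu]_xi (nc (G t xi))%:E < +oo)%E.
  have mnF := measurable_nc mF.
  apply: (@le_lt_trans _ _ (M%:E * \int[mu]_t \int[mu]_xi (nc (F t xi))%:E)%E); last first.
    by apply: (@lte_mul_pinfty _ M%:E); [rewrite lee_fin|by []|exact: finF].
  rewrite -ge0_integralZl_EFin//; last 2 first.
  - by move=> t _; apply: integral_ge0 => x _; rewrite lee_fin nc_ge0.
  - exact: measurable_int_nc.
  apply: le_int => t; first by apply: integral_ge0 => x _; rewrite lee_fin nc_ge0.
  have mFt := measurable_nc (cmeas_slice t mF).
  rewrite -intZ//; last by move=> x; exact: nc_ge0.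
  apply: le_int => xi; first by rewrite lee_fin nc_ge0.
  by rewrite lee_fin ncM ler_wpM2r ?nc_ge0.
have tk (k : R) : test_fun (fun x => k * chi x).
  rewrite (_ : (fun x => _) = fun x => chi x * k); last by apply/funext => x; rewrite mulrC.
  by apply: test_funM => // n; exact: Cn_cst.
have [_ _ /(_ _ (tk (phi 0))) f0E] := f0.
have K (a b : R) : a = b -> a%:C = b%:C by move=> ->.
have idC := K _ _ id; rewrite Rint_indic -cintegral_of_real RCN f0E in idC.
have Lp := cL1_pairing L0 mc Lc.
have mW : measurable_fun setT (fun z : R * R => weak_integrand 1 eta u ux (fun t x => phi t * chi x) z.1 z.2).
  have q0 := partial_measurable tpsi [::]; have q1 := partial_measurable tpsi [:: true].
  have q2 := partial_measurable tpsi [:: false]; have q3 := measurable_Lambda_partial tpsi [::].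
  apply: mfunD; last exact: (mfunN (mfunM meta q3)).
  apply: mfunD; last exact: (mfunM (mfunM mu_ meta) q2).
  apply: mfunD; first exact: (mfunM meta q1).
  exact: (mfunM (mfunM mux meta) q0).
have I1 : cintegral (fun t => cintegral (G t)) = - ((phi 0)%:C * cintegral (fun xi => g0 xi * conjc (fourier chi xi))).
  apply: etrans (etrans _ idC) _; last first.
    congr (- _); rewrite -(cintegralZ _ Lp); apply: eq_cintegral => xi.
    by rewrite (fourierZ _ _ tc); ring.
  apply: cintegral_ae; first exact: cmeas_cintegral.
    apply: cmeas_real; apply: mfunM; first exact: (mfun_indic (measurable_itv _) (@measurable_id _ _ _)).
    exact: (measurable_Rint (F := weak_integrand 1 eta u ux (fun t x => phi t * chi x))).
  have nt := ae_neq (0 : R).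
  apply: aeS (aeI nt pot) => t [t0 P]; rewrite indic_itvccE /G /F triE.
  have [/andP[t0' tT]|_] := boolP (0 <= t <= T); last first.
    by rewrite mul0r (eq_cintegral (g := fun _ => 0)) ?cintegral0// => xi; rewrite mul0r mulr0.
  have tp : 0 < t by rewrite lt_neqAle eq_sym t0.
  have [p1 p2] := P tp; rewrite mul1r (weak_space tc t0' p1 p2).
  by apply: eq_cintegral => xi; rewrite -[(true%:R)%:C]/(1 : R[i]) mul1r mulrC.
have I2 : cintegral (fun xi => conjc (fourier chi xi) * cintegral (F^~ xi)) = cintegral (fun t => cintegral (G t)).
  rewrite (cfubini mG finG); apply: cintegral_ae.
  - exact: cmeasM.
  - apply: (cmeas_cintegral (F := fun xi t => G t xi)).
    by apply: (cmeas_comp (f := fun z : R * R => G z.1 z.2) mG (h := fun w : R * R => (w.2, w.1))); meas.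
  apply: aeS (cfubini_ae (F := fun xi t => F t xi) mF' finF') => xi LF.
  exact: esym (cintegralZ _ LF).
have LI : cL1 (fun xi => conjc (fourier chi xi) * cintegral (F^~ xi)).
  apply: (cL1M_bounded (M := M)) => //; split => //; apply: le_lt_trans finF'.
  apply: le_int => xi; first by rewrite lee_fin nc_ge0.
  by apply: nc_cintegral; exact: (cmeas_swap_slice (z := F) xi mF).
transitivity (cintegral (fun xi => (phi 0)%:C * (g0 xi * conjc (fourier chi xi)) + conjc (fourier chi xi) * cintegral (F^~ xi))).
  by apply: eq_cintegral => xi; rewrite /V /F; ring.
by rewrite (cintegralD (cL1Z _ Lp) LI) (cintegralZ _ Lp) I2 I1 subrr.
Qed.

End test.

Let J t xi : R[i] := cintegral (fun s => (tri t s)%:C * rate m (H s) xi).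
(** The residual of the integral equation, to be shown to vanish. *)
Let z t xi : R[i] := H t xi - (g0 xi + J t xi).

Let mJ : cmeas (fun w : R * R => J w.1 w.2).
Proof.
have mt2 := @measurable_tri R.
apply: (cmeas_cintegral (F := fun (w : R * R) s => (tri w.1 s)%:C * rate m (H s) w.2)).
apply: cmeasM.
  by apply: cmeas_real; apply: (mfun_joint (F := @tri R) mt2); meas.
by apply: (cmeas_joint (F := fun s => rate m (H s)) mr); meas.
Qed.

Let mz : cmeas (fun w : R * R => z w.1 w.2).
Proof.
apply: cmeasB => //; apply: cmeasD => //.
exact: (cmeas_comp (f := g0) mg0 (@measurable_snd _ _ _ _)).
Qed.

Let good_ae : {ae mu, forall xi : R, forall r, (trin (H^~ xi) r < +oo)%E /\
  (trin (fun s => rate m (H s) xi) r < +oo)%E}.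
Proof.
have A (n : nat) : {ae mu, forall xi : R, (trin (H^~ xi) n.+1%:R < +oo)%E /\
    (trin (fun s => rate m (H s) xi) n.+1%:R < +oo)%E}.
  have n0 : 0 < n.+1%:R :> R by rewrite ltr0n.
  apply: aeI; first exact: (trim_fin_ae (n := 0) mH (trim_bounded n0 B0 H0)).
  exact: (trim_fin_ae (n := 0) mr (trim_bounded n0 C0 rate0)).
apply: aeS (ae_forall_nat A) => xi h r.
have rn : r <= (Num.bound `|r|).+1%:R.
  apply: le_trans (ler_norm _) _; apply: ltW; apply: lt_le_trans (archi_boundP (normr_ge0 r)) _.
  by rewrite ler_nat.
by have [h1 h2] := h (Num.bound `|r|); split; [apply: le_lt_trans h1|apply: le_lt_trans h2]; exact: trin_le.
Qed.

Section good.
Variable xi : R.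
Hypothesis gd : forall r, (trin (H^~ xi) r < +oo)%E /\
  (trin (fun s => rate m (H s) xi) r < +oo)%E.

Let mHx : cmeas (H^~ xi). Proof. exact: cmeas_swap_slice. Qed.
Let mrx : cmeas (fun s => rate m (H s) xi).
Proof. exact: (cmeas_swap_slice (z := fun s => rate m (H s)) xi mr). Qed.
Let mJx : cmeas (J^~ xi). Proof. exact: (cmeas_swap_slice (z := J) xi mJ). Qed.
Let mzx : cmeas (z^~ xi). Proof. exact: (cmeas_swap_slice (z := z) xi mz). Qed.

Lemma trin_cL1 (y : R -> R[i]) r : cL1 (fun t => (tri r t)%:C * y t) -> (trin y r < +oo)%E.
Proof.
move=> [_]; apply: le_lt_trans; apply: le_int => t; first by rewrite lee_fin mulr_ge0 ?tri_ge0 ?nc_ge0.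
by rewrite lee_fin ncM nc_real ger0_norm ?tri_ge0.
Qed.

Lemma cL1_tri_primitive r : 0 <= r -> cL1 (fun t => (tri r t)%:C * (g0 xi + J t xi)).
Proof.
move=> r0; have mt := measurable_tri1 r; have [_ fr] := gd r.
pose M := nc (g0 xi) + fine (trin (fun s => rate m (H s) xi) r).
have M0 : 0 <= M by rewrite addr_ge0 ?nc_ge0// fine_ge0// trin_ge0.
split.
  by apply: cmeasM; [meas|apply: cmeasD; [exact: cmeas_cst|exact: mJx]].
apply: (@le_lt_trans _ _ (\int[mu]_t (M * tri r t)%:E)%E); last first.
  by rewrite intZ ?int_tri -?EFinM ?ltry// => t; exact: tri_ge0.
apply: le_int => t; first by rewrite lee_fin nc_ge0.
rewrite lee_fin ncM nc_real ger0_norm ?tri_ge0// triE.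
have [/andP[t0 tr]|_] := boolP (0 <= t <= r); last by rewrite mul0r mulr0.
rewrite mul1r mulr1; apply: le_trans (ncD _ _) _; rewrite lerD2l.
rewrite -lee_fin fineK ?ge0_fin_numE ?trin_ge0//; apply: le_trans (trin_le _ tr).
apply: le_trans (nc_cintegral (cmeas_tri t mrx)) _.
rewrite le_eqVlt; apply/orP; left; apply/eqP; apply: eq_integral => s _.
by rewrite ncM nc_real ger0_norm ?tri_ge0.
Qed.

Lemma cL1_tri_residual r : 0 <= r -> cL1 (fun t => (tri r t)%:C * z t xi).
Proof.
move=> r0; have [fH' _] := gd r.
rewrite (_ : (fun t => _) = fun t => (tri r t)%:C * H t xi - (tri r t)%:C * (g0 xi + J t xi)).
  by apply: cL1B; [exact: (cL1_tri mHx fH')|exact: cL1_tri_primitive].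
by apply/funext => t; rewrite mulrBr.
Qed.

(** Since [phi' = f] on [t >= 0], [time_by_parts] rewrites the term in [phi] of the hypothesis as
    the pairing of [f] with the primitive of the rate. *)
Lemma residual_test r (f phi : R -> R) : 0 < r -> test_fun f -> test_fun phi ->
  (forall t, 0 <= t -> derive1 phi t = f t) -> (forall t, r <= t -> phi t = 0) ->
  (forall t, ~ (0 < t < r) -> f t = 0) ->
  (phi 0)%:C * g0 xi + cintegral (fun t => (tri (r + 1) t)%:C *
    ((f t)%:C * H t xi + (phi t)%:C * rate m (H t) xi)) = 0 ->
  cintegral (fun t => (f t)%:C * z t xi) = 0.
Proof.
move=> r0 tf tphi dphi out fout V0; set T := r + 1 in V0.
have T0 : 0 <= T by rewrite addr_ge0// ltW.
have [K1 HK1] := test_fun_bounded tf; have [K HK] := test_fun_bounded tphi.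
have mf := test_fun_measurable tf; have mphi := test_fun_measurable tphi.
have phiT : phi T = 0 by apply: out; rewrite lerDl.
have [fHT frT] := gd T.
have PE (s : R) : 0 <= s <= T -> (phi s)%:C = - cintegral (fun t => (tri T t * tri t s)%:C * (f t)%:C).
  move=> /andP[s0 sT]; have E := test_fun_FTC tphi sT; rewrite phiT sub0r in E.
  rewrite -[phi s]opprK -E RCN Rint_indic; congr (- _).
  rewrite -cintegral_of_real; apply: eq_cintegral => t; rewrite -RCM; congr (_%:C).
  rewrite !triE indic_itvccE s0/=; have [st|st] := leP s t; last by rewrite mulr0 !mul0r.
  have t0 := le_trans s0 st.
  by rewrite t0 mulr1 dphi.
have MB t : 0 <= t <= T -> nc ((f t)%:C) <= K1 by move=> _; rewrite nc_real.
have := time_by_parts (g0 xi) T0 mrx (cmeas_real mf) frT MB PE.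
rewrite -/(J _ xi) => TP.
have bf t : nc ((f t)%:C) <= K1 by rewrite nc_real.
have bp t : nc ((phi t)%:C) <= K by rewrite nc_real.
have L1 := cL1M_bounded (cmeas_real mf) bf (cL1_tri mHx fHT).
have L2 := cL1M_bounded (cmeas_real mphi) bp (cL1_tri mrx frT).
have L3 := cL1M_bounded (cmeas_real mf) bf (cL1_tri_primitive T0).
have E : cintegral (fun t => (f t)%:C * z t xi) =
    cintegral (fun t => (f t)%:C * ((tri T t)%:C * H t xi)) -
    cintegral (fun t => (f t)%:C * ((tri T t)%:C * (g0 xi + J t xi))).
  rewrite -(cintegralB L1 L3); apply: eq_cintegral => t; rewrite /z.
  have [t0T|nt] := boolP (0 < t < r); last by rewrite fout ?mul0r ?subr0//; exact/negP.
  have /andP[t0 tr] := t0T.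
  rewrite triE (ltW t0) (le_trans (ltW tr))/= ?lerDl//.
  by rewrite -[(true%:R)%:C]/(1 : R[i]); ring.
have E3 : cintegral (fun t => (f t)%:C * ((tri T t)%:C * (g0 xi + J t xi))) =
    - ((phi 0)%:C * g0 xi) - cintegral (fun s => (tri T s)%:C * (rate m (H s) xi * (phi s)%:C)).
  by rewrite -TP; apply: eq_cintegral => t; exact: mulrCA.
have E2 : cintegral (fun t => (f t)%:C * ((tri T t)%:C * H t xi)) =
    - ((phi 0)%:C * g0 xi) - cintegral (fun s => (tri T s)%:C * (rate m (H s) xi * (phi s)%:C)).
  have -> : cintegral (fun s => (tri T s)%:C * (rate m (H s) xi * (phi s)%:C)) =
      cintegral (fun t => (phi t)%:C * ((tri T t)%:C * rate m (H t) xi)).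
    by apply: eq_cintegral => t; ring.
  have D := cintegralD L1 L2; apply/eqP; rewrite -subr_eq0 opprB opprK addrA -D addrC; apply/eqP.
  by rewrite -[RHS]V0; congr (_ + _); apply: eq_cintegral => t; ring.
by rewrite E E2 E3 subrr.
Qed.

End good.

(** Each test function in time yields its own null set of frequencies, so only the countable family
    of bumps on []0, p / q[], with [p], [q] positive integers, is used. *)
Lemma spectral_equation : {ae mu, forall xi : R, {ae mu, forall t : R, 0 <= t ->
  H t xi = g0 xi + cintegral (fun s => (tri t s)%:C * rate m (H s) xi)}}.
Proof.
have Z (p q n : nat) : {ae mu, forall xi : R, cintegral (fun t => (bump 0 (p.+1%:R / q.+1%:R) n t)%:C * z t xi) = 0}.
  set r := _ / _; have r0 : 0 < r by rewrite divr_gt0// ltr0n.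
  have tf := test_fun_bump 0 r n.
  have fout t : ~ (0 < t < r) -> bump 0 r n t = 0 by exact: bump_out.
  have [phi [tphi dphi out]] := test_antiderivative tf r0 fout.
  apply: aeS (aeI good_ae (weak_equation_test r0 tf tphi dphi out)) => xi [gd V0].
  exact: (residual_test gd r0 tf tphi dphi out fout V0).
have Zall : {ae mu, forall xi : R, forall p q n : nat, cintegral (fun t => (bump 0 (p.+1%:R / q.+1%:R) n t)%:C * z t xi) = 0}.
  by apply: ae_forall_nat => p; apply: ae_forall_nat => q; apply: ae_forall_nat => n; exact: Z.
apply: aeS (aeI good_ae Zall) => xi [gd V0].
have mzx : cmeas (z^~ xi) by exact: (cmeas_swap_slice (z := z) xi mz).
suff W : {ae mu, forall t : R, 0 <= t -> z t xi = 0}.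
  by apply: aeS W => t h /h /eqP; rewrite subr_eq0 => /eqP.
have nt := @ae_neq R.
apply: ae0_of_tri => // [r r0|[|p] q].
- by apply: trin_cL1; exact: cL1_tri_residual.
- rewrite mul0r -[RHS]cintegral0; apply: cintegral_ae.
  + by have mt := measurable_tri1 (0 : R); meas.
  + exact: cmeas_cst.
  apply: aeS (nt 0) => t t0; rewrite triE -eq_le eq_sym (negbTE t0).
  by rewrite mul0r.
set r := _ / _; have r0 : 0 < r by rewrite divr_gt0// ltr0n.
have L := cL1_tri_residual gd (ltW r0).
have mt := measurable_tri1 r.
have mnz := measurable_nc mzx.
(* The bumps tend to the indicator of []0, r[], which is [tri r] off two points. *)
have D : nc (cintegral (fun t => (bump 0 r n t)%:C * z t xi) - cintegral (fun t => (tri r t)%:C * z t xi)) @[n --> \oo] --> (0 : R).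
  apply: (cintegral_dct (b := fun t => tri r t * nc (z t xi))).
  - by move=> n; apply: cmeasM mzx; apply: cmeas_real; exact: measurable_bump.
  - exact: L.
  - by meas.
  - under eq_integral do rewrite ger0_norm ?mulr_ge0 ?tri_ge0 ?nc_ge0//.
    exact: (trin_cL1 L).
  - apply: aeT => t n; rewrite ncM nc_real ger0_norm ?bump_ge0// ler_wpM2r ?nc_ge0//.
    apply: le_trans (bump_le 0 r n t) _; rewrite triE indicE mem_setE in_itv/=.
    by case: (ltP 0 t) => [/ltW ->|]//; case: (ltP t r) => [/ltW ->|].
  apply: aeS (aeI (nt 0) (nt r)) => t [t0 tr].
  have -> : tri r t = \1_(`]0, r[%classic) t.
    by rewrite triE indicE mem_setE in_itv/= !lt_neqAle tr [0 == t]eq_sym t0.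
  have cb := @cvg_bump R 0 r t.
  under eq_fun do rewrite -mulrBl -RCB ncM nc_real.
  have cb' : `|bump 0 r n t - \1_(`]0, r[%classic) t| @[n --> \oo] --> (0 : R).
    by apply/norm_cvg0P; apply/subr_cvg0.
  by have := cvgM cb' (cvg_cst (nc (z t xi))); rewrite mul0r; exact.
move: D; under eq_fun do rewrite /r V0 sub0r ncN.
by move=> /(cvg_lim (@Rhausdorff R)); rewrite lim_cst// => h; exact: nc_eq0.
Qed.

End spectral_equation.

(** * Comparison of two solutions of the integral equation *)

Section uniqueness.
Context {R : realType}.

(** Tonelli. The weak formulation is exploited frequency by frequency, whereas moments are taken at
    a given time. *)
Lemma ae_swap (y : R -> R -> R[i]) : cmeas (fun w : R * R => y w.1 w.2) ->
  {ae mu, forall xi : R, {ae mu, forall t : R, 0 <= t -> y t xi = 0}} ->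
  {ae mu, forall t : R, 0 <= t -> {ae mu, forall xi : R, y t xi = 0}}.
Proof.
move=> my H; have mny := measurable_nc my.
have mi : measurable_fun setT (fun t : R => \1_(`[0, +oo[%classic) t : R).
  exact: (mfun_indic (measurable_itv _) (@measurable_id _ _ _)).
pose F t xi : \bar R := (\1_(`[0, +oo[%classic) t * nc (y t xi))%:E.
have F0 t xi : (0 <= F t xi)%E by rewrite lee_fin mulr_ge0 ?nc_ge0// indicE.
have mF : measurable_fun setT (fun z : R * R => F z.1 z.2).
  by apply: measurable_EFin; apply: mfunM => //; exact: (measurableT_comp mi (@measurable_fst _ _ _ _)).
have mFx xi : measurable_fun setT (F^~ xi).
  have mx := measurable_nc (cmeas_swap_slice (z := y) xi my).
  by apply: measurable_EFin; apply: mfunM.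
have Z : (\int[mu]_t \int[mu]_xi F t xi = 0)%E.
  rewrite (int_fubini mF F0); apply/eqP; rewrite eq_le; apply/andP; split; last first.
    by apply: integral_ge0 => xi _; apply: integral_ge0.
  apply: (@le_trans _ _ (\int[mu]_(xi in [set: R]) (0%E : \bar R))%E); last by rewrite integral0.
  apply: le_int_ae => //.
  - apply: (measurable_int_prod (F := fun xi t => F t xi)) => //.
    apply: (measurableT_comp (f := fun z : R * R => F z.1 z.2) mF (g := fun w : R * R => (w.2, w.1))).
    by meas.
  - by move=> xi; apply: integral_ge0.
  apply: aeS H => xi h.
  apply: (@le_trans _ _ (\int[mu]_(t in [set: R]) (0%E : \bar R))%E); last by rewrite integral0.
  apply: le_int_ae => //; apply: aeS h => t h; rewrite /F indic_ge0E.
  by have [t0|t0] := leP 0 t; rewrite ?mul0r// h// nc0 mulr0.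
have I0 (t : R) : (0 <= \int[mu]_xi F t xi)%E by apply: integral_ge0 => xi _; exact: F0.
have A := int0_ae (measurable_int_prod mF F0) I0 Z.
apply: aeS A => t Ft t0.
have mFt : measurable_fun setT (F t) by exact: (measurableT_comp mF (pair1_measurable t)).
apply: aeS (int0_ae mFt (F0 t) Ft) => xi; rewrite /F indic_ge0E t0 mul1r => -[h].
exact: nc_eq0.
Qed.

Variable m : R -> R.
Hypotheses (mm : measurable_fun setT m) (m_ge0 : forall x, 0 <= m x)
  (m_le1 : forall x, m x <= 1).
Variables (g0 : R -> R[i]) (B : R).
Hypotheses (mg0 : cmeas g0) (B0 : 0 <= B).
Let c0 := @cF_gt0 R.

Let F (y : R -> R -> R[i]) s := advec m (y s) (y s).

(** Weaker than [evolution]: at a given frequency the equation holds for almost every time, which is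
    what the weak formulation provides. *)
Record spectral_solution (y : R -> R -> R[i]) : Prop := SpectralSolution {
  ss_cmeas : cmeas (fun w : R * R => y w.1 w.2);
  ss_moment0 : forall t, 0 <= t -> (moment 0 (y t) <= B%:E)%E;
  ss_moment1 : forall t, 0 <= t -> (moment 1 (y t) <= B%:E)%E;
  ss_eq : {ae mu, forall xi : R, {ae mu, forall t : R, 0 <= t ->
    y t xi = g0 xi + cintegral (fun s => (tri t s)%:C * rate m (y s) xi)}} }.

Lemma cmeas_forcing_joint y : cmeas (fun w : R * R => y w.1 w.2) ->
  cmeas (fun w : R * R => F y w.1 w.2).
Proof. by move=> my; exact: cmeas_advec_joint. Qed.

Lemma moment0_forcing_le y s : spectral_solution y -> 0 <= s ->
  (moment 0 (F y s) <= (cF * (B * B))%:E)%E.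
Proof.
move=> sy s0; have my := cmeas_slice s (ss_cmeas sy).
apply: le_trans (moment0_advec mm m_ge0 m_le1 my my) _.
rewrite EFinM lee_wpmul2l ?lee_fin ?(ltW c0)// EFinM.
by apply: lee_pmul (moment_ge0 _ _) (moment_ge0 _ _) (ss_moment0 sy s0) (ss_moment1 sy s0).
Qed.

Lemma trim_forcing y (T : R) : spectral_solution y -> 0 < T -> (trim 0 (F y) T < +oo)%E.
Proof.
move=> sy T0; have K0 : 0 <= cF * (B * B) by rewrite !mulr_ge0// ltW.
by apply: (trim_bounded T0 K0) => s s0; exact: moment0_forcing_le.
Qed.

(** At almost every frequency [sduh_unique] turns the integral equation into Duhamel's formula, from
    which the dissipation estimates are derived. *)
Lemma spectral_duhamel y : spectral_solution y ->
  {ae mu, forall xi : R, {ae mu, forall t : R, 0 <= t -> y t xi = duh g0 (F y) t xi}}.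
Proof.
move=> sy; have my := ss_cmeas sy; have mF := cmeas_forcing_joint my.
have A (n : nat) : {ae mu, forall xi : R, (trin (y^~ xi) n.+1%:R < +oo)%E /\
    (trin (fun s => F y s xi) n.+1%:R < +oo)%E}.
  have n0 : 0 < n.+1%:R :> R by rewrite ltr0n.
  apply: aeI; first exact: (trim_fin_ae (n := 0) my (trim_bounded n0 B0 (ss_moment0 sy))).
  exact: (trim_fin_ae (n := 0) mF (trim_forcing sy n0)).
apply: aeS (aeI (ss_eq sy) (ae_forall_nat A)) => xi [E fin].
have myx := cmeas_swap_slice (z := y) xi my; have mFx := cmeas_swap_slice (z := F y) xi mF.
have D n : {ae mu, forall t : R, 0 <= t <= n.+1%:R -> y t xi = duh g0 (F y) t xi}.
  have [f1 f2] := fin n.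
  apply: (sduh_unique (normr_ge0 xi) mFx myx (ler0n _ _) f2 f1).
  apply: aeS E => t E /andP[t0 _]; rewrite (E t0); congr (_ + _).
apply: aeS (ae_forall_nat D) => t h t0; apply: (h (Num.bound t)).
by rewrite t0/=; apply: ltW; apply: lt_le_trans (archi_boundP t0) _; rewrite ler_nat.
Qed.

Variables (g H : R -> R -> R[i]) (a : R).
Hypotheses (sg : spectral_solution g) (sH : spectral_solution H).
Hypotheses (a0 : 0 <= a) (ca : cF * a < 1).
Hypothesis ga : forall t, 0 <= t -> (moment 0 (g t) <= a%:E)%E.

(** Equal to [H - g] at almost every time and frequency, but obeying the moment estimates of Duhamel
    integrals at every time. *)
Let D t xi : R[i] := duh g0 (F H) t xi - duh g0 (F g) t xi.
Let mg := ss_cmeas sg.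
Let mH := ss_cmeas sH.
Let mD : cmeas (fun w : R * R => D w.1 w.2).
Proof. by apply: cmeasB; apply: cmeas_duh => //; exact: cmeas_forcing_joint. Qed.

Let D_ae : {ae mu, forall t : R, 0 <= t -> {ae mu, forall xi : R, H t xi - g t xi = D t xi}}.
Proof.
have A := @ae_swap (fun t xi => D t xi - (H t xi - g t xi)) (cmeasB mD (cmeasB mH mg)).
have {}A : {ae mu, forall t : R, 0 <= t -> {ae mu, forall xi : R, D t xi - (H t xi - g t xi) = 0}}.
  apply: A; apply: aeS (aeI (spectral_duhamel sH) (spectral_duhamel sg)) => xi [h1 h2].
  apply: aeS (aeI h1 h2) => t [e1 e2] t0.
  by rewrite /D (e1 t0) (e2 t0) subrr.
by apply: aeS A => t A t0; apply: aeS (A t0) => xi /eqP; rewrite subr_eq0 => /eqP.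
Qed.

Let FB s xi : R[i] := F H s xi - F g s xi.

Let forcing_bound : {ae mu, forall s : R, 0 <= s ->
  (moment 0 (FB s) <= (cF * B)%:E * moment 0 (D s) + (cF * a)%:E * moment 1 (D s))%E}.
Proof.
apply: aeS D_ae => s e s0; have {}e := e s0.
have mHs := cmeas_slice s mH; have mgs := cmeas_slice s mg; have mDs := cmeas_slice s mD.
have LH : cL1 (H s) by apply: moment0_cL1 => //; apply: le_lt_trans (ss_moment0 sH s0) (ltry _).
have Lg : cL1 (g s) by apply: moment0_cL1 => //; apply: le_lt_trans (ss_moment0 sg s0) (ltry _).
have LiH : cL1 (ixi (H s)) by apply: cL1_ixi => //; apply: le_lt_trans (ss_moment1 sH s0) (ltry _).
have Lig : cL1 (ixi (g s)) by apply: cL1_ixi => //; apply: le_lt_trans (ss_moment1 sg s0) (ltry _).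
apply: le_trans (moment0_advecB mm m_ge0 m_le1 LH Lg LiH Lig mHs mgs) _.
rewrite !(moment_ae _ (cmeasB mHs mgs) mDs e).
rewrite ge0_muleDr ?mule_ge0 ?moment_ge0//; apply: leeD; rewrite EFinM -muleA;
  apply: lee_wpmul2l; rewrite ?lee_fin ?(ltW c0)//.
  by rewrite muleC; apply: lee_wpmul2r; [exact: moment_ge0|exact: ss_moment1].
by apply: lee_wpmul2r; [exact: moment_ge0|exact: ga].
Qed.

Let trim_FB (T : R) : 0 < T -> (trim 0 FB T < +oo)%E.
Proof.
move=> T0; have K0 : 0 <= cF * (B * B) by rewrite !mulr_ge0// ltW.
apply: (trim_bounded T0 (addr_ge0 K0 K0)) => s s0.
have m1 := cmeas_slice s (cmeas_forcing_joint mH); have m2 := cmeas_slice s (cmeas_forcing_joint mg).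
by apply: le_trans (momentB 0 m1 m2) _; rewrite EFinD; apply: leeD; exact: moment0_forcing_le.
Qed.

Let difference_bound (t : R) : 0 <= t -> (moment 0 (D t) + trim 1 D t <= trim 0 FB t)%E.
Proof.
move=> t0; have T0 : 0 < t + 1 by rewrite ltr_wpDl.
have tT : t <= t + 1 by rewrite lerDl.
apply: (moment_duhB 0 mg0 (cmeas_forcing_joint mH) (cmeas_forcing_joint mg) t0).
- exact: le_lt_trans (trim_le _ _ tT) (trim_forcing sH T0).
- exact: le_lt_trans (trim_le _ _ tT) (trim_forcing sg T0).
Qed.

Let mFB : cmeas (fun w : R * R => FB w.1 w.2).
Proof. by apply: cmeasB; exact: cmeas_forcing_joint. Qed.

Let trim_FB_le (t : R) : (trim 0 FB t <= (cF * B)%:E * trim 0 D t + (cF * a)%:E * trim 1 D t)%E.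
Proof.
have cB0 : 0 <= cF * B by rewrite mulr_ge0// ltW.
have ca0 : 0 <= cF * a by rewrite mulr_ge0// ltW.
have mtr n : measurable_fun setT (fun s => (tri t s)%:E * moment n (D s))%E.
  by apply: measurable_triM; exact: measurable_moment.
have p n s : (0 <= (tri t s)%:E * moment n (D s))%E.
  by rewrite mule_ge0 ?moment_ge0// lee_fin tri_ge0.
have E n (k : R) : 0 <= k -> (k%:E * trim n D t = \int[mu]_s (k%:E * ((tri t s)%:E * moment n (D s))))%E.
  move=> k0; apply: esym; apply: ge0_integralZl_EFin => //; exact: mtr.
rewrite (E 0%N _ cB0) (E 1%N _ ca0) -ge0_integralD//; last 4 first.
- by move=> s _; rewrite mule_ge0// lee_fin.
- by apply: measurable_funeM; exact: mtr.
- by move=> s _; rewrite mule_ge0// lee_fin.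
- by apply: measurable_funeM; exact: mtr.
apply: le_int_ae.
- by apply: measurable_triM; exact: measurable_moment.
- by apply: emeasurable_funD; apply: measurable_funeM; exact: mtr.
- by move=> s; rewrite mule_ge0 ?moment_ge0// lee_fin tri_ge0.
- by move=> s; rewrite adde_ge0// mule_ge0// lee_fin.
apply: aeS forcing_bound => s h; rewrite triE.
have [/andP[s0 _]|_] := boolP (0 <= s <= t); last by rewrite !mul0e !mule0 adde0.
by rewrite !mul1e; exact: h.
Qed.

(** The term in [M_1] on the right has coefficient [cF a < 1] and is absorbed by the dissipation on
    the left, which leaves an inequality in [M_0] alone. *)
Let D_gronwall (t : R) : 0 <= t -> (moment 0 (D t) <= (cF * B)%:E * trim 0 D t)%E.
Proof.
move=> t0; have T0 : 0 < t + 1 by rewrite ltr_wpDl.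
have tT : t <= t + 1 by rewrite lerDl.
have fin : (trim 0 FB t < +oo)%E := le_lt_trans (trim_le _ _ tT) (trim_FB T0).
have h := le_trans (difference_bound t0) (trim_FB_le t).
(* Cancelling the dissipation on both sides requires it to be finite; it is bounded by
   [trim 0 FB t]. *)
have f1 : trim 1 D t \is a fin_num.
  rewrite ge0_fin_numE; last exact: trim_ge0.
  apply: le_lt_trans fin; apply: le_trans (difference_bound t0).
  by apply: leeDr; exact: moment_ge0.
rewrite -(leeD2rE _ _ f1); apply: le_trans h _; rewrite leeD2l//.
by rewrite -[leRHS]mul1e lee_wpmul2r ?trim_ge0// lee_fin ltW.
Qed.

Lemma spectral_unique : {ae mu, forall t : R, 0 <= t -> {ae mu, forall xi : R, H t xi = g t xi}}.
Proof.
have cB0 : 0 <= cF * B by rewrite mulr_ge0// ltW.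
have mM : measurable_fun setT (fun t => moment 0 (D t)) by exact: measurable_moment.
have A (n : nat) : {ae mu, forall t : R, 0 <= t <= n%:R -> moment 0 (D t) = 0%E}.
  apply: (gronwall (C := cF * B)) => //; first by move=> t; exact: moment_ge0.
    have T0 : 0 < n.+1%:R :> R by rewrite ltr0n.
    have fK : trim 0 FB n.+1%:R \is a fin_num by rewrite ge0_fin_numE ?trim_ge0// trim_FB.
    have mt := measurable_tri1 (n%:R : R).
    apply: (@le_lt_trans _ _ (\int[mu]_s (fine (trim 0 FB n.+1%:R) * tri n%:R s)%:E)%E).
      apply: le_int => s; first by rewrite mule_ge0 ?moment_ge0// lee_fin tri_ge0.
      rewrite triE; have [/andP[s0 sn]|_] := boolP (0 <= s <= n%:R); last by rewrite mul0e mulr0.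
      rewrite mul1e mulr1 fineK//.
      have sn' : s <= n.+1%:R by rewrite (le_trans sn)// ler_nat.
      apply: le_trans (trim_le 0 FB sn'); apply: le_trans (difference_bound s0).
      by apply: leeDl; exact: trim_ge0.
    rewrite intZ//; last by move=> s; exact: tri_ge0.
      by rewrite int_tri// -EFinM ltry.
    by apply: fine_ge0; exact: trim_ge0.
  by apply: aeT => t /andP[t0 _]; exact: D_gronwall.
apply: aeS (aeI D_ae (ae_forall_nat A)) => t [e h] t0.
have Z : moment 0 (D t) = 0%E.
  by apply: (h (Num.bound t)); rewrite t0/=; exact: ltW (archi_boundP t0).
have mDt := cmeas_slice t mD; have mnD := measurable_nc mDt.
have D0 : {ae mu, forall xi : R, nc (D t xi) = 0}.
  apply: int_ae_eq0 => //; first by move=> xi; exact: nc_ge0.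
  by rewrite -moment0.
apply: aeS (aeI (e t0) D0) => xi [e1 /nc_eq0 e2].
by apply/eqP; rewrite -subr_eq0 e1 e2.
Qed.

End uniqueness.

(** By Tonelli applied to [|f - g|], the null sets at each time assemble into a null set of the
    plane. *)
Lemma ae_product (R : realType) (f g : R -> R -> R) :
  jointly_measurable f -> jointly_measurable g ->
  {ae mu, forall t : R, 0 <= t -> {ae mu, forall x : R, f t x = g t x}} ->
  {ae (lebesgue_measure \x lebesgue_measure)%E, forall z : R * R, 0 < z.1 -> f z.1 z.2 = g z.1 z.2}.
Proof.
move=> mf mg H.
have mi : measurable_fun setT (fun t : R => \1_(`[0, +oo[%classic) t : R).
  exact: (mfun_indic (measurable_itv _) (@measurable_id _ _ _)).
pose F t x : \bar R := (\1_(`[0, +oo[%classic) t * `|f t x - g t x|)%:E.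
have F0 t x : (0 <= F t x)%E by rewrite lee_fin mulr_ge0// indicE.
have mF : measurable_fun setT (fun z : R * R => F z.1 z.2).
  apply: measurable_EFin; apply: mfunM.
    exact: (measurableT_comp mi (@measurable_fst _ _ _ _)).
  by apply: mfun_norm; exact: (mfunD mf (mfunN mg)).
have Z : (\int[mu]_t \int[mu]_x F t x = 0)%E.
  apply/eqP; rewrite eq_le; apply/andP; split; last first.
    by apply: integral_ge0 => t _; apply: integral_ge0.
  apply: (@le_trans _ _ (\int[mu]_(t in [set: R]) (0%E : \bar R))%E); last by rewrite integral0.
  apply: le_int_ae => //; [exact: measurable_int_prod|by move=> t; apply: integral_ge0|].
  apply: aeS H => t h.
  apply: (@le_trans _ _ (\int[mu]_(x in [set: R]) (0%E : \bar R))%E); last by rewrite integral0.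
  apply: le_int_ae => //; first exact: (measurableT_comp mF (pair1_measurable t)).
  have [t0|t0] := leP 0 t; last by apply: aeT => x; rewrite /F indic_ge0E (lt_geF t0) mul0r.
  by apply: aeS (h t0) => x e; rewrite /F e subrr normr0 mulr0.
have F0' (z : R * R) : (0 <= F z.1 z.2)%E by exact: F0.
have E := @fubini_tonelli1 _ _ _ _ R mu mu (fun z => F z.1 z.2) mF F0'.
have E0 : (\int[(lebesgue_measure \x lebesgue_measure)%E]_z F z.1 z.2 = 0)%E by rewrite -Z; exact: E.
have [K _] := @ae_eq_integral_abs _ _ R (lebesgue_measure \x lebesgue_measure)%E setT measurableT _ mF.
have [|A [mA A0 sub]] := K.
  by rewrite -[RHS]E0; apply: eq_integral => z _; rewrite gee0_abs.
exists A; split => //; apply: subset_trans sub; apply: subsetC => z hz z0.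
have := hz I; rewrite /F indic_ge0E (ltW z0) mul1r => -[/eqP].
by rewrite normr_eq0 subr_eq0 => /eqP.
Qed.

(** The horizon [t + 1] is positive and contains [t] also when [t = 0]; the dissipation, being
    nonnegative, is dropped. *)
Lemma ereal_sup_estimate (R : realType) (theta0 : R -> R) (eta : R -> R -> R) (B k t : R) :
  0 <= k -> 0 <= t -> wiener_norm 1 theta0 = B%:E ->
  (ereal_sup [set wiener_norm 1 (eta t) + k%:E * \int[lebesgue_measure]_(s in `[0%R, t]) wiener_norm_dx 1 (eta s)
    | t in `[0%R, (t + 1)%R]] <= wiener_norm 1 theta0)%E ->
  (wiener_norm 1 (eta t) <= B%:E)%E.
Proof.
move=> k0 t0 BE; rewrite BE; apply: le_trans.
apply: (@le_trans _ _ (wiener_norm 1 (eta t) +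
    k%:E * \int[lebesgue_measure]_(s in `[0%R, t]) wiener_norm_dx 1 (eta s))%E); last first.
  apply: ereal_sup_ubound; exists t; last by [].
  by rewrite /= in_itv/= t0 lerDl ler01.
rewrite leeDl// mule_ge0 ?lee_fin//; apply: integral_ge0 => s _.
by apply: norm_through_ge0 => h; exact: wiener_norm_ge0.
Qed.

Lemma wiener_finite_has_fourier (R : realType) (s B : R) (f : R -> R) :
  (wiener_norm s f <= B%:E)%E -> exists g, has_fourier f g.
Proof.
move=> fB; apply: contrapT => H; move: fB; rewrite /wiener_norm /norm_through.
suff -> : [set h | has_fourier f h] = set0 by rewrite image_set0 ereal_inf0 leye_eq.
by rewrite -subset0 => g fg; apply: H; exists g.
Qed.

Theorem theorem1p8 (R : realType) (alpha : R) (theta0 : R -> R)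
  (alpha_ge0 : 0 <= alpha)
  (theta0_A1 : wiener 1 theta0)
  (theta0_small :
    (wiener_norm 0 theta0 < (Num.sqrt (pi : R) / Num.sqrt 2)%:E)%E) :
  exists_unique_ae (fun theta : R -> R -> R =>
    weak_solution alpha 1 theta0 theta /\
    forall T : R, 0 < T ->
      W_space T theta /\
      (ereal_sup
         [set wiener_norm 1 (theta t) +
              (1 - Num.sqrt 2 * fine (wiener_norm 0 theta0) /
                   Num.sqrt (pi : R))%:E *
              \int[lebesgue_measure]_(s in `[0%R, t])
                 wiener_norm_dx 1 (theta s)
         | t in `[0%R, T]]
       <= wiener_norm 1 theta0)%E).
Proof.
have [g0 [g [B [a [f0 evo BE [hg [ca [a0 ga]]] sol]]]]] := existence alpha_ge0 theta0_A1 theta0_small.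
exists (fun t => synth (g t)); split; first exact: sol.
move=> eta [weak est].
set k := 1 - Num.sqrt 2 * fine (wiener_norm 0 theta0) / Num.sqrt (pi : R) in est.
(* Smallness makes the coefficient of the dissipation nonnegative, so the estimate bounds the [A^1]
   norm of [eta] at every time. *)
have k0 : 0 <= k.
  have sp : 0 < Num.sqrt (pi : R) by rewrite sqrtr_gt0 pi_gt0.
  have s2 : 0 < Num.sqrt (2 : R) by rewrite sqrtr_gt0.
  rewrite subr_ge0 ler_pdivrMr// mul1r mulrC -ler_pdivlMr//.
  apply: fine_le_real (ltW theta0_small).
  exact: wiener_norm_ge0.
have etaB t : 0 <= t -> (wiener_norm 1 (eta t) <= B%:E)%E.
  move=> t0; have T0 : 0 < t + 1 by rewrite ltr_wpDl.
  by have [_] := est _ T0; exact: ereal_sup_estimate.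
(* The condition on [t] is placed inside so that a transform can be chosen at every real [t], with 0
   as default value at negative times. *)
have ex t : exists h : R -> R[i], 0 <= t -> has_fourier (eta t) h.
  have [t0|t0] := leP 0 t; last by exists (fun=> 0).
  by have [h fh] := wiener_finite_has_fourier (etaB t t0); exists h.
have meta : jointly_measurable eta by case: weak.
(* The choice made time by time carries no measurability in [t]; it is replaced by a jointly
   measurable version. *)
have [H mH fH] := jointly_measurable_fourier (h := fun t => projT1 (cid (ex t)))
  (D := [set t | 0 <= t]) meta (fun t t0 => projT2 (cid (ex t)) t0).
have HB t : 0 <= t -> (moment 0 (H t) + moment 1 (H t) <= B%:E)%E.
  by move=> t0; rewrite -(wiener_norm1E (fH t t0)); exact: etaB.
have H0 t : 0 <= t -> (moment 0 (H t) <= B%:E)%E.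
  by move=> t0; apply: le_trans (HB t t0); rewrite leeDl ?moment_ge0.
have H1 t : 0 <= t -> (moment 1 (H t) <= B%:E)%E.
  by move=> t0; apply: le_trans (HB t t0); rewrite leeDr ?moment_ge0.
have B0 : 0 <= B by rewrite -lee_fin -BE; exact: wiener_norm_ge0.
have mm := measurable_bessel alpha; have m0 := bessel_ge0 alpha; have m1 := bessel_le1 alpha_ge0.
have sH : spectral_solution (bessel alpha) g0 B H.
  by split => //; exact: (spectral_equation alpha_ge0 f0 weak mH fH H0 H1).
have sg : spectral_solution (bessel alpha) g0 B g.
  split; [exact: evo_cmeas evo|exact: evo_moment0 evo|exact: evo_moment1 evo|].
  by apply: aeS (evo_eq evo) => xi E; exact: aeT.
have U := spectral_unique mm m0 m1 (has_fourier_cmeas f0) B0 sg sH a0 ca ga.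
apply: (ae_product (f := eta) (g := fun t => synth (g t)) meta (evo_measurable_theta evo)).
apply: aeS U => t e t0; have {}e := e t0.
have /has_fourierP[_ [mHt _] e1] := fH t t0.
have /has_fourierP[_ [mgt _] e2] := synth_has_fourier (evo_cL1 evo t0) (hg t t0).
apply: aeS (aeI e1 e2) => x [h1 h2].
have K (u v : R) : u%:C = v%:C -> u = v by case.
by apply: K; rewrite -h1 -h2; exact: eq_inverse_fourier.
Qed.
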